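(* Let $0 \le \omega_0 < 1/2$. (1) Assume that for every $\omega$ with $\omega_0 < \omega < 1/2$ there exists $x_\omega \ge 1$ such that $h_\omega(x) \ge 0$ for all $x \in (x_\omega,\infty)$. Then $\zeta(s) \neq 0$ for all $s$ with $\Re(s) > 1/2 + \omega_0$. (2) Assume the Riemann Hypothesis for $\zeta(s)$. Then for every $0 < \omega < 1/2$ there exists $x_\omega \ge 1$ such that $h_\omega$ is nonnegative on $(x_\omega,\infty)$. In particular, the Riemann Hypothesis is equivalent to the statement that for every $0<\omega<1/2$ there exists $x_\omega \ge 1$ such that $h_\omega$ is nonnegative on $(x_\omega,\infty)$.
   Context: $\zeta(s)$ is the Riemann zeta function; the Riemann Hypothesis (RH) asserts that all zeros of $\zeta(s)$ in the strip $0<\Re(s)<1$ lie on $\Re(s)=1/2$. For $0 \le z \le 1$, $\Re(p)>0$, $\Re(q)>0$ put $\beta(z;p,q) = \int_z^1 x^{p-1}(1-x)^{q-1}\,dx$. For $0<\omega<1/2$ define $g_\omega:(0,\infty)\to\mathbb{R}$ by $$g_\omega(x) = \frac{4\omega}{2\omega-1}\frac{\pi^\omega}{\Gamma(\omega)}\left\{ x^{\omega-1}\,\beta\!\left(x^2;\frac{3-2\omega}{2},\omega\right) - \frac{2\omega+1}{4\omega}\,x^{-1/2}\,\beta\!\left(x^2;\frac{5-2\omega}{4},\omega\right)\right\}$$ for $0<x<1$ and $g_\omega(x)=0$ for $x\ge 1$. For $n \in \mathbb{N}$ let $c_\omega(n) = n^{\omega}\sum_{d\mid n}\mu(d)\,d^{-2\omega}$,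 where $\mu$ is the Möbius function. Define $h_\omega:(0,\infty)\to\mathbb{R}$ by $h_\omega(x) = x^{-1/2}\sum_{n=1}^\infty c_\omega(n)\, g_\omega(n/x)$ (a finite sum for each $x$). *)

(* Defs.v *)
From mathcomp Require Import all_boot all_order all_algebra complex.
From mathcomp Require Import all_classical all_reals all_analysis.

Set Implicit Arguments.
Unset Strict Implicit.
Unset Printing Implicit Defensive.

Import Order.TTheory GRing.Theory Num.Theory.
Import numFieldNormedType.Exports.

Local Open Scope classical_set_scope.
Local Open Scope ring_scope.

Section RiemannZeta.
Variable R : realType.

(* exp(-s log n) for n > 0, expanded into real and imaginary parts. *)
Definition nat_cpowN (n : nat) (s : R[i]) : R[i] :=
  Complex (expR (- complex.Re s * ln n%:R) * cos (complex.Im s * ln n%:R))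
          (- (expR (- complex.Re s * ln n%:R) * sin (complex.Im s * ln n%:R))).

(* R[i]^o is R[i] with the topology and the R[i]-module structure of a normed
   space over itself, so that derivability in direction 1 is complex
   differentiability. *)
Definition zeta_continuation (f : R[i]^o -> R[i]^o) : Prop :=
  (forall s : R[i]^o, 1 < complex.Re s ->
     series (fun n => nat_cpowN n.+1 s : R[i]^o) @ \oo --> f s) /\
  (forall s : R[i]^o, s <> 1 -> derivable f s 1).

(* The analytic continuation of \sum_(n >= 1) n^-s to R[i] minus {1}; it is
   unique there, and its value at the pole s = 1 is unspecified. *)
Definition zeta : R[i] -> R[i] :=
  xget (fun=> 0) [set f | zeta_continuation f].

Definition riemann_hypothesis : Prop :=
  forall s : R[i], 0 < complex.Re s < 1 -> zeta s = 0 -> complex.Re s = 1 / 2.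

End RiemannZeta.

Definition mobius (n : nat) : int :=
  if all (fun p => logn p n == 1%N) (primes n) then (-1) ^+ size (primes n)
  else 0.

Section SummatoryFunction.
Variable R : realType.
Notation mu := (@lebesgue_measure R).

Definition Gamma (a : R) : R :=
  \int[mu]_(t in `]0, +oo[) (t `^ (a - 1) * expR (- t)).

Definition inc_beta (z p q : R) : R :=
  \int[mu]_(x in `[z, 1]) (x `^ (p - 1) * (1 - x) `^ (q - 1)).

Definition g (w x : R) : R :=
  if x < 1 then
    4 * w / (2 * w - 1) * (pi `^ w / Gamma w) *
    (x `^ (w - 1) * inc_beta (x ^+ 2) ((3 - 2 * w) / 2) w
     - (2 * w + 1) / (4 * w) *
       (x `^ (- (1 / 2)) * inc_beta (x ^+ 2) ((5 - 2 * w) / 4) w))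
  else 0.

Definition c (w : R) (n : nat) : R :=
  n%:R `^ w * \sum_(d <- divisors n) (mobius d)%:~R * d%:R `^ (- (2 * w)).

(* All terms with n >= x vanish, so the partial sums are eventually constant. *)
Definition h (w x : R) : R :=
  x `^ (- (1 / 2)) *
  limn (fun N => \sum_(1 <= n < N) c w n * g w (n%:R / x) : R).

End SummatoryFunction.

(* Main.v *)
(** With x = e^u, the Laplace transform of the function u |-> h_w (e^u) is
    F(z) = xi(1/2 + z - w) / (z xi(1/2 + z + w)): the c_w(n) are the Dirichlet coefficients of
    zeta(s - w) / zeta(s + w), and g_w contributes the Gamma factors through the beta integral.

    If h_w is eventually nonnegative, Landau's theorem shows that F is holomorphic for Re z > 0.
    A zero rho of xi with Re rho > 1/2 + w then forces a zero at rho - 2 w; if this holds for an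
    interval of w, these zeros accumulate and the identity theorem makes xi vanish.

    Conversely, F has residue 1 at z = 0.  Under the Riemann hypothesis Borel-Caratheodory applied
    to log zeta bounds zeta and 1 / zeta by |s|^eps in Re s > 1/2, and a half-period shift in the
    beta integral gives the decay of the quotient of Gamma factors.  Averaging h_w (e^u) - 1 against
    a Gaussian of width e^(-B u) makes F integrable on vertical lines; the contour moves to
    Re z = -dl < 0, and a modulus of continuity for h_w undoes the averaging. *)
From HB Require Import structures.
Require Import Defs.
From mathcomp Require Import all_boot all_order all_algebra complex.
From mathcomp Require Import all_classical all_reals all_analysis.
From mathcomp Require Import measurable_realfun ring lra zify.
Import Order.TTheory GRing.Theory Num.Theory.
Import numFieldNormedType.Exports.
Set Implicit Arguments.
Unset Strict Implicit.
Unset Printing Implicit Defensive.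
Local Open Scope classical_set_scope.
Local Open Scope complex_scope.
Local Open Scope ring_scope.


(** * Complex differentiation and the exponential *)

Notation Re := complex.Re.
Notation Im := complex.Im.

Notation mR := measurableTypeR.
Notation ray0 R := (`[0%R, +oo[%classic : set (measurableTypeR R)).

(** Most transcendental functions below are integrals of [f x * cexp (z * a x)]: Gamma and beta
    functions, the theta integral, Dirichlet series over the counting measure, the transform of h.
    Holomorphy is proved once for this shape, and identities are checked at real z and extended by
    the identity theorem. Several nonvanishing results come from beta or convolution identities
    whose two arguments differ by a free real parameter: one zero forces a segment of zeros.

    The converse must overcome two weak facts. On Re z = -dl the transform, freed of its pole,
    decays only like |y|^(k - 1) with k slightly above dl, which is not integrable; and h changes
    between u and u + t by about e^((w - 1/2) u) (1 + e^u t). A Gaussian of width tau = e^(-B u)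
    costs tau^(-k) = e^(B k u) against the gain e^(-dl u), so B k < dl, which forces B < 1. Undoing
    the average costs e^((w + 1/2 - B) u), so B > 1/2 + w. The window is open exactly because w <
    1/2, and k is then taken close enough to dl. *)

Lemma eq_ler (R : numDomainType) (x y : R) : x = y -> x <= y. Proof. by move->. Qed.

Section ComplexBasics.
Variable R : realType.
Local Notation C := R[i].
Implicit Types (z w : C) (x y : R).

(** The modulus with values in [R]. The norm of [R[i]] lands in [R[i]] itself, whose order is only
    partial, so estimates are carried out with [nm] and transported by [nm_lt_normr] and
    [nm_le_normr]. *)
Definition nm (z : C) : R := Normc.normc z.

Lemma ReD z w : Re (z + w) = Re z + Re w. Proof. by case: z; case: w. Qed.
Lemma ImD z w : Im (z + w) = Im z + Im w. Proof. by case: z; case: w. Qed.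
Lemma ReN z : Re (- z) = - Re z. Proof. by case: z. Qed.
Lemma ImN z : Im (- z) = - Im z. Proof. by case: z. Qed.
Lemma ReM z w : Re (z * w) = Re z * Re w - Im z * Im w.
Proof. by case: z; case: w. Qed.
Lemma ImM z w : Im (z * w) = Re z * Im w + Im z * Re w.
Proof. by case: z; case: w. Qed.
Lemma Re0 : Re (0 : C) = 0. Proof. by []. Qed.
Lemma Im0 : Im (0 : C) = 0. Proof. by []. Qed.
Lemma Re1 : Re (1 : C) = 1. Proof. by []. Qed.
Lemma Im1 : Im (1 : C) = 0. Proof. by []. Qed.
Definition reimE := (ReD, ImD, ReN, ImN, ReM, ImM, Re0, Im0, Re1, Im1).

Lemma ceqP z w : Re z = Re w -> Im z = Im w -> z = w.
Proof. by case: z => a b; case: w => c d /= -> ->. Qed.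
Lemma nm_ge0 z : 0 <= nm z.
Proof. by case: z => a b; exact: sqrtr_ge0. Qed.
Hint Resolve nm_ge0 : core.
Lemma nm0 : nm 0 = 0. Proof. exact: Normc.normc0. Qed.
Lemma nm1 : nm 1 = 1. Proof. exact: Normc.normc1. Qed.
Lemma nmM z w : nm (z * w) = nm z * nm w. Proof. exact: Normc.normcM. Qed.
Lemma nmV z : nm z^-1 = (nm z)^-1. Proof. exact: Normc.normcV. Qed.
Lemma nmN z : nm (- z) = nm z.
Proof. by case: z => a b; rewrite /nm /= !sqrrN. Qed.
Lemma nmE z : nm z = Num.sqrt (Re z ^+ 2 + Im z ^+ 2).
Proof. by case: z. Qed.
Lemma nmD z w : nm (z + w) <= nm z + nm w.
Proof. exact: le_normcD. Qed.
Lemma nmB z w : nm (z - w) <= nm z + nm w.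
Proof. by rewrite -(nmN w); exact: nmD. Qed.
Lemma nm_distC z w : nm (z - w) = nm (w - z).
Proof. by rewrite -nmN opprB. Qed.
Lemma nm_eq0 z : (nm z == 0) = (z == 0).
Proof.
apply/eqP/eqP => [|->]; last exact: nm0.
exact: Normc.eq0_normc.
Qed.
Lemma nm_gt0 z : (0 < nm z) = (z != 0).
Proof. by rewrite lt_def nm_eq0 nm_ge0 andbT. Qed.
Lemma nmX z n : nm (z ^+ n) = nm z ^+ n.
Proof. by elim: n => [|n ih]; rewrite ?expr0 ?nm1// !exprS nmM ih. Qed.
Lemma nmR x : nm (x%:C) = `|x|.
Proof. by rewrite /nm /= expr0n addr0 sqrtr_sqr. Qed.
Lemma nm_sqr z : nm z ^+ 2 = Re z ^+ 2 + Im z ^+ 2.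
Proof. by rewrite nmE sqr_sqrtr// addr_ge0// sqr_ge0. Qed.
Lemma le_Re_nm z : `|Re z| <= nm z.
Proof.
rewrite -ler_sqr ?nnegrE// nm_sqr real_normK ?num_real//.
by rewrite lerDl sqr_ge0.
Qed.
Lemma le_Im_nm z : `|Im z| <= nm z.
Proof.
rewrite -ler_sqr ?nnegrE// nm_sqr real_normK ?num_real//.
by rewrite lerDr sqr_ge0.
Qed.
Lemma nm_le_ReIm z : nm z <= `|Re z| + `|Im z|.
Proof.
rewrite -ler_sqr ?nnegrE ?addr_ge0// nm_sqr sqrrD.
rewrite -[Re z ^+ 2]real_normK ?num_real// -[Im z ^+ 2]real_normK ?num_real//.
have := mulr_ge0 (normr_ge0 (Re z)) (normr_ge0 (Im z)).
lra.
Qed.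
Lemma nm_i : nm 'i%C = 1.
Proof. by rewrite /nm /= expr0n expr1n add0r sqrtr1. Qed.
Lemma nm_sum (I : Type) (r : seq I) (P : pred I) (F : I -> C) :
 nm (\sum_(i <- r | P i) F i) <= \sum_(i <- r | P i) nm (F i).
Proof.
elim/big_ind2 : _ => //[|x1 x2 y1 y2 h1 h2]; first by rewrite nm0.
by rewrite (le_trans (nmD _ _))// lerD.
Qed.
Lemma nm_normr z : (nm z)%:C = `|z|.
Proof. by rewrite normc_def nmE. Qed.
Lemma nm_lt_normr z x : (`|z| < x%:C) = (nm z < x).
Proof. by rewrite -nm_normr ltcR. Qed.
Lemma nm_le_normr z x : (`|z| <= x%:C) = (nm z <= x).
Proof. by rewrite -nm_normr lecR. Qed.
Definition cderiv (f : C -> C) (z l : C) : Prop :=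
 is_derive (z : C^o) (1 : C^o) (f : C^o -> C^o) l.

Lemma gt0_complexP (e : C) : 0 < e -> exists2 r : R, 0 < r & e = r%:C.
Proof.
case: e => a b; rewrite ltcE /= => /andP[/eqP -> a0]; by exists a.
Qed.
(** In the quotient-free form the bound at [h = 0] is trivial, so a chain rule can substitute an
    increment without asking whether it vanishes. *)
Lemma cderivP f z l : cderiv f z l <-> (forall e : R, 0 < e -> exists2 d, 0 < d &
 forall h, nm h < d -> nm (f (z + h) - f z - l * h) <= e * nm h).
Proof.
split.
 case => df Df e e0; move: df.
 move/cvgrPdist_le => /(_ e%:C); rewrite (ltcR 0) => /(_ e0).
 rewrite /dnbhs /within /= => /nbhs_ballP[dC /= /gt0_complexP[d d0 ->]] H.
 exists d => // h hd.
 have [->|hn0] := eqVneq h 0; first by rewrite addr0 subrr mulr0 subr0 nm0 mulr0.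
 have := H h; rewrite /ball /= sub0r normrN nm_lt_normr => /(_ hd hn0).
 rewrite nm_le_normr /= => H'.
 have {}H' : nm (l - h^-1 *: (f (h *: (1 : C^o) + z) - f z)) <= e.
  by rewrite -Df; exact: H'.
 have -> : f (z + h) - f z - l * h = - (h * (l - h^-1 *: ((f (h *: (1:C^o) + z)) - f z))).
  by rewrite /GRing.scale /= mulr1 mulrBr mulVKf// (addrC h) opprB (mulrC h).
 by rewrite nmN nmM mulrC ler_wpM2r.
move=> H; have cv : (h^-1 *: ((f \o shift z) (h *: (1:C^o)) - f z) : C^o) @[h --> (0:C^o)^'] --> (l : C^o).
 apply/cvgrPdist_le => _ /gt0_complexP[e e0 ->].
 have [d d0 Hd] := H e e0.
 rewrite /dnbhs /within /=; apply/nbhs_ballP; exists d%:C; rewrite /= ?(ltcR 0)// => h.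
 rewrite /ball /= sub0r normrN nm_lt_normr nm_le_normr => hd hn0.
 have := Hd h hd.
 have -> : f (z + h) - f z - l * h = - (h * (l - h^-1 *: ((f (h *: (1:C^o) + z)) - f z))).
  by rewrite /GRing.scale /= mulr1 mulrBr mulVKf// (addrC h) opprB (mulrC h l).
 by rewrite nmN nmM mulrC ler_pM2r// nm_gt0.
split; first by apply/cvg_ex; exists l.
exact/cvg_lim.
Qed.
Lemma cderiv_unique f z l l' : cderiv f z l -> cderiv f z l' -> l = l'.
Proof. by case=> _ <- [_ <-]. Qed.
Lemma cderiv_near f g z l d : 0 < d -> (forall w, nm (w - z) < d -> f w = g w) ->
 cderiv f z l -> cderiv g z l.
Proof.
move=> d0 fg /cderivP H; apply/cderivP => e e0; have [d' d'0 H'] := H e e0.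
exists (Num.min d d'); first by rewrite lt_min d0.
move=> h; rewrite lt_min => /andP[hd hd'].
rewrite -!fg ?subrr ?nm0//; first exact: H'.
by rewrite addrC addKr.
Qed.
Lemma cderiv_cst c z : cderiv (fun=> c) z 0.
Proof. exact: is_derive_cst. Qed.
Lemma cderiv_id z : cderiv id z 1.
Proof. exact: is_derive_id. Qed.
Lemma cderivD f g z a b : cderiv f z a -> cderiv g z b ->
 cderiv (fun w => f w + g w) z (a + b).
Proof. by move=> fa gb; exact: is_deriveD. Qed.
Lemma cderivN f z a : cderiv f z a -> cderiv (fun w => - f w) z (- a).
Proof. by move=> fa; exact: is_deriveN. Qed.
Lemma cderivB f g z a b : cderiv f z a -> cderiv g z b ->
 cderiv (fun w => f w - g w) z (a - b).
Proof. by move=> fa gb; exact: is_deriveB. Qed.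
Lemma cderivM f g z a b : cderiv f z a -> cderiv g z b ->
 cderiv (fun w => f w * g w) z (f z * b + g z * a).
Proof. by move=> fa gb; exact: is_deriveM. Qed.
Lemma cderivV f z a : f z != 0 -> cderiv f z a ->
 cderiv (fun w => (f w)^-1) z (- (f z)^-2 * a).
Proof.
move=> fz fa; have [df Df] := fa.
split; first exact: derivableV.
by rewrite deriveV// Df.
Qed.
Lemma cderivZ f z a c : cderiv f z a -> cderiv (fun w => c * f w) z (c * a).
Proof. by move=> fa; have := cderivM (cderiv_cst c z) fa; rewrite mulr0 addr0. Qed.

Section Increment.
Context (V : zmodType) (j : V -> C).

(** One notion for both kinds of parameter: [j = id] gives complex differentiability and
    [j = real_complex R] differentiability along a real parameter, so continuity and the chain rule
    are proved once. *)
Definition incr (f : V -> C) (z : V) (l : C) := forall e : R, 0 < e -> exists2 d, 0 < d &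
 forall h, nm (j h) < d -> nm (f (z + h) - f z - l * j h) <= e * nm (j h).

Lemma incr_bound f (z : V) l : incr f z l -> exists M d, [/\ 0 < d, 0 <= M &
 forall h, nm (j h) < d -> nm (f (z + h) - f z) <= M * nm (j h)].
Proof.
move=> /(_ 1 ltr01)[d d0 H]; exists (nm l + 1), d; split => //.
 by rewrite addr_ge0.
move=> h /H hh.
have -> : f (z + h) - f z = (f (z + h) - f z - l * j h) + l * j h by rewrite subrK.
by rewrite (le_trans (nmD _ _))// nmM mulrDl addrC lerD2l.
Qed.
Lemma incr_cont f (z : V) l : incr f z l -> forall e : R, 0 < e -> exists2 d, 0 < d &
 forall w : V, nm (j (w - z)) < d -> nm (f w - f z) < e.
Proof.
move=> /incr_bound[M [d [d0 M0 H]]] e e0.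
exists (Num.min d (e / (M + 1))).
 by rewrite lt_min d0 divr_gt0// ltr_wpDl.
move=> w; rewrite lt_min => /andP[wd we].
have := H (w - z) wd; rewrite [z + _]addrC subrK => h.
rewrite (le_lt_trans h)// (@le_lt_trans _ _ ((M + 1) * nm (j (w - z))))//.
 by rewrite ler_wpM2r// lerDl.
by rewrite mulrC -ltr_pdivlMr// ltr_wpDl.
Qed.
Lemma incr_comp f g (z : V) a b : incr f z a -> cderiv g (f z) b -> incr (fun v => g (f v)) z (b * a).
Proof.
move=> fa /cderivP gb; have [M [d1 [d10 M0 H1]]] := incr_bound fa.
move=> e e0.
have e1 : 0 < e / 2 / (M + 1) by rewrite !divr_gt0// ltr_wpDl.
have e2 : 0 < e / 2 / (nm b + 1) by rewrite !divr_gt0// ltr_wpDl.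
have [d2 d20 H2] := gb _ e1; have [d3 d30 H3] := fa _ e2.
exists (Num.min d1 (Num.min d3 (d2 / (M + 1)))).
 by rewrite !lt_min d10 d30 divr_gt0// ltr_wpDl.
move=> h; rewrite !lt_min => /and3P[h1 h3 h2].
pose k := f (z + h) - f z.
have kM : nm k <= M * nm (j h) by exact: H1.
have kd : nm k < d2.
 rewrite (le_lt_trans kM)// (@le_lt_trans _ _ ((M + 1) * nm (j h)))//.
  by rewrite ler_wpM2r// lerDl.
 by rewrite mulrC -ltr_pdivlMr// ltr_wpDl.
have -> : g (f (z + h)) - g (f z) - b * a * j h =
 (g (f z + k) - g (f z) - b * k) + b * (k - a * j h).
 by rewrite /k (addrC (f z)) subrK; ring.
rewrite (le_trans (nmD _ _))// (splitr e) mulrDl lerD//.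
 rewrite (le_trans (H2 _ kd))// (@le_trans _ _ (e / 2 / (M + 1) * ((M + 1) * nm (j h))))//.
  rewrite ler_wpM2l ?(ltW e1)// (le_trans kM)// ler_wpM2r// lerDl//.
 by rewrite mulrA divfK// gt_eqF// ltr_wpDl.
rewrite nmM (@le_trans _ _ ((nm b + 1) * (e / 2 / (nm b + 1) * nm (j h))))//.
 by apply: ler_pM => //; [rewrite lerDl|exact: H3].
by rewrite mulrA [_ * (e / 2 / _)]mulrC divfK// gt_eqF// ltr_wpDl.
Qed.
End Increment.

Lemma cderiv_bound f z l : cderiv f z l -> exists M d, [/\ 0 < d, 0 <= M &
 forall h, nm h < d -> nm (f (z + h) - f z) <= M * nm h].
Proof. by move/cderivP; exact: (@incr_bound _ id). Qed.
Lemma cderiv_cont f z l : cderiv f z l -> forall e : R, 0 < e -> exists2 d, 0 < d &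
 forall w, nm (w - z) < d -> nm (f w - f z) < e.
Proof. by move/cderivP; exact: (@incr_cont _ id). Qed.
Lemma cderiv_comp f g z a b : cderiv f z a -> cderiv g (f z) b -> cderiv (fun w => g (f w)) z (b * a).
Proof. by move=> /cderivP fa gb; apply/cderivP; exact: (@incr_comp C id f g z a b fa gb). Qed.
Lemma cderivX f z a n : cderiv f z a ->
 cderiv (fun w => f w ^+ n) z (n%:R * f z ^+ n.-1 * a).
Proof.
move=> fa; elim: n => [|n ih].
 by rewrite !mul0r; exact: cderiv_cst.
have -> : (n.+1)%:R * f z ^+ n.+1.-1 * a = f z * (n%:R * f z ^+ n.-1 * a) + f z ^+ n * a.
 case: n {ih} => [|n] /=; first by rewrite !mul0r mulr0 add0r expr0 mulr1.
 by rewrite exprS -[n.+2%:R]natr1; ring.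
have := cderivM fa ih; congr (cderiv _ _ _).
by apply/funext => w; rewrite exprS.
Qed.
Definition cexp (z : C) : C :=
 Complex (expR (Re z) * cos (Im z)) (expR (Re z) * sin (Im z)).

Lemma cexp0 : cexp 0 = 1.
Proof. by rewrite /cexp /= expR0 cos0 sin0 mulr1 mulr0. Qed.
Lemma cexpD z w : cexp (z + w) = cexp z * cexp w.
Proof.
apply: ceqP; rewrite reimE /= !reimE expRD; [rewrite cosD|rewrite sinD]; ring.
Qed.
Lemma nm_cexp z : nm (cexp z) = expR (Re z).
Proof.
rewrite nmE /= !exprMn -mulrDr cos2Dsin2 mulr1 sqrtr_sqr ger0_norm// expR_ge0.
Qed.
Lemma cexp_neq0 z : cexp z != 0.
Proof. by rewrite -nm_gt0 nm_cexp expR_gt0. Qed.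
Lemma cexpN z : cexp (- z) = (cexp z)^-1.
Proof.
by apply: (mulfI (cexp_neq0 z)); rewrite -cexpD subrr cexp0 divff// cexp_neq0.
Qed.
Lemma cexpR x : cexp x%:C = (expR x)%:C.
Proof. by apply: ceqP => /=; rewrite ?cos0 ?sin0 ?mulr1 ?mulr0. Qed.
Lemma cexpMn z n : cexp (z *+ n) = cexp z ^+ n.
Proof. by elim: n => [|n ih]; rewrite ?mulr0n ?cexp0// mulrS exprS cexpD ih. Qed.

End ComplexBasics.
Ltac ceq := apply: ceqP; rewrite !reimE /=.

Arguments nm : simpl never.
Arguments cexp : simpl never.
#[export] Hint Extern 0 (is_true (Order.le _ (nm _))) => exact: nm_ge0 : core.

Section Cexp.
Variable R : realType.
Local Notation C := R[i].
Implicit Types (z w h : C) (x y : R).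

Lemma within_deriv (f df : R -> R) (a b : R) :
 (forall x : R, is_derive x 1 f (df x)) -> {within `[a, b], continuous f}.
Proof.
move=> H; apply: continuous_in_subspaceT => x _.
by apply: differentiable_continuous; apply/derivable1_diffP; have [] := H x.
Qed.
(** A mean value estimate from 0, applied in a chain: a bound for sin gives one for cos - 1, and a
    bound for cos - 1 gives one for sin x - x. *)
Lemma lip_of_deriv (f df : R -> R) (x y M : R) :
 (forall x : R, is_derive x 1 f (df x)) ->
 (forall t, `|t| <= `|x| -> `|df t| <= M) ->
 `|f x - f 0| <= M * `|x|.
Proof.
move=> H B; have [x0|x0|x0] := ltgtP 0 x.
- have [c /andP[]] := MVT x0 (fun t _ => H t) (@within_deriv _ _ _ _ H).
 rewrite !bnd_simp => c0 cx ->; rewrite subr0 normrM ler_wpM2r// B//.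
 by rewrite !gtr0_norm// ltW.
- have [c /andP[]] := MVT x0 (fun t _ => H t) (@within_deriv _ _ _ _ H).
 rewrite !bnd_simp => c0 cx; rewrite -normrN opprB => ->.
 rewrite sub0r normrM normrN ler_wpM2r// B//.
 by rewrite !ltr0_norm// lerN2 ltW.
- by rewrite -x0 subrr !normr0 mulr0.
Qed.
Lemma abs_sin_le x : `|sin x| <= `|x|.
Proof.
have := @lip_of_deriv sin cos x 0 1 (@is_derive_sin R).
by rewrite sin0 subr0 mul1r; apply => t _; rewrite ler_norml cos_geN1 cos_le1.
Qed.
Lemma abs_cosB1_le x : `|cos x - 1| <= `|x| ^+ 2.
Proof.
have := @lip_of_deriv cos (fun t => - sin t) x 0 `|x| (@is_derive_cos R).
rewrite cos0 -expr2; apply => t tx.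
by rewrite normrN (le_trans (abs_sin_le t)).
Qed.
Lemma abs_cosB1_le1 x : `|cos x - 1| <= `|x|.
Proof.
have := @lip_of_deriv cos (fun t => - sin t) x 0 1 (@is_derive_cos R).
rewrite cos0 mul1r; apply => t tx.
by rewrite normrN ler_norml sin_geN1 sin_le1.
Qed.
Lemma abs_sinB_le x : `|sin x - x| <= `|x| ^+ 2.
Proof.
have H (t : R) : is_derive t 1 (fun t => sin t - t) (cos t - 1).
 by apply: is_deriveB.
have := @lip_of_deriv _ _ x 0 `|x| H.
rewrite sin0 !subr0 -expr2; apply => t tx.
by rewrite (le_trans (abs_cosB1_le1 t)).
Qed.
Lemma expRB1_le (x : R) : expR x - 1 <= x * expR x.
Proof.
have := expR_ge1Dx (- x); rewrite expRN -div1r ler_pdivlMr ?expR_gt0// mulrBl mul1r; lra.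
Qed.
Lemma abs_expRB1_le x : `|expR x - 1| <= `|x| * expR `|x|.
Proof.
have H1 := expR_ge1Dx x; have := expR_ge1Dx (- x); rewrite expRN => H2.
have e0 := expR_gt0 x.
have H3 := expRB1_le x.
have [x0|x0] := lerP 0 x.
 rewrite ger0_norm; last by rewrite subr_ge0; lra.
 by rewrite ger0_norm.
rewrite [X in X * _]ltr0_norm// ler0_norm; last first.
 by rewrite subr_le0 -[leRHS]expR0 ler_expR ltW.
rewrite (@le_trans _ _ (- x))//; first lra.
by rewrite -[leLHS]mulr1 ler_wpM2l ?oppr_ge0 1?ltW// -[ltLHS]expR0 ltr_expR normr_gt0 lt_eqF.
Qed.
Lemma abs_expRB1B_le x : `|expR x - 1 - x| <= `|x| ^+ 2 * expR `|x|.
Proof.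
have H1 := expR_ge1Dx x; have := expR_ge1Dx (- x); rewrite expRN => H2.
have e0 := expR_gt0 x.
have H3 := expRB1_le x.
rewrite ger0_norm; last lra.
rewrite (@le_trans _ _ (x * (expR x - 1)))//; first lra.
rewrite (le_trans (ler_norm _))// normrM expr2 -mulrA ler_wpM2l//.
exact: abs_expRB1_le.
Qed.
(** An explicit quadratic remainder valid for all [h]. It gives the derivative of [cexp] here and,
    later, a majorant in the integration variable for differentiating under the integral sign. *)
Lemma nm_cexpB1B_le h : nm (cexp h - 1 - h) <= 3 * nm h ^+ 2 * expR (nm h).
Proof.
set x := Re h; set y := Im h.
have xh : `|x| <= nm h := le_Re_nm h; have yh : `|y| <= nm h := le_Im_nm h.
have exh : expR `|x| <= expR (nm h) by rewrite ler_expR.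
have ex : expR x <= expR `|x| by rewrite ler_expR ler_norm.
have e0 := expR_ge0 x; have e1 := expR_gt0 `|x|.
have s2 := nm_sqr h; rewrite -/x -/y in s2.
have x2 : `|x| ^+ 2 = x ^+ 2 by rewrite real_normK// num_real.
have y2 : `|y| ^+ 2 = y ^+ 2 by rewrite real_normK// num_real.
rewrite (le_trans (nm_le_ReIm _))// !reimE /= -/x -/y subr0.
have A : `|expR x * cos y - 1 - x| <= expR `|x| * (`|x| ^+ 2 + `|y| ^+ 2).
 have -> : expR x * cos y - 1 - x = (expR x - 1 - x) + expR x * (cos y - 1) by ring.
 rewrite (le_trans (ler_normD _ _))// [leRHS]mulrDr lerD//.
  by rewrite mulrC abs_expRB1B_le.
 by rewrite normrM ger0_norm// ler_pM// abs_cosB1_le.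
have B : `|expR x * sin y - y| <= expR `|x| * (`|y| ^+ 2 + `|x| * `|y|).
 have -> : expR x * sin y - y = expR x * (sin y - y) + (expR x - 1) * y by ring.
 rewrite (le_trans (ler_normD _ _))// [leRHS]mulrDr lerD//.
  by rewrite normrM ger0_norm// ler_pM// abs_sinB_le.
 by rewrite normrM mulrA ler_wpM2r// mulrC abs_expRB1_le.
rewrite (le_trans (lerD A B))// -mulrDr mulrC ler_pM//.
rewrite s2 -x2 -y2; have := sqr_ge0 (`|x| - `|y|); rewrite sqrrB.
have := sqr_ge0 `|x|; have := sqr_ge0 `|y|.
move: (`|x| ^+ 2) (`|y| ^+ 2) (`|x| * `|y|) => a b c; lra.
Qed.
Lemma cderiv_cexp z : cderiv (@cexp R) z (cexp z).
Proof.
apply/cderivP => e e0.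
have K : 0 < 3 * expR 1 * nm (cexp z) + 1.
 by rewrite ltr_wpDl// mulr_ge0// mulr_ge0 ?expR_ge0.
exists (Num.min 1 (e / (3 * expR 1 * nm (cexp z) + 1))).
 by rewrite lt_min ltr01 divr_gt0.
move=> h; rewrite lt_min => /andP[h1 he].
have -> : cexp (z + h) - cexp z - cexp z * h = cexp z * (cexp h - 1 - h).
 by rewrite cexpD; ring.
rewrite nmM (@le_trans _ _ (nm (cexp z) * (3 * nm h ^+ 2 * expR 1)))//.
 rewrite ler_wpM2l// (le_trans (nm_cexpB1B_le h))// ler_wpM2l//.
  by rewrite mulr_ge0// sqr_ge0.
 by rewrite ler_expR ltW.
have -> : nm (cexp z) * (3 * nm h ^+ 2 * expR 1) =
 (3 * expR 1 * nm (cexp z)) * nm h * nm h by ring.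
rewrite ler_wpM2r//.
move: he; rewrite ltr_pdivlMr// => he.
have := nm_ge0 h; move: he.
set k := 3 * _ * _; move: (nm h) => a; nra.
Qed.
End Cexp.

(** * Real and complex integrals over segments *)

Section Integrals.
Variable R : realType.
Local Notation C := R[i].
Notation mu := (@lebesgue_measure R).
Implicit Types (a b x y t : R).

Definition ivl (f : R -> R) a b : R := \int[mu]_(x in `[a, b]) f x.
(** Continuity is asked two-sidedly even at the end points. Complex differentiability at each point
    of a closed rectangle provides it, and sums and products then stay out of the relative
    topology. *)
Definition ctn (f : R -> R) a b := forall t, a <= t <= b -> {for t, continuous f}.

Lemma ctn_within f a b : ctn f a b -> {within `[a, b], continuous f}.
Proof.
move=> H; apply: continuous_in_subspaceT => t; rewrite inE /= in_itv /= => tab.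
exact: H.
Qed.
Lemma ctn_itg f a b : ctn f a b -> mu.-integrable `[a, b] (EFin \o f).
Proof.
move=> H; apply: continuous_compact_integrable; first exact: segment_compact.
exact: ctn_within.
Qed.
Lemma ivlD f g a b : ctn f a b -> ctn g a b ->
 ivl (fun t => f t + g t) a b = ivl f a b + ivl g a b.
Proof. by move=> cf cg; apply: RintegralD => //; exact: ctn_itg. Qed.
Lemma ivlB f g a b : ctn f a b -> ctn g a b ->
 ivl (fun t => f t - g t) a b = ivl f a b - ivl g a b.
Proof. by move=> cf cg; apply: RintegralB => //; exact: ctn_itg. Qed.
Lemma ivlZ k f a b : ctn f a b -> ivl (fun t => k * f t) a b = k * ivl f a b.
Proof. by move=> cf; apply: RintegralZl => //; exact: ctn_itg. Qed.
Lemma ivl_cat f a b c : a <= b -> b <= c -> ctn f a c ->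
 ivl f a c = ivl f a b + ivl f b c.
Proof.
move=> ab bc cf.
have i1 : mu.-integrable `]b, c] (EFin \o f).
 apply: integrableS (ctn_itg cf) => //; apply: subset_itvr.
 by rewrite bnd_simp.
have := @Rintegral_itvB R f (BLeft a) (BRight c) b (ctn_itg cf).
rewrite !bnd_simp => /(_ ab bc) h.
rewrite /ivl -(@Rintegral_itv_obnd_cbnd R b (BRight c) f)// -h.
by rewrite addrC subrK.
Qed.
Lemma ivl_bound f a b M : a <= b -> ctn f a b ->
 (forall t, a <= t <= b -> `|f t| <= M) -> `|ivl f a b| <= M * (b - a).
Proof.
move=> ab cf B.
have i1 := ctn_itg cf.
rewrite (le_trans (le_normr_Rintegral _ i1))//.
have i2 : mu.-integrable `[a, b] (EFin \o cst M).
 by apply: ctn_itg => t _; exact: cst_continuous.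
rewrite (@le_trans _ _ (\int[mu]_(x in `[a, b]) (cst M) x))//.
 have i3 : mu.-integrable `[a, b] (EFin \o (fun t => `|f t|)) by exact: (integrable_norm i1).
 by apply: le_Rintegral => // t; rewrite /= in_itv /= => /B.
rewrite Rintegral_cst//= lebesgue_measure_itv /= lte_fin.
case: ifPn => //=; rewrite -leNgt => ba.
by rewrite (le_anti (introT andP (conj ab ba))) subrr.
Qed.
Lemma ivl_aa f a : ivl f a a = 0.
Proof. by rewrite /ivl set_itv1 Rintegral_set1. Qed.
Lemma ivl_FTC f F a b : a <= b -> ctn f a b ->
 (forall t, a <= t <= b -> is_derive t 1 F (f t)) -> ivl f a b = F b - F a.
Proof.
rewrite le_eqVlt => /predU1P[<- _ _|ab cf dF]; first by rewrite ivl_aa subrr.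
have cF t : a <= t <= b -> {for t, continuous F}.
 move=> tab; apply: differentiable_continuous; apply/derivable1_diffP.
 by have [] := dF t tab.
rewrite /ivl /Rintegral (@continuous_FTC2 R f F a b)//.
- exact: ctn_within.
- split.
 + move=> t; rewrite in_itv /= => /andP[at' tb]; have [] // := dF t _.
  by rewrite !ltW.
 + apply: cvg_at_right_filter; apply: cF; by rewrite lexx ltW.
 + apply: cvg_at_left_filter; apply: cF; by rewrite lexx andbT ltW.
- move=> t; rewrite in_itv /= => /andP[at' tb].
 have tab : a <= t <= b by rewrite !ltW.
 by have [_] := dF t tab; rewrite derive1E.
Qed.
Definition ccont (f : R -> C) t := forall e : R, 0 < e -> exists2 d, 0 < d &
 forall s, `|s - t| < d -> nm (f s - f t) < e.
Definition cctn f a b := forall t, a <= t <= b -> ccont f t.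

Lemma ccont_Re f t : ccont f t -> {for t, continuous (fun s => Re (f s))}.
Proof.
move=> H; apply/cvgrPdist_lt => e e0; have [d d0 Hd] := H e e0.
near=> s; rewrite distrC -ReN -ReD (le_lt_trans (le_Re_nm _))// Hd//.
Unshelve. all: by end_near. Qed.
Lemma ccont_Im f t : ccont f t -> {for t, continuous (fun s => Im (f s))}.
Proof.
move=> H; apply/cvgrPdist_lt => e e0; have [d d0 Hd] := H e e0.
near=> s; rewrite distrC -ImN -ImD (le_lt_trans (le_Im_nm _))// Hd//.
Unshelve. all: by end_near. Qed.
Lemma ccont_cst c t : ccont (fun=> c) t.
Proof. by move=> e e0; exists 1 => // s _; rewrite subrr nm0. Qed.
Lemma ccontD f g t : ccont f t -> ccont g t -> ccont (fun s => f s + g s) t.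
Proof.
move=> cf cg e e0; have e2 : 0 < e / 2 by rewrite divr_gt0.
have [d d0 H] := cf _ e2; have [d' d'0 H'] := cg _ e2.
exists (Num.min d d') => [|s]; first by rewrite lt_min d0.
rewrite lt_min => /andP[/H h /H' h'].
have -> : f s + g s - (f t + g t) = (f s - f t) + (g s - g t) by ring.
by rewrite (le_lt_trans (nmD _ _))// (splitr e) ltrD.
Qed.
Lemma ccontM f g t : ccont f t -> ccont g t -> ccont (fun s => f s * g s) t.
Proof.
move=> cf cg e e0.
have K1 : 0 < nm (g t) + 1 by rewrite ltr_wpDl.
have K2 : 0 < nm (f t) + 1 by rewrite ltr_wpDl.
have e1 : 0 < e / 2 / (nm (g t) + 1) by rewrite !divr_gt0.
have e2 : 0 < Num.min 1 (e / 2 / (nm (f t) + 1)) by rewrite lt_min ltr01 !divr_gt0.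
have [d d0 H] := cf _ e1; have [d' d'0 H'] := cg _ e2.
exists (Num.min d d') => [|s]; first by rewrite lt_min d0.
rewrite lt_min => /andP[/H h /H']; rewrite lt_min => /andP[h1 h2].
have -> : f s * g s - f t * g t = (f s - f t) * g s + f t * (g s - g t) by ring.
rewrite (le_lt_trans (nmD _ _))// (splitr e) !nmM.
have gs : nm (g s) < nm (g t) + 1.
 have -> : g s = (g s - g t) + g t by rewrite subrK.
 by rewrite (le_lt_trans (nmD _ _))// addrC ltrD2l.
apply: ltr_leD.
 rewrite (@le_lt_trans _ _ (nm (f s - f t) * (nm (g t) + 1)))//.
  by rewrite ler_wpM2l// ltW.
 by rewrite -ltr_pdivlMr.
rewrite (@le_trans _ _ ((nm (f t) + 1) * nm (g s - g t)))//.
 by rewrite ler_wpM2r// lerDl.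
by rewrite mulrC -ler_pdivlMr// ltW.
Qed.
Lemma ccontN f t : ccont f t -> ccont (fun s => - f s) t.
Proof.
move=> cf e e0; have [d d0 H] := cf e e0; exists d => // s /H.
by rewrite -opprD nmN.
Qed.
Lemma ccontB f g t : ccont f t -> ccont g t -> ccont (fun s => f s - g s) t.
Proof. by move=> cf cg; apply: ccontD => //; exact: ccontN. Qed.
Definition rderiv (f : R -> C) t (l : C) := forall e : R, 0 < e -> exists2 d, 0 < d &
 forall h, `|h| < d -> nm (f (t + h) - f t - l * h%:C) <= e * `|h|.

Lemma is_derive_epsdel (f : R -> R) t l :
 (forall e : R, 0 < e -> exists2 d, 0 < d &
  forall h, `|h| < d -> `|f (t + h) - f t - l * h| <= e * `|h|) ->
 is_derive t 1 f l.
Proof.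
move=> H; have cv : (h^-1 *: ((f \o shift t) (h *: (1:R)) - f t)) @[h --> (0:R)^'] --> l.
 apply/cvgrPdist_le => e e0; have [d d0 Hd] := H e e0.
 rewrite /dnbhs /within /=; apply/nbhs_ballP; exists d => //= h.
 rewrite /ball /= sub0r normrN => hd hn0.
 have := Hd h hd.
 have -> : f (t + h) - f t - l * h = - (h * (l - h^-1 *: ((f (h *: (1:R) + t)) - f t))).
  by rewrite /GRing.scale /= mulr1 mulrBr mulVKf// (addrC h) opprB (mulrC h l).
 by rewrite normrN normrM mulrC ler_pM2r// normr_gt0.
split; first by apply/cvg_ex; exists l.
exact/cvg_lim.
Qed.
Lemma rderiv_Re f t l : rderiv f t l -> is_derive t 1 (fun s => Re (f s)) (Re l).
Proof.
move=> H; apply: is_derive_epsdel => e e0; have [d d0 Hd] := H e e0.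
exists d => // h /Hd; apply: le_trans.
have -> : Re (f (t + h)) - Re (f t) - Re l * h = Re (f (t + h) - f t - l * h%:C).
 by rewrite !reimE /= mulr0 subr0.
exact: le_Re_nm.
Qed.
Lemma rderiv_Im f t l : rderiv f t l -> is_derive t 1 (fun s => Im (f s)) (Im l).
Proof.
move=> H; apply: is_derive_epsdel => e e0; have [d d0 Hd] := H e e0.
exists d => // h /Hd; apply: le_trans.
have -> : Im (f (t + h)) - Im (f t) - Im l * h = Im (f (t + h) - f t - l * h%:C).
 by rewrite !reimE /= mulr0 add0r.
exact: le_Im_nm.
Qed.
Lemma rderivP f t l : rderiv f t l <-> incr (real_complex R) f t l.
Proof. by split=> H e /H[d d0 K]; exists d => // h; have := K h; rewrite nmR. Qed.
Lemma rderiv_cont f t l : rderiv f t l -> ccont f t.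
Proof. by move=> /rderivP/incr_cont H e /H[d d0 K]; exists d => // s; have := K s; rewrite nmR. Qed.
Lemma cderiv_rcomp (f : R -> C) (g : C -> C) t (a b : C) : rderiv f t a -> cderiv g (f t) b ->
 rderiv (fun w => g (f w)) t (b * a).
Proof. by move=> /rderivP fa gb; apply/rderivP; exact: incr_comp. Qed.
Lemma rderiv_affine (p v : C) t : rderiv (fun s => p + v * s%:C) t v.
Proof.
move=> e e0; exists 1 => // h _.
have -> : p + v * (t + h)%:C - (p + v * t%:C) - v * h%:C = 0.
 by rewrite rmorphD /=; ring.
by rewrite nm0 mulr_ge0// ltW.
Qed.
Definition cI (f : R -> C) a b : C :=
 Complex (ivl (fun t => Re (f t)) a b) (ivl (fun t => Im (f t)) a b).

Lemma cctn_Re f a b : cctn f a b -> ctn (fun t => Re (f t)) a b.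
Proof. by move=> H t tab; apply: ccont_Re; exact: H. Qed.
Lemma cctn_Im f a b : cctn f a b -> ctn (fun t => Im (f t)) a b.
Proof. by move=> H t tab; apply: ccont_Im; exact: H. Qed.
Hint Resolve cctn_Re cctn_Im : core.

Lemma cI_eq f g a b : (forall t, a <= t <= b -> f t = g t) -> cI f a b = cI g a b.
Proof.
move=> fg; apply: ceqP => /=; apply: eq_Rintegral => t;
 by rewrite inE /= in_itv /= => tab; rewrite fg.
Qed.
Lemma cID f g a b : cctn f a b -> cctn g a b ->
 cI (fun t => f t + g t) a b = cI f a b + cI g a b.
Proof.
move=> cf cg; ceq; rewrite -ivlD; auto;
 by apply: eq_Rintegral => t _; rewrite reimE.
Qed.
Lemma cIZ k f a b : cctn f a b -> cI (fun t => k * f t) a b = k * cI f a b.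
Proof.
move=> cf; have cr := cctn_Re cf; have ci := cctn_Im cf.
have cz (r : R) (g : R -> R) : ctn g a b -> ctn (fun t => r * g t) a b.
 by move=> cg t tab; apply: cvgM; [exact: cvg_cst|exact: cg].
ceq; rewrite -!ivlZ//.
 rewrite -ivlB; [|exact: cz..].
 by apply: eq_Rintegral => t _; rewrite reimE.
rewrite -ivlD; [|exact: cz..].
by apply: eq_Rintegral => t _; rewrite reimE.
Qed.
Lemma cIB f g a b : cctn f a b -> cctn g a b ->
 cI (fun t => f t - g t) a b = cI f a b - cI g a b.
Proof.
move=> cf cg; ceq; rewrite -ivlB; auto;
 by apply: eq_Rintegral => t _; rewrite !reimE.
Qed.
Lemma cI_cat f a b c : a <= b -> b <= c -> cctn f a c -> cI f a c = cI f a b + cI f b c.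
Proof. by move=> ab bc cf; ceq; rewrite -ivl_cat; auto. Qed.
(** The factor 2 comes from bounding real and imaginary parts separately; the later estimates
    tolerate it. *)
Lemma cI_bound f a b M : a <= b -> cctn f a b ->
 (forall t, a <= t <= b -> nm (f t) <= M) -> nm (cI f a b) <= 2 * M * (b - a).
Proof.
move=> ab cf B; rewrite (le_trans (nm_le_ReIm _))//= -mulrA mulr_natl mulr2n.
by apply: lerD; apply: ivl_bound; auto => t tab;
 [apply: le_trans (le_Re_nm _) _|apply: le_trans (le_Im_nm _) _]; exact: B.
Qed.
Lemma cI_FTC f F a b : a <= b -> cctn f a b ->
 (forall t, a <= t <= b -> rderiv F t (f t)) -> cI f a b = F b - F a.
Proof.
move=> ab cf dF; ceq.
 by apply: (ivl_FTC (F := fun t => Re (F t))); auto => t /dF /rderiv_Re.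
by apply: (ivl_FTC (F := fun t => Im (F t))); auto => t /dF /rderiv_Im.
Qed.
Lemma cctnS f a b a' b' : a <= a' -> b' <= b -> cctn f a b -> cctn f a' b'.
Proof.
move=> aa bb cf t /andP[at' tb]; apply: cf.
by rewrite (le_trans aa)// (le_trans tb).
Qed.
Lemma cI_cst c a b : a <= b -> cI (fun=> c) a b = c * (b - a)%:C.
Proof.
move=> ab; rewrite (@cI_FTC _ (fun t => 0 + c * t%:C))//.
- by rewrite rmorphB /=; ring.
- by move=> t _; exact: ccont_cst.
- by move=> t _; exact: rderiv_affine.
Qed.
(** Controls the difference quotient of an integral whose upper limit moves in either direction;
    this is what differentiates a primitive defined by integration along a path. *)
Lemma cI_inc_bound f a b y y' c e : a <= y <= b -> a <= y' <= b -> cctn f a b ->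
 (forall t, `|t - y| <= `|y' - y| -> a <= t <= b -> nm (f t - c) <= e) ->
 nm (cI f a y' - cI f a y - c * (y' - y)%:C) <= 2 * e * `|y' - y|.
Proof.
move=> /andP[ay yb] /andP[ay' y'b] cf.
have key u v : a <= u -> u <= v -> v <= b ->
 (forall t, u <= t <= v -> nm (f t - c) <= e) ->
 nm (cI f a v - cI f a u - c * (v - u)%:C) <= 2 * e * (v - u).
 move=> au uv vb B.
 have cuv : cctn f u v by apply: cctnS cf.
 rewrite (@cI_cat f a u v)//; last exact: cctnS cf.
 rewrite [cI f a u + _]addrC addrK -cI_cst// -cIB//; last by move=> t _; exact: ccont_cst.
 apply: cI_bound => // t tuv; apply: ccontB; [exact: cuv|exact: ccont_cst].
have [yy|yy] := lerP y y'.
 move=> H; apply: key => // t /andP[yt ty].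
 apply: H; last by rewrite (le_trans ay)// (le_trans ty).
 by rewrite ger0_norm ?subr_ge0// lerD2r.
move=> H.
have -> : cI f a y' - cI f a y - c * (y' - y)%:C = - (cI f a y - cI f a y' - c * (y - y')%:C).
 by rewrite !rmorphB /=; ring.
rewrite nmN; apply: key => //; first exact: ltW.
move=> t /andP[yt ty].
apply: H; last by rewrite (le_trans ay')// (le_trans ty).
by rewrite ler0_norm ?subr_le0// opprB lerB.
Qed.

End Integrals.
Arguments cI : simpl never.

(** * Goursat's theorem *)

Section Goursat.
Variable R : realType.
Local Notation C := R[i].
Implicit Types (f F : C -> C) (x y : R) (z : C).

Definition cder_at f z := exists l, cderiv f z l.
Definition in_rect x1 x2 y1 y2 z := x1 <= Re z <= x2 /\ y1 <= Im z <= y2.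
Definition holo_rect f x1 x2 y1 y2 := forall z, in_rect x1 x2 y1 y2 z -> cder_at f z.

Definition hline y t : C := Complex t y.
Definition vline x t : C := Complex x t.

Lemma rderiv_hline y t : rderiv (hline y) t 1.
Proof.
have := @rderiv_affine R (Complex 0 y) 1 t; congr (rderiv _ _ _).
by apply/funext => s; ceq; ring.
Qed.
Lemma rderiv_vline x t : rderiv (vline x) t 'i.
Proof.
have := @rderiv_affine R (Complex x 0) 'i t; congr (rderiv _ _ _).
by apply/funext => s; ceq; ring.
Qed.
Lemma ccont_comp f (p : R -> C) t v : cder_at f (p t) -> rderiv p t v ->
 ccont (fun s => f (p s)) t.
Proof. by move=> [l df] dp; apply: rderiv_cont (cderiv_rcomp dp df). Qed.
Definition rct f x1 x2 y1 y2 : C :=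
 cI (fun t => f (hline y1 t)) x1 x2 + 'i * cI (fun t => f (vline x2 t)) y1 y2
 - cI (fun t => f (hline y2 t)) x1 x2 - 'i * cI (fun t => f (vline x1 t)) y1 y2.

Lemma cctn_h f x1 x2 y1 y2 y : holo_rect f x1 x2 y1 y2 -> y1 <= y <= y2 ->
 cctn (fun t => f (hline y t)) x1 x2.
Proof. by move=> hf yy t tx; apply: ccont_comp (rderiv_hline y t); exact: hf. Qed.
Lemma cctn_v f x1 x2 y1 y2 x : holo_rect f x1 x2 y1 y2 -> x1 <= x <= x2 ->
 cctn (fun t => f (vline x t)) y1 y2.
Proof. by move=> hf yy t tx; apply: ccont_comp (rderiv_vline x t); exact: hf. Qed.
Lemma holo_rectS f x1 x2 y1 y2 u1 u2 v1 v2 : x1 <= u1 -> u2 <= x2 -> y1 <= v1 -> v2 <= y2 ->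
 holo_rect f x1 x2 y1 y2 -> holo_rect f u1 u2 v1 v2.
Proof.
move=> a b c d hf z [/andP[e g] /andP[h i]]; apply: hf; split.
 by rewrite (le_trans a)// (le_trans g).
by rewrite (le_trans c)// (le_trans i).
Qed.
Lemma rct_splitx f x1 xm x2 y1 y2 : x1 <= xm <= x2 -> y1 <= y2 ->
 holo_rect f x1 x2 y1 y2 ->
 rct f x1 x2 y1 y2 = rct f x1 xm y1 y2 + rct f xm x2 y1 y2.
Proof.
move=> /andP[a b] c hf; rewrite /rct.
rewrite (@cI_cat R (fun t => f (hline y1 t)) x1 xm x2)//; last by apply: (cctn_h hf); rewrite lexx.
rewrite (@cI_cat R (fun t => f (hline y2 t)) x1 xm x2)//; last by apply: (cctn_h hf); rewrite lexx andbT.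
ring.
Qed.
Lemma rct_splity f x1 x2 y1 ym y2 : x1 <= x2 -> y1 <= ym <= y2 ->
 holo_rect f x1 x2 y1 y2 ->
 rct f x1 x2 y1 y2 = rct f x1 x2 y1 ym + rct f x1 x2 ym y2.
Proof.
move=> c /andP[a b] hf; rewrite /rct.
rewrite (@cI_cat R (fun t => f (vline x1 t)) y1 ym y2)//; last by apply: (cctn_v hf); rewrite lexx.
rewrite (@cI_cat R (fun t => f (vline x2 t)) y1 ym y2)//; last by apply: (cctn_v hf); rewrite lexx andbT.
ring.
Qed.
Lemma rct_prim f F x1 x2 y1 y2 : x1 <= x2 -> y1 <= y2 -> holo_rect f x1 x2 y1 y2 ->
 (forall z, in_rect x1 x2 y1 y2 z -> cderiv F z (f z)) -> rct f x1 x2 y1 y2 = 0.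
Proof.
move=> a b hf dF; rewrite /rct.
have H y : y1 <= y <= y2 -> cI (fun t => f (hline y t)) x1 x2 = F (hline y x2) - F (hline y x1).
 move=> yy; apply: (cI_FTC (F := fun t => F (hline y t))) => //; first exact: (cctn_h hf).
 move=> t tx; rewrite -[f _]mulr1; apply: cderiv_rcomp (rderiv_hline y t) _.
 exact: dF.
have V x : x1 <= x <= x2 -> 'i * cI (fun t => f (vline x t)) y1 y2 = F (vline x y2) - F (vline x y1).
 move=> xx; rewrite -cIZ; last exact: (cctn_v hf).
 apply: (cI_FTC (F := fun t => F (vline x t))) => //.
  by move=> t ty; apply: ccontM; [exact: ccont_cst|exact: (cctn_v hf)].
 move=> t tx; rewrite mulrC; apply: cderiv_rcomp (rderiv_vline x t) _.
 exact: dF.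
rewrite !H ?lexx ?andbT// !V ?lexx ?andbT//.
have -> : hline y1 x2 = vline x2 y1 by []. have -> : hline y2 x2 = vline x2 y2 by [].
have -> : hline y1 x1 = vline x1 y1 by []. have -> : hline y2 x1 = vline x1 y2 by [].
ring.
Qed.
Lemma rctB f g x1 x2 y1 y2 : x1 <= x2 -> y1 <= y2 -> holo_rect f x1 x2 y1 y2 ->
 holo_rect g x1 x2 y1 y2 ->
 rct (fun z => f z - g z) x1 x2 y1 y2 = rct f x1 x2 y1 y2 - rct g x1 x2 y1 y2.
Proof.
move=> a b hf hg; rewrite /rct !cIB;
 try (by [apply: (cctn_h hf); rewrite lexx ?andbT | apply: (cctn_h hg); rewrite lexx ?andbT
  | apply: (cctn_v hf); rewrite lexx ?andbT | apply: (cctn_v hg); rewrite lexx ?andbT]).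
ring.
Qed.
Lemma rct_bound f x1 x2 y1 y2 M : x1 <= x2 -> y1 <= y2 -> holo_rect f x1 x2 y1 y2 ->
 (forall z, in_rect x1 x2 y1 y2 z -> nm (f z) <= M) ->
 nm (rct f x1 x2 y1 y2) <= 4 * M * ((x2 - x1) + (y2 - y1)).
Proof.
move=> a b hf B; rewrite /rct.
have H y : y1 <= y <= y2 -> nm (cI (fun t => f (hline y t)) x1 x2) <= 2 * M * (x2 - x1).
 by move=> yy; apply: cI_bound => //; [exact: (cctn_h hf)|move=> t tx; exact: B].
have V x : x1 <= x <= x2 -> nm ('i * cI (fun t => f (vline x t)) y1 y2) <= 2 * M * (y2 - y1).
 by move=> xx; rewrite nmM nm_i mul1r; apply: cI_bound => //; [exact: (cctn_v hf)|move=> t tx; exact: B].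
have h1 : y1 <= y1 <= y2 by rewrite lexx. have h2 : y1 <= y2 <= y2 by rewrite lexx andbT.
have v1 : x1 <= x1 <= x2 by rewrite lexx. have v2 : x1 <= x2 <= x2 by rewrite lexx andbT.
have := H _ h1; have := H _ h2; have := V _ v1; have := V _ v2.
set p := cI (fun t => f (hline y1 t)) _ _; set q := 'i * cI (fun t => f (vline x2 t)) _ _.
set r := cI (fun t => f (hline y2 t)) _ _; set s := 'i * cI (fun t => f (vline x1 t)) _ _ => e1 e2 e3 e4.
have := nmB (p + q - r) s; have := nmB (p + q) r; have := nmD p q; lra.
Qed.

Section bisect.
Variables (f : C -> C) (x0 y0 W H e : R).
Hypothesis W0 : 0 <= W.
Hypothesis H0 : 0 <= H.
Hypothesis e0 : 0 < e.
Hypothesis hf : holo_rect f x0 (x0 + W) y0 (y0 + H).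
Let w n := W / 2 ^+ n.
Let h n := H / 2 ^+ n.
(** Halving both sides divides this bound by four, so if a rectangle violates it then so does one of
    its four quarters. *)
Let good (p : R * R) n := nm (rct f p.1 (p.1 + w n) p.2 (p.2 + h n)) <= 4 * e * (w n + h n) ^+ 2.
Let inb (p : R * R) n := [/\ x0 <= p.1, p.1 + w n <= x0 + W, y0 <= p.2 & p.2 + h n <= y0 + H].
Let two0 n : (2 : R) ^+ n != 0. Proof. by rewrite expf_neq0// pnatr_eq0. Qed.
Let wS n : w n = w n.+1 + w n.+1. Proof. by rewrite /w exprS; field; rewrite two0. Qed.
Let hS n : h n = h n.+1 + h n.+1. Proof. by rewrite /h exprS; field; rewrite two0. Qed.
Let w0 n : 0 <= w n. Proof. by rewrite divr_ge0// exprn_ge0. Qed.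
Let h0 n : 0 <= h n. Proof. by rewrite divr_ge0// exprn_ge0. Qed.
Let step n (p : R * R) : R * R :=
 if ~~ good p n.+1 then p else
 if ~~ good (p.1 + w n.+1, p.2) n.+1 then (p.1 + w n.+1, p.2) else
 if ~~ good (p.1, p.2 + h n.+1) n.+1 then (p.1, p.2 + h n.+1) else
 (p.1 + w n.+1, p.2 + h n.+1).

Let step_range n p : [/\ p.1 <= (step n p).1 , (step n p).1 + w n.+1 <= p.1 + w n,
 p.2 <= (step n p).2 & (step n p).2 + h n.+1 <= p.2 + h n].
Proof.
have := w0 n.+1; have := h0 n.+1; rewrite /step (wS n) (hS n).
by move: (w n.+1) (h n.+1) => a b; case: ifP => _; [|case: ifP => _; [|case: ifP => _]] => /=; split; lra.
Qed.
Let step_inb n p : inb p n -> inb (step n p) n.+1.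
Proof. by move=> [a b c d]; have [a' b' c' d'] := step_range n p; split; lra. Qed.
Let step_bad n p : inb p n -> ~~ good p n -> ~~ good (step n p) n.+1.
Proof.
move=> [a b c d]; rewrite /step.
case: ifPn => [//|]; rewrite negbK => g1.
case: ifPn => [//|]; rewrite negbK => g2.
case: ifPn => [//|]; rewrite negbK => g3.
apply: contra => g4; rewrite /good (wS n) (hS n).
move: g1 g2 g3 g4; rewrite /good /=.
have hfr : holo_rect f p.1 (p.1 + w n) p.2 (p.2 + h n) by apply: holo_rectS hf.
have ww := w0 n.+1; have hh := h0 n.+1; have EW := wS n; have EH := hS n.
rewrite (@rct_splitx f p.1 (p.1 + w n.+1) (p.1 + (w n.+1 + w n.+1)) p.2 (p.2 + (h n.+1 + h n.+1))); [|lra|lra|by rewrite -wS -hS].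
have -> : p.1 + (w n.+1 + w n.+1) = p.1 + w n.+1 + w n.+1 by rewrite addrA.
have -> : p.2 + (h n.+1 + h n.+1) = p.2 + h n.+1 + h n.+1 by rewrite addrA.
have hl : holo_rect f p.1 (p.1 + w n.+1) p.2 (p.2 + h n.+1 + h n.+1).
 by apply: holo_rectS hfr => //; lra.
have hr : holo_rect f (p.1 + w n.+1) (p.1 + w n.+1 + w n.+1) p.2 (p.2 + h n.+1 + h n.+1).
 by apply: holo_rectS hfr => //; lra.
rewrite (@rct_splity f p.1 (p.1 + w n.+1) p.2 (p.2 + h n.+1) (p.2 + h n.+1 + h n.+1)); [|lra|lra|by []].
rewrite (@rct_splity f (p.1 + w n.+1) (p.1 + w n.+1 + w n.+1) p.2 (p.2 + h n.+1) (p.2 + h n.+1 + h n.+1)); [|lra|lra|by []].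
set A := rct f p.1 (p.1 + w n.+1) p.2 (p.2 + h n.+1).
set B := rct f p.1 (p.1 + w n.+1) (p.2 + h n.+1) (p.2 + h n.+1 + h n.+1).
set A' := rct f _ _ p.2 (p.2 + h n.+1).
set B' := rct f (p.1 + w n.+1) (p.1 + w n.+1 + w n.+1) (p.2 + h n.+1) (p.2 + h n.+1 + h n.+1) => g1 g2 g3 g4.
have := nmD (A + B) (A' + B'); have := nmD A B; have := nmD A' B'; move: g1 g2 g3 g4.
rewrite !expr2; nra.
Qed.
Let pt := fix pt n : R * R := if n is n'.+1 then step n' (pt n') else (x0, y0).

Lemma bisection : nm (rct f x0 (x0 + W) y0 (y0 + H)) <= 4 * e * (W + H) ^+ 2.
Proof.
have wz : w 0 = W by rewrite /w expr0 divr1.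
have hz : h 0 = H by rewrite /h expr0 divr1.
suff : good (x0, y0) 0 by rewrite /good /= wz hz.
apply/negPn/negP => bad0.
have inv n : inb (pt n) n /\ ~~ good (pt n) n.
 elim: n => [|n [i b]] /=.
  by split => //; split; rewrite /= ?wz ?hz.
 by split; [exact: step_inb|exact: step_bad].
have mono n m : (n <= m)%N -> [/\ (pt n).1 <= (pt m).1, (pt m).1 + w m <= (pt n).1 + w n,
  (pt n).2 <= (pt m).2 & (pt m).2 + h m <= (pt n).2 + h n].
 elim: m => [|m IH]; first by rewrite leqn0 => /eqP ->.
 rewrite leq_eqVlt => /predU1P[->//|]; rewrite ltnS => /IH[a b c d].
 have [a' b' c' d'] := step_range m (pt m).
 by rewrite [pt m.+1]/=; split; lra.
have ub1 n m : (pt m).1 <= (pt n).1 + w n.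
 have [a b _ _] := mono _ _ (leq_maxl n m); have [a' b' _ _] := mono _ _ (leq_maxr n m).
 have := w0 (maxn n m); lra.
have ub2 n m : (pt m).2 <= (pt n).2 + h n.
 have [_ _ a b] := mono _ _ (leq_maxl n m); have [_ _ a' b'] := mono _ _ (leq_maxr n m).
 have := h0 (maxn n m); lra.
(* Lower left corners increase and stay below every upper right corner, so the suprema give a point
   common to all the nested rectangles. *)
pose X := sup (range (fun n => (pt n).1)); pose Y := sup (range (fun n => (pt n).2)).
have XP n : (pt n).1 <= X <= (pt n).1 + w n.
 apply/andP; split.
  apply: ub_le_sup; last by exists n.
  by exists ((pt 0).1 + w 0) => _ [m _ <-]; exact: ub1.
 apply: ge_sup; first by exists (pt 0).1; exists 0%N.
 by move=> _ [m _ <-]; exact: ub1.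
have YP n : (pt n).2 <= Y <= (pt n).2 + h n.
 apply/andP; split.
  apply: ub_le_sup; last by exists n.
  by exists ((pt 0).2 + h 0) => _ [m _ <-]; exact: ub2.
 apply: ge_sup; first by exists (pt 0).2; exists 0%N.
 by move=> _ [m _ <-]; exact: ub2.
have [l dl] : cder_at f (Complex X Y).
 by apply: hf; split; [have := XP 0%N|have := YP 0%N]; rewrite /= ?wz ?hz.
have /cderivP /(_ e e0)[d d0 Hd] := dl.
have [n nd] : exists n, w n + h n < d.
 have [N WN] : exists N : nat, (W + H) / d < N%:R.
  by exists (Num.bound ((W + H) / d)); apply: archi_boundP; rewrite divr_ge0 ?addr_ge0// ltW.
 exists N; rewrite /w /h -mulrDl ltr_pdivrMr ?exprn_gt0//.
 move: WN; rewrite ltr_pdivrMr// => WN; rewrite (lt_le_trans WN)// mulrC ler_wpM2l// ltW//.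
 by rewrite -natrX ltr_nat ltn_expl.
have [[i1 i2 i3 i4] /negP b] := inv n; apply: b; rewrite /good.
set x1 := (pt n).1 in i1 i2 *; set y1 := (pt n).2 in i3 i4 *.
have /andP[X1 X2] := XP n; have /andP[Y1 Y2] := YP n; rewrite -/x1 -/y1 in X1 X2 Y1 Y2.
have wn := w0 n; have hn := h0 n.
have xw : x1 <= x1 + w n by lra. have yh : y1 <= y1 + h n by lra.
have hfr : holo_rect f x1 (x1 + w n) y1 (y1 + h n) by apply: holo_rectS hf.
(* Near the common point [f] differs from its affine part [g] by at most [e] times the distance, and
   [g] has the primitive [G], so only the difference contributes to the boundary integral. *)
pose g z := f (Complex X Y) + l * (z - Complex X Y).
pose G z := f (Complex X Y) * z + l / 2 * ((z - Complex X Y) ^+ 2).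
have dG z : cderiv G z (g z).
 have d1 : cderiv (fun z => z - Complex X Y) z 1.
  by have := cderivB (cderiv_id z) (cderiv_cst (Complex X Y) z); rewrite subr0.
 have := cderivD (cderivZ (f (Complex X Y)) (cderiv_id z)) (cderivZ (l / 2) (cderivX 2 d1)).
 by congr (cderiv _ _ _); rewrite /g expr1; field.
have dg z : cderiv g z l.
 have d1 : cderiv (fun z => z - Complex X Y) z 1.
  by have := cderivB (cderiv_id z) (cderiv_cst (Complex X Y) z); rewrite subr0.
 have := cderivD (cderiv_cst (f (Complex X Y)) z) (cderivZ l d1).
 by rewrite mulr1 add0r.
have hg : holo_rect g x1 (x1 + w n) y1 (y1 + h n) by move=> z _; exists l.
have E : rct f x1 (x1 + w n) y1 (y1 + h n) = rct (fun z => f z - g z) x1 (x1 + w n) y1 (y1 + h n).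
 by rewrite rctB// (@rct_prim g G)// subr0.
rewrite E; have -> : 4 * e * (w n + h n) ^+ 2 =
 4 * (e * (w n + h n)) * ((x1 + w n - x1) + (y1 + h n - y1)) by ring.
apply: rct_bound => //.
 by move=> z /hfr[l' dl']; exists (l' - l); apply: cderivB.
move=> z [/andP[z1 z2] /andP[z3 z4]].
have nz : nm (z - Complex X Y) <= w n + h n.
 rewrite (le_trans (nm_le_ReIm _))// !reimE /= lerD// ler_norml; lra.
have := Hd (z - Complex X Y) (le_lt_trans nz nd); rewrite [Complex X Y + _]addrC subrK => B.
rewrite /g opprD addrA (le_trans B)// ler_wpM2l// ltW//.
Qed.
End bisect.

Theorem Goursat f x1 x2 y1 y2 : x1 <= x2 -> y1 <= y2 -> holo_rect f x1 x2 y1 y2 ->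
 rct f x1 x2 y1 y2 = 0.
Proof.
move=> a b hf; apply/eqP; rewrite -nm_eq0; apply/eqP/le_anti; rewrite nm_ge0 andbT.
have W0 : 0 <= x2 - x1 by rewrite subr_ge0. have H0 : 0 <= y2 - y1 by rewrite subr_ge0.
apply/ler_addgt0Pr => e e0; rewrite add0r.
set K := (x2 - x1) + (y2 - y1); have K0 : 0 <= K by rewrite addr_ge0.
have k0 : 0 < 4 * K ^+ 2 + 1 by rewrite ltr_wpDl// mulr_ge0// sqr_ge0.
have e1 : 0 < e / (4 * K ^+ 2 + 1) by rewrite divr_gt0.
have := @bisection f x1 y1 (x2 - x1) (y2 - y1) _ W0 H0 e1.
rewrite [x1 + _]addrC [y1 + _]addrC !subrK => /(_ hf) h; apply: le_trans h _.
rewrite -/K -mulrA mulrCA mulrAC ler_pdivrMr// ler_wpM2l ?(ltW e0)// mulrC lerDl//.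
Qed.
Definition in_sq (a : C) (r : R) z := `|Re z - Re a| < r /\ `|Im z - Im a| < r.
Definition holo_sq f a r := forall z, in_sq a r z -> cder_at f z.

Lemma in_sqS a r r' z : r <= r' -> in_sq a r z -> in_sq a r' z.
Proof. by move=> rr [p q]; split; exact: lt_le_trans rr. Qed.
Lemma nm_in_sq a r z : nm (z - a) < r -> in_sq a r z.
Proof.
move=> h; split; rewrite (le_lt_trans _ h)//; last by rewrite -ImN -ImD le_Im_nm.
by rewrite -ReN -ReD le_Re_nm.
Qed.

(** The primitive integrates from a corner along one horizontal and one vertical leg. Goursat's
    theorem allows the legs to be exchanged, so the increment in each coordinate is an integral
    along a single leg. The square shrinks from [r] to [r'] because the corner itself must lie where
    [f] is differentiable. *)
Theorem primitive_sq f a r r' : holo_sq f a r -> r' < r ->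
 exists F : C -> C, forall z, in_sq a r' z -> cderiv F z (f z).
Proof.
move=> hf rr.
pose x0 := Re a - r'; pose y0 := Im a - r'; pose x3 := Re a + r'; pose y3 := Im a + r'.
have hr : holo_rect f x0 x3 y0 y3.
 move=> z [/andP[p q] /andP[s t]]; apply: hf; split; rewrite (le_lt_trans _ rr)// ler_norml;
 rewrite /x0 /x3 /y0 /y3 in p q s t; lra.
pose F z := cI (fun t => f (hline y0 t)) x0 (Re z) + 'i * cI (fun t => f (vline (Re z) t)) y0 (Im z).
exists F => z [zx zy].
have zx' : x0 < Re z < x3 by move: zx; rewrite ltr_norml /x0 /x3; lra.
have zy' : y0 < Im z < y3 by move: zy; rewrite ltr_norml /y0 /y3; lra.
have FG u v : x0 <= u <= x3 -> y0 <= v <= y3 ->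
 F (Complex u v) = 'i * cI (fun t => f (vline x0 t)) y0 v + cI (fun t => f (hline v t)) x0 u.
 move=> /andP[u1 u2] /andP[v1 v2].
 have := @Goursat f x0 u y0 v u1 v1 (holo_rectS (lexx _) u2 (lexx _) v2 hr).
 rewrite /F /rct /=.
 set p := cI _ _ _; set q := 'i * _; set s := cI _ _ _; set t := 'i * _ => /eqP.
 by rewrite subr_eq0 subr_eq => /eqP ->.
have [l dl] : cder_at f z by apply: hf; apply: in_sqS (ltW rr) _.
apply/cderivP => e e0.
have e4 : 0 < e / 4 by rewrite divr_gt0.
have [d d0 Hd] := cderiv_cont dl e4.
pose d1 := Num.min (Num.min (Re z - x0) (x3 - Re z)) (Num.min (Im z - y0) (y3 - Im z)).
exists (Num.min (d / 2) d1).
 rewrite !lt_min divr_gt0//= !subr_gt0.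
 by case/andP: zx' => -> ->; case/andP: zy' => -> ->.
move=> k; rewrite !lt_min => /andP[kd /andP[/andP[k1 k2] /andP[k3 k4]]].
have := le_Re_nm k; have := le_Im_nm k; set u := Re k; set v := Im k => kv ku.
have xu : x0 <= Re z + u <= x3 by move: ku; rewrite ler_norml; lra.
have yv : y0 <= Im z + v <= y3 by move: kv; rewrite ler_norml; lra.
have Ezk : z + k = Complex (Re z + u) (Im z + v) by apply: ceqP; rewrite reimE.
have Ez : z = Complex (Re z) (Im z) by case: (z).
have nmk : nm k = nm (u%:C + 'i * v%:C).
 by congr nm; ceq; ring.
have E : F (z + k) - F z - f z * k =
 'i * (cI (fun t => f (vline (Re z + u) t)) y0 (Im z + v) -
    cI (fun t => f (vline (Re z + u) t)) y0 (Im z) - f z * (Im z + v - Im z)%:C)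
 + (cI (fun t => f (hline (Im z) t)) x0 (Re z + u) -
  cI (fun t => f (hline (Im z) t)) x0 (Re z) - f z * (Re z + u - Re z)%:C).
 have -> : k = u%:C + 'i * v%:C by ceq; ring.
 have -> : F (z + (u%:C + 'i * v%:C)) - F z =
  (F (Complex (Re z + u) (Im z + v)) - F (Complex (Re z + u) (Im z))) +
  (F (Complex (Re z + u) (Im z)) - F (Complex (Re z) (Im z))).
  have -> : z + (u%:C + 'i * v%:C) = Complex (Re z + u) (Im z + v).
   by ceq; ring.
  by rewrite -Ez addrA subrK.
 have -> : F (Complex (Re z + u) (Im z)) - F (Complex (Re z) (Im z)) =
   cI (fun t => f (hline (Im z) t)) x0 (Re z + u) - cI (fun t => f (hline (Im z) t)) x0 (Re z).
  rewrite (FG (Re z + u)); [|by []|lra].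
  rewrite (FG (Re z)); [|lra|lra].
  ring.
 rewrite /F /= [Im z + v - Im z]addrC addKr [Re z + u - Re z]addrC addKr; ring.
rewrite E (le_trans (nmD _ _))// nmM nm_i mul1r.
have zu : x0 <= Re z <= x3 by lra. have zv : y0 <= Im z <= y3 by lra.
have B1 : nm (cI (fun t => f (vline (Re z + u) t)) y0 (Im z + v) -
    cI (fun t => f (vline (Re z + u) t)) y0 (Im z) - f z * (Im z + v - Im z)%:C)
 <= 2 * (e / 4) * `|Im z + v - Im z|.
 apply: (@cI_inc_bound R _ y0 y3) => //; first exact: (cctn_v hr).
 move=> t; rewrite [Im z + v - Im z]addrC addKr => tv _; apply/ltW/Hd.
 rewrite (le_lt_trans (nm_le_ReIm _))// !reimE /= [Re z + u - _]addrC addKr; lra.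
have B2 : nm (cI (fun t => f (hline (Im z) t)) x0 (Re z + u) -
  cI (fun t => f (hline (Im z) t)) x0 (Re z) - f z * (Re z + u - Re z)%:C)
 <= 2 * (e / 4) * `|Re z + u - Re z|.
 apply: (@cI_inc_bound R _ x0 x3) => //; first exact: (cctn_h hr).
 move=> t; rewrite [Re z + u - Re z]addrC addKr => tv _; apply/ltW/Hd.
 by rewrite (le_lt_trans (nm_le_ReIm _))// !reimE /= subrr normr0; lra.
move: B1 B2; rewrite [Im z + v - Im z]addrC addKr [Re z + u - Re z]addrC addKr => B1 B2.
rewrite (le_trans (lerD B1 B2))//; nra.
Qed.

End Goursat.
Arguments rct : simpl never.

(** * Power series *)

Section PowerSeries.
Variable R : realType.
Local Notation C := R[i].
Implicit Types (u v s : nat -> C) (a z w l : C) (f : C -> C) (r : R).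

Definition cvs s l := forall e : R, 0 < e -> exists N, forall n, (N <= n)%N -> nm (s n - l) < e.

Lemma le_small_eq0 (x K : R) : 0 <= x -> (forall e : R, 0 < e -> x <= K * e) -> x = 0.
Proof.
move=> x0 H; apply/eqP; rewrite eq_le x0 andbT; apply/ler_addgt0Pr => e e0; rewrite add0r.
have K1 : 0 < `|K| + 1 by rewrite ltr_wpDl.
have e1 : 0 < e / (`|K| + 1) by rewrite divr_gt0.
rewrite (le_trans (H _ e1))// (@le_trans _ _ (`|K| * (e / (`|K| + 1))))//.
 by rewrite ler_wpM2r ?(ltW e1)// ler_norm.
by rewrite mulrCA -[leRHS]mulr1 ler_wpM2l ?(ltW e0)// ler_pdivrMr// mul1r lerDl.
Qed.
Lemma cvs_le s l (B : R) N0 : cvs s l -> (forall n, (N0 <= n)%N -> nm (s n) <= B) -> nm l <= B.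
Proof.
move=> sl sB; apply/ler_addgt0Pr => e e0; have [N HN] := sl e e0.
have h1 := HN _ (leq_maxl N N0); have h2 := sB _ (leq_maxr N N0).
have -> : l = s (maxn N N0) - (s (maxn N N0) - l) by ring.
by rewrite (le_trans (nmB _ _))// lerD// ltW.
Qed.
Lemma cvs_unique s l l' : cvs s l -> cvs s l' -> l = l'.
Proof.
move=> sl sl'; apply/eqP; rewrite -subr_eq0 -nm_eq0; apply/eqP.
apply: (@le_small_eq0 _ 2) => // e e0.
have [N HN] := sl e e0; have [N' HN'] := sl' e e0.
have h1 := HN _ (leq_maxl N N'); have h2 := HN' _ (leq_maxr N N').
have -> : l - l' = (s (maxn N N') - l') - (s (maxn N N') - l) by ring.
by rewrite (le_trans (nmB _ _))//; lra.
Qed.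
Lemma cvs_cst l : cvs (fun=> l) l.
Proof. by move=> e e0; exists 0%N => n _; rewrite subrr nm0. Qed.
Lemma cvsD s t l l' : cvs s l -> cvs t l' -> cvs (fun n => s n + t n) (l + l').
Proof.
move=> sl tl e e0; have e2 : 0 < e / 2 by rewrite divr_gt0.
have [N HN] := sl _ e2; have [M HM] := tl _ e2.
exists (maxn N M) => n; rewrite geq_max => /andP[/HN h1 /HM h2].
have -> : s n + t n - (l + l') = (s n - l) + (t n - l') by ring.
by rewrite (le_lt_trans (nmD _ _))//; lra.
Qed.
Lemma cvsZ s l k : cvs s l -> cvs (fun n => k * s n) (k * l).
Proof.
move=> sl e e0; have K1 : 0 < nm k + 1 by rewrite ltr_wpDl.
have e1 : 0 < e / (nm k + 1) by rewrite divr_gt0.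
have [N HN] := sl _ e1; exists N => n /HN.
rewrite -mulrBr nmM ltr_pdivlMr// => h; have := nm_ge0 (s n - l).
move: (nm_ge0 k) h; move: (nm k) (nm _) => A B; nra.
Qed.
Lemma cvsN s l : cvs s l -> cvs (fun n => - s n) (- l).
Proof. by move=> sl e e0; have [N HN] := sl e e0; exists N => n /HN; rewrite -opprD nmN. Qed.
Lemma cvsB s t l l' : cvs s l -> cvs t l' -> cvs (fun n => s n - t n) (l - l').
Proof. by move=> sl tl; apply: cvsD => //; exact: cvsN. Qed.
Lemma cvs_ext s t l N0 : (forall n, (N0 <= n)%N -> s n = t n) -> cvs s l -> cvs t l.
Proof.
move=> st sl e e0; have [N HN] := sl e e0; exists (maxn N N0) => n.
by rewrite geq_max => /andP[/HN h /st <-].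
Qed.
Lemma cvs_shift s l : cvs s l -> cvs (fun n => s n.+1) l.
Proof.
by move=> sl e e0; have [N HN] := sl e e0; exists N => n Nn; apply: HN; exact: leqW.
Qed.
Lemma cvs_bounded s l : cvs s l -> exists2 B : R, 0 <= B & forall n, nm (s n) <= B.
Proof.
move=> /(_ 1 ltr01)[N HN]; exists (nm l + 1 + \sum_(n < N) nm (s n)).
 by rewrite !addr_ge0// sumr_ge0.
move=> n; have [Nn|nN] := leqP N n.
 rewrite -[s n](subrK l) (le_trans (nmD _ _))// addrC -addrA lerD2l.
 by rewrite (le_trans (ltW (HN _ Nn)))// lerDl sumr_ge0.
rewrite (bigD1 (Ordinal nN))//= addrCA lerDl !addr_ge0//.
by rewrite sumr_ge0.
Qed.
Lemma cvs_ReIm s l : (fun n => Re (s n)) @ \oo --> Re l ->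
 (fun n => Im (s n)) @ \oo --> Im l -> cvs s l.
Proof.
move=> /cvgrPdist_lt H1 /cvgrPdist_lt H2 e e0.
have e2 : 0 < e / 2 by rewrite divr_gt0.
have [N _ HN] := H1 _ e2; have [M _ HM] := H2 _ e2.
exists (maxn N M) => n; rewrite geq_max => /andP[/HN /= h1 /HM /= h2].
rewrite (le_lt_trans (nm_le_ReIm _))// !reimE distrC [`|Im _ - _|]distrC; lra.
Qed.
Lemma geo_tail (q : R) J n : 0 <= q < 1 -> \sum_(J <= j < n) q ^+ j <= q ^+ J / (1 - q).
Proof.
move=> /andP[q0 q1]; have q1' : 0 < 1 - q by rewrite subr_gt0.
have [nJ|Jn] := leqP n J.
 by rewrite big_geq// divr_ge0 ?exprn_ge0// ltW.
rewrite ler_pdivlMr//.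
have tel m : (\sum_(J <= j < J + m) q ^+ j) * (1 - q) = q ^+ J - q ^+ (J + m).
 elim: m => [|m ih]; first by rewrite addn0 big_geq// mul0r subrr.
 by rewrite addnS big_nat_recr ?leq_addr//= mulrDl ih exprS; ring.
by rewrite -(subnKC (ltnW Jn)) tel gerBl exprn_ge0.
Qed.
Lemma geo_bound_sum u (K q : R) J n : 0 <= K -> 0 <= q < 1 -> (forall n, nm (u n) <= K * q ^+ n) ->
 nm (\sum_(J <= j < n) u j) <= K * (q ^+ J / (1 - q)).
Proof.
move=> K0 q01 uB; rewrite (le_trans (nm_sum _ _ _))//.
rewrite (@le_trans _ _ (\sum_(J <= j < n) K * q ^+ j))//; first by apply: ler_sum => j _; exact: uB.
by rewrite -mulr_sumr ler_wpM2l// geo_tail.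
Qed.
Lemma geo_cvs u (K q : R) : 0 <= K -> 0 <= q < 1 -> (forall n, nm (u n) <= K * q ^+ n) ->
 exists l, cvs (fun N => \sum_(0 <= n < N) u n) l.
Proof.
move=> K0 q01 uB; have /andP[q0 q1] := q01.
have G : cvgn (series (fun n => K * q ^+ n)).
 have -> : (fun n => K * q ^+ n) = geometric K q by [].
 by apply: is_cvg_geometric_series; rewrite ger0_norm.
have A (p : C -> R) : (forall z, `|p z| <= nm z) -> cvgn (series (fun n => p (u n))).
 move=> pn; apply: normed_cvg.
 apply: (series_le_cvg _ _ _ G) => n //=; first by rewrite mulr_ge0// exprn_ge0.
 by rewrite (le_trans (pn _)).
have cR := A _ (@le_Re_nm R); have cI := A _ (@le_Im_nm R).
exists (Complex (limn (series (fun n => Re (u n)))) (limn (series (fun n => Im (u n))))).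
apply: cvs_ReIm => /=.
 have -> : (fun n => Re (\sum_(0 <= n0 < n) u n0)) = series (fun n => Re (u n)).
  by apply/funext => n; rewrite /series /=; elim/big_rec2: _ => // i x y _ <-; rewrite reimE.
 exact: cR.
have -> : (fun n => Im (\sum_(0 <= n0 < n) u n0)) = series (fun n => Im (u n)).
 by apply/funext => n; rewrite /series /=; elim/big_rec2: _ => // i x y _ <-; rewrite reimE.
exact: cI.
Qed.
Definition psum u z N := \sum_(0 <= n < N) u n * z ^+ n.
(** Only pointwise convergence on the open disc is recorded; geometric bounds on smaller discs are
    recovered through [pser_bound]. *)
Definition pser u a f r := forall z, nm (z - a) < r -> cvs (psum u (z - a)) (f z).

Lemma pser_bound u a f r rho : pser u a f r -> 0 <= rho < r ->
 exists2 M : R, 0 <= M & forall n, nm (u n) * rho ^+ n <= M.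
Proof.
move=> pf /andP[r0 rr].
have h : nm (a + rho%:C - a) < r by rewrite [a + _]addrC addrK nmR ger0_norm.
have [B B0 HB] := cvs_bounded (pf _ h).
exists (B + B); first by rewrite addr_ge0.
move=> n; have -> : nm (u n) * rho ^+ n =
 nm (psum u (a + rho%:C - a) n.+1 - psum u (a + rho%:C - a) n).
 rewrite /psum big_nat_recr//= [X in nm (X - _)]addrC addrK nmM nmX.
 by rewrite [a + _]addrC addrK nmR ger0_norm.
by rewrite (le_trans (nmB _ _))// lerD.
Qed.
Lemma pserS u a f r r' : r' <= r -> pser u a f r -> pser u a f r'.
Proof. by move=> rr pf z zr; apply: pf; exact: lt_le_trans rr. Qed.
Lemma pserB u v a f g r : pser u a f r -> pser v a g r ->
 pser (fun n => u n - v n) a (fun z => f z - g z) r.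
Proof.
move=> pf pg z zr; have := cvsB (pf _ zr) (pg _ zr).
apply: (@cvs_ext _ _ _ 0%N) => n _; rewrite /psum -sumrB.
by apply: eq_bigr => i _; rewrite mulrBl.
Qed.
(** By strong induction the earlier coefficients vanish. At a zero [z] with [nm (z - a) < e] the
    tail beyond index [n] is at most a constant times [nm (z - a) ^+ n.+1], which bounds [nm (u n)]
    by a constant times [e]. *)
Lemma pser_zeros u a f r : 0 < r -> pser u a f r ->
 (forall d : R, 0 < d -> exists z, [/\ z != a, nm (z - a) < d & f z = 0]) ->
 forall n, u n = 0.
Proof.
move=> r0 pf Z n; have [m] := ubnP n; elim: m n => // m IH n; rewrite ltnS => nm'.
have {}IH k : (k < n)%N -> u k = 0 by move=> kn; apply: IH; exact: leq_trans nm'.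
have rho0 : 0 < r / 2 by rewrite divr_gt0.
have rho1 : 0 <= r / 2 < r by rewrite ltW//=; lra.
have [M M0 HM] := pser_bound pf rho1.
apply/eqP; rewrite -nm_eq0; apply/eqP.
apply: (@le_small_eq0 _ (2 * M / (r / 2) ^+ n.+1)) => // e e0.
have [|z [za zd fz]] := Z (Num.min e (r / 4)); first by rewrite lt_min e0 divr_gt0.
move: zd; rewrite lt_min => /andP[ze zr].
set h := z - a in za ze zr; have h0 : 0 < nm h by rewrite nm_gt0 subr_eq0.
set t := nm h / (r / 2).
have t01 : 0 <= t < 1 by rewrite divr_ge0 ?(ltW rho0)//= ltr_pdivrMr// mul1r; lra.
have t2 : t <= 2^-1 by rewrite ler_pdivrMr//; lra.
have key : nm (f z - u n * h ^+ n) <= M * (t ^+ n.+1 / (1 - t)).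
 have hz : nm h < r by lra.
 apply: (cvs_le (N0 := n.+1) (cvsB (pf z hz) (cvs_cst (u n * h ^+ n)))) => N nN.
 rewrite /psum (big_cat_nat (n := n.+1))//= big_nat_recr//= [X in nm (X + _ + _ - _)]big_nat_cond.
 rewrite big1 => [|i /andP[/andP[_ /IH -> _]]]; last by rewrite mul0r.
 rewrite add0r addrAC subrr add0r; apply: geo_bound_sum => // k.
 rewrite nmM nmX exprMn exprVn mulrCA -[leLHS]mulrC ler_wpM2l ?exprn_ge0//.
 by rewrite ler_pdivlMr ?exprn_gt0.
move: key; rewrite fz sub0r nmN nmM nmX => key.
have t1 : t ^+ n.+1 / (1 - t) <= 2 * t ^+ n.+1.
 rewrite ler_pdivrMr; last by case/andP: t01; rewrite subr_gt0.
 have : 0 <= t ^+ n.+1 by rewrite exprn_ge0//; case/andP: t01.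
 by move: (t ^+ n.+1) => T; nra.
have {}key : nm (u n) * nm h ^+ n <= M * (2 * t ^+ n.+1).
 by rewrite (le_trans key)// ler_wpM2l.
have e1 : M * (2 * t ^+ n.+1) = (2 * M / (r / 2) ^+ n.+1 * nm h) * nm h ^+ n.
 by rewrite /t exprMn exprVn exprS; ring.
move: key; rewrite e1 ler_pM2r ?exprn_gt0// => key.
rewrite (le_trans key)// ler_wpM2l ?(ltW ze)// divr_ge0// ?mulr_ge0// exprn_ge0// ltW//.
Qed.
Lemma pser_uniq u v a f g r r' : 0 < r -> 0 < r' -> pser u a f r -> pser v a g r' ->
 (forall z, nm (z - a) < Num.min r r' -> f z = g z) -> forall n, u n = v n.
Proof.
move=> r0 r'0 pf pg fg n; set m := Num.min r r'.
have m0 : 0 < m by rewrite lt_min r0.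
have mr : m <= r by rewrite ge_min lexx.
have mr' : m <= r' by rewrite ge_min lexx orbT.
have := pserB (pserS mr pf) (pserS mr' pg) => P.
apply/eqP; rewrite -subr_eq0; apply/eqP; apply: (pser_zeros m0 P) => d d0.
exists (a + (Num.min (d / 2) (m / 2))%:C); set k := Num.min _ _.
have k0 : 0 < k by rewrite lt_min !divr_gt0.
have km : nm (a + k%:C - a) < m.
 rewrite [a + _]addrC addrK nmR gtr0_norm// (@le_lt_trans _ _ (m / 2))//; last lra.
 by rewrite ge_min lexx orbT.
split.
- by rewrite -subr_eq0 [a + _]addrC addrK -nm_eq0 nmR gtr0_norm// gt_eqF.
- rewrite [a + _]addrC addrK nmR gtr0_norm// (@le_lt_trans _ _ (d / 2))//; last lra.
 by rewrite ge_min lexx.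
- by rewrite fg// subrr.
Qed.
(** Serves to absorb the factors [n] and ['C(n, 2)] of differentiated series into a slightly larger
    geometric ratio. *)
Lemma bernoulli2 (t : R) n : 0 <= t -> n%:R * t <= (1 + t) ^+ n /\ 'C(n, 2)%:R * t ^+ 2 <= (1 + t) ^+ n.
Proof.
move=> t0; suff H : 1 + n%:R * t + 'C(n, 2)%:R * t ^+ 2 <= (1 + t) ^+ n.
 have A : 0 <= n%:R * t by rewrite mulr_ge0.
 have B : 0 <= 'C(n, 2)%:R * t ^+ 2 by rewrite mulr_ge0// sqr_ge0.
 by split; lra.
elim: n => [|n ih]; first by rewrite bin0n mul0r mul0r expr0 !addr0.
rewrite [leRHS]exprS binS bin1 natrD -[n.+1%:R]natr1.
apply: (@le_trans _ _ ((1 + t) * (1 + n%:R * t + 'C(n, 2)%:R * t ^+ 2))).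
 have : 0 <= 'C(n, 2)%:R * t ^+ 3 by rewrite mulr_ge0// exprn_ge0.
 by rewrite !exprS expr0; move: ('C(n, 2)%:R : R) (n%:R : R) => B N; nra.
by rewrite ler_wpM2l// addr_ge0.
Qed.
(** Multiplying through by [rho ^+ 2] avoids the truncated exponent n - 2; the induction follows the
    recursion of the second order remainder. *)
Lemma pow_second_order (z h : C) (rho : R) n : 0 <= rho -> nm z <= rho -> nm (z + h) <= rho ->
 nm ((z + h) ^+ n - z ^+ n - n%:R * z ^+ n.-1 * h) * rho ^+ 2 <=
 'C(n, 2)%:R * nm h ^+ 2 * rho ^+ n.
Proof.
move=> rho0 zr zhr; elim: n => [|n ih].
 by rewrite !expr0 subrr bin0n !mul0r subr0 nm0 !mul0r.
have -> : (z + h) ^+ n.+1 - z ^+ n.+1 - n.+1%:R * z ^+ n.+1.-1 * h =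
 (z + h) * ((z + h) ^+ n - z ^+ n - n%:R * z ^+ n.-1 * h) + n%:R * z ^+ n.-1 * h ^+ 2.
 case: n {ih} => [|n]; first by rewrite /= !expr0; ring.
 by rewrite /= !exprS -[n.+2%:R]natr1; ring.
rewrite binS bin1 natrD.
apply: (@le_trans _ _ ((nm (z + h) * nm ((z + h) ^+ n - z ^+ n - n%:R * z ^+ n.-1 * h)
 + nm (n%:R * z ^+ n.-1 * h ^+ 2)) * rho ^+ 2)).
 by rewrite ler_wpM2r ?sqr_ge0// -nmM nmD.
rewrite mulrDl [X in _ <= X * _ * _]addrC 2!mulrDl addrC; apply: lerD.
 rewrite !nmM !nmX; have -> : nm (n%:R : C) = n%:R by rewrite -(rmorph_nat (real_complex R)) nmR ger0_norm.
 case: n {ih} => [|n]; first by rewrite !mul0r.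
 have -> : n.+1%:R * nm z ^+ n.+1.-1 * nm h ^+ 2 * rho ^+ 2 =
  n.+1%:R * nm h ^+ 2 * rho ^+ 2 * nm z ^+ n by rewrite /=; ring.
 have -> : n.+1%:R * nm h ^+ 2 * rho ^+ n.+1.+1 = n.+1%:R * nm h ^+ 2 * rho ^+ 2 * rho ^+ n.
  by rewrite [rho ^+ n.+2]exprS [rho ^+ n.+1]exprS; ring.
 by rewrite ler_wpM2l ?mulr_ge0 ?sqr_ge0// lerXn2r ?nnegrE.
rewrite -mulrA (@le_trans _ _ (rho * ('C(n, 2)%:R * nm h ^+ 2 * rho ^+ n)))//.
 by apply: ler_pM => //; rewrite mulr_ge0// sqr_ge0.
by rewrite [rho ^+ n.+1]exprS; apply: eq_ler; ring.
Qed.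
Lemma nm_nat (n : nat) : nm (n%:R : C) = n%:R.
Proof. by rewrite -(rmorph_nat (real_complex R)) nmR ger0_norm. Qed.

Theorem pser_derive u a f r : pser u a f r -> exists f1,
 pser (fun n => n.+1%:R * u n.+1) a f1 r /\ forall z, nm (z - a) < r -> cderiv f z (f1 z).
Proof.
move=> pf.
have data (rho' : R) : 0 < rho' < r -> exists K q : R, [/\ 0 <= K, 0 <= q < 1 &
 forall n, nm (u n) * (rho' ^+ n) * n%:R <= K * q ^+ n /\
      nm (u n) * (rho' ^+ n) * 'C(n, 2)%:R <= K * q ^+ n].
 move=> /andP[rr0 rr1]; pose rho := (rho' + r) / 2.
 have rho1 : 0 <= rho < r by rewrite /rho; lra.
 have rho2 : rho' < rho by rewrite /rho; lra.
 have rho0 : 0 < rho by lra.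
 have [M M0 HM] := pser_bound pf rho1.
 (* The bound at [rho] leaves the ratio [q] at [rho']; [t] is chosen so that [(1 + t) * q] is the
    midpoint of [q] and 1, and the powers of [1 + t] absorb the polynomial factors. *)
 pose q := rho' / rho; pose t := (q^-1 - 1) / 2.
 have q0 : 0 < q by rewrite divr_gt0.
 have q1 : q < 1 by rewrite ltr_pdivrMr// mul1r.
 have t0 : 0 < t by rewrite divr_gt0// subr_gt0 invf_gt1.
 have sq : (1 + t) * q = (1 + q) / 2 by rewrite /t; field; rewrite gt_eqF.
 exists (M / t + M / t ^+ 2), ((1 + t) * q); split.
 - by rewrite addr_ge0// divr_ge0// ?exprn_ge0// ltW.
 - by rewrite sq; lra.
 move=> n; have [b1 b2] := bernoulli2 n (ltW t0).
 have Mq : nm (u n) * rho' ^+ n <= M * q ^+ n.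
  have -> : rho' = rho * q by rewrite /q mulrC divfK// gt_eqF.
  by rewrite exprMn mulrA ler_wpM2r// exprn_ge0// ltW.
 have qn : 0 <= q ^+ n by rewrite exprn_ge0// ltW.
 have sn : 0 <= (1 + t) ^+ n by rewrite exprn_ge0//; lra.
 have t20 : 0 < t ^+ 2 by rewrite exprn_gt0.
 have X1 : 0 <= M / t * ((1 + t) ^+ n * q ^+ n) by rewrite !mulr_ge0// invr_ge0 ltW.
 have X2 : 0 <= M / t ^+ 2 * ((1 + t) ^+ n * q ^+ n) by rewrite !mulr_ge0// invr_ge0 ltW.
 rewrite [((1 + t) * q) ^+ n]exprMn mulrDl; split.
  apply: (@le_trans _ _ (M * q ^+ n * ((1 + t) ^+ n / t))).
   by apply: ler_pM => //; [rewrite mulr_ge0// exprn_ge0// ltW|rewrite ler_pdivlMr].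
  have -> : M * q ^+ n * ((1 + t) ^+ n / t) = M / t * ((1 + t) ^+ n * q ^+ n) by ring.
  by rewrite lerDl.
 apply: (@le_trans _ _ (M * q ^+ n * ((1 + t) ^+ n / t ^+ 2))).
  by apply: ler_pM => //; [rewrite mulr_ge0// exprn_ge0// ltW|rewrite ler_pdivlMr].
 have -> : M * q ^+ n * ((1 + t) ^+ n / t ^+ 2) = M / t ^+ 2 * ((1 + t) ^+ n * q ^+ n) by ring.
 by rewrite lerDr.
pose u1 n := n.+1%:R * u n.+1 : C.
have ex z : exists l, nm (z - a) < r -> cvs (psum u1 (z - a)) l.
 have [zr|] := ltP (nm (z - a)) r; last by exists 0.
 pose rho' := (nm (z - a) + r) / 2.
 have z0 := nm_ge0 (z - a).
 have rr : 0 < rho' < r by rewrite /rho'; lra.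
 have [K [q [K0 q01 H]]] := data _ rr.
 have /andP[rr0 rr1] := rr.
 have [|l hl] := @geo_cvs (fun n => u1 n * (z - a) ^+ n) (K * q / rho') q
  (divr_ge0 (mulr_ge0 K0 (proj1 (andP q01))) (ltW rr0)) q01; last by exists l.
 move=> n; have [h1 _] := H n.+1.
 rewrite nmM nmX /u1 nmM nm_nat.
 have -> : K * q / rho' * q ^+ n = K * q ^+ n.+1 / rho' by rewrite exprS; ring.
 rewrite ler_pdivlMr// (le_trans _ h1)//.
 have -> : nm (u n.+1) * rho' ^+ n.+1 * n.+1%:R = n.+1%:R * nm (u n.+1) * rho' ^+ n * rho'.
  by rewrite exprS; ring.
 rewrite ler_wpM2r ?(ltW rr0)// ler_wpM2l ?mulr_ge0// lerXn2r ?nnegrE ?(ltW rr0)//.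
 by rewrite /rho'; lra.
have [f1 hf1] := choice ex.
exists f1; split => // z zr.
have z0 := nm_ge0 (z - a).
pose rho := (nm (z - a) + r) / 2.
have rr : 0 < rho < r by rewrite /rho; lra.
have /andP[rr0 rr1] := rr.
have [K [q [K0 q01 H]]] := data _ rr.
have /andP[q0 q1] := q01.
pose K' := K / (1 - q) / rho ^+ 2.
have K'0 : 0 <= K' by rewrite !divr_ge0 ?subr_ge0 ?sqr_ge0// ltW.
apply/cderivP => e e0.
exists (Num.min (rho - nm (z - a)) (e / (K' + 1))).
 rewrite lt_min subr_gt0 divr_gt0 ?ltr_wpDl// andbT /rho; lra.
move=> h; rewrite lt_min => /andP[h1 h2].
have zh : nm (z + h - a) <= rho.
 rewrite (_ : z + h - a = (z - a) + h); last by ring.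
 by rewrite (le_trans (nmD _ _))//; lra.
have zh' : nm (z + h - a) < r by lra.
have key : nm (f (z + h) - f z - h * f1 z) <= K' * nm h ^+ 2.
 have lim' : cvs (fun N => \sum_(0 <= n < N.+1) u n * ((z - a + h) ^+ n - (z - a) ^+ n - n%:R * (z - a) ^+ n.-1 * h)) (f (z + h) - f z - h * f1 z).
  have := cvsB (cvs_shift (cvsB (pf _ zh') (pf _ zr))) (cvsZ h (hf1 _ zr)).
  apply: (@cvs_ext _ _ _ 0%N) => N _.
  have -> : h * psum u1 (z - a) N = \sum_(0 <= n < N.+1) u n * (n%:R * (z - a) ^+ n.-1 * h).
   rewrite big_nat_recl//= mul0r mul0r mulr0 add0r /psum mulr_sumr; apply: eq_bigr => i _.
   by rewrite /u1; ring.
  rewrite /psum -!sumrB; apply: eq_bigr => i _.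
  by rewrite (_ : z + h - a = z - a + h); [rewrite !mulrBr|ring].
 apply: (cvs_le (N0 := 0%N) lim') => N _.
 apply: (@le_trans _ _ (K * nm h ^+ 2 / rho ^+ 2 * (q ^+ 0 / (1 - q)))).
  apply: geo_bound_sum => //; first by rewrite divr_ge0 ?sqr_ge0// mulr_ge0// sqr_ge0.
  move=> n; have [_ h3] := H n.
  have zr' : nm (z - a) <= rho by rewrite /rho; lra.
  have zhr : nm (z - a + h) <= rho by move: zh; rewrite (_ : z + h - a = z - a + h)//; ring.
  have h4 := pow_second_order n (ltW rr0) zr' zhr.
  rewrite nmM [leRHS]mulrAC ler_pdivlMr ?exprn_gt0// -[leLHS]mulrA.
  apply: (@le_trans _ _ (nm (u n) * ('C(n, 2)%:R * nm h ^+ 2 * rho ^+ n))).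
   by rewrite ler_wpM2l.
  have -> : nm (u n) * ('C(n, 2)%:R * nm h ^+ 2 * rho ^+ n) = nm (u n) * rho ^+ n * 'C(n, 2)%:R * nm h ^+ 2 by ring.
  by rewrite [leRHS]mulrAC ler_wpM2r ?sqr_ge0.
 by rewrite expr0 /K'; apply: eq_ler; field; rewrite !gt_eqF ?subr_gt0.
rewrite [f1 z * h]mulrC (le_trans key)// expr2 mulrA ler_wpM2r//.
move: h2; rewrite ltr_pdivlMr ?ltr_wpDl// => h2; have := nm_ge0 h.
by move: h2; move: (nm h) => a'; nra.
Qed.

End PowerSeries.

(** * Cauchy's formula and Taylor expansion *)

Section Taylor.
Variable R : realType.
Local Notation C := R[i].
Implicit Types (u v s : nat -> C) (a z w l : C) (f F : C -> C) (r : R).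
Definition circ (a : C) (rho : R) (t : R) : C := a + rho%:C * cexp ('i * t%:C).

Lemma rderiv_cis (k : C) t : rderiv (fun t : R => cexp (k * t%:C)) t (cexp (k * t%:C) * k).
Proof.
have := cderiv_rcomp (@rderiv_affine R 0 k t) (cderiv_cexp (0 + k * t%:C)).
rewrite add0r.
have -> : (fun s : R => cexp (0 + k * s%:C)) = (fun s : R => cexp (k * s%:C)).
 by apply/funext => s; rewrite add0r.
by [].
Qed.
Lemma rderiv_circ a rho t : rderiv (circ a rho) t ('i * (circ a rho t - a)).
Proof.
have d := @rderiv_cis 'i t.
have e1 : cderiv (fun z => a + rho%:C * z) (cexp ('i * t%:C)) (rho%:C).
 by have := cderivD (cderiv_cst a _) (cderivZ rho%:C (cderiv_id (cexp ('i * t%:C)))); rewrite add0r mulr1.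
have := cderiv_rcomp d e1; congr (rderiv _ _ _).
by rewrite /circ [a + _]addrC addrK; ring.
Qed.
Lemma nm_circ a rho t : 0 <= rho -> nm (circ a rho t - a) = rho.
Proof.
move=> r0; rewrite /circ [a + _]addrC addrK nmM nmR ger0_norm// nm_cexp.
by rewrite !reimE /= mulr0 mul0r subrr expR0 mulr1.
Qed.
Lemma circ_2pi a rho : circ a rho (pi *+ 2) = circ a rho 0.
Proof.
rewrite /circ; congr (_ + _ * _); apply: ceqP; rewrite /= !mul0r !mulr0 !add0r ?oppr0 ?subr0 !mul1r.
 by rewrite !expR0 cos2pi cos0.
by rewrite !expR0 sin2pi sin0.
Qed.
Lemma ccont_circ a rho t : ccont (circ a rho) t.
Proof. exact: rderiv_cont (rderiv_circ a rho t). Qed.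
Lemma two_pi_ge0 : 0 <= pi *+ 2 :> R. Proof. by rewrite mulrn_wge0// pi_ge0. Qed.
Lemma ccontV (g : R -> C) (t : R) : g t != 0 -> ccont g t -> ccont (fun y => (g y)^-1) t.
Proof.
move=> g0 cg e e0; have n0 : 0 < nm (g t) by rewrite nm_gt0.
have e1 : 0 < Num.min (nm (g t) / 2) (e * nm (g t) ^+ 2 / 2).
 by rewrite lt_min !divr_gt0// mulr_gt0// exprn_gt0.
have [d d0 H] := cg _ e1; exists d => // s /H; rewrite lt_min => /andP[h1 h2].
have gs : nm (g t) / 2 < nm (g s).
 have := nmB (g s) (g s - g t); have -> : g s - (g s - g t) = g t by ring.
 lra.
have gs0 : g s != 0 by rewrite -nm_gt0; lra.
have -> : (g s)^-1 - (g t)^-1 = - (g s - g t) / (g s * g t) by field; rewrite gs0 g0.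
rewrite nmM nmN nmV nmM ltr_pdivrMr; last by rewrite mulr_gt0//; lra.
by rewrite (lt_trans h2)// -mulrA ltr_pM2l// expr2 mulrAC ltr_pM2r.
Qed.
Lemma cI_cis_int (n : nat) : (0 < n)%N ->
 cI (fun t => cexp (- (n%:R * 'i) * t%:C)) 0 (pi *+ 2) = 0 :> C.
Proof.
move=> n0; set k := - (n%:R * 'i).
have k0 : k != 0 by rewrite oppr_eq0 mulf_eq0 pnatr_eq0 (gtn_eqF n0) /= -nm_eq0 nm_i oner_eq0.
have cc t : ccont (fun t => cexp (k * t%:C)) t by apply: rderiv_cont (rderiv_cis k t).
have := @cI_FTC R (fun t => k * cexp (k * t%:C)) (fun t => cexp (k * t%:C)) 0 (pi *+ 2) two_pi_ge0.
rewrite cIZ; last by move=> t _.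
move=> H; apply: (mulfI k0); rewrite mulr0 H.
- have -> : k * (pi *+ 2)%:C = (k * 0%:C) - ('i * (pi *+ 2)%:C) *+ n.
  by rewrite mulr0 sub0r /k -mulr_natr; ring.
 rewrite cexpD cexpN cexpMn.
 have -> : cexp ('i * (pi *+ 2)%:C) = 1 :> C.
  by apply: ceqP; rewrite /= !mul0r !mulr0 ?oppr0 !add0r ?subr0 !mul1r ?expR0 ?mul1r ?cos2pi ?sin2pi.
 by rewrite expr1n invr1 mulr1 subrr.
- by move=> t _; apply: ccontM; [exact: ccont_cst|exact: cc].
- by move=> t _; rewrite mulrC; exact: rderiv_cis.
Qed.
Lemma circV a rho t n : 0 < rho ->
 (circ a rho t - a)^-1 ^+ n = (rho%:C)^-1 ^+ n * cexp (- (n%:R * 'i) * t%:C).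
Proof.
move=> r0; rewrite /circ [a + _]addrC addrK invfM exprMn; congr (_ * _).
by rewrite -cexpN -cexpMn; congr cexp; rewrite -[LHS]mulr_natr; ring.
Qed.
(** Expands 1 / (circ - w) into a finite geometric sum with an explicit remainder that tends to zero
    geometrically, and integrates the sum term by term. The exponent is [n] rather than n + 1
    because the parametrised dz supplies a factor circ - a. *)
Lemma cauchy_expand (G : R -> C) a rho w : 0 < rho -> nm (w - a) < rho ->
 (forall t, 0 <= t <= pi *+ 2 -> ccont G t) ->
 (exists B : R, forall t, 0 <= t <= pi *+ 2 -> nm (G t) <= B) ->
 cvs (psum (fun n => 'i * cI (fun t => G t * (circ a rho t - a)^-1 ^+ n) 0 (pi *+ 2)) (w - a))
   (cI (fun t => G t * ('i * (circ a rho t - a)) / (circ a rho t - w)) 0 (pi *+ 2)).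
Proof.
move=> r0 wr cG [B HB] e e0.
set q := nm (w - a) / rho.
have q0 : 0 <= q by rewrite divr_ge0// ltW.
have q1 : q < 1 by rewrite ltr_pdivrMr// mul1r.
have B0 : 0 <= B by apply: le_trans (HB 0 _) => //; rewrite lexx two_pi_ge0.
have ca0 t : circ a rho t - a != 0 by rewrite -nm_gt0 nm_circ// ltW.
have cw0 t : circ a rho t - w != 0.
 rewrite -nm_gt0; have := nmB (circ a rho t - w) (a - w).
 have -> : circ a rho t - w - (a - w) = circ a rho t - a by ring.
 rewrite nm_circ ?(ltW r0)// (nm_distC a w); lra.
have cc1 t : ccont (fun t => circ a rho t - a) t by apply: ccontB; [exact: ccont_circ|exact: ccont_cst].
have cc2 t : ccont (fun t => circ a rho t - w) t by apply: ccontB; [exact: ccont_circ|exact: ccont_cst].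
have ccV n t : ccont (fun t => (circ a rho t - a)^-1 ^+ n) t.
 elim: n => [|n ih]; first by apply: ccont_cst.
 have -> : (fun t => (circ a rho t - a)^-1 ^+ n.+1) = (fun t => (circ a rho t - a)^-1 * (circ a rho t - a)^-1 ^+ n).
  by apply/funext => s; rewrite exprS.
 by apply: ccontM => //; apply: ccontV.
pose rem N t := G t * ('i * ((w - a) ^+ N * (circ a rho t - a)^-1 ^+ N)) * ((circ a rho t - a) / (circ a rho t - w)).
have crem N t : 0 <= t <= pi *+ 2 -> ccont (rem N) t.
 move=> tt; apply: ccontM.
  apply: ccontM; first exact: cG.
  apply: ccontM; first exact: ccont_cst.
  by apply: ccontM; [exact: ccont_cst|exact: ccV].
 by apply: ccontM => //; exact: ccontV.
have E N : cI (fun t => G t * ('i * (circ a rho t - a)) / (circ a rho t - w)) 0 (pi *+ 2) =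
 psum (fun n => 'i * cI (fun t => G t * (circ a rho t - a)^-1 ^+ n) 0 (pi *+ 2)) (w - a) N
 + cI (rem N) 0 (pi *+ 2).
 elim: N => [|N ih].
  rewrite /psum big_geq// add0r; apply: cI_eq => t tt.
  by rewrite /rem !expr0; ring.
 rewrite ih /psum big_nat_recr//= -addrA; congr (_ + _).
 have cN : cctn (fun t => G t * (circ a rho t - a)^-1 ^+ N) 0 (pi *+ 2).
  by move=> t tt; apply: ccontM; [exact: cG|exact: ccV].
 rewrite -mulrA [X in 'i * X]mulrC mulrA -cIZ// -cID; last by move=> t tt; exact: crem.
  apply: cI_eq => t tt; rewrite /rem !exprS.
  by field; rewrite ca0 cw0.
 by move=> t tt; apply: ccontM; [exact: ccont_cst|exact: cN].
have Brem N t : 0 <= t <= pi *+ 2 -> nm (rem N t) <= B * (rho / (rho - nm (w - a))) * q ^+ N.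
 move=> tt; rewrite /rem !nmM nm_i mul1r !nmX !nmV nm_circ ?(ltW r0)//.
 have lb : rho - nm (w - a) <= nm (circ a rho t - w).
  have := nmB (circ a rho t - w) (a - w).
  have -> : circ a rho t - w - (a - w) = circ a rho t - a by ring.
  rewrite nm_circ ?(ltW r0)// (nm_distC a w); lra.
 have rw : 0 < rho - nm (w - a) by rewrite subr_gt0.
 have -> : nm (w - a) ^+ N * rho^-1 ^+ N = q ^+ N by rewrite exprMn exprVn.
 rewrite mulrAC; apply: ler_pM.
 - by rewrite mulr_ge0// divr_ge0 ?(ltW r0).
 - by rewrite exprn_ge0.
 - apply: ler_pM => //; rewrite ?HB// ?divr_ge0 ?(ltW r0)//.
  by rewrite ler_pM2l// lef_pV2 ?posrE//; apply: lt_le_trans lb.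
 - by [].
set K := 2 * (B * (rho / (rho - nm (w - a)))) * (pi *+ 2 - 0).
have K0 : 0 <= K.
 rewrite /K subr0 mulr_ge0 ?two_pi_ge0// mulr_ge0// mulr_ge0// divr_ge0 ?(ltW r0)//.
 by rewrite subr_ge0 ltW.
have [N HN] : exists N, forall n, (N <= n)%N -> K * q ^+ n < e.
 have : (fun n => K * q ^+ n) @ \oo --> (0 : R).
  rewrite -[X in _ --> X](mulr0 K); apply: cvgM; first exact: cvg_cst.
  by apply: cvg_expr; rewrite ger0_norm.
 move=> /cvgrPdist_lt /(_ _ e0)[N _ H]; exists N => n /H /=.
 by rewrite sub0r normrN ger0_norm// mulr_ge0// exprn_ge0.
exists N => n /HN; apply: le_lt_trans.
rewrite (E n) opprD addrA subrr sub0r nmN.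
have := @cI_bound R (rem n) 0 (pi *+ 2) _ two_pi_ge0 (fun t tt => crem n t tt) (fun t tt => Brem n t tt).
by move/le_trans; apply; rewrite /K; apply: eq_ler; ring.
Qed.
(** Integrates the first order expansion of [f] along the segment from [w] to [w + h]. This makes
    the difference quotient of [F] differentiable at [w] itself. *)
Lemma second_order F f a r w : holo_sq f a r ->
 (forall z, in_sq a r z -> cderiv F z (f z)) -> in_sq a r w ->
 forall l, cderiv f w l -> forall e : R, 0 < e -> exists2 d, 0 < d & forall h, nm h < d ->
 nm (F (w + h) - F w - f w * h - l / 2 * h ^+ 2) <= e * nm h ^+ 2.
Proof.
move=> hf dF [w1 w2] l dl e e0.
have e2 : 0 < e / 2 by rewrite divr_gt0.
have /cderivP /(_ _ e2)[d d0 Hd] := dl.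
pose m := Num.min (r - `|Re w - Re a|) (r - `|Im w - Im a|).
have m0 : 0 < m by rewrite lt_min !subr_gt0 w1 w2.
exists (Num.min d m); first by rewrite lt_min d0.
move=> h; rewrite !lt_min => /and3P[hd h1 h2].
have th t : 0 <= t <= 1 -> nm (h * t%:C) <= nm h.
 by move=> /andP[t0 t1]; rewrite nmM nmR ger0_norm// ler_piMr.
have sq t : 0 <= t <= 1 -> in_sq a r (w + h * t%:C).
 move=> tt; have k := th t tt; have := le_Re_nm (h * t%:C); have := le_Im_nm (h * t%:C) => k1 k2.
 split; rewrite reimE addrAC.
  by rewrite (le_lt_trans (ler_normD _ _))//; lra.
 by rewrite (le_lt_trans (ler_normD _ _))//; lra.
pose Phi (t : R) := F (w + h * t%:C) - (f w * (w + h * t%:C) + l / 2 * (w + h * t%:C - w) ^+ 2).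
pose phi (t : R) := (f (w + h * t%:C) - (f w + l * (w + h * t%:C - w))) * h.
have dP t : 0 <= t <= 1 -> rderiv Phi t (phi t).
 move=> tt; have dd := dF _ (sq t tt).
 have d1 : cderiv (fun z => z - w) (w + h * t%:C) 1.
  by have := cderivB (cderiv_id (w + h * t%:C)) (cderiv_cst w _); rewrite subr0.
 have := cderivB dd (cderivD (cderivZ (f w) (cderiv_id _)) (cderivZ (l / 2) (cderivX 2 d1))).
 move=> D; have := cderiv_rcomp (@rderiv_affine R w h t) D.
 congr (rderiv _ _ _); rewrite /phi; congr (_ * _).
 by rewrite expr1; field.
have cphi : cctn phi 0 1.
 move=> t tt; apply: ccontM; last exact: ccont_cst.
 have ca := rderiv_affine w h t.
 apply: ccontB; first by apply: ccont_comp ca; exact: hf (sq t tt).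
 apply: ccontD; first exact: ccont_cst.
 apply: ccontM; first exact: ccont_cst.
 by apply: ccontB; [exact: rderiv_cont ca|exact: ccont_cst].
have := cI_FTC ler01 cphi dP.
have -> : Phi 1 - Phi 0 = F (w + h) - F w - f w * h - l / 2 * h ^+ 2.
 by rewrite /Phi mulr1 mulr0 !addr0; ring.
move=> <-.
have B t : 0 <= t <= 1 -> nm (phi t) <= e / 2 * nm h ^+ 2.
 move=> tt; rewrite /phi nmM expr2 mulrA ler_wpM2r//.
 have -> : w + h * t%:C - w = h * t%:C by ring.
 have -> : f (w + h * t%:C) - (f w + l * (h * t%:C)) = f (w + h * t%:C) - f w - l * (h * t%:C) by ring.
 have hh : nm (h * t%:C) < d by exact: le_lt_trans (th t tt) hd.
 by rewrite (le_trans (Hd _ hh))// ler_wpM2l ?th// ltW.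
rewrite (le_trans (cI_bound ler01 cphi B))//.
by apply: eq_ler; field.
Qed.
Definition slope F f w z := if z == w then f w else (F z - F w) / (z - w).

Lemma slope_holo F f a r w : holo_sq f a r ->
 (forall z, in_sq a r z -> cderiv F z (f z)) -> in_sq a r w ->
 holo_sq (slope F f w) a r.
Proof.
move=> hf dF ws z zs; have [->|zw] := eqVneq z w.
 have [l dl] := hf w ws; exists (l / 2); apply/cderivP => e e0.
 have [d d0 H] := second_order hf dF ws dl e0.
 exists d => // h hd; rewrite /slope eqxx.
 have [->|h0] := eqVneq h 0; first by rewrite addr0 eqxx subrr mulr0 subrr nm0 mulr0.
 have -> : (w + h == w) = false by rewrite -subr_eq0 addrAC subrr add0r (negbTE h0).
 have -> : (F (w + h) - F w) / (w + h - w) - f w - l / 2 * h =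
  (F (w + h) - F w - f w * h - l / 2 * h ^+ 2) / h.
  have -> : w + h - w = h by ring.
  by field.
 have n0 : 0 < nm h by rewrite nm_gt0.
 rewrite nmM nmV ler_pdivrMr// -mulrA.
 by have := H h hd; rewrite [nm h ^+ 2]expr2 !mulrA.
have zw0 : z - w != 0 by rewrite subr_eq0.
have d1 : cderiv (fun z => z - w) z 1.
 by have := cderivB (cderiv_id z) (cderiv_cst w z); rewrite subr0.
have dF1 : cderiv (fun z => F z - F w) z (f z).
 by have := cderivB (dF z zs) (cderiv_cst (F w) z); rewrite subr0.
have D := cderivM dF1 (@cderivV _ (fun z => z - w) z _ zw0 d1).
eexists; apply: (@cderiv_near _ _ _ _ _ (nm (z - w)) _ _ D); first by rewrite nm_gt0.
move=> y yz; rewrite /slope; case: eqP => // yw.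
by move: yz; rewrite yw nm_distC ltxx.
Qed.
(** The expansion with [G = 1]: every term but the constant one integrates a nontrivial character
    over full periods. *)
Lemma cI_circ_winding a rho w : 0 < rho -> nm (w - a) < rho ->
 cI (fun t => ('i * (circ a rho t - a)) / (circ a rho t - w)) 0 (pi *+ 2) = 'i * (pi *+ 2)%:C.
Proof.
move=> r0 wr.
have b1 : exists B : R, forall t : R, 0 <= t <= pi *+ 2 -> nm (1 : C) <= B by exists 1 => t _; rewrite nm1.
have H := @cauchy_expand (fun=> 1) a rho w r0 wr (fun t _ => ccont_cst 1 t) b1.
have e1 : cI (fun t => 1 * ('i * (circ a rho t - a)) / (circ a rho t - w)) 0 (pi *+ 2) =
 cI (fun t => ('i * (circ a rho t - a)) / (circ a rho t - w)) 0 (pi *+ 2).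
 by apply: cI_eq => t _; rewrite mul1r.
rewrite e1 in H; apply: (cvs_unique H).
apply: (@cvs_ext _ (fun=> 'i * (pi *+ 2)%:C) _ _ 1%N); last exact: cvs_cst.
case=> // n _; rewrite /psum big_nat_recl// big1_seq ?addr0; last first.
 move=> i _; rewrite (_ : cI _ _ _ = 0) ?mulr0 ?mul0r//.
 have -> : (fun t => 1 * (circ a rho t - a)^-1 ^+ i.+1) =
  (fun t => (rho%:C)^-1 ^+ i.+1 * cexp (- (i.+1%:R * 'i) * t%:C)).
  by apply/funext => t; rewrite mul1r circV.
 rewrite cIZ; last by move=> t _; apply: rderiv_cont (rderiv_cis _ t).
 by rewrite cI_cis_int// mulr0.
rewrite expr0 mulr1; congr (_ * _).
have -> : (fun t => 1 * (circ a rho t - a)^-1 ^+ 0) = (fun=> 1).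
 by apply/funext => t; rewrite mul1r expr0.
by rewrite cI_cst ?two_pi_ge0// mul1r subr0.
Qed.
Lemma circ_closed_prim (q Q : C -> C) a rho :
 (forall t, 0 <= t <= pi *+ 2 -> cder_at q (circ a rho t)) ->
 (forall t, 0 <= t <= pi *+ 2 -> cderiv Q (circ a rho t) (q (circ a rho t))) ->
 cI (fun t => q (circ a rho t) * ('i * (circ a rho t - a))) 0 (pi *+ 2) = 0.
Proof.
move=> hq dQ.
rewrite (@cI_FTC R _ (fun t => Q (circ a rho t)) _ _ two_pi_ge0).
- by rewrite circ_2pi subrr.
- move=> t tt; apply: ccontM; first by apply: ccont_comp (rderiv_circ a rho t); exact: hq.
 apply: ccontM; first exact: ccont_cst.
 by apply: ccontB; [exact: ccont_circ|exact: ccont_cst].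
- by move=> t tt; apply: cderiv_rcomp (rderiv_circ a rho t) (dQ t tt).
Qed.
Lemma circ_in_sq a rho r t : 0 <= rho < r -> in_sq a r (circ a rho t).
Proof. by move=> /andP[r0 rr]; apply: nm_in_sq; rewrite nm_circ. Qed.
(** Stated for a function whose derivative [f] is already known to be differentiable, since
    Goursat's theorem is applied to the slope, which must be differentiable at [w] too. [taylor]
    meets this by working with a primitive and differentiating its series. *)
Lemma cauchy_formula F f a r rho w : holo_sq f a r ->
 (forall z, in_sq a r z -> cderiv F z (f z)) -> 0 < rho < r -> nm (w - a) < rho ->
 F w * ('i * (pi *+ 2)%:C) =
 cI (fun t => F (circ a rho t) * ('i * (circ a rho t - a)) / (circ a rho t - w)) 0 (pi *+ 2).
Proof.
move=> hf dF /andP[r0 rr] wr.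
have rr' : 0 <= rho < r by rewrite (ltW r0).
have ws : in_sq a r w by apply: nm_in_sq; exact: lt_trans rr.
have hq := slope_holo hf dF ws.
have [rho' /andP[rp rp']] : exists rho', rho < rho' < r.
 by exists ((rho + r) / 2); apply/andP; split; [rewrite ltr_pdivlMr//; lra|rewrite ltr_pdivrMr//; lra].
have [Q dQ] := primitive_sq hq rp'.
have cs t : in_sq a rho' (circ a rho t) by apply: circ_in_sq; rewrite (ltW r0).
have cw0 t : circ a rho t - w != 0.
 rewrite -nm_gt0; have := nmB (circ a rho t - w) (a - w).
 have -> : circ a rho t - w - (a - w) = circ a rho t - a by ring.
 rewrite nm_circ ?(ltW r0)// (nm_distC a w); lra.
have Z := @circ_closed_prim (slope F f w) Q a rho (fun t _ => hq _ (circ_in_sq a t rr')) (fun t _ => dQ _ (cs t)).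
have cc2 t : ccont (fun t => circ a rho t - w) t by apply: ccontB; [exact: ccont_circ|exact: ccont_cst].
have cc1 t : ccont (fun t => 'i * (circ a rho t - a)) t.
 by apply: ccontM; [exact: ccont_cst|apply: ccontB; [exact: ccont_circ|exact: ccont_cst]].
have cK : cctn (fun t => ('i * (circ a rho t - a)) / (circ a rho t - w)) 0 (pi *+ 2).
 by move=> t _; apply: ccontM => //; apply: ccontV.
have cF : cctn (fun t => F (circ a rho t)) 0 (pi *+ 2).
 move=> t _; apply: ccont_comp (rderiv_circ a rho t).
 by exists (f (circ a rho t)); apply: dF; exact: circ_in_sq.
have E : cI (fun t => slope F f w (circ a rho t) * ('i * (circ a rho t - a))) 0 (pi *+ 2) =
 cI (fun t => F (circ a rho t) * ('i * (circ a rho t - a)) / (circ a rho t - w)) 0 (pi *+ 2) -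
 F w * cI (fun t => ('i * (circ a rho t - a)) / (circ a rho t - w)) 0 (pi *+ 2).
 rewrite -cIZ// -cIB.
 - apply: cI_eq => t _; rewrite /slope -subr_eq0 (negbTE (cw0 t)); field.
  exact: cw0.
 - by move=> t tt; apply: ccontM; [apply: ccontM => //; exact: cF|apply: ccontV].
 - by move=> t tt; apply: ccontM; [exact: ccont_cst|exact: cK].
by move: E; rewrite Z cI_circ_winding// => /esym/subr0_eq ->.
Qed.
Lemma compact_bound (G : R -> C) (x y : R) : x <= y -> cctn G x y ->
 exists B : R, forall t, x <= t <= y -> nm (G t) <= B.
Proof.
move=> xy cG.
have cn : {within `[x, y], continuous (fun t => `|Re (G t)| + `|Im (G t)|)}.
 apply: continuous_in_subspaceT => t; rewrite inE /= in_itv /= => tab.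
 by apply: cvgD; apply: cvg_norm; [apply: ccont_Re|apply: ccont_Im]; exact: cG.
have [z _ H] := EVT_max xy cn.
exists (`|Re (G z)| + `|Im (G z)|) => t tt; apply: le_trans (nm_le_ReIm _) _.
by apply: H; rewrite in_itv.
Qed.
Lemma pser_circ F f a r rho : 0 < rho < r -> holo_sq f a r -> (forall z, in_sq a r z -> cderiv F z (f z)) ->
 pser (fun n => (pi *+ 2)%:C^-1 * cI (fun t => F (circ a rho t) * (circ a rho t - a)^-1 ^+ n) 0 (pi *+ 2)) a F rho.
Proof.
move=> rr hf dF w wr; have /andP[rho0 rhor] := rr.
have p0 : (pi *+ 2)%:C != 0 :> C by rewrite -nm_eq0 nmR normr_eq0 mulrn_eq0 /= gt_eqF// pi_gt0.
have i0 : 'i != 0 :> C by rewrite -nm_eq0 nm_i oner_eq0.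
have cF : cctn (fun t => F (circ a rho t)) 0 (pi *+ 2).
 move=> t _; apply: ccont_comp (rderiv_circ a rho t).
 by exists (f (circ a rho t)); apply: dF; apply: circ_in_sq; rewrite ltW.
have := cauchy_expand rho0 wr cF (compact_bound two_pi_ge0 cF).
rewrite -(cauchy_formula hf dF rr wr) => /(cvsZ ('i * (pi *+ 2)%:C)^-1).
rewrite mulrCA mulVf ?mulf_neq0// mulr1; apply: (@cvs_ext _ _ _ _ 0%N) => n _.
rewrite /psum mulr_sumr; apply: eq_bigr => m _; rewrite mulrA; congr (_ * _).
by move: p0 i0; move: (cI _ _ _) ((pi *+ 2)%:C) ('i : C) => X Y I p0 i0; field; rewrite i0 p0.
Qed.
(** Expansions on smaller discs have the same coefficients by uniqueness, so one sequence serves the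
    whole open disc. *)
Lemma pser_extend f a r : 0 < r -> (forall r', 0 < r' < r -> exists u, pser u a f r') -> exists u, pser u a f r.
Proof.
move=> r0 loc; have r2 : 0 < r / 2 < r by lra.
have [u pu] := loc _ r2; exists u => w wr.
pose m := Num.max (nm (w - a)) (r / 2); pose rho := (m + r) / 2.
have [m1 m2 mr] : [/\ nm (w - a) <= m, r / 2 <= m & m < r].
 by rewrite !le_max !lexx orbT gt_max wr; split => //=; lra.
have rho0 : 0 < rho by rewrite /rho; lra.
have rr : 0 < rho < r by rewrite rho0 /rho; lra.
have [v pv] := loc _ rr; have wp : nm (w - a) < rho by rewrite /rho; lra.
have E := pser_uniq rho0 (divr_gt0 r0 (ltr0n _ 2)) pv pu (fun z _ => erefl).
have := pv w wp; apply: (@cvs_ext _ _ _ _ 0%N) => n _.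
by rewrite /psum; apply: eq_bigr => i _; rewrite E.
Qed.

Theorem taylor f a r : 0 < r -> holo_sq f a r -> exists u, pser u a f r.
Proof.
move=> r0 hf; apply: pser_extend => // rho /andP[rho0 rr].
pose r' := (rho + r) / 2; have r'r : r' < r by rewrite /r'; lra.
have [F dF] := primitive_sq hf r'r.
have hf' : holo_sq f a r' by move=> z zs; apply: hf; exact: in_sqS (ltW r'r) zs.
have rr' : 0 < rho < r' by rewrite rho0 /r'; lra.
have [f1 [pf1 df1]] := pser_derive (pser_circ rr' hf' dF).
eexists => z zr; have <- : f1 z = f z; last exact: pf1.
apply: cderiv_unique (df1 z zr) (dF z _); apply: nm_in_sq; apply: lt_trans zr _.
by case/andP: rr'.
Qed.

Corollary holo_deriv f df a r : (forall z, in_sq a r z -> cderiv f z (df z)) -> holo_sq df a r.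
Proof.
move=> dfz z zs.
have hf : holo_sq f a r by move=> y ys; exists (df y); exact: dfz.
have /andP[w1 w2] : (`|Re z - Re a| < r) && (`|Im z - Im a| < r) by case: zs => -> ->.
pose m := Num.min (r - `|Re z - Re a|) (r - `|Im z - Im a|).
have m0 : 0 < m by rewrite lt_min !subr_gt0 w1 w2.
have sub y : in_sq z m y -> in_sq a r y.
 move=> [h1 h2]; move: h1 h2; rewrite !lt_min => /andP[h1 _] /andP[_ h2]; split.
  by have := ler_distD (Re z) (Re y) (Re a); lra.
 by have := ler_distD (Im z) (Im y) (Im a); lra.
have hz : holo_sq f z m by move=> y /sub; exact: hf.
have [u pu] := taylor m0 hz.
have [f1 [pf1 df1]] := pser_derive pu.
have [f2 [_ df2]] := pser_derive pf1.
have zz : nm (z - z) < m by rewrite subrr nm0.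
exists (f2 z); apply: (@cderiv_near _ f1 _ _ _ m m0) (df2 z zz) => y yr.
by apply: cderiv_unique (df1 y yr) (dfz y (sub y (nm_in_sq yr))).
Qed.
Lemma taylor_coef F f u a r rho n : 0 < rho < r ->
 (forall z, in_sq a r z -> cderiv F z (f z)) -> pser u a F r ->
 cI (fun t => F (circ a rho t) * (circ a rho t - a)^-1 ^+ n) 0 (pi *+ 2) = (pi *+ 2)%:C * u n.
Proof.
move=> rr dF pF; have /andP[rho0 rhor] := rr.
rewrite -(pser_uniq rho0 (lt_trans rho0 rhor) (pser_circ rr (holo_deriv dF) dF) pF (fun z _ => erefl) n).
by rewrite mulVKf// -nm_eq0 nmR normr_eq0 mulrn_eq0 /= gt_eqF// pi_gt0.
Qed.

End Taylor.

(** * Identity theorem *)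

Section Identity.
Variable R : realType.
Local Notation C := R[i].
Implicit Types (a b z w l : C) (f g F : C -> C) (r : R) (D : C -> Prop).

Definition copen D := forall z, D z -> exists2 r, 0 < r & forall y, in_sq z r y -> D y.
Definition cconvex D := forall x y (t : R), D x -> D y -> 0 <= t <= 1 -> D (x + (y - x) * t%:C).
Definition holo D f := forall z, D z -> cder_at f z.

Definition near0 f z := exists2 r, 0 < r & forall y, nm (y - z) < r -> f y = 0.

Lemma accum_near0 D f a : copen D -> holo D f -> D a ->
 (forall d : R, 0 < d -> exists z, [/\ z != a, nm (z - a) < d & f z = 0]) -> near0 f a.
Proof.
move=> oD hf Da Z; have [r r0 Hr] := oD a Da.
have hs : holo_sq f a r by move=> z /Hr; exact: hf.
have [u pu] := taylor r0 hs; have u0 := pser_zeros r0 pu Z.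
exists r => // y /pu H; apply: (cvs_unique H).
apply: (@cvs_ext _ (fun=> 0) _ _ 0%N); last exact: cvs_cst.
by move=> n _; rewrite /psum big1// => i _; rewrite u0 mul0r.
Qed.

Theorem identity_accum D f a : copen D -> cconvex D -> holo D f -> D a ->
 (forall d : R, 0 < d -> exists z, [/\ z != a, nm (z - a) < d & f z = 0]) ->
 forall z, D z -> f z = 0.
Proof.
move=> oD cD hf Da Z b Db; have [->|ab] := eqVneq b a.
 have [r r0 H] := accum_near0 oD hf Da Z.
 by apply: H; rewrite subrr nm0.
pose p (t : R) := a + (b - a) * t%:C.
have pE s t : p s - p t = (b - a) * (s - t)%:C by rewrite /p rmorphB /=; ring.
have K0 : 0 < nm (b - a) by rewrite nm_gt0 subr_eq0.
have npE s t : nm (p s - p t) = nm (b - a) * `|s - t| by rewrite pE nmM nmR.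
have Dp t : 0 <= t <= 1 -> D (p t) by move=> tt; exact: cD.
(* Vanishing is carried along the segment from [a] to [b]: [S] collects the parameters up to which
   [f] vanishes near every point. Its supremum [T] must be 1, because vanishing near [p T] extends
   past [T]. *)
pose S := [set t : R | 0 <= t <= 1 /\ forall s, 0 <= s <= t -> near0 f (p s)].
have p0 : p 0 = a by rewrite /p mulr0 addr0.
have S0 : S 0.
 split; first by rewrite lexx ler01.
 move=> s; rewrite -eq_le => /eqP <-; rewrite p0; exact: (accum_near0 oD hf Da Z).
have Sub : ubound S 1 by move=> t [/andP[]].
have hS : has_sup S by split; [exists 0|exists 1].
pose T := sup S.
have T0 : 0 <= T by apply: ub_le_sup => //; case: hS.
have T1 : T <= 1 by apply: sup_le_ub => //; exists 0.
have DT : D (p T) by apply: Dp; rewrite T0.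
have below s : 0 <= s -> s < T -> near0 f (p s).
 move=> s0 sT; have sT' : 0 < T - s by rewrite subr_gt0.
 have [t [tt Ht] st] := sup_adherent sT' hS.
 apply: Ht; rewrite s0 /=; move: st; rewrite -/T; lra.
have ZT : near0 f (p T).
 move: T0; rewrite le_eqVlt => /predU1P[<-|T0]; first by rewrite p0; exact: (accum_near0 oD hf Da Z).
 apply: (accum_near0 oD hf DT) => d d0.
 pose s := T - Num.min T (d / nm (b - a)) / 2.
 have m0 : 0 < Num.min T (d / nm (b - a)) by rewrite lt_min T0 divr_gt0.
 have mT : Num.min T (d / nm (b - a)) <= T by rewrite ge_min lexx.
 have md : Num.min T (d / nm (b - a)) <= d / nm (b - a) by rewrite ge_min lexx orbT.
 have sT : s < T by rewrite /s; lra.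
 have s0 : 0 <= s by rewrite /s; lra.
 have [r r0 Hr] := below s s0 sT.
 exists (p s); split.
 - by rewrite -subr_eq0 -nm_gt0 npE mulr_gt0// normr_gt0 subr_eq0 lt_eqF.
 - rewrite npE mulrC -ltr_pdivlMr// distrC ger0_norm ?subr_ge0 ?(ltW sT)//.
  by rewrite /s; lra.
 - by apply: Hr; rewrite subrr nm0.
have [r r0 Hr] := ZT.
have [Te|Tlt] := eqVneq T 1.
 apply: Hr; rewrite Te /p mulr1.
 by rewrite (_ : b - (a + (b - a)) = 0); [rewrite nm0|ring].
have {Tlt T1}T1 : T < 1 by rewrite lt_neqAle Tlt.
pose d := Num.min (1 - T) (r / nm (b - a) / 2).
have d0 : 0 < d by rewrite lt_min subr_gt0 T1 divr_gt0// divr_gt0.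
have d1 : d <= 1 - T by rewrite ge_min lexx.
have d2 : d <= r / nm (b - a) / 2 by rewrite ge_min lexx orbT.
have : S (T + d).
 split; first by lra.
 move=> s /andP[s0 sd]; have [sT|Ts] := ltP s T; first exact: below.
 have h : nm (p s - p T) < r.
  rewrite npE mulrC -ltr_pdivlMr// ger0_norm ?subr_ge0//.
  have : 0 < r / nm (b - a) by rewrite divr_gt0.
  lra.
 exists (r - nm (p s - p T)); first by rewrite subr_gt0.
 move=> y yr; apply: Hr.
 have -> : y - p T = (y - p s) + (p s - p T) by ring.
 by rewrite (le_lt_trans (nmD _ _))//; lra.
by move=> ST; have := ub_le_sup (proj2 hS) ST; rewrite -/T => TT; exfalso; move: TT d0; lra.
Qed.

Theorem identity_real D f g x1 x2 : copen D -> cconvex D -> holo D f -> holo D g -> x1 < x2 ->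
 (forall x, x1 < x < x2 -> D x%:C) -> (forall x, x1 < x < x2 -> f x%:C = g x%:C) ->
 forall z, D z -> f z = g z.
Proof.
move=> oD cD hf hg x12 Dx fg z Dz; apply/eqP; rewrite -subr_eq0; apply/eqP.
have hfg : holo D (fun z => f z - g z).
 by move=> y Dy; have [l dl] := hf y Dy; have [m dm] := hg y Dy; exists (l - m); exact: cderivB.
pose c := (x1 + x2) / 2.
have cc : x1 < c < x2 by rewrite /c; lra.
apply: (@identity_accum D (fun z => f z - g z) c%:C oD cD hfg (Dx c cc) _ z Dz) => d d0.
pose e := Num.min d (x2 - c) / 2.
have e0 : 0 < Num.min d (x2 - c) by rewrite lt_min d0 subr_gt0; case/andP: cc.
have ed : Num.min d (x2 - c) <= d by rewrite ge_min lexx.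
have ex : Num.min d (x2 - c) <= x2 - c by rewrite ge_min lexx orbT.
have ce : (c + e)%:C - c%:C = e%:C :> C by rewrite rmorphD /= addrAC subrr add0r.
exists (c + e)%:C; split.
- by rewrite -subr_eq0 ce -nm_eq0 nmR normr_eq0 gt_eqF// /e; lra.
- by rewrite ce nmR ger0_norm /e; lra.
- by rewrite fg ?subrr//; case/andP: cc => c1 c2; rewrite /e; lra.
Qed.

(** The form in which zeros are excluded later: a single zero is shown to force zeros on a
    horizontal segment ending at a point of the domain, and then the function vanishes
    identically. *)
Theorem zero_propagates D f a (eta : R) : copen D -> cconvex D -> holo D f -> D a -> 0 < eta ->
 (forall q : R, 0 < q < eta -> f (a - q%:C) = 0) -> forall z, D z -> f z = 0.
Proof.
move=> oD cD hf Da eta0 H; apply: (identity_accum oD cD hf Da) => d d0.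
pose e := Num.min d eta / 2.
have e0 : 0 < Num.min d eta by rewrite lt_min d0.
have ed : Num.min d eta <= d by rewrite ge_min lexx.
have ex : Num.min d eta <= eta by rewrite ge_min lexx orbT.
have ce : a - e%:C - a = - e%:C by ring.
exists (a - e%:C); split.
- by rewrite -subr_eq0 ce oppr_eq0 -nm_eq0 nmR normr_eq0 gt_eqF// /e; lra.
- by rewrite ce nmN nmR ger0_norm /e; lra.
- by apply: H; rewrite /e; lra.
Qed.
Definition hplane (x : R) z := x < Re z.

Lemma hplane_open x : copen (hplane x).
Proof.
move=> z xz; exists (Re z - x); first by rewrite subr_gt0.
by move=> y [h _]; rewrite /hplane; move: h; rewrite ltr_distlC => /andP[]; lra.
Qed.
Lemma convex_bounds (a b t m : R) : m < a -> m < b -> 0 <= t <= 1 -> m < a + (b - a) * t.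
Proof. by move=> ma mb /andP[t0 t1]; have [ab|ba] := lerP a b; nra. Qed.
Lemma hplane_convex x : cconvex (hplane x).
Proof.
move=> y z t hy hz tt; rewrite /hplane !reimE /= !mulr0 ?mul0r subr0.
exact: convex_bounds.
Qed.
Lemma hplane_mid (x : R) (z : C) : hplane x z -> exists2 y, x < y & hplane y z.
Proof. by rewrite /hplane => h; exists ((x + Re z) / 2); lra. Qed.
Definition whole (z : C) := True.
Lemma whole_open : copen whole. Proof. by move=> z _; exists 1. Qed.
Lemma whole_convex : cconvex whole. Proof. by []. Qed.
Lemma holoS D D' f : (forall z, D' z -> D z) -> holo D f -> holo D' f.
Proof. by move=> DD hf z /DD; exact: hf. Qed.
Lemma holoD D f g : holo D f -> holo D g -> holo D (fun z => f z + g z).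
Proof. by move=> hf hg z Dz; have [l ?] := hf z Dz; have [m ?] := hg z Dz; exists (l + m); exact: cderivD. Qed.
Lemma holoB D f g : holo D f -> holo D g -> holo D (fun z => f z - g z).
Proof. by move=> hf hg z Dz; have [l ?] := hf z Dz; have [m ?] := hg z Dz; exists (l - m); exact: cderivB. Qed.
Lemma holoM D f g : holo D f -> holo D g -> holo D (fun z => f z * g z).
Proof. by move=> hf hg z Dz; have [l h1] := hf z Dz; have [m h2] := hg z Dz; exists (f z * m + g z * l); exact: (cderivM h1 h2). Qed.
Lemma holoV D f : (forall z, D z -> f z != 0) -> holo D f -> holo D (fun z => (f z)^-1).
Proof. by move=> f0 hf z Dz; have [l h1] := hf z Dz; exists (- (f z)^-2 * l); exact: (cderivV (f0 z Dz) h1). Qed.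
Lemma holo_cst D c : holo D (fun=> c).
Proof. by move=> z _; exists 0; exact: cderiv_cst. Qed.
Lemma holo_id D : holo D id.
Proof. by move=> z _; exists 1; exact: cderiv_id. Qed.
Lemma holo_comp D D' f g : (forall z, D z -> D' (f z)) -> holo D f -> holo D' g -> holo D (fun z => g (f z)).
Proof.
move=> DD hf hg z Dz; have [l ?] := hf z Dz; have [m ?] := hg _ (DD z Dz).
by exists (m * l); exact: cderiv_comp.
Qed.
Lemma holo_cexp D f : holo D f -> holo D (fun z => cexp (f z)).
Proof. by move=> hf z Dz; have [l h1] := hf z Dz; exists (cexp (f z) * l); exact: (cderiv_comp h1 (cderiv_cexp (f z))). Qed.
Definition cder f z : C := xget 0 [set l | cderiv f z l].
Lemma cderE f z : cder_at f z -> cderiv f z (cder f z).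
Proof. by move=> [l dl]; rewrite /cder; apply: (@xgetPex _ 0 [set l | cderiv f z l]); exists l. Qed.
Lemma holo_cder D f : copen D -> holo D f -> holo D (cder f).
Proof.
move=> oD hf z Dz; have [r r0 Hr] := oD z Dz.
have H : forall y, in_sq z r y -> cderiv f y (cder f y) by move=> y /Hr /hf /cderE.
by apply: (holo_deriv H); split; rewrite subrr normr0.
Qed.
Lemma sq_open a r : copen (in_sq a r).
Proof.
move=> z [w1 w2].
exists (Num.min (r - `|Re z - Re a|) (r - `|Im z - Im a|)); first by rewrite lt_min !subr_gt0 w1 w2.
move=> y [h1 h2]; move: h1 h2; rewrite !lt_min => /andP[h1 _] /andP[_ h2]; split.
 by have := ler_distD (Re z) (Re y) (Re a); lra.
by have := ler_distD (Im z) (Im y) (Im a); lra.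
Qed.
Lemma sq_seg a r z (t : R) : in_sq a r z -> 0 <= t <= 1 -> in_sq a r (a + (z - a) * t%:C).
Proof.
move=> [h1 h2] /andP[t0 t1]; split; rewrite !reimE /= !mulr0 ?mul0r ?subr0 ?addr0 ?add0r addrAC subrr add0r normrM (ger0_norm t0).
 by rewrite (le_lt_trans _ h1)// ler_piMr.
by rewrite (le_lt_trans _ h2)// ler_piMr.
Qed.
Lemma cderiv0_cst F a r : (forall z, in_sq a r z -> cderiv F z 0) ->
 forall z, in_sq a r z -> F z = F a.
Proof.
move=> dF z zs.
have D t : 0 <= t <= 1 -> rderiv (fun t => F (a + (z - a) * t%:C)) t 0.
 move=> tt; have := cderiv_rcomp (@rderiv_affine R a (z - a) t) (dF _ (sq_seg zs tt)).
 by rewrite mul0r.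
have := cI_FTC ler01 (fun t _ => ccont_cst 0 t) D.
rewrite cI_cst ?ler01// mul0r mulr1 mulr0 addr0 => /esym/subr0_eq.
by have -> : a + (z - a) = z by ring.
Qed.

(** A primitive of f' / f, corrected by a real constant. Only the modulus is matched, which leaves
    the additive imaginary constant of the logarithm free. *)
Theorem log_modulus f a r r' : 0 < r' < r -> holo_sq f a r -> (forall z, in_sq a r z -> f z != 0) ->
 exists2 l : C -> C, holo_sq l a r' & forall z, in_sq a r' z -> expR (Re (l z)) = nm (f z).
Proof.
move=> /andP[r'0 rr] hf f0.
have hd : holo (in_sq a r) (cder f) by apply: holo_cder => //; exact: sq_open.
have hq : holo_sq (fun z => cder f z * (f z)^-1) a r by apply: (@holoM (in_sq a r)) => //; exact: holoV.
have [F dF] := primitive_sq hq rr.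
have sub z : in_sq a r' z -> in_sq a r z by apply: in_sqS; exact: ltW.
have dG z : in_sq a r' z -> cderiv (fun z => f z * cexp (- F z)) z 0.
 move=> zs; have d1 := cderE (hf z (sub z zs)).
 have := cderivM d1 (cderiv_comp (cderivN (dF z zs)) (cderiv_cexp (- F z))).
 congr (cderiv _ _ _).
 by field; exact: f0 (sub z zs).
have as' : in_sq a r' a by split; rewrite subrr normr0.
pose k := nm (f a * cexp (- F a)).
have k0 : 0 < k by rewrite nm_gt0 mulf_neq0 ?cexp_neq0// f0//; exact: sub.
exists (fun z => F z + (ln k)%:C).
 by move=> z zs; exists (cder f z * (f z)^-1 + 0); apply: cderivD; [exact: dF|exact: cderiv_cst].
move=> z zs; rewrite reimE /= expRD lnK// /k -(cderiv0_cst dG zs) nmM mulrCA nm_cexp reimE.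
by rewrite -expRD subrr expR0 mulr1.
Qed.
Lemma ivl_ge0 (f : R -> R) x y : (forall t, x <= t <= y -> 0 <= f t) -> 0 <= ivl f x y.
Proof. by move=> H; apply: Rintegral_ge0 => t /=; rewrite in_itv /=; exact: H. Qed.
Lemma ivl_le (f g : R -> R) x y : ctn f x y -> ctn g x y -> (forall t, x <= t <= y -> f t <= g t) ->
 ivl f x y <= ivl g x y.
Proof.
move=> cf cg H; rewrite -subr_ge0 -ivlB//; apply: ivl_ge0 => t tt.
by rewrite subr_ge0 H.
Qed.
Lemma ivl_cst k (x y : R) : x <= y -> ivl (fun=> k) x y = k * (y - x).
Proof. by move=> xy; have := congr1 (fun z : C => Re z) (cI_cst k%:C xy); rewrite !reimE /= mulr0 subr0. Qed.

End Identity.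

(** * Integrals, Fubini and Laplace transforms *)

Section HasIntegral.
Context d (T : measurableType d) (R : realType) (mu : {measure set T -> \bar R}).
Implicit Types (D : set T) (f g : T -> R).

Definition itg D f := mu.-integrable D (EFin \o f).
(** Integrability and value are kept together: the real-valued integral falls back on a default when
    the extended one is not finite, so an equation between values alone would say little. *)
Definition hasI D f v := itg D f /\ \int[mu]_(x in D) f x = v.

Lemma itg_meas D f : itg D f -> measurable_fun D f.
Proof. by move=> /integrableP[/measurable_EFinP]. Qed.
Lemma itg_le D f g : measurable D -> measurable_fun D f -> itg D g ->
 (forall x, D x -> `|f x| <= g x) -> itg D f.
Proof.
move=> mD mf ig fg; apply: (le_integrable mD _ _ ig); first exact/measurable_EFinP.
by move=> x Dx /=; rewrite lee_fin (le_trans (fg x Dx))// ler_norm.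
Qed.
Lemma eq_itg D f g : measurable D -> (forall x, D x -> f x = g x) -> itg D f -> itg D g.
Proof.
move=> mD fg; apply: eq_integrable => // x; rewrite inE => Dx.
by rewrite /= fg.
Qed.
Lemma itgD D f g : measurable D -> itg D f -> itg D g -> itg D (fun x => f x + g x).
Proof. by move=> mD i1 i2; exact: (integrableD mD i1 i2). Qed.
Lemma itgB D f g : measurable D -> itg D f -> itg D g -> itg D (fun x => f x - g x).
Proof. by move=> mD i1 i2; exact: (integrableB mD i1 i2). Qed.
Lemma itgZ D k f : measurable D -> itg D f -> itg D (fun x => k * f x).
Proof. by move=> mD i1; exact: (integrableZl mD k i1). Qed.
Lemma itg_norm D f : itg D f -> itg D (fun x => `|f x|).
Proof. by move=> i1; exact: (integrable_norm i1). Qed.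
Lemma itg0 D : itg D (fun=> 0).
Proof. exact: integrable0. Qed.
Lemma itgS D E f : measurable D -> measurable E -> E `<=` D -> itg D f -> itg E f.
Proof. by move=> mD mE ED; exact: integrableS. Qed.
Lemma hasI_itg D f : itg D f -> hasI D f (\int[mu]_(x in D) f x).
Proof. by []. Qed.
Lemma eq_hasI D f g v : measurable D -> (forall x, D x -> f x = g x) -> hasI D f v -> hasI D g v.
Proof.
move=> mD fg [i1 <-]; split; first exact: eq_itg i1.
by apply: eq_Rintegral => x; rewrite inE => /fg.
Qed.
Lemma hasI_D D f g v w : measurable D -> hasI D f v -> hasI D g w -> hasI D (fun x => f x + g x) (v + w).
Proof. by move=> mD [i1 <-] [i2 <-]; split; [exact: itgD|exact: RintegralD]. Qed.
Lemma hasI_B D f g v w : measurable D -> hasI D f v -> hasI D g w -> hasI D (fun x => f x - g x) (v - w).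
Proof. by move=> mD [i1 <-] [i2 <-]; split; [exact: itgB|exact: RintegralB]. Qed.
Lemma hasI_Z D k f v : measurable D -> hasI D f v -> hasI D (fun x => k * f x) (k * v).
Proof. by move=> mD [i1 <-]; split; [exact: itgZ|exact: RintegralZl]. Qed.
Lemma hasI_le D f g v w : measurable D -> hasI D f v -> hasI D g w -> (forall x, D x -> f x <= g x) -> v <= w.
Proof. by move=> mD [i1 <-] [i2 <-] H; exact: le_Rintegral. Qed.
Lemma hasI_ge0 D f v : hasI D f v -> (forall x, D x -> 0 <= f x) -> 0 <= v.
Proof. by move=> [i1 <-] H; exact: Rintegral_ge0. Qed.
Lemma hasI_uniq D f v w : hasI D f v -> hasI D f w -> v = w.
Proof. by move=> [_ <-] [_ <-]. Qed.
Lemma hasI_EFin D f v : measurable D -> hasI D f v -> (\int[mu]_(x in D) (f x)%:E = v%:E)%E.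
Proof. by move=> mD [i1 <-]; rewrite /Rintegral fineK//; exact: (integrable_fin_num mD i1). Qed.
Lemma EFin_hasI D f v : measurable D -> measurable_fun D f -> (forall x, D x -> 0 <= f x) ->
 (\int[mu]_(x in D) (f x)%:E = v%:E)%E -> hasI D f v.
Proof.
move=> mD mf f0 E; split; last by rewrite /Rintegral E.
apply/integrableP; split; first exact/measurable_EFinP.
rewrite (_ : (\int[mu]_(x in D) `|(EFin \o f) x| = \int[mu]_(x in D) (f x)%:E)%E); first by rewrite E ltry.
by apply: eq_integral => x; rewrite inE => Dx; rewrite /= ger0_norm ?f0.
Qed.
Lemma itg_lty D f : measurable_fun D f -> (forall x, D x -> 0 <= f x) ->
 (\int[mu]_(x in D) (f x)%:E < +oo)%E -> itg D f.
Proof.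
move=> mf f0 E; apply/integrableP; split; first exact/measurable_EFinP.
rewrite (_ : (\int[mu]_(x in D) `|(EFin \o f) x| = \int[mu]_(x in D) (f x)%:E)%E)//.
by apply: eq_integral => x; rewrite inE => Dx; rewrite /= ger0_norm ?f0.
Qed.
Lemma RI_abs_le D f g v : measurable D -> itg D f -> hasI D g v -> (forall x, D x -> `|f x| <= g x) ->
 `|\int[mu]_(x in D) f x| <= v.
Proof.
move=> mD i1 h H; apply: le_trans (le_normr_Rintegral mD i1) _.
by apply: (hasI_le mD (hasI_itg (itg_norm i1)) h).
Qed.
End HasIntegral.

Lemma integral_if d (T : measurableType d) (R : realType) (m : {measure set T -> \bar R}) D (f : T -> R)
  (b : bool) A : measurable D -> (b -> hasI m D f A) ->
 (\int[m]_x (if b && (x \in D) then f x else 0)%:E = (if b then A else 0)%:E)%E.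
Proof.
move=> mD; case: b => [/(_ isT) H|_]; last by rewrite integral0_eq.
rewrite -(hasI_EFin mD H) [RHS]integral_mkcond; apply: eq_integral => x _.
by rewrite patchE /=; case: ifP.
Qed.

(** * Exchange of integrals when the slices are already evaluated *)

Section Tonelli.
Context d1 d2 (T1 : measurableType d1) (T2 : measurableType d2) (R : realType).
Variables (m1 : {sigma_finite_measure set T1 -> \bar R}) (m2 : {sigma_finite_measure set T2 -> \bar R}).
Variables (D1 : set T1) (D2 : set T2) (f : T1 * T2 -> R).
Hypotheses (mD1 : measurable D1) (mD2 : measurable D2) (mf : measurable_fun (D1 `*` D2) f).

Let F := fun p => ((f \_ (D1 `*` D2)) p)%:E.
Let mF : measurable_fun setT F.
Proof. by apply/measurable_EFinP/measurable_restrict => //; [exact: measurableX|rewrite setTI]. Qed.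

Section ge0.
Local Notation slices1 A := (forall x, D1 x -> hasI m2 D2 (fun y => f (x, y)) (A x)).
Local Notation slices2 B := (forall y, D2 y -> hasI m1 D1 (fun x => f (x, y)) (B y)).
Hypothesis f0 : forall x y, D1 x -> D2 y -> 0 <= f (x, y).
Let F0 p : (0 <= F p)%E.
Proof.
rewrite /F lee_fin patchE; case: ifPn => // /set_mem[]; case: p => x y /=; exact: f0.
Qed.
Let FE x y : F (x, y) = (if (x \in D1) && (y \in D2) then f (x, y) else 0)%:E.
Proof. by rewrite /F patchE in_setX. Qed.
Let innerF x A : (D1 x -> hasI m2 D2 (fun y => f (x, y)) A) ->
 (\int[m2]_y F (x, y) = ((if x \in D1 then A else 0))%:E)%E.
Proof. by move=> H; under eq_integral do rewrite FE; apply: integral_if => // /set_mem. Qed.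
Let innerG y B : (D2 y -> hasI m1 D1 (fun x => f (x, y)) B) ->
 (\int[m1]_x F (x, y) = ((if y \in D2 then B else 0))%:E)%E.
Proof.
by move=> H; under eq_integral do rewrite FE andbC; apply: (integral_if (f := fun x => f (x, y))) => // /set_mem.
Qed.
Lemma meas_inner1 A : slices1 A -> measurable_fun D1 A.
Proof.
move=> HA; have := measurable_fun_fubini_tonelli_F (m2 := m2) F mF F0.
rewrite /fubini_F; under eq_fun do rewrite (innerF (@HA _)).
move=> /measurable_EFinP H; apply: (eq_measurable_fun (fun x => if x \in D1 then A x else 0)).
 by move=> x ->.
exact: measurable_funTS.
Qed.
Lemma meas_inner2 B : slices2 B -> measurable_fun D2 B.
Proof.
move=> HB; have := measurable_fun_fubini_tonelli_G (m1 := m1) F mF F0.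
rewrite /fubini_G; under eq_fun do rewrite (innerG (@HB _)).
move=> /measurable_EFinP H; apply: (eq_measurable_fun (fun y => if y \in D2 then B y else 0)).
 by move=> x ->.
exact: measurable_funTS.
Qed.
Let tonE A B : slices1 A -> slices2 B -> (\int[m1]_(x in D1) (A x)%:E = \int[m2]_(y in D2) (B y)%:E)%E.
Proof.
move=> HA HB; have := fubini_tonelli (m1 := m1) (m2 := m2) F mF F0.
under eq_integral do rewrite (innerF (@HA _)).
under [in RHS]eq_integral do rewrite (innerG (@HB _)).
rewrite [in X in _ -> X = _]integral_mkcond [in X in _ -> _ = X]integral_mkcond => E.
transitivity (\int[m1]_x (if x \in D1 then A x else 0)%:E)%E.
 by apply: eq_integral => x _; rewrite patchE; case: ifP.
by rewrite E; apply: eq_integral => x _; rewrite patchE; case: ifP.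
Qed.
(** Slices enter with named values rather than as integrals, so an identity between transforms is
    obtained by evaluating one double integral both ways. Measurability of the slice values comes
    out of the product construction. *)
Lemma tonelli A B v : slices1 A -> slices2 B -> hasI m1 D1 A v -> hasI m2 D2 B v.
Proof.
move=> HA HB Hv; apply: EFin_hasI => //; first exact: meas_inner2.
 by move=> y Dy; apply: hasI_ge0 (HB y Dy) _ => x Dx; exact: f0.
by rewrite -(tonE HA HB) (hasI_EFin mD1 Hv).
Qed.
Lemma tonelli' A B v : slices1 A -> slices2 B -> hasI m2 D2 B v -> hasI m1 D1 A v.
Proof.
move=> HA HB Hv; apply: EFin_hasI => //; first exact: meas_inner1.
 by move=> x Dx; apply: hasI_ge0 (HA x Dx) _ => y Dy; exact: f0.
by rewrite (tonE HA HB) (hasI_EFin mD2 Hv).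
Qed.
End ge0.
End Tonelli.

Section Fubini.
Context d1 d2 (T1 : measurableType d1) (T2 : measurableType d2) (R : realType).
Variables (m1 : {sigma_finite_measure set T1 -> \bar R}) (m2 : {sigma_finite_measure set T2 -> \bar R}).

Lemma meas_fst (D1 : set T1) (D2 : set T2) (p : T1 -> R) : measurable D1 -> measurable D2 ->
 measurable_fun D1 p -> measurable_fun (D1 `*` D2) (fun x => p x.1).
Proof.
move=> mD1 mD2 mp; apply: (measurable_comp mD1) => //; first by move=> _ [x [? ?] <-].
exact: measurable_funTS.
Qed.
Lemma meas_snd (D1 : set T1) (D2 : set T2) (p : T2 -> R) : measurable D1 -> measurable D2 ->
 measurable_fun D2 p -> measurable_fun (D1 `*` D2) (fun x => p x.2).
Proof.
move=> mD1 mD2 mp; apply: (measurable_comp mD2) => //; first by move=> _ [x [? ?] <-].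
exact: measurable_funTS.
Qed.
Lemma fubini_dom (D1 : set T1) (D2 : set T2) (f : T1 * T2 -> R) (p : T1 -> R) (q : T2 -> R) A B :
 measurable D1 -> measurable D2 -> measurable_fun (D1 `*` D2) f ->
 itg m1 D1 p -> itg m2 D2 q ->
 (forall x y, D1 x -> D2 y -> `|f (x, y)| <= p x * q y) ->
 (forall x, D1 x -> hasI m2 D2 (fun y => f (x, y)) (A x)) ->
 (forall y, D2 y -> hasI m1 D1 (fun x => f (x, y)) (B y)) ->
 exists v, hasI m1 D1 A v /\ hasI m2 D2 B v.
Proof.
move=> mD1 mD2 mf ip iq fpq HA HB.
pose P := \int[m1]_(x in D1) p x. pose Q := \int[m2]_(y in D2) q y.
(* Adding the majorant makes the integrand nonnegative; Tonelli applies to [F], and the known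
   contribution of the majorant is subtracted at the end. *)
pose F (z : T1 * T2) := f z + p z.1 * q z.2.
have mF : measurable_fun (D1 `*` D2) F.
 apply: measurable_funD => //; apply: measurable_funM.
  by apply: meas_fst => //; exact: itg_meas ip.
 by apply: meas_snd => //; exact: itg_meas iq.
have F0 x y : D1 x -> D2 y -> 0 <= F (x, y).
 by move=> Dx Dy; have := fpq x y Dx Dy; rewrite ler_norml /F /=; lra.
have HA' x : D1 x -> hasI m2 D2 (fun y => F (x, y)) (A x + p x * Q).
 by move=> Dx; exact: (hasI_D mD2 (HA x Dx) (hasI_Z (p x) mD2 (hasI_itg iq))).
have HB' y : D2 y -> hasI m1 D1 (fun x => F (x, y)) (B y + q y * P).
 move=> Dy; apply: hasI_D => //; first exact: HB.
 by apply: (@eq_hasI _ _ _ _ _ (fun x => q y * p x)) => //; [move=> x _; rewrite mulrC|apply: hasI_Z => //; exact: hasI_itg].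
have mA : measurable_fun D1 A.
 have := meas_inner1 mD1 mD2 mF F0 HA' => H.
 apply: (eq_measurable_fun (fun x => (A x + p x * Q) - Q * p x)); first by move=> x _; ring.
 by apply: measurable_funB => //; apply: measurable_funM => //; exact: itg_meas ip.
have iA : itg m1 D1 A.
 apply: (@itg_le _ _ _ _ _ _ (fun x => Q * p x)) => //; first exact: itgZ.
 move=> x Dx; have [i1 <-] := HA x Dx.
 apply: RI_abs_le => //; last by move=> y Dy; exact: fpq.
 by rewrite mulrC; apply: hasI_Z => //; exact: hasI_itg.
exists (\int[m1]_(x in D1) A x); split => //.
have V : hasI m1 D1 (fun x => A x + p x * Q) (\int[m1]_(x in D1) A x + Q * P).
 apply: hasI_D => //; apply: (@eq_hasI _ _ _ _ _ (fun x => Q * p x)) => //; first by move=> x _; rewrite mulrC.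
 by apply: hasI_Z => //; exact: hasI_itg.
have W := tonelli mD1 mD2 mF F0 HA' HB' V.
have W2 : hasI m2 D2 (fun y => P * q y) (P * Q) by apply: hasI_Z => //; exact: hasI_itg.
have := hasI_B mD2 W W2; rewrite (mulrC Q P) addrK.
by apply: eq_hasI => // y _; ring.
Qed.
(** With a countable discrete factor, measurability on the product is checked slice by slice; the
    exchanges of a series with an integral or another series enter Tonelli this way. *)
Lemma meas_nat_prod (D : set T2) (f : nat -> T2 -> R) : measurable D ->
 (forall n, measurable_fun D (f n)) -> measurable_fun ([set: nat] `*` D) (fun p => f p.1 p.2).
Proof.
move=> mD mf _ Y mY.
have -> : (([set: nat] `*` D) `&` (fun p => f p.1 p.2) @^-1` Y) =
 \bigcup_n ([set n] `*` (D `&` f n @^-1` Y)).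
 apply/seteqP; split => [[n x] /= [[_ Dx] Yx]|[n x] [m _ /= [-> [Dx Yx]]]] //.
 by exists n.
apply: bigcupT_measurable => n; apply: measurableX => //.
exact: mf.
Qed.
End Fubini.

Section Counting.
Variable R : realType.
Notation cnt := (@counting nat R).

(** Reduces to nonnegative functions by writing f as (|f| + f) - |f|. It connects integrals over the
    counting measure with limits of partial sums. *)
Lemma count_series (f : nat -> R) : itg cnt setT f -> series f @ \oo --> \int[cnt]_(n in setT) f n.
Proof.
move=> i1.
have pos (g : nat -> R) : (forall n, 0 <= g n) -> itg cnt setT g -> series g @ \oo --> \int[cnt]_(n in setT) g n.
 move=> g0 ig; have H := hasI_EFin measurableT (hasI_itg ig).
 rewrite ge0_integral_count in H; last by move=> k; rewrite lee_fin.
 have : (fun n => \sum_(0 <= k < n) (g k)%:E)%E @ \oo --> (\int[cnt]_(n in setT) g n)%:E.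
  by rewrite -H; apply: is_cvg_nneseries => k _ _; rewrite lee_fin.
 move=> /fine_cvgP[_]; apply: cvg_trans; apply: near_eq_cvg; near=> n.
 by rewrite /= sumEFin.
have i2 := itg_norm i1.
have H1 := pos (fun n => `|f n|) (fun n => normr_ge0 _) i2.
have H2 := pos (fun n => `|f n| + f n) (fun n => _) (itgD measurableT i2 i1).
have {}H2 : series (fun n => `|f n| + f n) @ \oo --> \int[cnt]_(n in setT) (`|f n| + f n).
 by apply: H2 => n; have := ler_norm (- f n); rewrite normrN; lra.
have H3 : (series (fun n => `|f n| + f n) - series (fun n => `|f n|)) @ \oo -->
  \int[cnt]_(n in setT) (`|f n| + f n) - \int[cnt]_(n in setT) `|f n| by apply: cvgB.
move: H3; rewrite RintegralD// addrAC subrr add0r.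
apply: cvg_trans; apply: near_eq_cvg; near=> n.
by rewrite /series /= !fctE -sumrB; apply: eq_bigr => i _; rewrite addrAC subrr add0r.
Unshelve. all: by end_near. Qed.
Lemma series_count (f : nat -> R) v : (forall n, 0 <= f n) -> series f @ \oo --> v -> hasI cnt setT f v.
Proof.
move=> f0 H; apply: EFin_hasI => //.
rewrite ge0_integral_count; last by move=> k; rewrite lee_fin.
apply/cvg_lim => //.
have : EFin \o series f @ \oo --> v%:E by apply: cvg_EFin => //; near=> n.
by apply: cvg_trans; apply: near_eq_cvg; near=> n; rewrite /= -sumEFin.
Unshelve. all: by end_near. Qed.
End Counting.

(** * Complex integrals and Laplace transforms with a general exponent function *)

Section Complex.
Context d (T : measurableType d) (R : realType) (mu : {measure set T -> \bar R}).
Local Notation C := R[i].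
Implicit Types (D : set T) (F G : T -> C).

Definition citg D F := itg mu D (fun x => Re (F x)) /\ itg mu D (fun x => Im (F x)).
Definition CI D F : C := Complex (\int[mu]_(x in D) Re (F x)) (\int[mu]_(x in D) Im (F x)).

Lemma eq_CI D F G : (forall x, D x -> F x = G x) -> CI D F = CI D G.
Proof. by move=> FG; apply: ceqP => /=; apply: eq_Rintegral => x; rewrite inE => /FG ->. Qed.
Lemma citgB D F G : measurable D -> citg D F -> citg D G -> citg D (fun x => F x - G x).
Proof.
move=> mD [h1 h2] [h3 h4]; split.
 by apply: eq_itg (itgB mD h1 h3) => // x _; rewrite !reimE.
by apply: eq_itg (itgB mD h2 h4) => // x _; rewrite !reimE.
Qed.
Lemma CIB D F G : measurable D -> citg D F -> citg D G -> CI D (fun x => F x - G x) = CI D F - CI D G.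
Proof.
move=> mD [h1 h2] [h3 h4]; ceq; rewrite -RintegralB//;
 by apply: eq_Rintegral => x _; rewrite !reimE.
Qed.
Lemma citgZ D k F : measurable D -> citg D F -> citg D (fun x => k * F x).
Proof.
move=> mD [h1 h2]; split.
 by apply: eq_itg (itgB mD (itgZ (Re k) mD h1) (itgZ (Im k) mD h2)) => // x _; rewrite !reimE.
apply: eq_itg (itgD mD (itgZ (Re k) mD h2) (itgZ (Im k) mD h1)) => // x _; rewrite !reimE.
by ring.
Qed.
Lemma CIZ D k F : measurable D -> citg D F -> CI D (fun x => k * F x) = k * CI D F.
Proof.
move=> mD [h1 h2]; ceq; rewrite -!RintegralZl//.
 rewrite -RintegralB//; [|exact: itgZ|exact: itgZ].
 by apply: eq_Rintegral => x _; rewrite !reimE.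
rewrite -RintegralD//; [|exact: itgZ|exact: itgZ].
by apply: eq_Rintegral => x _; rewrite !reimE; ring.
Qed.
Lemma citg_le D F (g : T -> R) : measurable D -> measurable_fun D (fun x => Re (F x)) ->
 measurable_fun D (fun x => Im (F x)) -> itg mu D g -> (forall x, D x -> nm (F x) <= g x) -> citg D F.
Proof.
move=> mD m1 m2 ig H; split; apply: itg_le ig _ => // x Dx.
 by rewrite (le_trans (le_Re_nm _))// H.
by rewrite (le_trans (le_Im_nm _))// H.
Qed.
Lemma CI_bound D F (g : T -> R) v : measurable D -> citg D F -> hasI mu D g v ->
 (forall x, D x -> nm (F x) <= g x) -> nm (CI D F) <= 2 * v.
Proof.
move=> mD [h1 h2] hg H; apply: le_trans (nm_le_ReIm _) _; rewrite /= mulr_natl mulr2n; apply: lerD.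
 by apply: RI_abs_le hg _ => // x Dx; rewrite (le_trans (le_Re_nm _))// H.
by apply: RI_abs_le hg _ => // x Dx; rewrite (le_trans (le_Im_nm _))// H.
Qed.

Section Laplace.
Variables (D : set T) (mD : measurable D).
Implicit Types f a : T -> R.

(** The exponent function [a] is left general: [- u] gives Laplace transforms, [- lnS R n] over the
    counting measure gives Dirichlet series, and the identity over the whole line gives Gamma. *)
Definition lapF f a z x : C := (f x)%:C * cexp (z * (a x)%:C).
Definition Lap f a z : C := CI D (lapF f a z).

Lemma nm_lapF f a z x : nm (lapF f a z x) = `|f x| * expR (Re z * a x).
Proof. by rewrite /lapF nmM nmR nm_cexp !reimE /= mulr0 subr0. Qed.
Lemma meas_lapF f a z : measurable_fun D f -> measurable_fun D a ->
 measurable_fun D (fun x => Re (lapF f a z x)) /\ measurable_fun D (fun x => Im (lapF f a z x)).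
Proof.
move=> mf ma.
have E x : lapF f a z x = Complex (f x * (expR (Re z * a x) * cos (Im z * a x))) (f x * (expR (Re z * a x) * sin (Im z * a x))).
 by rewrite /lapF /cexp; ceq; rewrite !mulr0 ?subr0 ?addr0 ?add0r !mul0r ?subr0 ?addr0.
have mexp : measurable_fun D (fun x => expR (Re z * a x)).
 by apply: measurableT_comp => //; apply: measurable_funM.
have mcos (p : R -> R) : continuous p -> measurable_fun D (fun x => p (Im z * a x)).
 move=> cp; apply: measurableT_comp; first exact: continuous_measurable_fun.
 exact: measurable_funM.
split; under eq_fun do rewrite E /=; apply: measurable_funM => //; apply: measurable_funM => //.
 by apply: mcos; exact: continuous_cos.
by apply: mcos; exact: continuous_sin.
Qed.
Lemma meas_fexp f a (x : R) : measurable_fun D f -> measurable_fun D a ->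
 measurable_fun D (fun t => f t * expR (x * a t)).
Proof.
move=> mf ma; apply: measurable_funM => //; apply: measurableT_comp => //.
exact: measurable_funM.
Qed.
Lemma lap_citg f a z : measurable_fun D f -> measurable_fun D a ->
 itg mu D (fun x => f x * expR (Re z * a x)) -> citg D (lapF f a z).
Proof.
move=> mf ma i1; have [m1 m2] := meas_lapF z mf ma.
apply: citg_le (itg_norm i1) _ => // x Dx.
by rewrite nm_lapF normrM (ger0_norm (expR_ge0 _)).
Qed.

Section strip.
Variables (f a : T -> R) (x1 x2 : R).
Hypotheses (mf : measurable_fun D f) (ma : measurable_fun D a).
Hypotheses (i1 : itg mu D (fun x => f x * expR (x1 * a x))) (i2 : itg mu D (fun x => f x * expR (x2 * a x))).

Let E t := `|f t| * (expR (x1 * a t) + expR (x2 * a t)).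
Let iE : itg mu D E.
Proof.
apply: eq_itg (itgD mD (itg_norm i1) (itg_norm i2)) => // t _.
by rewrite /E !normrM !(ger0_norm (expR_ge0 _)) mulrDr.
Qed.
Let expE x t : x1 <= x <= x2 -> expR (x * a t) <= expR (x1 * a t) + expR (x2 * a t).
Proof.
move=> /andP[h1 h2]; have e1 := expR_ge0 (x1 * a t); have e2 := expR_ge0 (x2 * a t).
have [a0|a0] := lerP 0 (a t).
 have : expR (x * a t) <= expR (x2 * a t) by rewrite ler_expR ler_wpM2r.
 by lra.
have : expR (x * a t) <= expR (x1 * a t) by rewrite ler_expR ler_wnM2r// ltW.
by lra.
Qed.
Lemma strip_itg x : x1 <= x <= x2 -> itg mu D (fun t => f t * expR (x * a t)).
Proof.
move=> xx; apply: itg_le iE _ => //; first exact: meas_fexp.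
move=> t _; rewrite normrM (ger0_norm (expR_ge0 _)) ler_wpM2l//.
exact: expE.
Qed.
(** A margin of [2 * eta] on both sides of [x] pays for a factor exp(2 eta |a t|), whatever the sign
    of [a t]. *)
Let abs_exp (x eta : R) (t : T) : 0 < eta -> x1 <= x - 2 * eta -> x + 2 * eta <= x2 ->
 expR (x * a t) * expR (2 * eta * `|a t|) <= expR (x1 * a t) + expR (x2 * a t).
Proof.
move=> e0 h1 h2; rewrite -expRD.
have [a0|a0] := ger0P (a t).
 by rewrite -mulrDl; apply: expE; lra.
have -> : x * a t + 2 * eta * - a t = (x - 2 * eta) * a t by ring.
by apply: expE; lra.
Qed.
Lemma strip_itg_deriv x : x1 < x < x2 -> itg mu D (fun t => f t * a t * expR (x * a t)).
Proof.
move=> /andP[h1 h2]; pose eta := Num.min (x - x1) (x2 - x) / 2.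
have m0 : 0 < Num.min (x - x1) (x2 - x) by rewrite lt_min !subr_gt0 h1.
have e0 : 0 < eta by rewrite divr_gt0.
have e1 : Num.min (x - x1) (x2 - x) <= x - x1 by rewrite ge_min lexx.
have e2 : Num.min (x - x1) (x2 - x) <= x2 - x by rewrite ge_min lexx orbT.
apply: (@itg_le _ _ _ _ _ _ (fun t => (2 * eta)^-1 * E t)) => //.
- by apply: meas_fexp => //; exact: measurable_funM.
- exact: itgZ.
move=> t _; rewrite !normrM (ger0_norm (expR_ge0 _)) /E mulrCA -mulrA ler_wpM2l//.
have h : x1 <= x - 2 * eta /\ x + 2 * eta <= x2 by split; rewrite /eta; lra.
have := abs_exp t e0 h.1 h.2; have := expR_ge1Dx (2 * eta * `|a t|); have := expR_gt0 (x * a t).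
rewrite [X in _ -> _ -> _ -> _ <= X]mulrC ler_pdivlMr ?mulr_gt0//.
move: (expR _) (expR (2 * eta * _)) (expR (x1 * _)) (expR (x2 * _)) => p q r s p0 h3 h4.
have : p * (2 * eta * `|a t|) <= p * q by rewrite ler_pM2l//; lra.
by lra.
Qed.

Theorem lap_deriv z : x1 < Re z < x2 -> cderiv (Lap f a) z (Lap (fun t => f t * a t) a z).
Proof.
move=> zz; have /andP[h1 h2] := zz; set x := Re z in zz h1 h2.
pose eta := Num.min (x - x1) (x2 - x) / 2.
have m0 : 0 < Num.min (x - x1) (x2 - x) by rewrite lt_min !subr_gt0 h1.
have e0 : 0 < eta by rewrite divr_gt0.
have e1 : Num.min (x - x1) (x2 - x) <= x - x1 by rewrite ge_min lexx.
have e2 : Num.min (x - x1) (x2 - x) <= x2 - x by rewrite ge_min lexx orbT.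
have [g1 g2] : x1 <= x - 2 * eta /\ x + 2 * eta <= x2 by split; rewrite /eta; lra.
have mfa : measurable_fun D (fun t => f t * a t) by exact: measurable_funM.
(* 12 is the 3 of the remainder bound for [cexp] times the 4 of x^2 <= 4 e^x. Each of the two bounds
   spends one factor exp(eta |a t|), which is why the strip has a margin of [2 * eta]. *)
pose K := 12 / eta ^+ 2; have K0 : 0 < K by rewrite divr_gt0// exprn_gt0.
have cz y : x1 <= Re y <= x2 -> citg D (lapF f a y) by move=> yy; apply: lap_citg => //; exact: strip_itg.
have cz1 : citg D (lapF (fun t => f t * a t) a z) by apply: lap_citg => //; exact: strip_itg_deriv.
have czz : citg D (lapF f a z) by apply: cz; rewrite !ltW.
pose V := \int[mu]_(t in D) E t.
have V0 : 0 <= V by apply: Rintegral_ge0 => t _; rewrite mulr_ge0// addr_ge0// expR_ge0.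
have main h : nm h <= eta ->
 nm (Lap f a (z + h) - Lap f a z - Lap (fun t => f t * a t) a z * h) <= 2 * (K * V) * nm h ^+ 2.
 move=> he; have re : `|Re h| <= eta by apply: le_trans (le_Re_nm h) he.
 have czh : citg D (lapF f a (z + h)).
  by apply: cz; rewrite reimE -/x; move: re; rewrite ler_norml => /andP[r1 r2]; lra.
 have -> : Lap f a (z + h) - Lap f a z - Lap (fun t => f t * a t) a z * h =
  CI D (fun t => lapF f a (z + h) t - lapF f a z t - h * lapF (fun t => f t * a t) a z t).
  rewrite CIB//; [|exact: citgB|exact: citgZ].
  by rewrite CIB// CIZ// [h * _]mulrC.
 rewrite (_ : 2 * (K * V) * nm h ^+ 2 = 2 * (nm h ^+ 2 * K * V)); last by ring.
 apply: (@CI_bound _ _ (fun t => nm h ^+ 2 * K * E t)) => //.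
 - by apply: citgB => //; [exact: citgB|exact: citgZ].
 - by apply: hasI_Z => //; exact: hasI_itg.
 move=> t _.
 have -> : lapF f a (z + h) t - lapF f a z t - h * lapF (fun t => f t * a t) a z t =
  lapF f a z t * (cexp (h * (a t)%:C) - 1 - h * (a t)%:C).
  by rewrite /lapF mulrDl cexpD rmorphM /=; ring.
 rewrite nmM nm_lapF -/x.
 have := nm_cexpB1B_le (h * (a t)%:C); rewrite nmM nmR => B.
 have B2 : expR (nm h * `|a t|) <= expR (eta * `|a t|) by rewrite ler_expR ler_wpM2r.
 have B3 : (eta * `|a t|) ^+ 2 <= 4 * expR (eta * `|a t|).
  have := expR_ge1Dx (eta * `|a t| / 2).
  have q0 : 0 <= eta * `|a t| by rewrite mulr_ge0// ltW.
  have -> : expR (eta * `|a t|) = expR (eta * `|a t| / 2) ^+ 2 by rewrite expr2 -expRD; congr expR; field.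
  by move: (eta * _) (expR _) q0 => q p q0 qp; nra.
 have B4 := abs_exp t e0 g1 g2.
 have B5 : expR (2 * eta * `|a t|) = expR (eta * `|a t|) ^+ 2 by rewrite expr2 -expRD; congr expR; ring.
 apply: (@le_trans _ _ (`|f t| * expR (x * a t) * (3 * (nm h * `|a t|) ^+ 2 * expR (eta * `|a t|)))).
  by rewrite ler_wpM2l ?mulr_ge0 ?expR_ge0// (le_trans B)// ler_wpM2l// mulr_ge0// sqr_ge0.
 rewrite B5 in B4; rewrite /E /K.
 have -> : nm h ^+ 2 * (12 / eta ^+ 2) * (`|f t| * (expR (x1 * a t) + expR (x2 * a t))) =
  `|f t| * (nm h ^+ 2 * 3 / eta ^+ 2) * (4 * (expR (x1 * a t) + expR (x2 * a t))) by field; rewrite gt_eqF.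
 have -> : `|f t| * expR (x * a t) * (3 * (nm h * `|a t|) ^+ 2 * expR (eta * `|a t|)) =
  `|f t| * (nm h ^+ 2 * 3 / eta ^+ 2) * (expR (x * a t) * expR (eta * `|a t|) * (eta * `|a t|) ^+ 2).
  by field; rewrite gt_eqF.
 rewrite ler_wpM2l ?mulr_ge0 ?sqr_ge0 ?invr_ge0 ?exprn_ge0 ?(ltW e0)//.
 rewrite (@le_trans _ _ (expR (x * a t) * expR (eta * `|a t|) * (4 * expR (eta * `|a t|))))//.
  by rewrite ler_wpM2l// mulr_ge0// expR_ge0.
 rewrite mulrCA ler_wpM2l//; apply: le_trans B4.
 by rewrite expr2 mulrA.
apply/cderivP => e ep.
have KV : 0 <= 2 * (K * V) by rewrite mulr_ge0// mulr_ge0// ltW.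
exists (Num.min eta (e / (2 * (K * V) + 1))).
 by rewrite lt_min e0 divr_gt0// ltr_wpDl.
move=> h; rewrite lt_min => /andP[he hd].
apply: le_trans (main h (ltW he)) _.
move: hd KV; move: (2 * (K * V)) => k hd k0.
rewrite expr2 mulrA ler_wpM2r//.
move: hd; rewrite ltr_pdivlMr ?ltr_wpDl// mulrDr mulr1 => hd.
by have := nm_ge0 h; rewrite mulrC; lra.
Qed.
End strip.

Lemma Lap_real f a (x v : R) : hasI mu D (fun t => f t * expR (x * a t)) v -> Lap f a x%:C = v%:C.
Proof.
move=> [_ <-]; apply: ceqP => /=.
 by apply: eq_Rintegral => t _; rewrite !mul0r !mulr0 !subr0 add0r cos0 mulr1.
rewrite (_ : (fun t => _) = fun=> 0) ?Rintegral_cst ?mul0r//.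
by apply/funext => t; rewrite !mul0r !mulr0 ?subr0 ?add0r ?sin0 ?mulr0 ?addr0 ?mulr0.
Qed.
End Laplace.
End Complex.

(** * The Borel-Caratheodory inequality *)

Section BorelCaratheodory.
Variable R : realType.
Local Notation C := R[i].

Definition cconj (z : C) : C := Complex (Re z) (- Im z).

Lemma cI_conj (F : R -> C) x y : cctn F x y ->
 cI (fun t => cconj (F t)) x y = cconj (cI F x y).
Proof.
move=> cF; apply: ceqP => //=; rewrite -mulN1r -ivlZ; last exact: cctn_Im.
by apply: eq_Rintegral => t _; rewrite mulN1r.
Qed.

(* The mean of f e^{int} vanishes and that of f e^{-int} is rho^n u_n; adding the conjugate of the former
 to the latter leaves the mean of 2 (Re f) e^{-int}, where Re f may be replaced by Re f - M <= 0. *)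
Theorem borel_caratheodory (f : C -> C) u a r rho M : 0 < rho < r -> holo_sq f a r -> pser u a f r ->
 (forall z, nm (z - a) <= rho -> Re (f z) <= M) ->
 forall n, (0 < n)%N -> nm (u n) * rho ^+ n <= 4 * (M - Re (u 0%N)).
Proof.
move=> rr hf pu HM n n0; have /andP[rho0 rhor] := rr.
have dF z : in_sq a r z -> cderiv f z (cder f z) by move=> /hf /cderE.
have rr' : 0 <= rho < r by rewrite ltW.
pose G t := f (circ a rho t); pose T : R := pi *+ 2.
have T0 : 0 < T by rewrite mulrn_wgt0// pi_gt0.
have hc t : cder_at f (circ a rho t) by apply: hf; exact: circ_in_sq.
have cG : cctn G 0 T by move=> t _; apply: ccont_comp (rderiv_circ a rho t).
have ce k : cctn (fun t : R => cexp (k * t%:C)) 0 T by move=> t _; apply: rderiv_cont (rderiv_cis k t).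
have cM F H : cctn F 0 T -> cctn H 0 T -> cctn (fun t => F t * H t) 0 T.
 by move=> h1 h2 t tt; apply: ccontM; [exact: h1|exact: h2].
pose e t : C := cexp (- (n%:R * 'i) * t%:C).
have I2 : cI (fun t => G t * cexp (n%:R * 'i * t%:C)) 0 T = 0.
 pose q z := f z * (z - a) ^+ n.-1.
 have hq : holo_sq q a r.
  apply: (@holoM _ (in_sq a r)) => // z _; eexists; apply: cderivX.
  by have := cderivB (cderiv_id z) (cderiv_cst a z); rewrite subr0.
 have [rho' /andP[rp rp']] : exists rho', rho < rho' < r by exists ((rho + r) / 2); lra.
 have [Q dQ] := primitive_sq hq rp'.
 have cs'' t : in_sq a rho' (circ a rho t) by apply: circ_in_sq; rewrite (ltW rho0).
 have := @circ_closed_prim R q Q a rho (fun t _ => hq _ (circ_in_sq a t rr')) (fun t _ => dQ _ (cs'' t)).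
 have E t : q (circ a rho t) * ('i * (circ a rho t - a)) = ('i * (rho ^+ n)%:C) * (G t * cexp (n%:R * 'i * t%:C)).
  have -> : cexp (n%:R * 'i * t%:C) = cexp ('i * t%:C) ^+ n :> C.
   by rewrite -cexpMn; congr cexp; rewrite -[RHS]mulr_natr; ring.
  rewrite /q (_ : circ a rho t - a = rho%:C * cexp ('i * t%:C)); last by rewrite /circ; ring.
  by rewrite /G -{2 3}(prednK n0) !exprS exprMn rmorphM rmorphXn /=; ring.
 under eq_fun do rewrite E.
 rewrite cIZ; last exact: cM; move/eqP; rewrite mulf_eq0 => /orP[|/eqP//].
 by rewrite -nm_eq0 nmM nm_i mul1r nmR normr_eq0 gt_eqF// exprn_gt0.
have I1 : cI (fun t => G t * e t) 0 T = (T * rho ^+ n)%:C * u n.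
 have := taylor_coef n rr dF pu.
 have -> : (fun t => f (circ a rho t) * (circ a rho t - a)^-1 ^+ n) = (fun t => (rho%:C)^-1 ^+ n * (G t * e t)).
  by apply/funext => t; rewrite circV// mulrCA.
 rewrite cIZ; last by apply: cM => //; exact: ce.
 move=> /(congr1 (fun x => rho%:C ^+ n * x)).
 have r0 : rho%:C != 0 :> C by rewrite -nm_eq0 nmR normr_eq0 gt_eqF.
 by rewrite mulrA -exprMn divff// expr1n mul1r -/T => ->; rewrite [in RHS]rmorphM [in RHS]rmorphXn /=; ring.
pose H t : C := (G t * e t + cconj (G t * cexp (n%:R * 'i * t%:C))) - (2 * M)%:C * e t.
have cGe := cM _ _ cG (ce (- (n%:R * 'i))); have cGs := cM _ _ cG (ce (n%:R * 'i)).
have ccj : cctn (fun t => cconj (G t * cexp (n%:R * 'i * t%:C))) 0 T.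
 move=> t /cGs h d /h[d' d'0 H']; exists d' => // y /H'; move: (G y * _) (G t * _) => v v'.
 rewrite !nmE !reimE /=; suff -> : (- Im v - - Im v') ^+ 2 = (Im v - Im v') ^+ 2 by [].
 by ring.
have IH : cI H 0 T = (T * rho ^+ n)%:C * u n.
 rewrite cIB ?cID ?cIZ ?cI_conj// ?I1 ?I2.
 - rewrite (_ : cI e 0 T = 0); last exact: cI_cis_int.
  by rewrite mulr0 subr0 (_ : cconj 0 = 0) ?addr0//; apply: ceqP; rewrite /= ?oppr0.
 - exact: ce.
 - by move=> t tt; apply: ccontD; [exact: cGe|exact: ccj].
 - by apply: cM => [t _|]; [exact: ccont_cst|exact: ce].
have HE t : H t = - (2 * (M - Re (G t)))%:C * e t.
 have ek (k : C) m : Re k = 0 -> Im k = m -> cexp (k * t%:C) = Complex (cos (m * t)) (sin (m * t)).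
  move=> k0 k1; have -> : k * t%:C = Complex 0 (m * t) by ceq; rewrite k0 k1; ring.
  by apply: ceqP; rewrite /= expR0 mul1r.
 have iE : n%:R * 'i = Complex 0 n%:R :> C by rewrite -(rmorph_nat (real_complex R)); ceq; ring.
 rewrite /H /e iE (ek (Complex 0 n%:R) n%:R)// (ek (- Complex 0 n%:R) (- n%:R)) ?mulNr ?cosN ?sinN ?reimE ?oppr0//.
 by move: (G t) (cos _) (sin _) => -[x y] p q; ceq; ring.
have hM : hasI lebesgue_measure `[0, T] (fun t => 2 * (M - Re (G t))) (2 * (T * (M - Re (u 0%N)))).
 have cg := cctn_Re cG; have cMg : ctn (fun t => M - Re (G t)) 0 T.
  by move=> t tt; apply: cvgB; [exact: cvg_cst|exact: cg].
 apply: hasI_Z; first exact: measurable_itv.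
 split; first exact: ctn_itg.
 change (ivl (fun t => M - Re (G t)) 0 T = T * (M - Re (u 0%N))).
 rewrite ivlB//; last by move=> t _; exact: cvg_cst.
 have := congr1 (fun z : C => Re z) (taylor_coef 0 rr dF pu); rewrite /= reimE /= mul0r subr0 -/T => E0.
 rewrite ivl_cst ?(ltW T0)// subr0 mulrBr -[T * Re _]E0 mulrC; congr (_ - _).
 by apply: eq_Rintegral => t _; rewrite expr0 mulr1.
have := @CI_bound _ _ R lebesgue_measure `[0, T] H _ _ (measurable_itv _) _ hM.
rewrite -[CI _ _ _]/(cI H 0 T) IH nmM nmR ger0_norm; last by rewrite mulr_ge0 ?exprn_ge0// ltW.
have cH : cctn H 0 T.
 by move=> t tt; apply: ccontB; [apply: ccontD; [exact: cGe|exact: ccj]|apply: ccontM; [exact: ccont_cst|exact: ce]].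
move=> B; rewrite -(ler_pM2l T0) [leRHS](_ : _ = 2 * (2 * (T * (M - Re (u 0%N))))); last by ring.
rewrite [leLHS](_ : _ = T * rho ^+ n * nm (u n)); last by ring.
apply: B.
 by split; apply: ctn_itg; [exact: cctn_Re|exact: cctn_Im].
move=> t _; rewrite HE nmM nmN nmR nm_cexp (_ : Re (- _ * _) = 0) ?expR0 ?mulr1.
 by rewrite ger0_norm// mulr_ge0// subr_ge0; apply: HM; rewrite nm_circ// ltW.
by rewrite -(rmorph_nat (real_complex R)) !reimE /=; ring.
Qed.
End BorelCaratheodory.

(** * Landau's theorem *)

Section Landau.
Context d (T : measurableType d) (R : realType) (mu : {measure set T -> \bar R}).
Local Notation C := R[i].
Variables (D : set T) (f a : T -> R).
Hypotheses (mD : measurable D) (mf : measurable_fun D f) (ma : measurable_fun D a).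
Hypotheses (f0 : forall t, D t -> 0 <= f t) (a0 : forall t, D t -> a t <= 0).

Let ok (x : R) := itg mu D (fun t => f t * expR (x * a t)).

Lemma itg_up x y : x <= y -> ok x -> ok y.
Proof.
move=> xy ix; apply: itg_le ix _ => //; first exact: meas_fexp.
move=> t Dt; rewrite ger0_norm ?mulr_ge0 ?expR_ge0 ?f0// ler_wpM2l ?f0// ler_expR.
by rewrite ler_wnM2r// a0.
Qed.
Lemma Lap_holo x : ok x -> holo (hplane x) (Lap mu D f a).
Proof.
move=> ix z xz; eexists; apply: (@lap_deriv _ _ _ _ _ mD f a x (Re z + 1)) => //.
 by apply: itg_up ix; move: xz; rewrite /hplane; lra.
by apply/andP; split => //; lra.
Qed.
Let fa n t := f t * a t ^+ n.

Let mfa n : measurable_fun D (fa n).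
Proof. by apply: measurable_funM => //; exact: measurable_funX. Qed.
Let ok_fa n x y : ok x -> x < y -> itg mu D (fun t => fa n t * expR (y * a t)).
Proof.
move=> ix; elim: n y => [|n ih] y xy.
 apply: eq_itg (itg_up (ltW xy) ix) => // t _.
 by rewrite /fa expr0 mulr1.
have h1 : x < (x + y) / 2 by lra.
have h2 := ih _ h1.
have h3 : x < y + 1 by lra.
have h4 : (x + y) / 2 < y < y + 1 by lra.
apply: eq_itg (strip_itg_deriv mD (mfa n) ma h2 (ih _ h3) h4) => // t _.
by rewrite /fa exprSr; ring.
Qed.
Let lap_fa n x z : ok x -> x < Re z -> cderiv (Lap mu D (fa n) a) z (Lap mu D (fa n.+1) a z).
Proof.
move=> ix xz.
have h1 : x < (x + Re z) / 2 by lra.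
have h3 : x < Re z + 1 by lra.
have h4 : (x + Re z) / 2 < Re z < Re z + 1 by lra.
have := lap_deriv mD (mfa n) ma (ok_fa n ix h1) (ok_fa n ix h3) h4.
congr (cderiv _ _ _); apply: eq_CI => t _; congr (_%:C * _).
by rewrite /fa exprSr; ring.
Qed.
(** Repeated differentiation under the integral sign turns the Taylor coefficients at [p],
    multiplied by factorials, into the moments of [a]. *)
Lemma lap_coef x (p eta : R) u : ok x -> 0 < eta -> x + eta <= p -> pser u p%:C (Lap mu D f a) eta ->
 forall n, Lap mu D (fa n) a p%:C = n`!%:R * u n.
Proof.
move=> ix e0 xp pu n.
have dom z : nm (z - p%:C) < eta -> x < Re z.
 by move=> /nm_in_sq[]; rewrite /= ltr_distlC => /andP[h h'] _; move: h h'; lra.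
suff H : pser (fun m => ((m + n) ^_ n)%:R * u (m + n)%N) p%:C (Lap mu D (fa n) a) eta.
 have := H p%:C; rewrite subrr nm0 => /(_ e0) H1; apply: (cvs_unique H1).
 apply: (@cvs_ext _ (fun=> n`!%:R * u n) _ _ 1%N); last exact: cvs_cst.
 case=> // k _; rewrite /psum big_nat_recl// expr0 mulr1 add0n ffactnn big1 ?addr0// => i _.
 by rewrite exprS mul0r mulr0.
elim: n => [|n ih].
 have -> : (fun m => ((m + 0) ^_ 0)%:R * u (m + 0)%N) = u.
  by apply/funext => m; rewrite addn0 ffactn0 mul1r.
 have -> : Lap mu D (fa 0) a = Lap mu D f a; last by [].
 by apply/funext => z; apply: eq_CI => t _; rewrite /lapF /fa expr0 mulr1.
have [f1 [p1 d1]] := pser_derive ih.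
have -> : (fun m => ((m + n.+1) ^_ n.+1)%:R * u (m + n.+1)%N) =
 (fun m => m.+1%:R * (((m.+1 + n) ^_ n)%:R * u (m.+1 + n)%N)).
 apply/funext => m; rewrite addnS addSn mulrA -natrM; congr (_%:R * _).
 by rewrite ffactnSr subSn ?leq_addl// addnK mulnC.
move=> z zr; have := p1 z zr.
by rewrite (cderiv_unique (d1 z zr) (lap_fa n ix (dom z zr))).
Qed.

(** The relation continues the transform as N / M, which is regular at the abscissa [s0] because [M]
    has no zero on the positive axis. The Taylor series at [p = s0 + eta] therefore converges at a
    point to the left of [s0]. As [a] is nonpositive and [f] nonnegative, all its terms have
    nonnegative integrands there, and monotone convergence makes the integral finite, against the
    choice of [s0]. *)
Theorem landau (M N : C -> C) s1 : holo (hplane 0) M -> holo (hplane 0) N ->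
 (forall x : R, 0 < x -> M x%:C != 0) -> 0 < s1 -> ok s1 ->
 (forall x : R, s1 < x -> M x%:C * Lap mu D f a x%:C = N x%:C) ->
 forall x, 0 < x -> ok x.
Proof.
move=> hM hN M0 s10 is1 MN x1 x10; apply: contrapT => nx1.
pose S := [set x : R | 0 < x /\ ok x].
have Slb x : S x -> x1 <= x.
 by move=> [x0 ix]; rewrite leNgt; apply/negP => xx; apply: nx1; apply: itg_up ix; exact: ltW.
have hS : has_inf S by split; [exists s1|exists x1].
pose s0 := inf S.
have s00 : 0 < s0 by apply: lt_le_trans x10 _; apply: lb_le_inf => //; exists s1.
have up y : s0 < y -> ok y.
 move=> sy; have sy' : 0 < y - s0 by rewrite subr_gt0.
 have [z [_ iz] zy] := inf_adherent sy' hS.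
 by apply: itg_up iz; move: zy; rewrite -/s0; lra.
have down y : 0 < y -> y < s0 -> ~ ok y.
 move=> y0 ys iy; have : S y by [].
 by move=> /(ge_inf (proj2 hS)); rewrite -/s0; lra.
have H0 : hplane 0 s0%:C by [].
have rel : forall z, hplane s0 z -> M z * Lap mu D f a z = N z.
 apply: (@identity_real R (hplane s0) (fun z => M z * Lap mu D f a z) N (Num.max s0 s1) (Num.max s0 s1 + 1)).
 - exact: hplane_open.
 - exact: hplane_convex.
 - apply: holoM; first by apply: holoS hM => y; rewrite /hplane; apply: lt_trans.
  move=> y sy; have h : s0 < (s0 + Re y) / 2 by move: sy; rewrite /hplane; lra.
  by apply: (Lap_holo (up _ h)); move: sy; rewrite /hplane; lra.
 - by apply: holoS hN => y; rewrite /hplane; apply: lt_trans.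
 - by lra.
 - by move=> y; rewrite gt_max => /andP[/andP[h _] _].
 - by move=> y; rewrite gt_max => /andP[/andP[_ h] _]; exact: MN.
have [d1 d10 Md1] : exists2 d1, 0 < d1 & forall w, nm (w - s0%:C) < d1 -> M w != 0.
 have n0 : 0 < nm (M s0%:C) by rewrite nm_gt0 M0.
 have [d1 d10 H1] := cderiv_cont (cderE (hM _ H0)) n0.
 by exists d1 => // w /H1; apply: contraTneq => ->; rewrite sub0r nmN ltxx.
(* The square of half side [3 * eta] about [s0 + eta] lies within distance [7 * eta] of [s0] and to
   the right of 0, so the divisor 9 leaves room. *)
pose eta := Num.min d1 s0 / 9.
have m0 : 0 < Num.min d1 s0 by rewrite lt_min d10.
have md : Num.min d1 s0 <= d1 by rewrite ge_min lexx.
have ms : Num.min d1 s0 <= s0 by rewrite ge_min lexx orbT.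
have e0 : 0 < eta by rewrite divr_gt0.
have [ed es] : 9 * eta <= d1 /\ 9 * eta <= s0 by split; rewrite /eta; lra.
pose p := s0 + eta.
pose Phi z := N z * (M z)^-1.
have hP : holo_sq Phi p%:C (3 * eta).
 move=> z [h1 h2]; move: h1 h2; rewrite /= subr0 ltr_distlC /p => /andP[g1 g2] g3.
 have z0 : hplane 0 z by rewrite /hplane; lra.
 have nz : M z != 0.
  apply: Md1; apply: le_lt_trans (nm_le_ReIm _) _; rewrite !reimE /= oppr0 addr0.
  have : `|Re z - s0| < 4 * eta by rewrite ltr_distlC; lra.
  by lra.
 have [l1 D1] := hN z z0; have [l2 D2] := hM z z0.
 by eexists; apply: cderivM D1 (cderivV nz D2).
have e3 : 0 < 3 * eta by rewrite mulr_gt0.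
have [v pv] := taylor e3 hP.
pose x := s0 + eta / 2; have ix : ok x by apply: up; rewrite /x; lra.
have e2 : 0 < eta / 2 by rewrite divr_gt0.
have hL : holo_sq (Lap mu D f a) p%:C (eta / 2).
 move=> z [h1 _]; move: h1; rewrite /= ltr_distlC /p => /andP[g1 g2].
 by apply: (Lap_holo ix); rewrite /hplane /x; lra.
have [u pu] := taylor e2 hL.
have uv n : u n = v n.
 apply: (pser_uniq e2 e3 pu pv) => z; rewrite lt_min => /andP[h1 h2].
 have [g1 g2] := nm_in_sq h1; move: g1; rewrite /= ltr_distlC /p => /andP[g1 g3].
 have hz : hplane s0 z by rewrite /hplane; lra.
 have nz : M z != 0.
  apply: Md1; have -> : z - s0%:C = (z - p%:C) + eta%:C by rewrite /p rmorphD /=; ring.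
  by apply: le_lt_trans (nmD _ _) _; rewrite nmR (ger0_norm (ltW e0)); lra.
 by rewrite /Phi -(rel z hz) mulrAC divff// mul1r.
have cf := lap_coef ix e2 (_ : x + eta / 2 <= p) pu.
have {}cf n : Lap mu D (fa n) a p%:C = n`!%:R * u n by apply: cf; rewrite /x /p; lra.
have xp : x < p by rewrite /x /p; lra.
have nz : nm ((p - 2 * eta)%:C - p%:C) < 3 * eta.
 have -> : (p - 2 * eta)%:C - p%:C = (- (2 * eta))%:C :> C by rewrite rmorphB rmorphN /=; ring.
 by rewrite nmR normrN ger0_norm; lra.
have zE : (p - 2 * eta)%:C - p%:C = (- (2 * eta))%:C :> C by rewrite rmorphB rmorphN /=; ring.
have [B B0 HB] := cvs_bounded (pv _ nz); rewrite zE in HB.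
(* Partial sums of the exponential series turn [expR (p * a t)] into [expR ((p - 2 * eta) * a t)];
   their integrals are partial sums of the Taylor series of N / M and hence bounded by [B]. *)
pose g n t := f t * expR (p * a t) * series (exp_coeff (- (2 * eta) * a t)) n.
have hg n : hasI mu D (g n) (Re (psum v (- (2 * eta))%:C n)).
 elim: n => [|n ih].
  rewrite /psum big_geq//= /g.
  by split; [apply: eq_itg (itg0 _ _) => // t _; rewrite /series /= big_geq ?mulr0|
   rewrite (_ : (fun t => _) = fun=> 0) ?Rintegral_cst ?mul0r//; apply/funext => t; rewrite /series /= big_geq ?mulr0].
 rewrite /psum big_nat_recr//= -/(psum v _ n) ReD.
 have hn := hasI_itg (ok_fa n ix xp).
 set In := Rintegral _ _ _ in hn.
 have vn : v n = (In / n`!%:R)%:C.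
  have nf : n`!%:R != 0 :> C by rewrite pnatr_eq0 -lt0n fact_gt0.
  rewrite -uv; apply: (mulfI nf); rewrite -cf (Lap_real mD hn).
  rewrite -(rmorph_nat (real_complex R)) -rmorphM /=; congr (_%:C).
  by rewrite mulrC divfK// pnatr_eq0 -lt0n fact_gt0.
 have -> : Re (v n * (- (2 * eta))%:C ^+ n) = (- (2 * eta)) ^+ n / n`!%:R * In.
  by rewrite vn -rmorphXn -rmorphM /=; ring.
 apply: eq_hasI (hasI_D mD ih (hasI_Z _ mD hn)) => // t _.
 rewrite /g /series /= big_nat_recr//= mulrDr; congr (_ + _).
 by rewrite /exp_coeff /= exprMn /fa; ring.
have gB n : Re (psum v (- (2 * eta))%:C n) <= B.
 by apply: le_trans (HB n); apply: le_trans (le_Re_nm _); exact: ler_norm.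
have a0' t : D t -> 0 <= - (2 * eta) * a t by move=> /a0 h; rewrite mulNr oppr_ge0 mulr_ge0_le0// mulr_ge0// ltW.
have fe0 t : D t -> 0 <= f t * expR (p * a t) by move=> Dt; rewrite mulr_ge0 ?f0// expR_ge0.
have g0 n t : D t -> 0 <= g n t.
 move=> Dt; rewrite /g mulr_ge0 ?fe0// sumr_ge0// => i _.
 by rewrite /exp_coeff /= divr_ge0// exprn_ge0// a0'.
have mg n : measurable_fun D (g n) by exact: itg_meas (hg n).1.
pose G t := f t * expR ((p - 2 * eta) * a t).
have gG t : D t -> g n t @[n --> \oo] --> G t.
 move=> Dt; rewrite /G mulrBl expRD mulrA -mulNr; apply: cvgM; first exact: cvg_cst.
 exact: is_cvg_series_exp_coeff.
have Glty : (\int[mu]_(t in D) (G t)%:E < +oo)%E.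
 have E := @cvg_monotone_convergence _ _ _ mu D mD (fun n t => (g n t)%:E).
 have mge n : measurable_fun D (fun t => (g n t)%:E) by apply/measurable_EFinP.
 have g0e n t : D t -> (0 <= (g n t)%:E)%E by move=> Dt; rewrite lee_fin g0.
 have nde t : D t -> {homo (fun n => (g n t)%:E) : n m / (n <= m)%N >-> (n <= m)%E}.
  move=> Dt m n mn; rewrite lee_fin /g ler_wpM2l ?fe0// /series /= [leRHS](big_cat_nat (n := m))//= lerDl.
  by rewrite sumr_ge0// => i _; rewrite /exp_coeff /= divr_ge0// exprn_ge0// a0'.
 have {}E := E mge g0e nde.
 have -> : (\int[mu]_(t in D) (G t)%:E = \int[mu]_(t in D) limn (fun n => (g n t)%:E))%E.
  apply: eq_integral => t /set_mem Dt; apply/esym/cvg_lim => //.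
  by apply: cvg_EFin; [near=> n|exact: gG].
 apply: le_lt_trans (ltry B); apply: (@cvge_to_le _ _ _ _ _ _ _ E); near=> n.
 by rewrite (hasI_EFin mD (hg n)) lee_fin.
apply: (down (p - 2 * eta)); [rewrite /p; lra|rewrite /p; lra|].
by apply: itg_lty => //; [exact: meas_fexp|move=> t Dt; rewrite mulr_ge0 ?f0// expR_ge0].
Unshelve. all: by end_near. Qed.

End Landau.

(** * The Gamma and beta functions *)

Section Translate.
Variable R : realType.
Notation mu := (@lebesgue_measure R).

Section shift.
Variable k : R.
Let tr (x : mR R) : mR R := x + k.
Let mtr : measurable_fun setT tr.
Proof.
have h : measurable_fun (setT : set R) (fun x : R => x + k).
 by apply: continuous_measurable_fun => x; apply: cvgD; [exact: cvg_id|exact: cvg_cst].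
exact: h.
Qed.
HB.instance Definition _ := isMeasurableFun.Build _ _ (mR R) (mR R) tr mtr.

Lemma lebesgue_shift (A : set (mR R)) : measurable A -> pushforward mu tr A = mu A.
Proof.
move=> mA; apply/esym/lebesgue_measure_unique => //= _ [[x y]] _ <-.
rewrite /pushforward.
have -> : tr @^-1` `]x, y] = `]x - k, y - k]%classic.
 by apply/seteqP; split => z /=; rewrite !in_itv /= /tr ltrBlDr lerBrDr.
rewrite !lebesgue_measure_itv /= !lte_fin ltrD2r; case: ifP => // _.
by rewrite -!EFinB; congr (_%:E); ring.
Qed.
(** The push-forward formula handles nonnegative functions; a general f is recovered from |f| + f
    and |f| - f. *)
Lemma hasI_shift (f : R -> R) v : hasI mu setT f v -> hasI mu setT (fun x => f (x + k)) v.
Proof.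
move=> [i1 e1].
have mf : measurable_fun (setT : set (mR R)) f := itg_meas i1.
have mft : measurable_fun (setT : set (mR R)) (f \o tr) by apply: measurableT_comp mf mtr.
have ge0 (g : R -> R) : measurable_fun (setT : set (mR R)) g -> (forall x, 0 <= g x) ->
  (\int[mu]_x (g (x + k))%:E = \int[mu]_x (g x)%:E)%E.
 move=> mg g0.
 have := @ge0_integral_pushforward _ _ (mR R) (mR R) R tr mtr mu setT (EFin \o g) measurableT.
 have mg' : measurable_fun (setT : set (mR R)) (EFin \o g) by exact: measurableT_comp.
 move=> /(_ mg' (fun x _ => g0 x)); rewrite preimage_setT => <-.
 by apply: eq_measure_integral => A mA _; exact: lebesgue_shift.
have pos (g : R -> R) y : hasI mu setT g y -> (forall x, 0 <= g x) -> hasI mu setT (fun x => g (x + k)) y.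
 move=> Hg g0; have mg : measurable_fun (setT : set (mR R)) g := itg_meas Hg.1.
 apply: EFin_hasI => //; first by apply: measurableT_comp mg mtr.
 by rewrite ge0//; exact: hasI_EFin Hg.
have Hf : hasI mu setT f v by [].
have Hn := hasI_itg (itg_norm i1).
have H1 := pos _ _ (hasI_D measurableT Hn Hf) (fun x => _).
have H2 := pos _ _ (hasI_B measurableT Hn Hf) (fun x => _).
have n1 x : 0 <= `|f x| + f x by have := ler_norm (- f x); rewrite normrN; lra.
have n2 x : 0 <= `|f x| - f x by have := ler_norm (f x); lra.
have := hasI_Z 2^-1 measurableT (hasI_B measurableT (H1 n1) (H2 n2)).
move: (\int[mu]_(x in _) _) => N.
have -> : 2^-1 * (N + v - (N - v)) = v by field.
by apply: eq_hasI => // x _; field.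
Qed.
End shift.
End Translate.

Section Subst.
Variable R : realType.
Notation mu := (@lebesgue_measure R).

Lemma mitv (i : interval R) : @measurable _ (mR R) [set` i].
Proof. exact: measurable_itv. Qed.
Lemma meas_cont (f : R -> R) (D : set (mR R)) : continuous f -> measurable_fun D f.
Proof.
move=> cf; have h : measurable_fun (setT : set R) f by exact: continuous_measurable_fun.
by apply: measurable_funTS; exact: h.
Qed.
Lemma meas_opp (D : set (mR R)) : measurable_fun D (fun u : mR R => - u : R).
Proof. by apply: meas_cont; exact: opp_continuous. Qed.
Lemma derive_of (F : R -> R) (F' x : R) : is_derive x 1 F F' -> derive1 F x = F'.
Proof. by move=> h; rewrite derive1E; exact: derive_val. Qed.
Lemma cont_powR (a y : R) : 0 < y -> {for y, continuous (fun v : R => v `^ a)}.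
Proof.
move=> y0; have c : {for y, continuous (fun v : R => expR (a * ln v))}.
 by apply: continuous_comp; [apply: cvgM; [exact: cvg_cst|exact: continuous_ln]|exact: continuous_expR].
have E : y `^ a = expR (a * ln y) by rewrite /powR gt_eqF.
change ((fun v : R => v `^ a) @ y --> y `^ a); rewrite E; apply: cvg_trans c; apply: near_eq_cvg; near=> v.
rewrite /powR gt_eqF//; near: v.
by exists y => //= v /=; rewrite ltr_distlC subrr => /andP[].
Unshelve. all: by end_near. Qed.
(** The domain is exhausted by the images of the segments from [- n] to [n], on which the
    substitution rule for segments applies; nonnegativity allows the passage to the limit. *)
Lemma subst_integral (D : set R) (F F' G : R -> R) : measurable D ->
 (forall x : R, is_derive x 1 F (F' x)) -> continuous F' -> (forall x, 0 < F' x) ->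
 (forall x, D (F x)) -> (forall y, D y -> exists x, y = F x) ->
 (forall y, D y -> {for y, continuous G}) -> (forall y, D y -> 0 <= G y) ->
 (\int[mu]_(y in D) (G y)%:E = \int[mu]_x (G (F x) * F' x)%:E)%E.
Proof.
move=> mD dF cF' F'0 DF Dex cG G0.
have cF : continuous F by move=> x; apply: differentiable_continuous; apply/derivable1_diffP; have [] := dF x.
have incF : {homo F : x y / x < y}.
 move=> x y xy; have := @MVT R F F' x y xy (fun z _ => dF z).
 have cw : {within `[x, y], continuous F} by apply: continuous_subspaceT.
 move=> /(_ cw)[z _ E]; rewrite -subr_gt0 E mulr_gt0// subr_gt0//.
have ndF : {homo F : x y / x <= y}.
 by move=> x y; rewrite le_eqVlt => /predU1P[->//|/incF/ltW].
have nn n : (- n%:R : R) <= n%:R by rewrite lerNl (le_trans _ (ler0n _ n))// oppr_le0.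
have bx (x : R) : `|x| < (Num.bound x)%:R by apply: lt_le_trans (archi_boundP (normr_ge0 x)) _; rewrite /Num.bound normr_id.
pose A n := [set` `[F (- n%:R), F n%:R]] : set R.
pose B n := [set` `[(- n%:R : R), n%:R]] : set R.
have UA : \bigcup_n A n = D.
 apply/seteqP; split => [y [n _]|y Dy].
  rewrite /A /= in_itv /= => /andP[y1 y2].
  have cw : {within `[- n%:R, n%:R], continuous F} by apply: continuous_subspaceT.
  have ym : Num.min (F (- n%:R)) (F n%:R) <= y <= Num.max (F (- n%:R)) (F n%:R).
   by rewrite ge_min y1 /= le_max y2 orbT.
  by have [x _ <-] := IVT (nn n) cw ym.
 have [x ->] := Dex y Dy.
 exists (Num.bound x) => //; rewrite /A /= in_itv /=.
 by move: (bx x); rewrite ltr_norml => /andP[h1 h2]; rewrite !ndF// ltW.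
have UB : \bigcup_n B n = setT.
 apply/seteqP; split => // x _; exists (Num.bound x) => //; rewrite /B /= in_itv /=.
 by move: (bx x); rewrite ltr_norml => /andP[h1 h2]; rewrite !ltW.
have ndA : nondecreasing_seq A.
 move=> m n mn; apply/subsetPset => y; rewrite /A /= !in_itv /= => /andP[y1 y2].
 by rewrite (le_trans (ndF _ _ _) y1) ?(le_trans y2 (ndF _ _ _))// ?lerN2 ler_nat.
have ndB : nondecreasing_seq B.
 move=> m n mn; apply/subsetPset => y; rewrite /B /= !in_itv /= => /andP[y1 y2].
 by rewrite (le_trans _ y1) ?(le_trans y2)// ?lerN2 ler_nat.
have AD n : A n `<=` D by rewrite -UA; exact: bigcup_sup.
have mG : forall n, measurable_fun (A n) G.
 move=> n; apply: subspace_continuous_measurable_fun; first exact: measurable_itv.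
 by apply: continuous_in_subspaceT => y /set_mem /AD /cG.
have cH : continuous (fun x => G (F x) * F' x).
 by move=> x; apply: cvgM; [apply: continuous_comp; [exact: cF|exact: cG]|exact: cF'].
have L1 : (\int[mu]_(y in A n) (G y)%:E)%E @[n --> \oo] --> (\int[mu]_(y in D) (G y)%:E)%E.
 rewrite -UA; apply: (@ge0_nondecreasing_set_cvg_integral _ (mR R) R A _ mu ndA).
  by move=> n; exact: measurable_itv.
  by move=> n; have h : measurable_fun (A n) (EFin \o G) by [apply/measurable_EFinP]; exact: h.
 by move=> n y /AD Dy; rewrite lee_fin G0.
have L2 : (\int[mu]_(x in B n) (G (F x) * F' x)%:E)%E @[n --> \oo] --> (\int[mu]_x (G (F x) * F' x)%:E)%E.
 rewrite -UB; apply: (@ge0_nondecreasing_set_cvg_integral _ (mR R) R B _ mu ndB).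
  by move=> n; exact: measurable_itv.
  move=> n; have h : measurable_fun (B n) (EFin \o (fun x => G (F x) * F' x)).
   by apply/measurable_EFinP/measurable_funTS; exact: continuous_measurable_fun.
  exact: h.
 by move=> n x _; rewrite lee_fin mulr_ge0 ?G0// ltW.
have E n : (\int[mu]_(y in A n) (G y)%:E = \int[mu]_(x in B n) (G (F x) * F' x)%:E)%E.
 have F'E : derive1 F = F' by apply/funext => x; apply: derive_of.
 rewrite /A /B (integration_by_substitution_increasing (nn n)).
 - by apply: eq_integral => x _; rewrite F'E.
 - by move=> x y _ _; exact: incF.
 - by rewrite F'E => x _; exact: cF'.
 - by rewrite F'E; apply/cvg_ex; exists (F' (- n%:R)); apply: cvg_at_right_filter; exact: cF'.
 - by rewrite F'E; apply/cvg_ex; exists (F' n%:R); apply: cvg_at_left_filter; exact: cF'.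
 - split; first by move=> x _; have [] := dF x.
   by apply: cvg_at_right_filter; exact: cF.
  by apply: cvg_at_left_filter; exact: cF.
 - by apply: continuous_in_subspaceT => y /set_mem /AD /cG.
have {}L2 : (\int[mu]_(y in A n) (G y)%:E)%E @[n --> \oo] --> (\int[mu]_x (G (F x) * F' x)%:E)%E.
 by under eq_fun do rewrite E.
exact: (cvg_unique _ L1 L2).
Qed.
Lemma hasI_exp_tail (q a : R) : 0 < q -> hasI mu `[a, +oo[ (fun u => expR (- q * u)) (expR (- q * a) / q).
Proof.
move=> q0; have cE : continuous (fun u : R => expR (- q * u)).
 move=> u; apply: continuous_comp; last exact: continuous_expR.
 by apply: cvgM; [exact: cvg_cst|exact: cvg_id].
apply: EFin_hasI => //; first by apply: measurable_funTS; exact: continuous_measurable_fun.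
pose F u := - (expR (- q * u) / q).
have dF (u : R) : is_derive u 1 F (expR (- q * u)).
 have H := rderiv_Re (rderiv_cis (- q)%:C u).
 have E : (fun s : R => Re (cexp ((- q)%:C * s%:C))) = (fun s => expR (- q * s)).
  by apply/funext => s; rewrite -rmorphM cexpR.
 rewrite E -rmorphM cexpR -rmorphM /= in H.
 have := is_deriveZ (- q^-1) H.
 have -> : (- q^-1) *: (expR (- q * u) * - q) = expR (- q * u).
  by rewrite /GRing.scale /=; field; rewrite gt_eqF.
 congr (is_derive _ _ _ _); apply/funext => y.
 by change (- q^-1 * expR (- q * y) = - (expR (- q * y) / q)); rewrite mulNr mulrC.
rewrite (@ge0_continuous_FTC2y R _ F a 0).
- by rewrite /F -EFinB; congr (_%:E); rewrite sub0r opprK.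
- by move=> x _; exact: expR_ge0.
- by apply: continuous_subspaceT.
- rewrite -oppr0 -(mul0r q^-1); apply: cvgN; apply: cvgM; last exact: cvg_cst.
 rewrite (_ : (fun x => expR (- q * x)) = (fun z => expR (- z)) \o (fun z => q * z)); last first.
  by apply: eq_fun => x; rewrite mulNr.
 apply: (@cvg_comp _ _ _ _ _ _ (pinfty_nbhs R)); last exact: cvgr_expR.
 exact: gt0_cvgMry.
- by move=> x _; have [] := dF x.
- by apply: cvg_at_right_filter; apply: differentiable_continuous; apply/derivable1_diffP; have [] := dF a.
- by move=> x _; apply: derive_of.
Qed.
Lemma hasI_exp_tail0 (q : R) : 0 < q -> hasI mu `]0, +oo[ (fun u => expR (- q * u)) q^-1.
Proof.
move=> q0; have [i E] := hasI_exp_tail 0 q0.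
have i2 : itg mu `]0, +oo[ (fun u => expR (- q * u)).
 by apply: itgS i; [exact: mitv|exact: mitv|apply: subset_itvr; rewrite bnd_simp].
by split => //; rewrite (Rintegral_itv_obnd_cbnd i2) E mulr0 expR0 mul1r.
Qed.
Lemma itg_exp_abs (c : R) : 0 < c -> itg mu setT (fun u => expR (- c * `|u|)).
Proof.
move=> c0; have cE : continuous (fun u : R => expR (- c * `|u|)).
 move=> u; apply: continuous_comp; last exact: continuous_expR.
 by apply: cvgM; [exact: cvg_cst|exact: norm_continuous].
have mE : measurable_fun setT (fun u : R => expR (- c * `|u|)) by exact: continuous_measurable_fun.
apply: itg_lty => //.
rewrite ge0_symfun_integralT//; last by move=> u; rewrite /= normrN.
rewrite -set_itvcy.
have H := hasI_EFin (mitv _) (hasI_exp_tail 0 c0).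
rewrite (_ : (\int[mu]_(x in `[0%R, +oo[) (expR (- c * `|x|))%:E = (expR (- c * 0) / c)%:E)%E).
 by rewrite -EFinM ltry.
rewrite -H; apply: eq_integral => u; rewrite inE /= in_itv /= andbT => u0.
by rewrite ger0_norm.
Qed.
(** The substitution t = e^u in Euler's integral: [Gr x] is the two-sided Laplace transform of
    [Gker], and scaling of t becomes translation of u. *)
Definition Gker (u : R) := expR (- expR u).
Definition Gr (x : R) := \int[mu]_(u in setT) (Gker u * expR (x * u)).

Lemma cont_id_mul (x : R) : continuous (fun u : R => x * u).
Proof. by move=> u; apply: cvgM; [exact: cvg_cst|exact: cvg_id]. Qed.
Lemma cont_Gker : continuous Gker.
Proof.
move=> u; apply: continuous_comp; last exact: continuous_expR.
by apply: cvgN; exact: continuous_expR.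
Qed.
Lemma cont_expM (x : R) : continuous (fun u : R => expR (x * u)).
Proof. by move=> u; apply: continuous_comp; [exact: cont_id_mul|exact: continuous_expR]. Qed.
Lemma cont_Gint x : continuous (fun u => Gker u * expR (x * u)).
Proof. by move=> u; apply: cvgM; [exact: cont_Gker|exact: cont_expM]. Qed.
Lemma Gker_bound x : 0 < x -> forall u, Gker u * expR (x * u) <= expR ((x + 1) ^+ 2) * expR (- Num.min 1 x * `|u|).
Proof.
move=> x0 u; rewrite /Gker -!expRD ler_expR.
have m1 : Num.min 1 x <= 1 by rewrite ge_min lexx.
have mx : Num.min 1 x <= x by rewrite ge_min lexx orbT.
have m0 : 0 < Num.min 1 x by rewrite lt_min ltr01.
have [u0|u0] := ger0P u.
 have e1 := expR_ge1Dx (u / 2); have -> : expR u = expR (u / 2) ^+ 2 by rewrite expr2 -expRD; congr expR; field.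
 have e2 : (1 + u / 2) ^+ 2 <= expR (u / 2) ^+ 2 by rewrite lerXn2r// nnegrE; [lra|exact: expR_ge0].
 have k1 : Num.min 1 x * u <= u by nra.
 have k2 := sqr_ge0 (x - u / 2).
 by move: k1 k2 e2; move: (expR _ ^+ 2) (Num.min 1 x * u) => E2 mu' k1 k2 e2; nra.
have : x * u <= Num.min 1 x * u by rewrite ler_wnM2r// ltW.
by have := expR_ge0 u; have := sqr_ge0 (x + 1); lra.
Qed.
Lemma itg_Gr x : 0 < x -> itg mu setT (fun u => Gker u * expR (x * u)).
Proof.
move=> x0; have m0 : 0 < Num.min 1 x by rewrite lt_min ltr01.
apply: (@itg_le _ _ _ mu _ _ (fun u => expR ((x + 1) ^+ 2) * expR (- Num.min 1 x * `|u|))) => //.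
- by apply: continuous_measurable_fun; exact: cont_Gint.
- by apply: itgZ => //; exact: itg_exp_abs.
by move=> u _; rewrite ger0_norm ?mulr_ge0 ?expR_ge0//; exact: Gker_bound.
Qed.
Lemma hasI_Gr x : 0 < x -> hasI mu setT (fun u => Gker u * expR (x * u)) (Gr x).
Proof. by move=> x0; exact/hasI_itg/itg_Gr. Qed.
Lemma Gr_gt0 x : 0 < x -> 0 < Gr x.
Proof.
move=> x0.
have k : hasI mu `[0, 1] (fun=> expR (- expR 1)) (expR (- expR 1)).
 split; first by apply: ctn_itg => t _; exact: cvg_cst.
 by have := @ivl_cst R (expR (- expR 1)) 0 1 ler01; rewrite /ivl subr0 mulr1.
have h : hasI mu `[0, 1] (fun u => Gker u * expR (x * u)) (\int[mu]_(u in `[0, 1]) (Gker u * expR (x * u))).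
 by apply/hasI_itg; apply: itgS (itg_Gr x0).
apply: (@lt_le_trans _ _ (expR (- expR 1))); first exact: expR_gt0.
apply: (@le_trans _ _ (\int[mu]_(u in `[0, 1]) (Gker u * expR (x * u)))).
 apply: (hasI_le _ k h); first exact: measurable_itv.
 move=> u /=; rewrite in_itv /= => /andP[u0 u1].
 rewrite /Gker -expRD ler_expR; have : expR u <= expR 1 by rewrite ler_expR.
 have h0 : 0 <= x * u by rewrite mulr_ge0// ltW.
 by move: h0; lra.
rewrite /Gr Rintegral_mkcond.
have i1 : itg mu setT ((fun u => Gker u * expR (x * u)) \_ `[0, 1]).
 have h' := itgS measurableT (mitv `[0, 1]) (@subsetT _ _) (itg_Gr x0).
 by move: h' => /(integrable_mkcond _ (mitv _)).1; rewrite restrict_EFin.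
apply: (hasI_le measurableT (hasI_itg i1) (hasI_Gr x0)) => u _.
by rewrite patchE; case: ifP => // _; rewrite mulr_ge0// expR_ge0.
Qed.
Lemma Gamma_Gr x : 0 < x -> Gamma x = Gr x.
Proof.
move=> x0; rewrite /Gamma /Gr /Rintegral; congr fine.
rewrite (@subst_integral `]0, +oo[ expR expR (fun t => t `^ (x - 1) * expR (- t))).
- apply: eq_integral => u _; congr (_%:E).
 rewrite /powR gt_eqF ?expR_gt0// expRK /Gker mulrAC mulrC -!expRD; congr expR; ring.
- exact: measurable_itv.
- exact: continuous_expR.
- exact: expR_gt0.
- by move=> u /=; rewrite in_itv /= expR_gt0.
- by move=> y /=; rewrite in_itv /= andbT => y0; exists (ln y); rewrite lnK.
- move=> y /=; rewrite in_itv /= andbT => y0; apply: cvgM; first exact: cont_powR.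
 by apply: continuous_comp; [apply: cvgN; exact: cvg_id|exact: continuous_expR].
- by move=> y _; rewrite mulr_ge0// ?powR_ge0 ?expR_ge0.
Qed.
Lemma Gr1 : Gr 1 = 1.
Proof.
rewrite -Gamma_Gr// /Gamma; have [_] := hasI_exp_tail0 (@ltr01 R); rewrite invr1 => E; rewrite -[RHS]E.
by apply: eq_Rintegral => t _; rewrite subrr powRr0 mul1r mulN1r.
Qed.
Definition lgs (r : R) := expR r / (1 + expR r).

Lemma lgs_gt0 r : 0 < lgs r.
Proof. by rewrite divr_gt0 ?expR_gt0// addr_gt0// expR_gt0. Qed.
Lemma lgs_lt1 r : lgs r < 1.
Proof. by rewrite ltr_pdivrMr ?addr_gt0 ?expR_gt0// mul1r ltrDr. Qed.
(** The beta density with the power of [v] written as an exponential, so that [p] is a Laplace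
    variable with exponent function [ln]. *)
Definition betak p q (v : R) := v^-1 * (1 - v) `^ (q - 1) * expR (p * ln v).
(** The product of two Gamma integrals in the variables [r + v] and [v]. For fixed [r] the integrand
    in [v] is again a Gamma integrand, translated by [ln (1 + expR r)]. *)
Lemma beta_gamma_add p q : 0 < p -> 0 < q ->
 hasI mu setT (fun r => expR (p * r) * expR (- (p + q) * ln (1 + expR r))) (Gr p * Gr q / Gr (p + q)).
Proof.
move=> p0 q0; have pq0 : 0 < p + q by rewrite addr_gt0.
pose f (z : R * R) := Gker (z.2 + z.1) * expR (p * (z.2 + z.1)) * (Gker z.1 * expR (q * z.1)).
have cadd : measurable_fun setT (fun z : R * R => z.2 + z.1).
 by apply: measurable_funD; [exact: measurable_snd|exact: measurable_fst].
have mf : measurable_fun (setT `*` setT) f.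
 rewrite setXTT; apply: measurable_funM.
  by apply: (measurableT_comp (f := fun y : R => Gker y * expR (p * y))) => //; apply: continuous_measurable_fun; exact: cont_Gint.
 apply: (measurableT_comp (f := fun y : R => Gker y * expR (q * y))) => //.
 by apply: continuous_measurable_fun; exact: cont_Gint.
have f0 x y : setT x -> setT y -> 0 <= f (x, y) by move=> _ _; rewrite !mulr_ge0// expR_ge0.
have HA v : setT v -> hasI mu setT (fun r => f (v, r)) (Gr p * (Gker v * expR (q * v))).
 move=> _; rewrite mulrC.
 apply: (@eq_hasI _ _ _ mu _ (fun r => Gker v * expR (q * v) * (Gker (r + v) * expR (p * (r + v))))) => //.
  by move=> r _; rewrite /f /= mulrC.
 exact: hasI_Z (hasI_shift v (hasI_Gr p0)).
have HB r : setT r -> hasI mu setT (fun v => f (v, r)) (Gr (p + q) * (expR (p * r) * expR (- (p + q) * ln (1 + expR r)))).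
 move=> _; rewrite mulrC; set L := ln (1 + expR r).
 have l0 : 0 < 1 + expR r by rewrite addr_gt0// expR_gt0.
 apply: (@eq_hasI _ _ _ mu _ (fun v => expR (p * r) * expR (- (p + q) * L) * (Gker (v + L) * expR ((p + q) * (v + L))))) => //.
  move=> v _; rewrite /f /Gker /= !expRD /L lnK ?posrE//.
  rewrite -!expRD; congr expR; rewrite expRD; ring.
 exact: hasI_Z (hasI_shift L (hasI_Gr pq0)).
have HV : hasI mu setT (fun v => Gr p * (Gker v * expR (q * v))) (Gr p * Gr q).
 by apply: hasI_Z => //; exact: hasI_Gr.
have := @tonelli _ _ _ _ R mu mu setT setT f measurableT measurableT mf f0 _ _ _ HA HB HV.
move=> /(hasI_Z (Gr (p + q))^-1 measurableT); rewrite mulrC.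
apply: eq_hasI => // r _; rewrite mulrA mulVf ?mul1r// gt_eqF//.
exact: Gr_gt0.
Qed.

Section BetaKernel.
Variables (a q : R).
Hypotheses (a0 : 0 < a) (q0 : 0 < q).

(** The beta density after the substitution v = e^(-u); the first parameter becomes the Laplace
    variable. *)
Definition phib (u : R) : R := expR (- a * u) * (1 - expR (- u)) `^ (q - 1).

Lemma phib_ge0 u : 0 <= phib u.
Proof. by rewrite mulr_ge0 ?expR_ge0 ?powR_ge0. Qed.
Lemma one_sub_exp_gt0 (u : R) : 0 < u -> 0 < 1 - expR (- u).
Proof. by move=> u0; rewrite subr_gt0 expR_lt1 oppr_lt0. Qed.
(** The substitution u = ln (1 + e^r) in [beta_gamma_add], with the two parameters exchanged because
    e^(-u) is one minus the logistic function of r. *)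
Lemma hasI_phib : hasI mu `]0, +oo[ phib (Gr a * Gr q / Gr (a + q)).
Proof.
pose F r : R := ln (1 + expR r).
have p1 (r : R) : 0 < 1 + expR r by rewrite addr_gt0// expR_gt0.
have H := hasI_EFin measurableT (beta_gamma_add q0 a0).
have cphi (u : R) : 0 < u -> {for u, continuous phib}.
 move=> u0; apply: cvgM; first exact: cont_expM.
 apply: (@continuous_comp _ _ _ (fun v : R => 1 - expR (- v)) (fun v : R => v `^ (q - 1))); last by apply: cont_powR; exact: one_sub_exp_gt0.
 apply: cvgB; first exact: cvg_cst.
 by apply: continuous_comp; [apply: cvgN; exact: cvg_id|exact: continuous_expR].
have dF (r : R) : is_derive r 1 F (lgs r).
 have d1 := is_deriveD (is_derive_cst (1 : R) r (1 : R)) (is_derive_expR r).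
 have := @is_derive1_comp R (@ln R) (cst 1 + expR) r _ _ (is_derive1_ln (p1 r)) d1.
 by congr (is_derive _ _ _ _); rewrite /lgs add0r mulrC.
have cl : continuous lgs.
 move=> x; apply: cvgM; first exact: continuous_expR.
 by apply: cvgV; [rewrite gt_eqF|apply: cvgD; [exact: cvg_cst|exact: continuous_expR]].
rewrite [Gr a * _]mulrC addrC; apply: EFin_hasI.
- exact: mitv.
- have h : measurable_fun (`]0, +oo[ : set R) phib.
  by apply: open_continuous_measurable_fun; [exact: interval_open|move=> y; rewrite inE /= in_itv /= andbT; exact: cphi].
 exact: h.
- by move=> u _; exact: phib_ge0.
rewrite (@subst_integral `]0, +oo[ F lgs phib).
- rewrite -H; apply: eq_integral => r _; congr (_%:E).
 have -> : phib (F r) = expR (- a * F r) * expR ((q - 1) * (r - F r)).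
  rewrite /phib; have -> : 1 - expR (- F r) = expR (r - F r).
   by rewrite expRD expRN /F lnK ?posrE//; field; rewrite gt_eqF.
  by congr (_ * _); rewrite /powR gt_eqF ?expR_gt0// expRK.
 have -> : lgs r = expR (r - F r) by rewrite expRD expRN /F lnK ?posrE.
 by rewrite -!expRD; congr expR; rewrite /F; ring.
- exact: measurable_itv.
- exact: cl.
- exact: lgs_gt0.
- by move=> r /=; rewrite in_itv /= andbT /F ln_gt0// ltrDl expR_gt0.
- move=> y /=; rewrite in_itv /= andbT => y0; exists (ln (expR y - 1)).
 by rewrite /F lnK ?posrE ?subr_gt0 ?expR_gt1// addrC subrK expRK.
- by move=> y /=; rewrite in_itv /= andbT; exact: cphi.
- by move=> y _; exact: phib_ge0.
Qed.

End BetaKernel.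

(** The beta integral with [q = 1] is an elementary exponential integral, and its two values give
    the recursion. *)
Lemma Gr_rec p : 0 < p -> Gr (p + 1) = p * Gr p.
Proof.
move=> p0; have S : hasI mu `]0, +oo[ (phib p 1) p^-1.
 apply: eq_hasI (hasI_exp_tail0 p0); first exact: mitv.
 by move=> u _; rewrite /phib subrr powRr0 mulr1.
have g0 : Gr (p + 1) != 0 by rewrite gt_eqF// Gr_gt0// addr_gt0.
have := hasI_uniq S (hasI_phib p0 ltr01); rewrite Gr1 mulr1 => /(congr1 (fun x => p * Gr (p + 1) * x)).
by rewrite mulrAC divff ?gt_eqF// mul1r => ->; field.
Qed.
Lemma hasI_beta p q : 0 < p -> 0 < q -> hasI mu `]0, 1[ (betak p q) (Gr p * Gr q / Gr (p + q)).
Proof.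
move=> p0 q0; have H := hasI_EFin measurableT (beta_gamma_add p0 q0).
have cb y : 0 < y < 1 -> {for y, continuous (betak p q)}.
 move=> /andP[y0 y1]; rewrite /betak; apply: cvgM; first apply: cvgM.
 - by apply: cvgV; [rewrite gt_eqF|exact: cvg_id].
 - have y1' : 0 < 1 - y by rewrite subr_gt0.
  apply: (@continuous_comp _ _ _ (fun v : R => 1 - v) (fun v : R => v `^ (q - 1))); last exact: cont_powR.
  by apply: cvgB; [exact: cvg_cst|exact: cvg_id].
 - apply: continuous_comp; last exact: continuous_expR.
  by apply: cvgM; [exact: cvg_cst|exact: continuous_ln].
apply: EFin_hasI.
- exact: measurable_itv.
- by apply: open_continuous_measurable_fun; [exact: interval_open|move=> y; rewrite inE /= in_itv /=; exact: cb].
- move=> y /=; rewrite in_itv /= => /andP[y0 y1].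
 by rewrite !mulr_ge0 ?powR_ge0 ?expR_ge0// invr_ge0 ltW.
have dl (r : R) : is_derive r 1 lgs (lgs r * (1 - lgs r)).
 have d1 := is_deriveD (is_derive_cst (1 : R) r (1 : R)) (is_derive_expR r).
 have n0 : 1 + expR r != 0 by rewrite gt_eqF// addr_gt0// expR_gt0.
 have d2 := @is_deriveV R (cst 1 + expR) r _ 1 n0 d1.
 have := is_deriveM (is_derive_expR r) d2.
 congr (is_derive _ _ _ _).
 rewrite /GRing.scale /= !fctE /lgs; field.
 by rewrite n0.
have cl : continuous lgs by move=> x; apply: differentiable_continuous; apply/derivable1_diffP; have [] := dl x.
rewrite (@subst_integral `]0, 1[ lgs (fun r => lgs r * (1 - lgs r))).
- rewrite -H; apply: eq_integral => r _; congr (_%:E).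
 have l0 : 0 < 1 + expR r by rewrite addr_gt0// expR_gt0.
 have oml : 1 - lgs r = (1 + expR r)^-1 by rewrite /lgs; field; rewrite gt_eqF.
 have om0 : 0 < 1 - lgs r by rewrite oml invr_gt0.
 rewrite /betak /powR (gt_eqF om0).
 have -> : ln (lgs r) = r - ln (1 + expR r) by rewrite /lgs ln_div ?posrE ?expR_gt0// expRK.
 rewrite (_ : (lgs r)^-1 * expR ((q - 1) * ln (1 - lgs r)) * expR (p * (r - ln (1 + expR r))) * (lgs r * (1 - lgs r)) =
  expR ((q - 1) * ln (1 - lgs r)) * expR (p * (r - ln (1 + expR r))) * (1 - lgs r)); last first.
  by field; rewrite gt_eqF// lgs_gt0.
 rewrite -{2}(lnK (_ : 1 - lgs r \is Num.pos)) ?posrE// oml lnV ?posrE//.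
 by rewrite -!expRD; congr expR; ring.
- exact: measurable_itv.
- by move=> r; apply: cvgM; [exact: cl|apply: cvgB; [exact: cvg_cst|exact: cl]].
- by move=> r; rewrite mulr_gt0 ?lgs_gt0// subr_gt0 lgs_lt1.
- by move=> r /=; rewrite in_itv /= lgs_gt0 lgs_lt1.
- move=> y /=; rewrite in_itv /= => /andP[y0 y1].
 exists (ln (y / (1 - y))); rewrite /lgs lnK ?posrE ?divr_gt0 ?subr_gt0//.
 have y2 : 1 - y != 0 by rewrite gt_eqF// subr_gt0.
 have -> : 1 + y / (1 - y) = (1 - y)^-1 by field.
 by rewrite invrK divfK.
- by move=> y /=; rewrite in_itv /=; exact: cb.
- move=> y /=; rewrite in_itv /= => /andP[y0 y1].
 by rewrite !mulr_ge0 ?powR_ge0 ?expR_ge0// invr_ge0 ltW.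
Qed.

Local Notation C := R[i].
Definition cgam (z : C) := Lap mu setT Gker id z.
Lemma meas_Gker : measurable_fun (setT : set (mR R)) Gker.
Proof. by apply: continuous_measurable_fun; exact: cont_Gker. Qed.
Lemma cgam_real x : 0 < x -> cgam x%:C = (Gr x)%:C.
Proof. by move=> x0; apply: Lap_real => //; exact: hasI_Gr. Qed.
Lemma holo_cgam : holo (hplane 0) cgam.
Proof.
move=> z z0; eexists; apply: (@lap_deriv _ _ _ mu setT measurableT Gker id (Re z / 2) (Re z + 1)).
- exact: meas_Gker.
- exact: measurable_id.
- by apply: itg_Gr; rewrite divr_gt0.
- by apply: itg_Gr; move: z0; rewrite /hplane; lra.
- by move: z0; rewrite /hplane => z0; lra.
Qed.
Lemma meas_betaf q : measurable_fun (`]0, 1[%classic : set (mR R)) (fun v => v^-1 * (1 - v) `^ (q - 1)).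
Proof.
have h : measurable_fun (`]0, 1[%classic : set R) (fun v : R => v^-1 * (1 - v) `^ (q - 1)).
 apply: measurable_funM.
  apply: open_continuous_measurable_fun; first exact: interval_open.
  by move=> y; rewrite inE /= in_itv /= => /andP[y0 _]; apply: cvgV; [rewrite gt_eqF|exact: cvg_id].
 apply: measurable_funTS; apply: (measurableT_comp (measurable_powR _)).
 by apply: measurable_funB.
exact: h.
Qed.
Lemma meas_ln01 : measurable_fun (`]0, 1[%classic : set (mR R)) (@ln R).
Proof. by apply: measurable_funTS; exact: measurable_ln. Qed.
Lemma holo_shift (f : C -> C) (x c : R) : holo (hplane (x + c)) f -> holo (hplane x) (fun z => f (z + c%:C)).
Proof.
move=> hf; apply: (holo_comp (f := fun z => z + c%:C) (D' := hplane (x + c))) => //.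
 by move=> z; rewrite /hplane reimE /= ltrD2r.
by apply: holoD; [exact: holo_id|exact: holo_cst].
Qed.
Definition bcore (q u : R) : R := (1 - expR (- u)) `^ (q - 1).
Definition cbeta (q : R) (z : C) := Lap mu `]0, +oo[ (bcore q) (fun u => - u) z.

Lemma bcoreE a q u : phib a q u = bcore q u * expR (a * - u).
Proof. by rewrite /phib /bcore mulrC mulNr mulrN. Qed.
Lemma hasI_bcore a q : 0 < a -> 0 < q -> hasI mu `]0, +oo[ (fun u => bcore q u * expR (a * - u)) (Gr a * Gr q / Gr (a + q)).
Proof. by move=> a0 q0; apply: eq_hasI (hasI_phib a0 q0); [exact: mitv|move=> u _; exact: bcoreE]. Qed.
Lemma meas_bcore q : 0 < q -> measurable_fun (`]0, +oo[%classic : set (mR R)) (bcore q).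
Proof.
move=> q0; have [/itg_meas h _] := hasI_bcore (@ltr01 R) q0.
have h' : measurable_fun (`]0, +oo[%classic : set (mR R)) (fun u => expR (1 * u)) by apply: meas_cont; exact: cont_expM.
apply: eq_measurable_fun (measurable_funM h h') => u _ /=.
by rewrite -mulrA -expRD !mul1r addNr expR0 mulr1.
Qed.
Lemma holo_cbeta q : 0 < q -> holo (hplane 0) (cbeta q).
Proof.
move=> q0 z z0; have [y y0 yz] := hplane_mid z0.
apply: (@Lap_holo _ _ R mu `]0, +oo[ (bcore q) (fun u => - u) (mitv _) (meas_bcore q0) (@meas_opp _) _ _ y) => //.
- by move=> u _; exact: powR_ge0.
- by move=> u /=; rewrite in_itv /= andbT oppr_le0 => /ltW.
- exact: (hasI_bcore y0 q0).1.
Qed.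
Lemma cbeta_cgam q (z : C) : 0 < q -> 0 < Re z -> cgam z * (Gr q)%:C = cbeta q z * cgam (z + q%:C).
Proof.
move=> q0; move: z; apply: (@identity_real R (hplane 0) (fun z => cgam z * (Gr q)%:C) (fun z => cbeta q z * cgam (z + q%:C)) 1 2).
- exact: hplane_open.
- exact: hplane_convex.
- by apply: holoM; [exact: holo_cgam|exact: holo_cst].
- apply: holoM; first exact: holo_cbeta.
 by apply: holo_shift; apply: holoS holo_cgam => z; rewrite /hplane; lra.
- by lra.
- by move=> x /andP[x1 _]; rewrite /hplane /=; lra.
- move=> x /andP[x1 _]; have x0 : 0 < x by lra.
 have xq : 0 < x + q by lra.
 rewrite /cbeta (Lap_real (mitv _) (hasI_bcore x0 q0)) -rmorphD (cgam_real x0) (cgam_real xq).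
 rewrite -!rmorphM; congr (_%:C); have := Gr_gt0 xq.
 by move: (Gr _) (Gr _) (Gr _) => A B D D0; rewrite divfK// gt_eqF.
Qed.
(** A zero at [z] forces zeros at all [z - q] with 0 < q < Re z, because Gamma(z - q) Gamma(q) is a
    beta integral times Gamma(z) and Gamma(q) is positive. Gamma would then vanish identically, yet
    it is positive at 1. *)
Lemma cgam_neq0 z : 0 < Re z -> cgam z != 0.
Proof.
move=> z0; apply/eqP => gz0.
have H := @zero_propagates R (hplane 0) cgam z (Re z) (@hplane_open R 0) (@hplane_convex R 0) holo_cgam z0 z0.
have : cgam 1%:C = 0.
 apply: H; last by rewrite /hplane /= ltr01.
 move=> q /andP[q0 qz].
 have q1 : 0 < Re (z - q%:C) by rewrite !reimE /= subr_gt0.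
 have := cbeta_cgam q0 q1; rewrite subrK gz0 mulr0 => /eqP; rewrite mulf_eq0 => /orP[/eqP//|].
 by rewrite -nm_eq0 nmR normr_eq0 gt_eqF// Gr_gt0.
rewrite cgam_real// => /(congr1 (fun z : C => Re z)) /=; apply/eqP.
by rewrite gt_eqF// Gr_gt0.
Qed.
Lemma cgam_rec z : 0 < Re z -> cgam (z + 1) = z * cgam z.
Proof.
move: z; apply: (@identity_real R (hplane 0) (fun z => cgam (z + 1)) (fun z => z * cgam z) 0 1).
- exact: hplane_open.
- exact: hplane_convex.
- by apply: (@holo_shift cgam 0 1); rewrite add0r; apply: holoS holo_cgam => z; rewrite /hplane; apply: lt_trans.
- by apply: holoM; [exact: holo_id|exact: holo_cgam].
- exact: ltr01.
- by move=> x /andP[x0 _].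
- move=> x /andP[x0 _].
 have x1 : 0 < x + 1 by rewrite addr_gt0.
 rewrite (_ : x%:C + 1 = (x + 1)%:C); last by ceq; rewrite ?addr0.
 rewrite (cgam_real x0) (cgam_real x1) Gr_rec//; move: (Gr x) => A.
 by ceq; rewrite !mulr0 ?mul0r ?subr0 ?addr0.
Qed.
(** 1 / Gamma on Re z > -n, by n steps of the recursion. Every admissible n gives the same value, so
    [rgam] may let n depend on [z] and still be entire. *)
Definition rgamP n (z : C) : C := (\prod_(k < n) (z + k%:R)) * (cgam (z + n%:R))^-1.

Lemma Re_addn (z : C) n : Re (z + n%:R) = Re z + n%:R.
Proof. by rewrite -(rmorph_nat (real_complex R)) reimE. Qed.
Lemma rgamP_S n z : 0 < Re z + n%:R -> rgamP n.+1 z = rgamP n z.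
Proof.
move=> h; rewrite /rgamP big_ord_recr /= -mulrA; congr (_ * _).
have h' : 0 < Re (z + n%:R) by rewrite Re_addn.
have zn0 : z + n%:R != 0 by apply: contraTneq h' => ->; rewrite ltxx.
rewrite -natr1 addrA cgam_rec// invfM mulrA divff// mul1r.
by [].
Qed.
Lemma rgamP_le n m z : (n <= m)%N -> 0 < Re z + n%:R -> rgamP m z = rgamP n z.
Proof.
move=> /subnK <-; elim: (m - n)%N => [//|k ih] h; rewrite addSn rgamP_S ?ih//.
by rewrite natrD; have : (0 : R) <= k%:R by []; lra.
Qed.
Definition rgam z := rgamP (Num.truncn `|Re z|).+1 z.

Lemma rgamE n z : 0 < Re z + n%:R -> rgam z = rgamP n z.
Proof.
move=> h; rewrite /rgam; set m := _.+1.
have hm : 0 < Re z + m%:R.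
 have /andP[_] := truncn_itv (normr_ge0 (Re z)); rewrite -/m => h1.
 by have := ler_norm (- Re z); rewrite normrN; lra.
have [nm'|mn] := leqP n m; first exact: rgamP_le.
by apply/esym; apply: rgamP_le => //; exact: ltnW.
Qed.
Lemma rgam_pos z : 0 < Re z -> rgam z = (cgam z)^-1.
Proof. by move=> z0; rewrite (@rgamE 0) ?addr0// /rgamP big_ord0 mul1r addr0. Qed.
Lemma holo_rgam : holo (@whole R) rgam.
Proof.
move=> z _; have [n hn] : exists n : nat, 1 < Re z + n%:R.
 exists (Num.truncn `|Re z|).+2; have /andP[_ h1] := truncn_itv (normr_ge0 (Re z)); rewrite -natr1.
 by have := ler_norm (- Re z); rewrite normrN; lra.
have D : cder_at (rgamP n) z.
 have hz : hplane (- n%:R) z by rewrite /hplane; lra.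
 move: z hz {hn}; change (holo (hplane (- n%:R)) (rgamP n)); rewrite /rgamP; apply: holoM.
  move: (hplane (- n%:R)) => H; elim: n => [|k ih].
   by move=> y _; exists 0; under eq_fun do rewrite big_ord0; exact: cderiv_cst.
  have e : (fun z : C => \prod_(i < k.+1) (z + i%:R)) = (fun z => (\prod_(i < k) (z + i%:R)) * (z + k%:R)).
   by apply/funext => y; rewrite big_ord_recr.
  rewrite e; apply: holoM => //.
  by apply: holoD; [exact: holo_id|exact: holo_cst].
 apply: holoV; first by move=> y hy; apply: cgam_neq0; rewrite Re_addn; move: hy; rewrite /hplane; lra.
 have -> : (fun y : C => cgam (y + n%:R)) = (fun y => cgam (y + (n%:R)%:C)).
  by apply/funext => y; rewrite -(rmorph_nat (real_complex R)).
 by apply: holo_shift; rewrite addNr; exact: holo_cgam.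
have [l dl] := D; exists l; apply: (@cderiv_near _ (rgamP n) _ _ _ 1 ltr01) dl => w wz.
by apply/esym/rgamE; have [+ _] := nm_in_sq wz; rewrite ltr_distlC => /andP[]; lra.
Qed.

End Subst.

HB.instance Definition _ (R : realType) :=
 @Measure_isSigmaFinite.Build _ _ R (@counting nat R) (sigma_finite_counting R).

Notation ray R := (`[0%R, +oo[%classic : set R).

(** * The zeta series as a Laplace transform of the floor function *)

Section CountSums.
Variable R : realType.
Notation cnt := (@counting nat R).
Notation mu := (@lebesgue_measure R).
Local Notation C := R[i].

Lemma hasI_sub d (T : measurableType d) (m : {measure set T -> \bar R}) (D E : set T) (f : T -> R) v :
 measurable D -> measurable E -> E `<=` D -> hasI m E f v -> hasI m D (fun x => if x \in E then f x else 0) v.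
Proof.
move=> mD mE ED [i1 <-].
have e : (fun x => if x \in E then f x else 0) = f \_ E by apply/funext => x; rewrite patchE.
have i2 : itg m setT (f \_ E) by move/(integrable_mkcond _ mE).1 : i1; rewrite restrict_EFin.
rewrite e; split; first by apply: itgS i2.
rewrite [RHS]Rintegral_mkcond Rintegral_mkcond; apply: eq_Rintegral => x _.
rewrite !patchE; case: ifPn => // xD; case: ifPn => // xE.
by case/negP: xD; apply/mem_set/ED/set_mem.
Qed.
Lemma count_fin (f : nat -> R) N : (forall n, 0 <= f n) ->
 hasI cnt setT (fun n => if (n < N)%N then f n else 0) (\sum_(n < N) f n).
Proof.
move=> f0; apply: series_count; first by move=> n; case: ifP.
apply: (cvg_near_cst); near=> M.
have NM : (N <= M)%N by near: M; exists N.
rewrite /series /= (big_cat_nat (n := N))//= [X in _ + X]big1_seq ?addr0; last first.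
 by move=> i; rewrite mem_index_iota => /andP[_ /andP[Ni _]]; rewrite ltnNge Ni.
by rewrite big_mkord; apply: eq_bigr => i _; rewrite ltn_ord.
Unshelve. all: by end_near. Qed.
Lemma count_single n0 (v : nat -> R) : 0 <= v n0 -> hasI cnt setT (fun n => if n == n0 then v n else 0) (v n0).
Proof.
move=> v0; have f0 n : 0 <= (if n == n0 then v n else 0) by case: eqP => [->|].
have := count_fin n0.+1 f0; rewrite big_ord_recr /= eqxx big1 ?add0r; last first.
 by move=> i _; rewrite ltn_eqF.
by apply: eq_hasI => // n _; case: ltnP => //; case: eqP => // ->; rewrite ltnn.
Qed.
Lemma count_zero : hasI cnt setT (fun=> 0) 0.
Proof. by have := @count_fin (fun=> 0) 0 (fun=> lexx 0); rewrite big_ord0; apply: eq_hasI. Qed.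
(** Reindexes a series along the multiples of [d], in the indexing where [n] stands for [n.+1]; this
    is the inner sum of a Dirichlet convolution. *)
Lemma count_multiples (d : nat) (F : nat -> R) v : (0 < d)%N -> (forall k, 0 <= F k) ->
 hasI cnt setT (fun k => F k.+1) v ->
 hasI cnt setT (fun N => if (d %| N.+1)%N then F (N.+1 %/ d)%N else 0) v.
Proof.
move=> d0 F0 H.
pose f (z : nat * nat) := if z.2.+1 == (d * z.1.+1)%N then F z.1.+1 else 0.
have mf : measurable_fun (setT `*` setT) f.
 by have := @meas_nat_prod _ _ R setT (fun k N => f (k, N)) measurableT (fun n => _); apply => n _ Y _; rewrite setTI.
have f0 x y : setT x -> setT y -> 0 <= f (x, y) by move=> _ _; rewrite /f; case: ifP.
apply: (@tonelli _ _ nat nat R cnt cnt setT setT f measurableT measurableT mf f0 (fun k => F k.+1)).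
- move=> k _; apply: (@eq_hasI _ _ _ _ _ (fun N => if N == (d * k.+1).-1 then F k.+1 else 0)) => //.
  move=> N _; rewrite /f /=; congr (if _ then _ else _).
  have e : (0 < d * k.+1)%N by rewrite muln_gt0 d0.
  by rewrite -{2}(prednK e) eqSS.
 exact: (@count_single _ (fun=> F k.+1)).
- move=> N _; case: ifPn => [dN|dN].
  apply: (@eq_hasI _ _ _ _ _ (fun k => if k == (N.+1 %/ d).-1 then F k.+1 else 0)) => //.
   move=> k _; rewrite /f /=; congr (if _ then _ else _).
   move: dN => /dvdnP[q E]; rewrite E mulnK//.
   have q0 : (0 < q)%N by move: E; case: q.
   by rewrite [(q * d)%N]mulnC eqn_pmul2l// -{2}(prednK q0) eqSS eq_sym.
  have q0 : (0 < N.+1 %/ d)%N by rewrite divn_gt0// dvdn_leq.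
  by have := @count_single (N.+1 %/ d).-1 (fun k => F k.+1) (F0 _); rewrite prednK.
 apply: eq_hasI count_zero => // k _; rewrite /f /=; case: eqP => // E.
 by case/negP: dN; rewrite E dvdn_mulr.
- exact: H.
Qed.
Definition flr (u : R) : R := (Num.truncn (expR u))%:R.

Lemma flr_bounds u : 0 <= flr u /\ flr u <= expR u /\ expR u < flr u + 1.
Proof.
have /andP[h1 h2] := truncn_itv (expR_ge0 u); rewrite /flr; split => //; split => //.
by rewrite natr1.
Qed.
Definition lnS (n : nat) : R := ln n.+1%:R.
Lemma lnS_ge0 n : 0 <= lnS n. Proof. by rewrite ln_ge0// ler1n. Qed.
Lemma expR_lnS n : expR (lnS n) = n.+1%:R. Proof. by rewrite lnK// posrE. Qed.
Definition zkern (s : R) (z : nat * R) : R := if lnS z.1 <= z.2 then expR (- s * z.2) else 0.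

Lemma meas_zkern s : measurable_fun ([set: nat] `*` (ray0 R)) (zkern s).
Proof.
apply: (@meas_nat_prod _ (mR R) R `[0, +oo[ (fun n u => zkern s (n, u))); first exact: mitv.
move=> n; have h : measurable_fun (ray R) (fun u => zkern s (n, u)).
 change (measurable_fun (ray R) (fun u : R => if lnS n <= u then expR (- s * u) else 0)).
 apply: measurable_funTS; apply: measurable_fun_ifT => //.
  by apply: measurable_fun_ler.
 by apply: continuous_measurable_fun; exact: cont_expM.
exact: h.
Qed.
Lemma zkern_u s n : 0 < s -> hasI mu `[0, +oo[ (fun u => zkern s (n, u)) (expR (- s * lnS n) / s).
Proof.
move=> s0; have h := hasI_exp_tail (lnS n) s0.
have := hasI_sub (mitv `[0, +oo[) (mitv `[lnS n, +oo[) _ h.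
move=> H; apply: eq_hasI (H _).
- exact: mitv.
- by move=> u _; rewrite /zkern /=; congr (if _ then _ else _); rewrite mem_setE in_itv /= andbT.
- by apply: subset_itvr; rewrite bnd_simp lnS_ge0.
Qed.
Lemma zkern_n s u : hasI cnt setT (fun n => zkern s (n, u)) (flr u * expR (- s * u)).
Proof.
have := @count_fin (fun=> expR (- s * u)) (Num.truncn (expR u)) (fun=> expR_ge0 _).
rewrite sumr_const card_ord -mulr_natl -/(flr u).
apply: eq_hasI => // n _; rewrite /zkern /=; congr (if _ then _ else _).
rewrite -ler_expR expR_lnS.
by rewrite -truncn_ge_nat ?expR_ge0.
Qed.
Lemma hasI_exp0 (q : R) : 0 < q -> hasI mu `[0, +oo[ (fun u => expR (- q * u)) q^-1.
Proof. by move=> q0; have := hasI_exp_tail 0 q0; rewrite mulr0 expR0 mul1r. Qed.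
Lemma zkern_f0 s x y : [set: nat] x -> (ray R) y -> 0 <= zkern s (x, y).
Proof. by move=> _ _; rewrite /zkern; case: ifP => // _; exact: expR_ge0. Qed.
Lemma meas_flr s : 0 < s -> measurable_fun (ray0 R) (fun u => flr u * expR (- s * u)).
Proof.
move=> s0; have h := @meas_inner2 _ _ nat (mR R) R cnt setT `[0, +oo[ (zkern s) measurableT (mitv _) (meas_zkern s)
 (@zkern_f0 s) (fun u => flr u * expR (- s * u)) (fun u _ => zkern_n s u).
exact: h.
Qed.
Definition frac (u : R) := expR u - flr u.
Lemma frac_ge0 u : 0 <= frac u. Proof. by have [_ [h _]] := flr_bounds u; rewrite subr_ge0. Qed.
Lemma frac_le1 u : frac u <= 1. Proof. by have [_ [_ h]] := flr_bounds u; rewrite /frac; lra. Qed.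
Lemma meas_frac : measurable_fun (ray0 R) frac.
Proof.
have h1 : measurable_fun (ray R) (fun u : R => expR (1 * u)).
 by apply: measurable_funTS; apply: continuous_measurable_fun; exact: cont_expM.
have h2 : measurable_fun (ray R) (fun u => flr u * expR (- 1 * u)) := meas_flr ltr01.
have h3 : measurable_fun (ray R) (fun u => expR (1 * u) - flr u * expR (- 1 * u) * expR (1 * u)).
 by apply: measurable_funB => //; apply: measurable_funM.
have h4 : measurable_fun (ray R) frac.
 apply: (eq_measurable_fun (fun u : R => expR (1 * u) - flr u * expR (- 1 * u) * expR (1 * u))) => //.
 by move=> u _; rewrite -mulrA -expRD -mulrDl addNr mul0r expR0 mulr1 mul1r.
exact: h4.
Qed.
Lemma itg_frac s : 0 < s -> itg mu `[0, +oo[ (fun u => frac u * expR (- s * u)).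
Proof.
move=> s0; apply: itg_le (hasI_exp0 s0).1 _; first exact: mitv.
 apply: measurable_funM; first exact: meas_frac.
 by apply: measurable_funTS; apply: continuous_measurable_fun; exact: cont_expM.
move=> u _; rewrite ger0_norm ?mulr_ge0 ?frac_ge0 ?expR_ge0// ler_piMl ?expR_ge0//.
exact: frac_le1.
Qed.
Definition fracI (s : R) := \int[mu]_(u in `[0, +oo[) (frac u * expR (- s * u)).

(** The sum of the zeta series for s > 1, in a form that isolates the pole: the floor of e^u is e^u,
    which yields s / (s - 1), minus the bounded fractional part. *)
Definition zr (s : R) := s / (s - 1) - s * fracI s.

(** Partial summation by Tonelli: n^(-s) is s times the integral of e^(-su) over u >= ln n, and at a
    fixed u the number of admissible n is [flr u]. *)
Lemma hasI_zeta s : 1 < s -> hasI cnt setT (fun n => expR (s * - lnS n)) (zr s).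
Proof.
move=> s1; have s0 : 0 < s by apply: lt_trans s1.
have e1 : hasI mu `[0, +oo[ (fun u => flr u * expR (- s * u)) ((s - 1)^-1 - fracI s).
 have s10 : 0 < s - 1 by rewrite subr_gt0.
 apply: eq_hasI (hasI_B (mitv _) (hasI_exp0 s10) (hasI_itg (itg_frac s0))); first exact: mitv.
 move=> u _; have -> : - (s - 1) * u = u + - s * u by ring.
 by rewrite expRD /frac; ring.
have := @tonelli' _ _ nat (mR R) R cnt mu setT `[0, +oo[ (zkern s) measurableT (mitv _) (meas_zkern s)
 (@zkern_f0 s) _ _ _ (fun n _ => zkern_u n s0) (fun u _ => zkern_n s u) e1.
move=> /(hasI_Z s measurableT); rewrite /zr mulrBr.
apply: eq_hasI => // n _; rewrite mulrC divfK ?gt_eqF//; congr expR; ring.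
Qed.

End CountSums.

(** * The theta function *)

Section Finite.
Variable R : realType.
Local Notation C := R[i].
Definition cis (x : R) : C := cexp (Complex 0 x).
Lemma cisD x y : cis (x + y) = cis x * cis y.
Proof. by rewrite /cis -cexpD; congr cexp; ceq; rewrite ?addr0. Qed.
Lemma cis0 : cis 0 = 1. Proof. exact: cexp0. Qed.
Lemma Re_cis x : Re (cis x) = cos x. Proof. by rewrite /= expR0 mul1r. Qed.
Lemma Im_cis x : Im (cis x) = sin x. Proof. by rewrite /= expR0 mul1r. Qed.
Lemma cisX x n : cis x ^+ n = cis (x *+ n).
Proof. by elim: n => [|n ih]; rewrite ?cis0// exprS ih mulrS cisD. Qed.
Lemma cis_2pin (n : nat) : cis (pi *+ 2 *+ n) = 1.
Proof.
rewrite -cisX (_ : cis _ = 1) ?expr1n//; apply: ceqP; rewrite ?Re_cis ?Im_cis.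
 by rewrite cos2pi.
by rewrite sin2pi.
Qed.
Lemma cos2E x : (2 * cos x)%:C = cis x + cis (- x).
Proof. by ceq; rewrite !expR0 !mul1r ?cosN ?sinN; ring. Qed.
Lemma cos_pow (m : nat) x : ((2 * cos x) ^+ (2 * m))%:C =
 \sum_(k < (2 * m).+1) ('C(2 * m, k))%:R * (cis (x *+ 2) ^+ k * cis (- (x *+ (2 * m)))).
Proof.
rewrite rmorphXn /= cos2E addrC exprDn; apply: eq_bigr => k _.
rewrite -mulr_natl; congr (_ * _).
have kl : (k <= 2 * m)%N by rewrite -ltnS.
rewrite !cisX -!cisD; congr cis.
have key (a b : nat) : (b <= a)%N -> - x *+ (a - b) + x *+ b = x *+ 2 *+ b - x *+ a.
 by move=> ba; rewrite mulNrn mulrnBr// opprB -[X in _ = X - _]mulrnA mul2n -addnn mulrnDr addrAC.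
exact: key.
Qed.
(** The root of unity filter. If [l] does not divide [N] the ratio differs from 1: otherwise the
    sine of the half angle pi r / l, with 0 < r < l, would vanish. *)
Lemma cis_geom (l N : nat) : (0 < l)%N ->
 \sum_(j < l) cis (pi *+ 2 * N%:R / l%:R) ^+ j = if (l %| N)%N then l%:R else 0.
Proof.
move=> l0; have lR : l%:R != 0 :> R by rewrite pnatr_eq0 -lt0n.
set w := cis _.
have wl : w ^+ l = 1.
 rewrite /w cisX (_ : _ *+ l = pi *+ 2 *+ N) ?cis_2pin//.
 by rewrite -[LHS]mulr_natr divfK// mulr_natr.
case: ifPn => [/dvdnP[q Nq]|ndv].
 have w1 : w = 1.
  by rewrite /w Nq natrM mulrA mulfK// mulr_natr cis_2pin.
 by under eq_bigr do rewrite w1 expr1n; rewrite sumr_const card_ord.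
have w1 : w != 1.
 apply: contraNneq ndv => w1.
 pose r := (N %% l)%N.
 have wr : cis (pi *+ 2 * r%:R / l%:R) = 1.
  rewrite -[RHS]w1 /w [in RHS](divn_eq N l) -/r natrD mulrDr mulrDl cisD natrM.
  rewrite [X in _ = cis X * _](_ : _ = pi *+ 2 *+ (N %/ l)) ?cis_2pin ?mul1r//.
  by rewrite -[RHS]mulr_natr; field.
 have [r0|r0] := posnP r; first by rewrite /dvdn -/r r0.
 have rl : (r < l)%N by rewrite ltn_mod.
 have s0 : sin (pi * r%:R / l%:R) = 0 :> R.
  have : cos (pi *+ 2 * r%:R / l%:R) = 1 :> R by rewrite -Re_cis wr.
  rewrite (_ : pi *+ 2 * r%:R / l%:R = (pi * r%:R / l%:R) *+ 2); last by rewrite -[RHS]mulr_natr; ring.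
  rewrite cos_mulr2n cos2sin2 => H; apply/eqP; rewrite -sqrf_eq0; apply/eqP; lra.
 have : 0 < sin (pi * r%:R / l%:R) :> R.
  have lR0 : 0 < l%:R :> R by rewrite ltr0n.
  have r0R : 0 < r%:R :> R by rewrite ltr0n.
  apply: sin_gt0_pi; rewrite divr_gt0 ?mulr_gt0 ?pi_gt0//=.
  by rewrite ltr_pdivrMr// ltr_pM2l ?pi_gt0// ltr_nat.
 by rewrite s0 ltxx.
have := subrX1 w l; rewrite wl subrr => /esym/eqP.
by rewrite mulf_eq0 subr_eq0 (negbTE w1) /= => /eqP.
Qed.
(** In the divisibility condition [l.-1 * m] is -m modulo [l], written without subtraction. *)
Lemma polya_sum (l m : nat) : (0 < l)%N ->
 \sum_(j < l) (2 * cos (pi * j%:R / l%:R)) ^+ (2 * m) =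
 l%:R * \sum_(k < (2 * m).+1) (if (l %| k + (l.-1) * m)%N then ('C(2 * m, k))%:R else 0) :> R.
Proof.
move=> l0; have lR : l%:R != 0 :> R by rewrite pnatr_eq0 -lt0n.
apply: (@complexI R); rewrite rmorph_sum /=.
under eq_bigr do rewrite cos_pow.
rewrite exchange_big /= mulr_sumr rmorph_sum.
apply: eq_bigr => k _; rewrite [RHS]rmorphM /= [X in _ = X * _]rmorph_nat.
transitivity (('C(2 * m, k))%:R * \sum_(j < l) cis (pi *+ 2 * (k + l.-1 * m)%:R / l%:R) ^+ j : C).
 rewrite mulr_sumr; apply: eq_bigr => j _; congr (_ * _).
 rewrite -[LHS]mul1r -(cis_2pin (j * m)) !cisX -!cisD; congr cis.
 have -> : (k + l.-1 * m)%:R = k%:R + (l%:R - 1) * m%:R :> R.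
  by rewrite natrD natrM -subn1 natrB.
 have mn (a : R) (n : nat) : a *+ n = a * n%:R by rewrite mulr_natr.
 rewrite (mn _ (j * m)%N) (mn _ k) (mn _ (2 * m)%N) (mn _ j) !natrM.
 move: (j%:R : R) (k%:R : R) (m%:R : R) lR => J K M; move: (l%:R : R) => L lR.
 by field.
rewrite cis_geom//; case: ifP => _; last by rewrite !mulr0.
by rewrite rmorph_nat mulrC.
Qed.
(** Polya's finite form of the theta identity. The sum of (2 cos)^(2m) over the angles pi j / l is
    computed directly and by the binomial theorem; for odd [l] the index j pairs with l - j, and the
    symmetry of binomial coefficients pairs the offsets d and -d. With m of order l^2 both sides
    become theta series. *)
Lemma polya (p m : nat) : let l := (2 * p).+1 in
 4 ^+ m * (1 + 2 * \sum_(1 <= j < p.+1) cos (pi * j%:R / l%:R) ^+ (2 * m)) =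
 l%:R * (('C(2 * m, m))%:R + 2 * \sum_(1 <= n < m.+1) ('C(2 * m, m + n * l))%:R) :> R.
Proof.
move=> l; have l0 : (0 < l)%N by [].
have lR : l%:R != 0 :> R by rewrite pnatr_eq0.
have := polya_sum m l0.
have -> : \sum_(j < l) (2 * cos (pi * j%:R / l%:R)) ^+ (2 * m) =
  4 ^+ m * (1 + 2 * \sum_(1 <= j < p.+1) cos (pi * j%:R / l%:R) ^+ (2 * m)) :> R.
 transitivity (4 ^+ m * \sum_(j < l) cos (pi * j%:R / l%:R) ^+ (2 * m) : R).
  rewrite mulr_sumr; apply: eq_bigr => j _.
  by rewrite exprMn [2 ^+ (2 * m)]exprM -natrX.
 congr (_ * _); rewrite -(big_mkord xpredT (fun j => cos (pi * j%:R / l%:R) ^+ (2 * m))).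
 rewrite big_ltn// mulr0 mul0r cos0 expr1n; congr (_ + _).
 rewrite (big_cat_nat (n := p.+1)) //=; last by rewrite /l; lia.
 rewrite mulr_natl mulr2n; congr (_ + _).
 rewrite big_nat_rev /= -{1}[p.+1]add1n big_addn.
 have -> : (l - p = p.+1)%N by rewrite /l; lia.
 rewrite big_nat [RHS]big_nat; apply: eq_bigr => j /andP[j1 jp].
 have -> : (p.+1 + l - (j + p).+1)%N = (l - j)%N by rewrite /l; lia.
 have jl : (j <= l)%N by rewrite /l; lia.
 have -> : pi * (l - j)%:R / l%:R = pi - pi * j%:R / l%:R :> R by rewrite natrB//; field.
 rewrite cosB cospi sinpi mul0r addr0 mulN1r !exprM sqrrN//.
move=> ->; congr (_ * _).
pose F k : R := if (l %| k + l.-1 * m)%N then ('C(2 * m, k))%:R else 0.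
rewrite -(big_mkord xpredT F) (big_cat_nat (n := m)) //=; last lia.
rewrite [X in _ + X = _]big_ltn; last lia.
have Fm : F m = ('C(2 * m, m))%:R.
 by rewrite /F (_ : (m + l.-1 * m = l * m)%N) ?dvdn_mulr// /l /=; lia.
rewrite Fm addrCA; congr (_ + _).
have A d : (d <= m)%N -> F (m + d)%N = if (l %| d)%N then ('C(2 * m, m + d))%:R else 0.
 move=> dm; rewrite /F (_ : (m + d + l.-1 * m = l * m + d)%N); last by rewrite /l /=; lia.
 by rewrite dvdn_addr// dvdn_mulr.
have B d : (d <= m)%N -> F (m - d)%N = if (l %| d)%N then ('C(2 * m, m + d))%:R else 0.
 move=> dm; rewrite /F.
 have -> : (l %| m - d + l.-1 * m)%N = (l %| d)%N.
  have E : (m - d + l.-1 * m + d = l * m)%N by rewrite /l /=; lia.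
  have D : (l %| m - d + l.-1 * m + d)%N by rewrite E dvdn_mulr.
  by apply/idP/idP => h; [rewrite -(dvdn_addr _ h)|rewrite -(dvdn_addl _ h)].
 by rewrite -bin_sub; [congr (if _ then _ %:R else _); congr ('C(_, _)); lia|lia].
transitivity (2 * \sum_(1 <= d < m.+1) (if (l %| d)%N then ('C(2 * m, m + d))%:R else 0) : R).
 rewrite mulr_natl mulr2n; congr (_ + _).
  rewrite big_nat_rev /= add0n -[1%N]add0n -[m.+1]addn1 big_addn addnK.
  rewrite big_nat [RHS]big_nat; apply: eq_bigr => d /andP[_ dm].
  by rewrite -B ?addn1// ; congr F; lia.
 rewrite -[m.+1 in LHS]add1n big_addn.
 have -> : ((2 * m).+1 - m = m.+1)%N by lia.
 rewrite big_nat [RHS]big_nat; apply: eq_bigr => d /andP[d1 dm].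
 by rewrite -A// addnC.
congr (_ * _).
rewrite -big_mkcond /= -big_filter.
transitivity (\sum_(d <- map (muln^~ l) [seq n <- index_iota 1 m.+1 | (n * l < m.+1)%N]) ('C(2 * m, m + d))%:R : R).
 apply: perm_big; apply: uniq_perm.
 - by rewrite filter_uniq// iota_uniq.
 - rewrite map_inj_uniq ?filter_uniq ?iota_uniq//.
  by move=> a b /eqP; rewrite eqn_pmul2r// => /eqP.
 move=> d; rewrite mem_filter mem_index_iota; apply/idP/mapP.
  case/and3P => /dvdnP[q dq] d1 dm; exists q => //.
  rewrite mem_filter mem_index_iota -dq dm /=.
  by move: d1 dm; rewrite dq /l; nia.
 case=> q; rewrite mem_filter mem_index_iota => /and3P[ql q1 qm] ->.
 by rewrite dvdn_mull// ql /= andbT muln_gt0 q1.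
rewrite big_map big_filter big_mkcond /=; apply: eq_bigr => n _.
case: ifPn => //; rewrite -leqNgt => h.
by rewrite bin_small//; lia.
Qed.

End Finite.

(** * Passage to the limit: the theta transformation *)

Section Limits.
Variable R : realType.

(** Dominated convergence with a geometric majorant, for sums whose length [N p] varies with [p] in
    an arbitrary way; the majorant is asked for large [p] only. *)
Lemma tannery (a : nat -> nat -> R) (b : nat -> R) (K q : R) (S : R) :
 0 <= K -> 0 <= q < 1 ->
 (\forall p \near \oo, forall j, `|a p j| <= K * q ^+ j) ->
 (forall j, a ^~ j @ \oo --> b j) ->
 series b @ \oo --> S ->
 forall N : nat -> nat, (forall p j, (N p <= j)%N -> a p j = 0) ->
 (fun p => \sum_(0 <= j < N p) a p j) @ \oo --> S.
Proof.
move=> K0 /andP[q0 q1] Ha ab bS N NP.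
have q1' : 0 < 1 - q by rewrite subr_gt0.
have bB j : `|b j| <= K * q ^+ j.
 have : (fun p => `|a p j|) @ \oo --> `|b j| by exact: cvg_norm.
 move=> cv; apply: (cvgr_to_le cv); apply: filterS Ha => p; exact.
have geo (u : nat -> R) J n : (forall j, `|u j| <= K * q ^+ j) ->
  `|\sum_(J <= j < n) u j| <= K * q ^+ J / (1 - q).
 move=> uB; apply: le_trans (ler_norm_sum _ _ _) _; apply: le_trans (ler_sum _ (fun j _ => uB j)) _.
 by rewrite -mulr_sumr -mulrA ler_wpM2l// geo_tail// q0.
apply/cvgrPdist_lt => e e0.
have [J HJ] : exists J, K * q ^+ J / (1 - q) < e / 4.
 have : (fun J => K / (1 - q) * q ^+ J) @ \oo --> (0 : R).
  rewrite -[X in _ --> X](mulr0 (K / (1 - q))); apply: cvgM; first exact: cvg_cst.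
  by apply: cvg_expr; rewrite ger0_norm.
 have e4 : 0 < e / 4 by rewrite divr_gt0.
 move=> /cvgrPdist_lt /(_ _ e4)[J _ HJ]; exists J.
 have := HJ J (leqnn J); rewrite /= sub0r normrN ger0_norm; last first.
  by rewrite mulr_ge0 ?exprn_ge0// divr_ge0// ltW.
 by rewrite mulrAC.
have fs : (fun p => \sum_(0 <= j < J) a p j) @ \oo --> \sum_(0 <= j < J) b j.
 elim: J {HJ} => [|J ih].
  rewrite big_geq//; under eq_fun do rewrite big_geq//; exact: cvg_cst.
 rewrite big_nat_recr//=; under eq_fun do rewrite big_nat_recr//=.
 exact: cvgD.
have SJ : `|S - \sum_(0 <= j < J) b j| <= K * q ^+ J / (1 - q).
 have : (fun n => `|series b n - \sum_(0 <= j < J) b j|) @ \oo --> `|S - \sum_(0 <= j < J) b j|.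
  by apply: cvg_norm; apply: cvgB => //; exact: cvg_cst.
 move=> cv; apply: (cvgr_to_le cv); exists J => // n /= Jn.
 by rewrite /series /= (big_cat_nat (n := J))//= addrAC subrr add0r; exact: geo.
have e4 : 0 < e / 4 by rewrite divr_gt0.
move/cvgrPdist_lt : fs => /(_ _ e4) fs.
near=> p.
have A1 : forall j, `|a p j| <= K * q ^+ j by near: p.
have A2 : `|\sum_(0 <= j < J) b j - \sum_(0 <= j < J) a p j| < e / 4 by near: p.
have E : \sum_(0 <= j < N p) a p j = \sum_(0 <= j < J) a p j + \sum_(J <= j < maxn J (N p)) a p j.
 rewrite -(big_cat_nat (n := J))//= ?leq_maxl//.
 rewrite (big_cat_nat (n := N p) (p := maxn J (N p)))//= ?leq_maxr//.
 by rewrite [X in _ = _ + X]big_nat_cond [X in _ = _ + X]big1 ?addr0// => j /andP[/andP[/NP]].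
have A3 := @geo (a p) J (maxn J (N p)) A1.
rewrite E.
have -> : S - (\sum_(0 <= j < J) a p j + \sum_(J <= j < maxn J (N p)) a p j) =
 (S - \sum_(0 <= j < J) b j) + (\sum_(0 <= j < J) b j - \sum_(0 <= j < J) a p j)
 - \sum_(J <= j < maxn J (N p)) a p j by ring.
rewrite (le_lt_trans (ler_normB _ _))//.
have := ler_normD (S - \sum_(0 <= j < J) b j) (\sum_(0 <= j < J) b j - \sum_(0 <= j < J) a p j).
lra.
Unshelve. all: by end_near. Qed.
Lemma exp_lb (u : R) : 0 <= u <= 2^-1 -> expR (- u - 2 * u ^+ 2) <= 1 - u.
Proof.
move=> /andP[u0 u2]; have u1 : 0 < 1 - u by lra.
apply: (@le_trans _ _ (expR (- (u / (1 - u))))).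
 rewrite ler_expR -opprD lerN2 ler_pdivrMr//; nra.
rewrite expRN -[leRHS]invrK lef_pV2 ?posrE ?expR_gt0 ?invr_gt0//.
apply: le_trans (expR_ge1Dx _); apply: eq_ler; field; by rewrite gt_eqF.
Qed.
Definition cbr (m : nat) : R := ('C(2 * m, m))%:R / 4 ^+ m.

Lemma cbrS m : cbr m.+1 = cbr m * (2 * m%:R + 1) / (2 * m%:R + 2).
Proof.
have f (k : nat) : ('C(2 * k, k) * (k`! * k`!) = (2 * k)`!)%N.
 have h1 : (k <= 2 * k)%N by lia.
 have e1 : (2 * k - k = k)%N by lia.
 by have := bin_fact h1; rewrite e1.
have f1 := f m; have f2 := f m.+1.
have E : ('C(2 * m.+1, m.+1) * (m.+1 * m.+1) = (2 * m).+2 * (2 * m).+1 * 'C(2 * m, m))%N.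
 apply/eqP; rewrite -(eqn_pmul2r (_ : 0 < m`! * m`!)%N) ?muln_gt0 ?fact_gt0//; apply/eqP.
 have -> : ('C(2 * m.+1, m.+1) * (m.+1 * m.+1) * (m`! * m`!) = 'C(2 * m.+1, m.+1) * (m.+1`! * m.+1`!))%N.
  by rewrite !factS; ring.
 rewrite f2 (_ : 2 * m.+1 = (2 * m).+2)%N; last lia.
 by rewrite !factS -f1; ring.
have ER : ('C(2 * m.+1, m.+1))%:R * ((m%:R + 1) * (m%:R + 1)) =
 (2 * m%:R + 2) * (2 * m%:R + 1) * ('C(2 * m, m))%:R :> R.
 have := congr1 (fun n => n%:R : R) E.
 by rewrite !natrM -[in X in X -> _]natr1 -![(2 * m).+2%:R]natr1 -![(2 * m).+1%:R]natr1 !natrM => ->; ring.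
rewrite /cbr exprS.
have m1 : m%:R + 1 != 0 :> R by rewrite natr1 pnatr_eq0.
have m2 : 2 * m%:R + 2 != 0 :> R by rewrite -natrM -natrD pnatr_eq0; lia.
have p4 : (4 : R) ^+ m != 0 by rewrite expf_neq0// pnatr_eq0.
have -> : ('C(2 * m.+1, m.+1))%:R = (2 * m%:R + 2) * (2 * m%:R + 1) * ('C(2 * m, m))%:R / ((m%:R + 1) * (m%:R + 1)) :> R.
 by rewrite -ER mulfK// mulf_neq0.
by field; rewrite m1 m2 p4.
Qed.
Lemma cbr_gt0 m : 0 < cbr m.
Proof. by rewrite divr_gt0 ?exprn_gt0// ltr0n bin_gt0; lia. Qed.
(** m cbr(m)^2 increases while (2m + 1) cbr(m)^2 stays at most 1. The limit is kept as an unknown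
    constant; its value 1 / pi comes out of the theta identity at t = 1. *)
Lemma wallis_cvg : exists2 w : R, 0 < w & (fun m : nat => m%:R * cbr m ^+ 2) @ \oo --> w.
Proof.
pose v (m : nat) : R := m%:R * cbr m ^+ 2.
have nd : nondecreasing_seq v.
 apply/nondecreasing_seqP => m; rewrite /v cbrS -natr1.
 move: (cbr m) => c'; rewrite [X in _ <= _ * X]exprMn [X in _ <= _ * (X * _)]exprMn exprVn.
 have c0 := sqr_ge0 c'; have m0 : 0 <= m%:R :> R by [].
 have d0 : 0 < (2 * m%:R + 2) ^+ 2 :> R by rewrite exprn_gt0//; lra.
 rewrite mulrA ler_pdivlMr//.
 move: c0 m0; move: (c' ^+ 2) (m%:R : R) => c x c0 x0; rewrite !expr2.
 have : 0 <= c * (x + 1) by rewrite mulr_ge0//; lra.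
 nra.
have ub m : (2 * m%:R + 1) * cbr m ^+ 2 <= 1.
 elim: m => [|m ih].
  by rewrite mulr0 add0r mul1r /cbr muln0 bin0 expr0 divr1 expr1n.
 rewrite cbrS -[m.+1%:R]natr1; move: (cbr m) ih => c' ih.
 rewrite [X in _ * X <= _]exprMn [X in _ * (X * _) <= _]exprMn exprVn.
 have c0 := sqr_ge0 c'; have m0 : 0 <= m%:R :> R by [].
 have d0 : 0 < (2 * m%:R + 2) ^+ 2 :> R by rewrite exprn_gt0//; lra.
 rewrite mulrA ler_pdivrMr// mul1r.
 move: c0 m0 ih; move: (c' ^+ 2) (m%:R : R) => c x c0 x0 ih; rewrite !expr2.
 have : (2 * x + 1) * c * ((2 * x + 3) * (2 * x + 1)) <= 1 * ((2 * x + 3) * (2 * x + 1)).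
  by rewrite ler_wpM2r// mulr_ge0//; lra.
 nra.
have ubv m : v m <= 1.
 rewrite (le_trans _ (ub m))// /v ler_wpM2r ?sqr_ge0//.
 have : 0 <= m%:R :> R by []; lra.
have hu : has_ubound (range v) by exists 1 => _ [m _ <-]; exact: ubv.
exists (sup (range v)); last exact: nondecreasing_cvgn.
apply: (@lt_le_trans _ _ (v 1)); last by apply: ub_le_sup => //; exists 1%N.
by rewrite /v mul1r exprn_gt0// cbr_gt0.
Qed.
(** Writes an off-centre binomial coefficient as the central one times factors 1 - d / (m + i), each
    comparable with an exponential; their product is close to exp(- d^2 / m). *)
Lemma bin_ratio m d : (d <= m)%N ->
 ('C(2 * m, m + d))%:R = ('C(2 * m, m))%:R * \prod_(1 <= i < d.+1) (1 - d%:R / (m + i)%:R) :> R.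
Proof.
move=> dm.
have F1 : (('C(2 * m, m + d))%:R * ((m + d)`!%:R * (m - d)`!%:R) = (2 * m)`!%:R :> R).
 have h1 : (m + d <= 2 * m)%N by lia.
 have e1 : (2 * m - (m + d) = m - d)%N by lia.
 by have := bin_fact h1; rewrite e1 -!natrM => ->.
have F2 : (('C(2 * m, m))%:R * (m`!%:R * m`!%:R) = (2 * m)`!%:R :> R).
 have h1 : (m <= 2 * m)%N by lia.
 have e1 : (2 * m - m = m)%N by lia.
 by have := bin_fact h1; rewrite e1 -!natrM => ->.
have G1 k : ((m + k)`!%:R = m`!%:R * \prod_(1 <= i < k.+1) (m + i)%:R :> R).
 elim: k => [|k ih]; first by rewrite addn0 big_geq// mulr1.
 by rewrite addnS factS natrM ih [in RHS]big_nat_recr//= addnS; ring.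
have G2 : (m`!%:R = (m - d)`!%:R * \prod_(1 <= i < d.+1) ((m + i)%:R - d%:R) :> R).
 have H k : (k <= d)%N -> ((m - d + k)`!%:R = (m - d)`!%:R * \prod_(1 <= i < k.+1) ((m + i)%:R - d%:R) :> R).
  elim: k => [|k ih] kd; first by rewrite addn0 big_geq// mulr1.
  rewrite addnS factS natrM ih 1?ltnW// [in RHS]big_nat_recr//=.
  have -> : (m - d + k).+1%:R = (m + k.+1)%:R - d%:R :> R.
   by rewrite -natrB; [congr (_%:R); lia|lia].
  by ring.
 by rewrite -(H d)// subnK.
have n0 k : (k`!%:R : R) != 0 by rewrite pnatr_eq0 -lt0n fact_gt0.
have P0 : \prod_(1 <= i < d.+1) ((m + i)%:R : R) != 0.
 rewrite big_nat_cond prodf_seq_neq0; apply/allP => i _; apply/implyP => /andP[/andP[i1 _] _].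
 by rewrite pnatr_eq0; lia.
have -> : \prod_(1 <= i < d.+1) (1 - d%:R / (m + i)%:R) =
 (\prod_(1 <= i < d.+1) ((m + i)%:R - d%:R)) / \prod_(1 <= i < d.+1) ((m + i)%:R) :> R.
 rewrite -prodf_div big_nat [RHS]big_nat; apply: eq_bigr => i /andP[i1 _].
 by field; rewrite -natrD pnatr_eq0; lia.
apply: (mulIf (_ : (m + d)`!%:R * (m - d)`!%:R != 0)); first by rewrite mulf_neq0.
rewrite F1 -F2 G1 {2}G2.
by field.
Qed.
Lemma sq_ext (u v : nat -> R) (l : R) : (\forall p \near \oo, u p = v p) -> u @ \oo --> l -> v @ \oo --> l.
Proof. by move=> uv; apply: cvg_trans; apply: near_eq_cvg. Qed.
Lemma sqM (u v : nat -> R) (a b : R) : u @ \oo --> a -> v @ \oo --> b ->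
 (fun n => u n * v n) @ \oo --> a * b.
Proof. exact: cvgM. Qed.
Lemma sqD (u v : nat -> R) (a b : R) : u @ \oo --> a -> v @ \oo --> b ->
 (fun n => u n + v n) @ \oo --> a + b.
Proof. exact: cvgD. Qed.
Lemma sqC (a : R) : (fun _ : nat => a) @ \oo --> a.
Proof. exact: cvg_cst. Qed.
(** A crude linear lower bound, made to give a geometric majorant for the cosine sum. *)
Lemma sin_lb (x : R) : 0 <= x <= pi / 2 -> x / 8 <= sin x.
Proof.
move=> /andP[x0 xp].
have [x1|x1] := leP x (1 / 2).
 have := abs_sinB_le x; rewrite ler_norml ger0_norm// => /andP[h _]; nra.
have h12 : 1 / 4 <= sin (1 / 2) :> R.
 have := abs_sinB_le (1 / 2 : R); rewrite ler_norml ger0_norm; lra.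
have x2 : x <= 2 by have := @pihalf_lt2 R; lra.
have : sin (1 / 2) <= sin x.
 have p4 : (1 / 2 : R) <= pi / 2 by have := @pi_ge2 R; lra.
 apply: (@ger0_derive1_le_cc R sin 0 (pi / 2)).
 - by move=> t _; have [] := is_derive_sin t.
 - move=> t /andP[]; rewrite !bnd_simp => t0 tp; rewrite derive1E.
  by have [_ ->] := is_derive_sin t; apply: cos_ge0_pihalf; rewrite (ltW tp) andbT; have := @pi_gt0 R; lra.
 - by apply: within_deriv => t; exact: is_derive_sin.
 - by rewrite in_itv /= p4 andbT; lra.
 - by rewrite in_itv /= x0 xp.
 - exact: ltW.
lra.
Qed.
Lemma cos2m_le (x : R) m : cos x ^+ (2 * m) <= expR (- (m%:R * sin x ^+ 2)).
Proof.
rewrite exprM cos2sin2 -[- (m%:R * _)]mulrN expRM_natl lerXn2r ?nnegrE ?expR_ge0 -?cos2sin2 ?sqr_ge0// cos2sin2.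
exact: expR_ge1Dx.
Qed.
Lemma cos2m_ge (x : R) m : sin x ^+ 2 <= 2^-1 ->
 expR (- (m%:R * (sin x ^+ 2 + 2 * sin x ^+ 4))) <= cos x ^+ (2 * m).
Proof.
move=> s2; rewrite exprM cos2sin2 -[- (m%:R * _)]mulrN expRM_natl lerXn2r ?nnegrE ?expR_ge0 -?cos2sin2 ?sqr_ge0// cos2sin2.
have := @exp_lb (sin x ^+ 2); rewrite sqr_ge0 s2 => /(_ isT).
by rewrite opprD -exprM.
Qed.
Definition thterm (t : R) (j : nat) : R := expR (- (pi * t * (j.+1 ^ 2)%:R)).
Definition psi (t : R) : R := limn (series (thterm t)).

Lemma thterm_le (t : R) j : 0 < t -> thterm t j <= expR (- (pi * t)) * expR (- (pi * t)) ^+ j.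
Proof.
move=> t0; rewrite -exprS -expRM_natl ler_expR mulrN lerN2 mulrC ler_wpM2l//.
 by rewrite mulr_ge0 ?pi_ge0// ltW.
by rewrite ler_nat; nia.
Qed.
Lemma expRN_lt1 (t : R) : 0 < t -> expR (- (pi * t)) < 1.
Proof. by move=> t0; rewrite -expR0 ltr_expR oppr_lt0 mulr_gt0// pi_gt0. Qed.
Lemma psi_cvg (t : R) : 0 < t -> series (thterm t) @ \oo --> psi t.
Proof.
move=> t0; set q := expR (- (pi * t)).
have G : cvgn (series (fun n => q * q ^+ n)).
 have -> : (fun n => q * q ^+ n) = geometric q q by [].
 by apply: is_cvg_geometric_series; rewrite ger0_norm ?expR_ge0// expRN_lt1.
have : cvgn (series (thterm t)); last by [].
apply: (series_le_cvg _ _ _ G) => n; first exact: expR_ge0.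
 by rewrite mulr_ge0 ?exprn_ge0 ?expR_ge0.
exact: thterm_le.
Qed.

Section identity.
Variable t : R.
Hypothesis t0 : 0 < t.
Let l (p : nat) : nat := (2 * p).+1.
Let L (p : nat) : R := (l p)%:R.
(** With m about t l^2 / pi, cos(pi j / l)^(2m) tends to exp(- pi t j^2), while the binomial ratio
    at offset j l behaves like exp(- (j l)^2 / m) and tends to exp(- pi j^2 / t). *)
Let m (p : nat) : nat := Num.truncn (t * L p ^+ 2 / pi).
Let M p : R := (m p)%:R.
Let L0 p : 0 < L p. Proof. by rewrite ltr0n. Qed.
Let mP p : M p <= t * L p ^+ 2 / pi < M p + 1.
Proof.
have h : 0 <= t * L p ^+ 2 / pi.
 by rewrite divr_ge0 ?pi_ge0// mulr_ge0 ?sqr_ge0// ltW.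
by have := truncn_itv h; rewrite natr1.
Qed.
Let Linv : (fun p => (L p)^-1) @ \oo --> (0 : R).
Proof.
apply: (@squeeze_cvgr _ _ _ _ (cst 0) (fun p => harmonic p)).
- near=> p; rewrite invr_ge0 ltW//= /harmonic lef_pV2 ?posrE ?ltr0n//.
 by rewrite ler_nat /l; lia.
- exact: cvg_cst.
- exact: cvg_harmonic.
Unshelve. all: by end_near. Qed.
Let rat1 : (fun p => M p / L p ^+ 2) @ \oo --> t / pi.
Proof.
have L2 : (fun p => (L p)^-1 ^+ 2) @ \oo --> (0 : R).
 by rewrite -[X in _ --> X](mulr0 0); apply: cvgM.
apply: (@squeeze_cvgr _ _ _ _ (fun p => t / pi - (L p)^-1 ^+ 2) (cst (t / pi))).
- near=> p; have /andP[h1 h2] := mP p.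
 have l2 : 0 < L p ^+ 2 by rewrite exprn_gt0.
 rewrite exprVn ler_pdivlMr// mulrBl mulVf ?gt_eqF//= ler_pdivrMr// mulrAC.
 by rewrite h1 andbT lerBlDr ltW.
- by rewrite -[X in _ --> X]subr0; apply: cvgB => //; exact: cvg_cst.
- exact: cvg_cst.
Unshelve. all: by end_near. Qed.
Let tpi0 : 0 < t / pi. Proof. by rewrite divr_gt0// pi_gt0. Qed.
Let near_rat : \forall p \near \oo, t / pi / 2 <= M p / L p ^+ 2.
Proof.
move/cvgrPdist_lt : rat1 => /(_ (t / pi / 2)); rewrite divr_gt0// => /(_ isT).
apply: filterS => p; rewrite ltr_norml; lra.
Qed.
Let near_Mpos : \forall p \near \oo, 0 < M p.
Proof.
apply: filterS near_rat => p h.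
have : 0 < M p / L p ^+ 2 by apply: lt_le_trans h; rewrite divr_gt0.
by rewrite pmulr_lgt0// invr_gt0 exprn_gt0.
Qed.
Let rat2 : (fun p => L p ^+ 2 / M p) @ \oo --> pi / t.
Proof.
have -> : pi / t = (t / pi)^-1 by rewrite invf_div.
have : (fun p => (M p / L p ^+ 2)^-1) @ \oo --> (t / pi)^-1.
 by apply: cvgV => //; rewrite gt_eqF.
by under eq_fun do rewrite invf_div.
Qed.
Let Minv : (fun p => (M p)^-1) @ \oo --> (0 : R).
Proof.
have L2 : (fun p => (L p)^-1 ^+ 2) @ \oo --> (0 : R).
 by rewrite -[X in _ --> X](mulr0 0); apply: cvgM.
have := sqM rat2 L2; rewrite mulr0; apply: sq_ext.
near=> p; rewrite exprVn /=; field.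
by rewrite !gt_eqF//; near: p; exact: near_Mpos.
Unshelve. all: by end_near. Qed.
Let a p j : R := if (j < p)%N then cos (pi * j.+1%:R / L p) ^+ (2 * m p) else 0.

Local Notation ang j p := (pi * j.+1%:R / L p).

Let angle p j : (j < p)%N -> 0 <= ang j p <= pi / 2.
Proof.
move=> jp; have pi0 := @pi_gt0 R.
rewrite divr_ge0 ?(ltW (L0 p)) ?mulr_ge0 ?pi_ge0//=.
rewrite ler_pdivrMr// mulrAC -mulrA ler_pM2l// ler_pdivlMr//.
by rewrite /L -natrM ler_nat /l; lia.
Qed.
Let xlim j : (fun p => pi * j.+1%:R / L p) @ \oo --> (0 : R).
Proof.
rewrite -[X in _ --> X](mulr0 (pi * j.+1%:R)).
by apply: cvgM => //; exact: cvg_cst.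
Qed.
Let Mx2 j : (fun p => M p * (ang j p) ^+ 2) @ \oo --> pi * t * (j.+1 ^ 2)%:R.
Proof.
have := sqM rat1 (@sqC (pi ^+ 2 * j.+1%:R ^+ 2)).
have -> : t / pi * (pi ^+ 2 * j.+1%:R ^+ 2) = pi * t * (j.+1 ^ 2)%:R.
 by rewrite natrX; move: (lt0r_neq0 (pi_gt0 R)); move: (pi : R) => P P0; field.
apply: sq_ext; near=> p => /=.
by field; rewrite gt_eqF.
Unshelve. all: by end_near. Qed.
Let sinx_x j : (fun p => sin (ang j p) / (ang j p)) @ \oo --> (1 : R).
Proof.
have X := xlim j.
apply: (@squeeze_cvgr _ _ _ _ (fun p => 1 - pi * j.+1%:R / L p) (fun p => 1 + pi * j.+1%:R / L p)).
- near=> p; set x := _ / L p.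
 have x0 : 0 < x by rewrite divr_gt0// mulr_gt0 ?pi_gt0.
 have := abs_sinB_le x; rewrite ler_norml gtr0_norm// => /andP[h1 h2].
 rewrite ler_pdivlMr// ler_pdivrMr//; nra.
- by rewrite -[X in _ --> X]subr0; apply: cvgB => //; exact: cvg_cst.
- by rewrite -[X in _ --> X]addr0; apply: cvgD => //; exact: cvg_cst.
Unshelve. all: by end_near. Qed.
Let Ms2 j : (fun p => M p * sin (ang j p) ^+ 2) @ \oo --> pi * t * (j.+1 ^ 2)%:R.
Proof.
have S2 := sqM (@sinx_x j) (@sinx_x j); rewrite mulr1 in S2.
have := sqM (@Mx2 j) S2; rewrite mulr1.
apply: sq_ext; near=> p => /=.
have x0 : ang j p != 0 by rewrite gt_eqF// divr_gt0// mulr_gt0 ?pi_gt0.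
move: x0; set x := pi * j.+1%:R / L p; move: (sin x) => s x0.
by field.
Unshelve. all: by end_near. Qed.
Let s2lim j : (fun p => sin (ang j p) ^+ 2) @ \oo --> (0 : R).
Proof.
have := sqM (@Ms2 j) Minv; rewrite mulr0; apply: sq_ext.
near=> p => /=; rewrite mulrAC divff ?mul1r//.
by rewrite gt_eqF//; near: p; exact: near_Mpos.
Unshelve. all: by end_near. Qed.
Let a_lim j : a ^~ j @ \oo --> thterm t j.
Proof.
have Ms4 : (fun p => M p * (sin (ang j p) ^+ 2 + 2 * sin (ang j p) ^+ 4))
  @ \oo --> pi * t * (j.+1 ^ 2)%:R.
 have := sqD (@Ms2 j) (sqM (@sqC (2)) (sqM (@Ms2 j) (@s2lim j))).
 rewrite !mulr0 addr0; apply: sq_ext; near=> p => /=.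
 by rewrite mulrDr; congr (_ + _); ring.
apply: (@squeeze_cvgr _ _ _ _
 (fun p => expR (- (M p * (sin (ang j p) ^+ 2 + 2 * sin (ang j p) ^+ 4))))
 (fun p => expR (- (M p * sin (ang j p) ^+ 2)))).
- near=> p; have jp : (j < p)%N by near: p; exists j.+1.
 rewrite /a jp cos2m_le andbT cos2m_ge//.
 near: p; have h2 : 0 < 2^-1 :> R by rewrite invr_gt0.
 move/cvgrPdist_lt : (@s2lim j) => /(_ _ h2); apply: filterS => p.
 by rewrite sub0r normrN ger0_norm ?sqr_ge0// => /ltW.
- by apply: continuous_cvg; [exact: continuous_expR|exact: cvgN].
- by apply: continuous_cvg; [exact: continuous_expR|exact: cvgN].
Unshelve. all: by end_near. Qed.
Let qa := expR (- (pi * t / 128)).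

Let a_dom : \forall p \near \oo, forall j, `|a p j| <= 1 * qa ^+ j.
Proof.
apply: filterS near_rat => p h j; rewrite mul1r /a.
case: ifPn => jp; last by rewrite normr0 exprn_ge0// expR_ge0.
rewrite ger0_norm; last by rewrite exprM exprn_ge0// sqr_ge0.
rewrite (le_trans (cos2m_le _ _))// /qa -expRM_natl ler_expR mulrN lerN2.
have /andP[x0 x1] := angle jp; have sl := sin_lb (angle jp).
set x := pi * _ / _ in x0 x1 sl *.
apply: (@le_trans _ _ (M p * (x / 8) ^+ 2)); last first.
 by rewrite ler_wpM2l// lerXn2r// nnegrE ?(le_trans _ sl)// divr_ge0.
have -> : M p * (x / 8) ^+ 2 = (M p / L p ^+ 2) * (pi ^+ 2 * (j.+1%:R ^+ 2) / 64).
 by rewrite /x; field; rewrite gt_eqF.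
apply: (@le_trans _ _ (t / pi / 2 * (pi ^+ 2 * (j.+1%:R ^+ 2) / 64))); last first.
 by rewrite ler_wpM2r// divr_ge0// mulr_ge0// sqr_ge0.
have -> : t / pi / 2 * (pi ^+ 2 * (j.+1%:R ^+ 2) / 64) = pi * t / 128 * j.+1%:R ^+ 2.
 by move: (lt0r_neq0 (pi_gt0 R)); move: (pi : R) => P P0; field.
rewrite mulrC ler_wpM2l ?divr_ge0 ?mulr_ge0 ?pi_ge0 ?(ltW t0)//.
by rewrite -natrX ler_nat; nia.
Qed.
Let LHS_lim : (fun p => \sum_(1 <= j < p.+1) cos (pi * j%:R / L p) ^+ (2 * m p)) @ \oo --> psi t.
Proof.
have q1 : 0 <= qa < 1.
 by rewrite expR_ge0 /= -expR0 ltr_expR oppr_lt0 divr_gt0// mulr_gt0// pi_gt0.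
have := @tannery a (thterm t) 1 qa (psi t) ler01 q1 a_dom a_lim (psi_cvg t0) id.
move=> H; apply: sq_ext (H _); last first.
 by move=> p j; rewrite /a ltnNge => ->.
near=> p => /=.
rewrite big_add1 /= big_nat [RHS]big_nat.
by apply: eq_bigr => j /andP[_ jp]; rewrite /a jp.
Unshelve. all: by end_near. Qed.
Let b p j : R := ('C(2 * m p, m p + j.+1 * l p))%:R / ('C(2 * m p, m p))%:R.

Let Cpos p : 0 < ('C(2 * m p, m p))%:R :> R.
Proof. by rewrite ltr0n bin_gt0; lia. Qed.
Let b_prod p j : (j.+1 * l p <= m p)%N ->
 b p j = \prod_(1 <= i < (j.+1 * l p).+1) (1 - (j.+1 * l p)%:R / (m p + i)%:R).
Proof. by move=> h; rewrite /b bin_ratio// mulrC mulKf// gt_eqF. Qed.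
Let b_ub p j : (j.+1 * l p <= m p)%N -> 0 < M p ->
 b p j <= expR (- ((j.+1 * l p)%:R ^+ 2 / (m p + j.+1 * l p)%:R)).
Proof.
move=> h M0; rewrite b_prod//; set d := (j.+1 * l p)%N in h *.
have d0 : (0 < d)%N by rewrite muln_gt0.
have -> : expR (- (d%:R ^+ 2 / (m p + d)%:R)) = \prod_(1 <= i < d.+1) expR (- (d%:R / (m p + d)%:R)) :> R.
 rewrite big_const_nat iter_mulr_1 subn1 /= -expRM_natl; congr expR.
 by rewrite expr2 mulrN mulrA.
rewrite big_nat [leRHS]big_nat; apply: ler_prod => i /andP[i1 id].
have mi : 0 < (m p + i)%:R :> R by rewrite ltr0n; lia.
rewrite subr_ge0 ler_pdivrMr// mul1r ler_nat (leq_trans h)/= ?leq_addr//.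
apply: (le_trans (expR_ge1Dx _)); rewrite ler_expR lerN2.
rewrite ler_wpM2l// lef_pV2 ?posrE//; last by rewrite ltr0n; lia.
by rewrite ler_nat; lia.
Qed.
Let b_lb p j : (2 * (j.+1 * l p) <= m p)%N -> 0 < M p ->
 expR (- ((j.+1 * l p)%:R ^+ 2 / M p + 2 * ((j.+1 * l p)%:R ^+ 3 / M p ^+ 2))) <= b p j.
Proof.
move=> h M0; set d := (j.+1 * l p)%N in h *.
have d0 : (0 < d)%N by rewrite muln_gt0.
rewrite b_prod -/d; last lia.
have -> : expR (- (d%:R ^+ 2 / M p + 2 * (d%:R ^+ 3 / M p ^+ 2))) =
 \prod_(1 <= i < d.+1) expR (- (d%:R / M p) - 2 * (d%:R / M p) ^+ 2) :> R.
 rewrite big_const_nat iter_mulr_1 subn1 /= -expRM_natl; congr expR.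
 by field; rewrite gt_eqF.
rewrite big_nat [leRHS]big_nat; apply: ler_prod => i /andP[i1 id].
rewrite expR_ge0 /=.
have u0 : 0 <= d%:R / M p <= 2^-1.
 rewrite divr_ge0//= ler_pdivrMr// mulrC ler_pdivlMr// mulrC /M -natrM ler_nat//.
rewrite (le_trans (exp_lb u0))// lerB// ler_wpM2l// lef_pV2 ?posrE ?ltr0n//; try lia.
 by rewrite ler_nat leq_addr.
Qed.
Let dL p j : (j.+1 * l p)%:R = j.+1%:R * L p :> R. Proof. by rewrite natrM. Qed.
Let near_small j : \forall p \near \oo, (2 * (j.+1 * l p) <= m p)%N.
Proof.
have LM : (fun p => L p / M p) @ \oo --> (0 : R).
 have := sqM rat2 Linv; rewrite mulr0; apply: sq_ext.
 near=> p => /=; field; rewrite !gt_eqF//; near: p; exact: near_Mpos.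
have e0 : 0 < (2 * j.+1%:R)^-1 :> R by rewrite invr_gt0 mulr_gt0.
move/cvgrPdist_lt : LM => /(_ _ e0) LM.
near=> p; have M0 : 0 < M p by near: p; exact: near_Mpos.
have : L p / M p < (2 * j.+1%:R)^-1.
 rewrite -[ltLHS]ger0_norm ?divr_ge0 ?ltW//.
 by have : `|0 - L p / M p| < (2 * j.+1%:R)^-1; [near: p|rewrite sub0r normrN].
rewrite ltr_pdivrMr// mulrC ltr_pdivlMr// => h.
by rewrite -(@ler_nat R) !natrM -/(L p) -/(M p); move: h; lra.
Unshelve. all: by end_near. Qed.
Let d2M j : (fun p => (j.+1 * l p)%:R ^+ 2 / M p) @ \oo --> pi * t^-1 * (j.+1 ^ 2)%:R.
Proof.
have := sqM rat2 (@sqC (j.+1%:R ^+ 2)).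
have -> : pi / t * j.+1%:R ^+ 2 = pi * t^-1 * (j.+1 ^ 2)%:R by rewrite natrX.
apply: sq_ext; near=> p => /=.
by rewrite dL; ring.
Unshelve. all: by end_near. Qed.
Let b_lim j : b ^~ j @ \oo --> thterm t^-1 j.
Proof.
have dM : (fun p => (j.+1 * l p)%:R / M p) @ \oo --> (0 : R).
 have := sqM (@d2M j) Linv; rewrite mulr0 => H.
 have := sqM H (@sqC (j.+1%:R^-1)); rewrite mul0r.
 apply: sq_ext.
 near=> p => /=; rewrite dL; have := L0 p; have : (0 : R) < j.+1%:R by [].
 by move: (j.+1%:R) (L p) (M p)^-1 => J LL MM J0 LL0; field; rewrite !gt_eqF.
have D3 : (fun p => (j.+1 * l p)%:R ^+ 2 / M p + 2 * ((j.+1 * l p)%:R ^+ 3 / M p ^+ 2)) @ \oo -->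
  pi * t^-1 * (j.+1 ^ 2)%:R.
 have := sqD (@d2M j) (sqM (@sqC (2)) (sqM (@d2M j) dM)).
 rewrite !mulr0 addr0; apply: sq_ext; near=> p => /=.
 by rewrite [_ ^+ 3]exprS [M p ^+ 2]expr2 invfM; ring.
have D4 : (fun p => (j.+1 * l p)%:R ^+ 2 / (m p + j.+1 * l p)%:R) @ \oo --> pi * t^-1 * (j.+1 ^ 2)%:R.
 have V : (fun p => (1 + (j.+1 * l p)%:R / M p)^-1) @ \oo --> (1 : R)^-1.
  apply: cvgV; first exact: oner_neq0.
  by rewrite -[X in _ --> X]addr0; apply: cvgD => //; exact: cvg_cst.
 have := sqM (@d2M j) V; rewrite invr1 mulr1.
 apply: sq_ext; near=> p => /=.
 have M0 : 0 < M p by near: p; exact: near_Mpos.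
 rewrite natrD -/(M p).
 have : 0 <= (j.+1 * l p)%:R :> R by [].
 move: ((j.+1 * l p)%:R : R) => d d0; field.
 by rewrite !gt_eqF// ltr_wpDr.
apply: (@squeeze_cvgr _ _ _ _
 (fun p => expR (- ((j.+1 * l p)%:R ^+ 2 / M p + 2 * ((j.+1 * l p)%:R ^+ 3 / M p ^+ 2))))
 (fun p => expR (- ((j.+1 * l p)%:R ^+ 2 / (m p + j.+1 * l p)%:R)))).
- near=> p; have M0 : 0 < M p by near: p; exact: near_Mpos.
 have sm : (2 * (j.+1 * l p) <= m p)%N by near: p; exact: near_small.
 by rewrite b_lb//= b_ub//; lia.
- by apply: continuous_cvg; [exact: continuous_expR|exact: cvgN].
- by apply: continuous_cvg; [exact: continuous_expR|exact: cvgN].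
Unshelve. all: by end_near. Qed.
Let qb := expR (- (pi / t / 2)).

Let b_dom : \forall p \near \oo, forall j, `|b p j| <= 1 * qb ^+ j.
Proof.
apply: filterS near_Mpos => p M0 j; rewrite mul1r.
rewrite ger0_norm; last by rewrite divr_ge0.
have [h|h] := leqP (j.+1 * l p) (m p); last first.
 by rewrite /b bin_small ?mul0r ?exprn_ge0 ?expR_ge0//; lia.
rewrite (le_trans (b_ub h M0))// /qb -expRM_natl ler_expR mulrN lerN2.
set d := (j.+1 * l p)%N in h *.
apply: (@le_trans _ _ (d%:R ^+ 2 / (2 * M p))); last first.
 rewrite ler_wpM2l ?sqr_ge0// lef_pV2 ?posrE ?mulr_gt0//; last by rewrite ltr0n; move: M0; rewrite /M ltr0n; lia.
 by rewrite natrD mulr_natl mulr2n lerD2l ler_nat.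
have /andP[h1 _] := mP p.
have -> : d%:R ^+ 2 / (2 * M p) = j.+1%:R ^+ 2 * (L p ^+ 2 / M p / 2).
 by rewrite /d dL; field; rewrite gt_eqF.
apply: ler_pM; rewrite ?divr_ge0 ?pi_ge0 ?(ltW t0)//.
 by rewrite -natrX ler_nat; nia.
rewrite ler_wpM2r ?invr_ge0// ler_pdivrMr// mulrAC ler_pdivlMr//.
by move: h1; rewrite ler_pdivlMr ?pi_gt0// => h1; rewrite mulrC [leRHS]mulrC.
Qed.
Let RHS_lim : (fun p => \sum_(1 <= n < (m p).+1) ('C(2 * m p, m p + n * l p))%:R / ('C(2 * m p, m p))%:R) @ \oo --> psi t^-1.
Proof.
have q1 : 0 <= qb < 1.
 by rewrite expR_ge0 /= -expR0 ltr_expR oppr_lt0 divr_gt0// divr_gt0// pi_gt0.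
have ti : 0 < t^-1 by rewrite invr_gt0.
have := @tannery b (thterm t^-1) 1 qb (psi t^-1) ler01 q1 b_dom b_lim (psi_cvg ti) m.
move=> H; apply: sq_ext (H _); last first.
 move=> p j mj; rewrite /b bin_small ?mul0r// /l; nia.
near=> p => /=.
by rewrite [RHS]big_add1.
Unshelve. all: by end_near. Qed.
(** The squared identity with the Wallis limit [w] still unknown; squaring keeps square roots of m
    out of the limit. *)
Lemma theta_pre (w : R) : (fun m : nat => m%:R * cbr m ^+ 2) @ \oo --> w ->
 (1 + 2 * psi t) ^+ 2 = pi / t * w * (1 + 2 * psi t^-1) ^+ 2.
Proof.
move=> Hw.
have mo : m @ \oo --> \oo.
 apply/cvgnyPge => A; have : \forall p \near \oo, (M p)^-1 < A.+1%:R^-1.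
  have e0 : 0 < A.+1%:R^-1 :> R by rewrite invr_gt0.
  move/cvgrPdist_lt : Minv => /(_ _ e0); apply: filterS => p.
  by rewrite sub0r normrN ger0_norm// invr_ge0.
 move=> H; near=> p; have M0 : 0 < M p by near: p; exact: near_Mpos.
 have : (M p)^-1 < A.+1%:R^-1 by near: p.
 by rewrite ltf_pV2 ?posrE// /M ltr_nat => /ltnW/ltnW.
have Hw' : (fun p => M p * cbr (m p) ^+ 2) @ \oo --> w.
 by apply: (cvg_comp m (fun k : nat => k%:R * cbr k ^+ 2)); [exact: mo|exact: Hw].
have R1 : (fun p => (L p ^+ 2 / M p) * (M p * cbr (m p) ^+ 2) *
 ((1 + 2 * \sum_(1 <= n < (m p).+1) ('C(2 * m p, m p + n * l p))%:R / ('C(2 * m p, m p))%:R) *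
  (1 + 2 * \sum_(1 <= n < (m p).+1) ('C(2 * m p, m p + n * l p))%:R / ('C(2 * m p, m p))%:R))) @ \oo
 --> pi / t * w * ((1 + 2 * psi t^-1) * (1 + 2 * psi t^-1)).
 have A : (fun p => 1 + 2 * \sum_(1 <= n < (m p).+1) ('C(2 * m p, m p + n * l p))%:R / ('C(2 * m p, m p))%:R : R) @ \oo --> 1 + 2 * psi t^-1.
  apply: cvgD; first exact: cvg_cst.
  by apply: cvgM; [exact: cvg_cst|exact: RHS_lim].
 by apply: cvgM; [exact: cvgM|exact: cvgM].
have R2 : (fun p => (1 + 2 * \sum_(1 <= j < p.+1) cos (pi * j%:R / L p) ^+ (2 * m p)) *
  (1 + 2 * \sum_(1 <= j < p.+1) cos (pi * j%:R / L p) ^+ (2 * m p))) @ \oo -->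
 (1 + 2 * psi t) * (1 + 2 * psi t).
 have A : (fun p => 1 + 2 * \sum_(1 <= j < p.+1) cos (pi * j%:R / L p) ^+ (2 * m p)) @ \oo --> 1 + 2 * psi t.
  apply: cvgD; first exact: cvg_cst.
  by apply: cvgM; [exact: cvg_cst|exact: LHS_lim].
 exact: cvgM.
rewrite !expr2; apply: (cvg_unique _ R2); first exact: Rhausdorff.
apply: sq_ext R1; near=> p => /=.
have M0 : 0 < M p by near: p; exact: near_Mpos.
have := @polya R p (m p); cbv zeta; rewrite -/(l p) -/(L p) => P.
have C0 := Cpos p.
have p4 : (0 : R) < 4 ^+ m p by rewrite exprn_gt0.
have -> : 1 + 2 * \sum_(1 <= j < p.+1) cos (pi * j%:R / L p) ^+ (2 * m p) =
 L p * cbr (m p) * (1 + 2 * \sum_(1 <= n < (m p).+1) ('C(2 * m p, m p + n * l p))%:R / ('C(2 * m p, m p))%:R).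
 apply: (mulfI (lt0r_neq0 p4)); rewrite P -mulr_suml /cbr; field.
 by rewrite !gt_eqF.
by field; rewrite gt_eqF.
Unshelve. all: by end_near. Qed.

End identity.

Lemma psi_ge0 (t : R) : 0 < t -> 0 <= psi t.
Proof.
move=> t0; apply: (cvgr_to_ge (psi_cvg t0)); near=> n.
by rewrite /series /= sumr_ge0// => i _; exact: expR_ge0.
Unshelve. all: by end_near. Qed.

Theorem theta_id (t : R) : 0 < t -> 1 + 2 * psi t^-1 = Num.sqrt t * (1 + 2 * psi t).
Proof.
move=> t0; have [w w0 Hw] := wallis_cvg.
have E1 := @theta_pre 1 ltr01 w Hw; rewrite !invr1 mulr1 in E1.
have Et := @theta_pre t t0 w Hw.
have p1 : 0 < 1 + 2 * psi 1 by have := psi_ge0 ltr01; lra.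
have pt := psi_ge0 t0.
have pti : 0 <= psi t^-1 by apply: psi_ge0; rewrite invr_gt0.
(* At [t = 1] the two theta factors coincide and are positive, which determines [w]. *)
have pw : pi * w = 1.
 apply: (mulIf (_ : (1 + 2 * psi 1) ^+ 2 != 0)); last by rewrite -E1 mul1r.
 by rewrite gt_eqF// exprn_gt0.
have : (1 + 2 * psi t^-1) ^+ 2 = (Num.sqrt t * (1 + 2 * psi t)) ^+ 2.
 rewrite exprMn sqr_sqrtr ?(ltW t0)// Et.
 have -> : pi / t * w = t^-1 by rewrite mulrAC pw mul1r.
 by rewrite mulVKf// gt_eqF.
move/eqP; rewrite eqrXn2// ?mulr_ge0 ?sqrtr_ge0//; try lra.
Qed.

End Limits.

(** * The completed zeta function *)

Section Xi.
Variable R : realType.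
Notation cnt := (@counting nat R).
Notation mu := (@lebesgue_measure R).
Local Notation C := R[i].

Lemma fold_line (f : R -> R) v : continuous f -> (forall u, 0 <= f u) -> hasI mu setT f v ->
 hasI mu `[0, +oo[ (fun u => f u + f (- u)) v.
Proof.
move=> cf f0 H.
have cfN : continuous (fun u : R => f (- u)) by move=> u; apply: continuous_comp; [exact: opp_continuous|exact: cf].
have mf : measurable_fun setT f by exact: continuous_measurable_fun.
have mfN : measurable_fun setT (fun u : R => f (- u)) by exact: continuous_measurable_fun.
apply: EFin_hasI.
- exact: mitv.
- by have h : measurable_fun (ray R) (fun u => f u + f (- u)) by [apply: measurable_funTS; exact: (measurable_funD mf mfN)]; exact: h.
- by move=> u _; rewrite addr_ge0.
have E1 : (\int[mu]_(u in `[0%R, +oo[) (f u + f (- u))%:E =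
 \int[mu]_(u in `[0%R, +oo[) (f u)%:E + \int[mu]_(u in `[0%R, +oo[) (f (- u))%:E)%E.
 under eq_integral do rewrite EFinD.
 have m1 : measurable_fun (ray R) (EFin \o f) by apply/measurable_EFinP/measurable_funTS.
 have m2 : measurable_fun (ray R) (EFin \o (fun u : R => f (- u))) by apply/measurable_EFinP/measurable_funTS.
 apply: ge0_integralD; [exact: mitv|by move=> u _; rewrite lee_fin|exact: m1|by move=> u _; rewrite lee_fin|exact: m2].
have cfw : {within `]-oo, (- 0)%R], continuous f} by exact: continuous_subspaceT.
have E2 := @ge0_integration_by_substitutionNy R f 0 cfw (fun u _ => f0 u).
rewrite E1 -E2 -(hasI_EFin measurableT H) oppr0.
have U : [set: R] = `]-oo, 0%R] `|` `]0%R, +oo[.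
 by apply/seteqP; split => // u _ /=; rewrite !in_itv /= andbT; case: lerP; [left|right].
rewrite U ge0_integral_setU//=.
- by rewrite addeC integral_itv_obnd_cbnd//; apply/measurable_EFinP/measurable_funTS.
- by rewrite -U; apply/measurable_EFinP.
- by move=> u _; rewrite lee_fin.
- by apply/disj_setPS => u [] /=; rewrite !in_itv /= andbT => h1 h2; move: h1; rewrite leNgt h2.
Qed.
Definition thk (x : R) n (u : R) := thterm (expR u) n * expR (x * u).

Lemma cont_thterm n : continuous (fun u : R => thterm (expR u) n).
Proof.
move=> u; rewrite /thterm; apply: continuous_comp; last exact: continuous_expR.
apply: cvgN; apply: cvgM; last exact: cvg_cst.
by apply: cvgM; [exact: cvg_cst|exact: continuous_expR].
Qed.
Lemma cont_thk x n : continuous (thk x n).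
Proof. by move=> u; apply: cvgM; [exact: cont_thterm|exact: cont_expM]. Qed.
Lemma thk_ge0 x n u : 0 <= thk x n u. Proof. by rewrite mulr_ge0// expR_ge0. Qed.
Definition lnpi : R := ln pi.

(** Translating u by the logarithm of pi (n + 1)^2 turns the theta term of index n into the Gamma
    integrand. *)
Lemma hasI_thk x n : 0 < x -> hasI mu setT (thk x n) (expR (- x * lnpi) * Gr x * expR (2 * x * - lnS R n)).
Proof.
move=> x0; pose c : R := lnpi + 2 * lnS R n.
have ec : expR c = pi * (n.+1 ^ 2)%:R.
 have -> : c = lnpi + (lnS R n + lnS R n) by rewrite /c; ring.
 by rewrite !expRD lnK ?posrE ?pi_gt0// expR_lnS -natrM mulnn.
have H := hasI_shift c (hasI_Gr x0).
have -> : expR (- x * lnpi) * Gr x * expR (2 * x * - lnS R n) = expR (- x * c) * Gr x.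
 by rewrite mulrAC -expRD; congr (expR _ * _); rewrite /c; ring.
apply: eq_hasI (hasI_Z _ measurableT H) => // u _.
rewrite /thk /thterm /Gker expRD ec.
have -> : expR u * (pi * (n.+1 ^ 2)%:R) = pi * expR u * (n.+1 ^ 2)%:R by ring.
by rewrite mulrCA; congr (_ * _); rewrite -expRD; congr expR; ring.
Qed.
Definition Vx (x : R) := expR (- x * lnpi) * Gr x * zr (2 * x).

Lemma hasI_V x : 2^-1 < x -> hasI cnt setT (fun n => expR (- x * lnpi) * Gr x * expR (2 * x * - lnS R n)) (Vx x).
Proof. by move=> x2; apply: hasI_Z => //; apply: hasI_zeta; lra. Qed.
Definition Psi (u : R) := psi (expR u).

Lemma hasI_Psi u : hasI cnt setT (fun n => thterm (expR u) n) (Psi u).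
Proof. by apply: series_count; [move=> n; exact: expR_ge0|apply: psi_cvg; exact: expR_gt0]. Qed.
Lemma meas_Psi : measurable_fun (ray0 R) Psi.
Proof.
have mk : measurable_fun ([set: nat] `*` (ray0 R)) (fun z : nat * R => thterm (expR z.2) z.1).
 apply: (@meas_nat_prod _ (mR R) R `[0, +oo[ (fun n u => thterm (expR u) n)); first exact: mitv.
 move=> n; have h : measurable_fun (ray R) (fun u => thterm (expR u) n).
  by apply: measurable_funTS; apply: continuous_measurable_fun; exact: cont_thterm.
 exact: h.
have h := @meas_inner2 _ _ nat (mR R) R cnt setT `[0, +oo[ _ measurableT (mitv _) mk
 (fun x y _ _ => expR_ge0 _) Psi (fun u _ => hasI_Psi u).
exact: h.
Qed.
Lemma Psi_ge0 u : 0 <= Psi u. Proof. by apply: psi_ge0; exact: expR_gt0. Qed.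
Lemma Psi_theta u : Psi (- u) = expR (u / 2) * Psi u + (expR (u / 2) - 1) / 2.
Proof.
have := theta_id (expR_gt0 u); rewrite -expRN -/(Psi _) -/(Psi _).
have -> : Num.sqrt (expR u) = expR (u / 2).
 have -> : expR u = expR (u / 2) ^+ 2 by rewrite expr2 -expRD; congr expR; field.
 by rewrite sqrtr_sqr ger0_norm// expR_ge0.
move: (expR _) (Psi _) (Psi u) => e p q; lra.
Qed.
(** Riemann's computation: sum the Gamma integrals over n, fold the line onto the half-line, and use
    the theta transformation on the negative half. Its elementary terms produce the two fractions
    that are subtracted. *)
Lemma hasI_theta x : 2^-1 < x -> hasI mu `[0, +oo[ (fun u => Psi u * expR (x * u) + Psi u * expR ((2^-1 - x) * u))
 (Vx x - ((x - 2^-1)^-1 - x^-1) / 2).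
Proof.
move=> x2; have x0 : 0 < x by lra. have x20 : 0 < x - 2^-1 by lra.
pose f (z : nat * R) := thk x z.1 z.2 + thk x z.1 (- z.2).
have mf : measurable_fun ([set: nat] `*` (ray0 R)) f.
 apply: (@meas_nat_prod _ (mR R) R `[0, +oo[ (fun n u => f (n, u))); first exact: mitv.
 move=> n; have h : measurable_fun (ray R) (fun u : R => thk x n u + thk x n (- u)).
  apply: measurable_funTS; apply: continuous_measurable_fun => u; apply: cvgD; first exact: cont_thk.
  by apply: continuous_comp; [exact: opp_continuous|exact: cont_thk].
 exact: h.
have Hn (u : R) : (ray R) u ->
  hasI cnt setT (fun n => f (n, u)) (expR (x * u) * Psi u + expR (x * - u) * Psi (- u)).
 move=> _.
 apply: (@eq_hasI _ _ _ cnt setT (fun n => expR (x * u) * thterm (expR u) n + expR (x * - u) * thterm (expR (- u)) n)) => //.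
  by move=> n _; rewrite /f /thk /=; congr (_ + _); rewrite mulrC.
 by apply: hasI_D => //; apply: hasI_Z => //; exact: hasI_Psi.
have H := @tonelli _ _ nat (mR R) R cnt mu setT `[0, +oo[ f measurableT (mitv _) mf
 (fun a b _ _ => addr_ge0 (thk_ge0 _ _ _) (thk_ge0 _ _ _)) _ _ _
 (fun n _ => fold_line (@cont_thk x n) (@thk_ge0 x n) (hasI_thk n x0)) Hn (hasI_V x2).
have H2 := hasI_Z (2^-1) (mitv _) (hasI_B (mitv _) (hasI_exp0 x20) (hasI_exp0 x0)).
rewrite (_ : ((x - 2^-1)^-1 - x^-1) / 2 = 2^-1 * ((x - 2^-1)^-1 - x^-1)); last by rewrite mulrC.
apply: eq_hasI (hasI_B (mitv _) H H2); first exact: mitv.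
move=> u _; rewrite Psi_theta.
have e1 (y : R) : (2^-1 - x) * y = y / 2 + x * - y by field.
have e2 (y : R) : - (x - 2^-1) * y = y / 2 + x * - y by field.
have e3 (y : R) : - x * y = x * - y by ring.
rewrite e1 e2 e3 !expRD; move: (expR _) (expR _) (expR _) (Psi u) => a b c p.
by field.
Qed.
(** For x > 1/2 integrability is contained in [hasI_theta], and smaller x only decrease the
    integrand on the half-line. Integrability for every real x is what makes [WL] entire. *)
Lemma itg_Psi x : itg mu `[0, +oo[ (fun u => Psi u * expR (x * u)).
Proof.
have m x' : measurable_fun (ray0 R) (fun u => Psi u * expR (x' * u)).
 apply: measurable_funM; first exact: meas_Psi.
 by apply: measurable_funTS; apply: continuous_measurable_fun; exact: cont_expM.
have pos y : 2^-1 < y -> itg mu `[0, +oo[ (fun u => Psi u * expR (y * u)).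
 move=> y2; apply: itg_le (hasI_theta y2).1 _; [exact: mitv|exact: m|].
 move=> u _; rewrite ger0_norm ?mulr_ge0 ?Psi_ge0 ?expR_ge0// lerDl.
 by rewrite mulr_ge0 ?Psi_ge0 ?expR_ge0.
have [x1|x1] := ltP 2^-1 x; first exact: pos.
have h1 : 2^-1 < 1 :> R by lra.
apply: itg_le (pos 1 h1) _; [exact: mitv|exact: m|].
move=> u /=; rewrite in_itv /= andbT => u0.
rewrite ger0_norm ?mulr_ge0 ?Psi_ge0 ?expR_ge0// ler_wpM2l ?Psi_ge0// ler_expR ler_wpM2r//; lra.
Qed.
Definition WL (z : C) := Lap mu `[0, +oo[ Psi id z.

Lemma holo_WL : holo (@whole R) WL.
Proof.
move=> z _; eexists; apply: (@lap_deriv _ _ _ mu `[0, +oo[ (mitv _) Psi id (Re z - 1) (Re z + 1)).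
- exact: meas_Psi.
- exact: measurable_id.
- exact: itg_Psi.
- exact: itg_Psi.
- by lra.
Qed.
(** Riemann's formula for z (z - 1) / 2 times pi^(-z/2) Gamma(z/2) zeta(z). With the poles at 0 and
    1 multiplied out, the function is entire and invariant under z -> 1 - z by construction. *)
Definition xi (z : C) : C := 2^-1 + z * (z - 1) / 2 * (WL (z / 2) + WL ((1 - z) / 2)).

Lemma xi_sym z : xi (1 - z) = xi z.
Proof. by rewrite /xi (_ : 1 - (1 - z) = z); [rewrite [WL _ + _]addrC; congr (_ + _ * _); field|ring]. Qed.
Lemma holo_xi : holo (@whole R) xi.
Proof.
apply: holoD; first exact: holo_cst.
apply: holoM.
 by apply: holoM; [apply: holoM; [exact: holo_id|apply: holoB; [exact: holo_id|exact: holo_cst]]|exact: holo_cst].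
apply: holoD; apply: (holo_comp (D' := @whole R) (g := WL)) => //; try exact: holo_WL.
 by apply: holoM; [exact: holo_id|exact: holo_cst].
by apply: holoM; [apply: holoB; [exact: holo_cst|exact: holo_id]|exact: holo_cst].
Qed.
Lemma xi_real (s : R) : 1 < s -> xi s%:C = ((s - 1) * expR (- (s / 2) * lnpi) * Gr (s / 2 + 1) * zr s)%:C.
Proof.
move=> s1; have x2 : 2^-1 < s / 2 by lra.
have x0 : 0 < s / 2 by lra.
have h1 := hasI_itg (itg_Psi (s / 2)). have h2 := hasI_itg (itg_Psi (2^-1 - s / 2)).
have E := hasI_uniq (hasI_D (mitv _) h1 h2) (hasI_theta x2).
rewrite /xi.
have -> : s%:C / 2 = (s / 2)%:C :> C by rewrite rmorphM /= fmorphV /= rmorph_nat.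
have -> : (1 - s%:C) / 2 = (2^-1 - s / 2)%:C :> C.
 by rewrite rmorphB rmorphM /= fmorphV /= rmorph_nat; field.
rewrite /WL (Lap_real (mitv _) h1) (Lap_real (mitv _) h2).
move: E; set A := Rintegral _ _ _; set B := Rintegral _ _ _ => E.
have -> : 2^-1 + s%:C * (s%:C - 1) / 2 * (A%:C + B%:C) = (2^-1 + s * (s - 1) / 2 * (A + B))%:C :> C.
 by rewrite !rmorphD !rmorphM !rmorphD /= rmorphN /= rmorph1 !fmorphV /= rmorph_nat.
congr (_%:C); rewrite E /Vx Gr_rec//.
have -> : 2 * (s / 2) = s by field.
have -> : - (s / 2) * lnpi = - (s * lnpi / 2) by field.
move: (expR _) (Gr _) (zr _) => e g zz.
by field; rewrite !gt_eqF//; lra.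
Qed.
(** (z - 1) zeta(z), recovered from [xi] through the entire function 1 / Gamma and therefore
    entire. *)
Definition zet1 (z : C) : C := xi z * cexp (z / 2 * lnpi%:C) * rgam (z / 2 + 1).
Definition zet (z : C) : C := zet1 z * (z - 1)^-1.

Lemma holo_half (D : C -> Prop) : holo D (fun z : C => z / 2).
Proof. by apply: holoM; [exact: holo_id|exact: holo_cst]. Qed.
Lemma holo_zet1 : holo (@whole R) zet1.
Proof.
apply: holoM; first apply: holoM; first exact: holo_xi.
 by apply: holo_cexp; apply: holoM; [exact: holo_half|exact: holo_cst].
apply: (holo_comp (D' := @whole R) (g := @rgam R)) => //; last exact: holo_rgam.
by apply: holoD; [exact: holo_half|exact: holo_cst].
Qed.
Lemma Re_half (z : C) : Re (z / 2) = Re z / 2.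
Proof.
have -> : (2 : C)^-1 = (2^-1)%:C by rewrite fmorphV /= rmorph_nat.
by rewrite reimE /= mulr0 subr0.
Qed.
Lemma xi_zet1 z : -2 < Re z -> xi z = zet1 z * cexp (- (z / 2 * lnpi%:C)) * cgam (z / 2 + 1).
Proof.
move=> z2; have h : 0 < Re (z / 2 + 1) by rewrite ReD Re_half /=; lra.
rewrite /zet1 rgam_pos//; set e := z / 2 * lnpi%:C; set g := cgam _.
have e1 : cexp e * cexp (- e) = 1 by rewrite -cexpD subrr cexp0.
have g1 : g^-1 * g = 1 by rewrite mulVf// cgam_neq0.
rewrite (_ : _ * cexp (- e) * g = xi z * (cexp e * cexp (- e)) * (g^-1 * g)); last by ring.
by rewrite e1 g1 !mulr1.
Qed.
Lemma zet1_real (s : R) : 1 < s -> zet1 s%:C = ((s - 1) * zr s)%:C.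
Proof.
move=> s1; rewrite /zet1 xi_real//.
have -> : s%:C / 2 = (s / 2)%:C :> C by rewrite rmorphM /= fmorphV /= rmorph_nat.
have -> : (s / 2)%:C + 1 = (s / 2 + 1)%:C :> C by rewrite rmorphD rmorph1.
have h : 0 < s / 2 + 1 by lra.
rewrite rgam_pos//= cgam_real// -rmorphM cexpR -fmorphV -!rmorphM /=; congr (_%:C).
have g0 := Gr_gt0 h.
rewrite mulNr expRN; have e0 := expR_gt0 (s / 2 * lnpi).
move: (expR _) (Gr _) (zr _) e0 g0 => e g zz e0 g0.
by field; rewrite !gt_eqF.
Qed.
Definition Kf (z : C) := Lap mu `[0, +oo[ (@frac R) (fun u => - u) z.

Lemma itg_fracN s : 0 < s -> itg mu `[0, +oo[ (fun u => frac u * expR (s * - u)).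
Proof. by move=> s0; apply: eq_itg (itg_frac s0); [exact: mitv|move=> u _; rewrite mulrN mulNr]. Qed.
Lemma holo_Kf : holo (hplane 0) Kf.
Proof.
move=> z z0; eexists; apply: (@lap_deriv _ _ _ mu `[0, +oo[ (mitv _) (@frac R) (fun u => - u) (Re z / 2) (Re z + 1)).
- exact: meas_frac.
- exact: meas_opp.
- by apply: itg_fracN; rewrite divr_gt0.
- by apply: itg_fracN; move: z0; rewrite /hplane; lra.
- by move: z0; rewrite /hplane => z0; lra.
Qed.
Lemma Kf_real s : 0 < s -> Kf s%:C = (fracI s)%:C.
Proof.
move=> s0; apply: Lap_real; first exact: mitv.
by apply: eq_hasI (hasI_itg (itg_frac s0)); [exact: mitv|move=> u _; rewrite mulrN mulNr].
Qed.
(** Both sides are holomorphic on Re z > 0 and agree at real z > 1. The right side grows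
    polynomially, and the upper bounds for zeta in the critical strip start from it. *)
Lemma zet1_frac z : 0 < Re z -> zet1 z = z - z * (z - 1) * Kf z.
Proof.
move: z; apply: (@identity_real R (hplane 0) zet1 (fun z => z - z * (z - 1) * Kf z) 1 2).
- exact: hplane_open.
- exact: hplane_convex.
- exact: holoS holo_zet1.
- apply: holoB; first exact: holo_id.
 apply: holoM; last exact: holo_Kf.
 by apply: holoM; [exact: holo_id|apply: holoB; [exact: holo_id|exact: holo_cst]].
- by rewrite ltr1n.
- by move=> x /andP[x1 _]; rewrite /hplane /=; lra.
- move=> x /andP[x1 _]; have x0 : 0 < x by lra.
 rewrite zet1_real// Kf_real// /zr; move: (fracI x) => F.
 have -> : x%:C - x%:C * (x%:C - 1) * F%:C = (x - x * (x - 1) * F)%:C :> C.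
  by rewrite rmorphB !rmorphM /= rmorphB rmorph1.
 by congr (_%:C); field; rewrite gt_eqF//; lra.
Qed.
Lemma nm_Kf z : 0 < Re z -> nm (Kf z) <= 2 * (Re z)^-1.
Proof.
move=> z0; apply: (@CI_bound _ _ _ mu _ _ (fun u => expR (- Re z * u))).
- exact: mitv.
- by apply: lap_citg; [exact: mitv|exact: meas_frac|exact: meas_opp|exact: itg_fracN].
- exact: hasI_exp0.
move=> u _; rewrite nm_lapF ger0_norm ?frac_ge0// mulrN mulNr ler_piMl ?expR_ge0//.
exact: frac_le1.
Qed.
Lemma zet1_bound z : 0 < Re z -> nm (zet1 z) <= nm z + nm z * (nm z + 1) * (2 / Re z).
Proof.
move=> z0; rewrite zet1_frac// (le_trans (nmB _ _))// lerD2l !nmM.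
apply: ler_pM => //; first by rewrite mulr_ge0.
 by apply: ler_wpM2l => //; rewrite (le_trans (nmB _ _))// nm1.
exact: nm_Kf.
Qed.
Lemma xi1 : xi 1 = 2^-1.
Proof. by rewrite /xi subrr mulr0 !mul0r addr0. Qed.
(** Below 1 the quantity s + s (1 - s) [fracI s] is visibly positive, above 1 the zeta series is,
    and at 1 the value is 1/2. Landau's theorem relies on this: the denominator of the transform of
    h has no zero on the positive axis. *)
Lemma xi_pos_real (s : R) : 0 < s -> Re (xi s%:C) > 0 /\ Im (xi s%:C) = 0.
Proof.
move=> s0; have [->|s1] := eqVneq s 1.
 rewrite rmorph1 xi1 (_ : (2 : C)^-1 = (2^-1)%:C); last by rewrite fmorphV /= rmorph_nat.
 by split; rewrite //= invr_gt0.
rewrite xi_zet1; last by rewrite /=; lra.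
have -> : s%:C / 2 = (s / 2)%:C :> C by rewrite rmorphM /= fmorphV /= rmorph_nat.
have -> : (s / 2)%:C + 1 = (s / 2 + 1)%:C :> C by rewrite rmorphD rmorph1.
have h : 0 < s / 2 + 1 by lra.
have K0 : 0 <= fracI s by apply: Rintegral_ge0 => u _; rewrite mulr_ge0 ?frac_ge0 ?expR_ge0.
rewrite cgam_real// -rmorphM -rmorphN cexpR zet1_frac// Kf_real//.
have -> : s%:C - s%:C * (s%:C - 1) * (fracI s)%:C = (s - s * (s - 1) * fracI s)%:C :> C.
 by rewrite rmorphB !rmorphM /= rmorphB rmorph1.
rewrite -!rmorphM /=; split => //.
have [lt|gt] := ltP s 1.
 rewrite !mulr_gt0 ?expR_gt0 ?Gr_gt0//.
 by have := mulr_ge0 (ltW s0) K0; nra.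
have {s1}gt1 : 1 < s by rewrite lt_neqAle eq_sym s1.
rewrite !mulr_gt0 ?expR_gt0 ?Gr_gt0//.
have : 0 < (s - 1) * zr s.
 rewrite mulr_gt0//; first by rewrite subr_gt0.
 have := hasI_le measurableT (@count_single R 0 (fun n => expR (s * - lnS R n)) (expR_ge0 _)) (hasI_zeta gt1).
 move=> H; apply: lt_le_trans (H _); first exact: expR_gt0.
 by move=> n _; case: eqP => // _; exact: expR_ge0.
rewrite /zr; have -> : (s - 1) * (s / (s - 1) - s * fracI s) = s - s * (s - 1) * fracI s; last by [].
by field; rewrite gt_eqF// subr_gt0.
Qed.

End Xi.

(** * The coefficients c *)

Section Mobius.
Variable R : realType.

Lemma mobius1 : mobius 1 = 1. Proof. by []. Qed.
Lemma mobius_prime_mul p d : prime p -> ~~ (p %| d)%N -> (0 < d)%N ->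
 mobius (p * d) = - mobius d.
Proof.
move=> pp pd d0.
have p0 := prime_gt0 pp.
have pe : perm_eq (primes (p * d)) (p :: primes d).
 apply: uniq_perm; first exact: primes_uniq.
  by rewrite /= primes_uniq andbT mem_primes pp d0 /= (negbTE pd).
 move=> q; rewrite primesM// inE; congr (_ || _).
 by rewrite primes_prime// inE.
rewrite /mobius (perm_size pe) /=.
have -> : all (fun q => logn q (p * d) == 1%N) (primes (p * d)) =
     all (fun q => logn q d == 1%N) (primes d).
 rewrite (perm_all _ pe) /= lognM// logn_prime// eqxx.
 have -> : logn p d = 0%N by apply/eqP; rewrite lognE pp d0 (negbTE pd).
 rewrite addn0 eqxx /=; apply: eq_in_all => q qd.
 rewrite lognM// logn_prime//.
 suff /negbTE -> : q != p by [].
 by apply: contraTneq qd => ->; rewrite mem_primes (negbTE pd) !andbF.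
by case: ifP => _; rewrite ?oppr0// exprS mulN1r.
Qed.
Lemma mobius_sq p d : prime p -> (p ^ 2 %| d)%N -> (0 < d)%N -> mobius d = 0.
Proof.
move=> pp pd d0; rewrite /mobius; case: ifP => // /allP /(_ p).
have p1 : (p %| d)%N by rewrite (dvdn_trans _ pd)// dvdn_exp.
rewrite mem_primes pp d0 p1 => /(_ isT) /eqP e.
by move: pd; rewrite pfactor_dvdn// e.
Qed.

Variable F : nat -> R.
Hypothesis F1 : F 1%N = 1.
Hypothesis FM : forall m n, (0 < m)%N -> (0 < n)%N -> F (m * n)%N = F m * F n.

Definition mob_sum n : R := \sum_(d <- divisors n) (mobius d)%:~R * F d.

(** Divisors divisible by p^2 drop out because [mobius] vanishes there; the remaining ones are d and
    p d with d dividing [m], and [mobius] changes sign between them. *)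
Lemma mob_sum_prime p k m : prime p -> (0 < m)%N -> ~~ (p %| m)%N ->
 mob_sum (p ^ k.+1 * m) = (1 - F p) * mob_sum m.
Proof.
move=> pp m0 pm; have p0 := prime_gt0 pp.
have pk0 : (0 < p ^ k.+1 * m)%N by rewrite muln_gt0 expn_gt0 p0.
rewrite /mob_sum (bigID (fun d => (p ^ 2 %| d)%N)) /= big_seq_cond big1 ?add0r; last first.
 move=> d /andP[]; rewrite -dvdn_divisors// => dn pd.
 by rewrite (mobius_sq pp pd) ?mul0r// (dvdn_gt0 _ dn).
have disj : [predU (mem (divisors m)) & mem (map (muln p) (divisors m))] =i
  [pred d | (d \in divisors (p ^ k.+1 * m)) && ~~ (p ^ 2 %| d)%N].
 move=> d; rewrite !inE /= -!dvdn_divisors//.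
 apply/orP/andP.
  case=> [dm|/mapP[e]].
   split; first by rewrite dvdn_mull.
   apply: contra pm => pd; apply: dvdn_trans dm; apply: dvdn_trans pd.
   by rewrite dvdn_exp.
  rewrite -dvdn_divisors// => em ->; split.
   by rewrite dvdn_mul// dvdn_exp.
  rewrite expnS expn1 dvdn_pmul2l//; apply: contra pm => pe.
  exact: dvdn_trans em.
 move=> [dn pd].
 have [pd1|pd1] := boolP (p %| d)%N; last first.
  left; move: dn; rewrite Gauss_dvdr//.
  by rewrite coprimeXr// coprime_sym prime_coprime.
 right; have /dvdnP[e de] := pd1.
 apply/mapP; exists e; last by rewrite de mulnC.
 rewrite -dvdn_divisors//.
 have pe : ~~ (p %| e)%N.
  by apply: contra pd => pe; rewrite de expnS expn1 dvdn_mul.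
 have : (e %| p ^ k.+1 * m)%N.
  by apply: dvdn_trans dn; rewrite de dvdn_mulr.
 by rewrite Gauss_dvdr// coprimeXr// coprime_sym prime_coprime.
have pe : perm_eq [seq d <- divisors (p ^ k.+1 * m) | ~~ (p ^ 2 %| d)%N]
 (divisors m ++ map (muln p) (divisors m)).
 apply: uniq_perm.
 - by rewrite filter_uniq// divisors_uniq.
 - rewrite cat_uniq divisors_uniq /= map_inj_uniq ?divisors_uniq ?andbT; last first.
   by move=> a b /eqP; rewrite eqn_pmul2l// => /eqP.
  apply/hasPn => d /mapP[e _ ->]; apply: contra pm.
  by rewrite -dvdn_divisors// => h; apply: dvdn_trans h; rewrite dvdn_mulr.
 - by move=> d; rewrite mem_filter andbC mem_cat; have := disj d; rewrite !inE.
rewrite -big_filter (perm_big _ pe) /= big_cat /= big_map mulrBl mul1r; congr (_ + _).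
rewrite mulr_sumr -sumrN big_seq_cond [RHS]big_seq_cond; apply: eq_bigr => d.
rewrite andbT -dvdn_divisors// => dm.
have d0 : (0 < d)%N by rewrite (dvdn_gt0 _ dm).
have pd : ~~ (p %| d)%N by apply: contra pm => h; exact: dvdn_trans dm.
by rewrite mobius_prime_mul// FM// rmorphN /=; ring.
Qed.
Lemma mob_sum1 : mob_sum 1 = 1.
Proof. by rewrite /mob_sum (_ : divisors 1 = [:: 1%N])// big_seq1 mobius1 F1 mulr1. Qed.
(** Strips one prime power at a time; this proves statements about the finite Euler product of the
    factors 1 - F p without writing the product. *)
Lemma mob_sum_ind (P : nat -> R -> Prop) : P 1%N 1 ->
 (forall p k m x, prime p -> (0 < m)%N -> ~~ (p %| m)%N -> P m x ->
  P (p ^ k.+1 * m)%N ((1 - F p) * x)) ->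
 forall n, (0 < n)%N -> P n (mob_sum n).
Proof.
move=> P1 PS n; have [N] := ubnP n; elim: N n => // N IH n.
rewrite ltnS => nN n0.
have [n1|n1] := leqP n 1.
 have -> : n = 1%N by lia.
 by rewrite mob_sum1.
have pp := pdiv_prime n1; set p := pdiv n in pp.
have pn : (p %| n)%N := pdiv_dvd n.
have [k pm e] := pfactor_coprime pp n0.
have l0 : (0 < logn p n)%N by rewrite logn_gt0 mem_primes pp n0.
have m0 : (0 < k)%N by move: n0; rewrite e muln_gt0 => /andP[].
have pk : ~~ (p %| k)%N by rewrite -prime_coprime.
rewrite e mulnC -(prednK l0) mob_sum_prime//.
apply: PS => //; apply: IH => //.
apply: leq_trans nN; rewrite [X in (_ < X)%N]e ltn_Pmulr// -(prednK l0) expnS.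
have := prime_gt1 pp; have : (0 < p ^ (logn p n).-1)%N by rewrite expn_gt0 (prime_gt0 pp).
nia.
Qed.

End Mobius.

Section Cw.
Variable R : realType.

(** Each prime contributes a factor 1 - p^(-a) between 0 and 1. The resulting nonnegativity of [c]
    carries both the 3-4-1 inequality and the regularity of h. *)
Lemma mob_sum_bounds (a : R) n : 0 <= a -> (0 < n)%N ->
 0 <= mob_sum (fun d => d%:R `^ (- a) : R) n <= 1.
Proof.
move=> a0; apply: (@mob_sum_ind R _ _ _ (fun _ x => 0 <= x <= 1)).
- by rewrite powR1.
- by move=> m k m0 k0; rewrite natrM powRM// ler0n.
- by rewrite ler01 lexx.
- move=> p k m x pp m0 pm /andP[x0 x1].
 have p1 : 0 <= (p%:R `^ (- a) : R) <= 1.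
  rewrite powR_ge0 /= powRN invf_le1; last first.
   by rewrite powR_gt0// ltr0n prime_gt0.
  by rewrite -[leLHS](powRr0 p%:R) ler_powR// ler1n prime_gt0.
 have /andP[p0 p2] := p1.
 by rewrite mulr_ge0 ?subr_ge0//= mulr_ile1// ?subr_ge0// lerBlDr lerDl.
Qed.
(** With [F] constantly 1 each prime contributes the factor 0. *)
Lemma sum_mobius n : (0 < n)%N ->
 \sum_(d <- divisors n) (mobius d)%:~R = (n == 1%N)%:R :> R.
Proof.
move=> n0.
have := @mob_sum_ind R (fun=> 1) erefl _ (fun n x => x = (n == 1%N)%:R).
move=> H; have := H _ _ _ n n0; rewrite /mob_sum; under eq_bigr do rewrite mulr1.
apply => //; first by move=> *; rewrite mulr1.
move=> p k m x pp m0 _ _; rewrite subrr mul0r.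
case: eqP => // /eqP; rewrite muln_eq1 => /andP[/eqP e _].
have := prime_gt1 pp; have : (0 < p ^ k)%N by rewrite expn_gt0 prime_gt0.
by move: e; rewrite expnS; nia.
Qed.
Lemma c_bounds (w : R) n : 0 <= w -> (0 < n)%N -> 0 <= c w n <= n%:R `^ w.
Proof.
move=> w0 n0; have := @mob_sum_bounds (2 * w) n _ n0; rewrite mulr_ge0// => /(_ isT).
rewrite /c /mob_sum => /andP[h0 h1]; rewrite mulr_ge0 ?powR_ge0//=.
by rewrite -[leRHS]mulr1 ler_wpM2l ?powR_ge0.
Qed.
(** Expanding [c] over n = d e, the sum of [mobius] over the divisors of N / e leaves only e = N.
    For Dirichlet series this reads: zeta(s + w) times the series of [c] equals zeta(s - w). *)
Lemma c_conv (w : R) N : (0 < N)%N ->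
 \sum_(n <- divisors N) c w n * (N %/ n)%:R `^ (- w) = N%:R `^ w.
Proof.
move=> N0; have DE n (f : nat -> R) : (n %| N)%N ->
  \sum_(d <- divisors n) f d = \sum_(d < N.+1 | (d %| n)%N) f d.
 move=> nN; have n0 : (0 < n)%N by rewrite (dvdn_gt0 _ nN).
 rewrite -(big_mkord (fun d => d %| n)%N) -big_filter; apply: perm_big.
 apply: uniq_perm; rewrite ?divisors_uniq ?filter_uniq ?iota_uniq// => d.
 rewrite mem_filter mem_index_iota -dvdn_divisors//=.
 case: (boolP (d %| n)%N) => //= dn.
 by rewrite ltnS (dvdn_leq N0)// (dvdn_trans dn).
transitivity (N%:R `^ (- w) * \sum_(n < N.+1 | (n %| N)%N) \sum_(d < N.+1)
  \sum_(e < N.+1 | (d * e == n)%N) (mobius d)%:~R * (e%:R `^ (2 * w) : R)).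
 rewrite DE// [RHS]mulr_sumr; apply: eq_bigr => n nN.
 have n0 : (0 < n)%N by rewrite (dvdn_gt0 _ nN).
 rewrite /c DE// mulrAC.
 have -> : N%:R `^ (- w) * (\sum_(d < N.+1) \sum_(e < N.+1 | (d * e == n)%N)
   (mobius d)%:~R * (e%:R `^ (2 * w) : R)) =
   N%:R `^ (- w) * \sum_(d < N.+1 | (d %| n)%N) (mobius d)%:~R * ((n %/ d)%:R `^ (2 * w) : R).
  congr (_ * _); rewrite [RHS]big_mkcond; apply: eq_bigr => d _.
  case: ifPn => [dn|dn]; last first.
   rewrite big_pred0// => e; apply/negbTE; apply: contra dn => /eqP <-.
   by rewrite dvdn_mulr.
  have d0 : (0 < d)%N by rewrite (dvdn_gt0 _ dn).
  have lt : (n %/ d < N.+1)%N by rewrite ltnS (leq_trans (leq_div _ _))// dvdn_leq.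
  rewrite (big_pred1 (Ordinal lt)) => [//|e]; rewrite /pred1 /= -val_eqE /=.
  by rewrite -[in RHS](eqn_pmul2l d0) (mulnC d (n %/ d)%N) divnK.
 rewrite !mulr_sumr; apply: eq_bigr => d dn.
 have d0 : (0 < d)%N by rewrite (dvdn_gt0 _ dn).
 have En : n%:R = (n %/ d)%:R * d%:R :> R by rewrite -natrM divnK.
 have EN : N%:R = (N %/ n)%:R * n%:R :> R by rewrite -natrM divnK.
 have q0 : 0 < (n %/ d)%:R :> R by rewrite ltr0n divn_gt0// dvdn_leq.
 have r0 : 0 < (N %/ n)%:R :> R by rewrite ltr0n divn_gt0// dvdn_leq.
 have dR : 0 < d%:R :> R by rewrite ltr0n.
 rewrite EN powRM ?ler0n// En !powRM ?mulr_ge0 ?ler0n// ?ltW//.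
 have W x : 0 < x -> x `^ (2 * w) = x `^ w * x `^ w :> R.
  by move=> x0; rewrite mulrDl mul1r powRD// (gt_eqF x0) implybT.
 have V (x : R) : 0 < x -> x `^ w * x `^ (- w) = 1.
  by move=> x0; rewrite powRN divff// gt_eqF// powR_gt0.
 have V2 (x : R) : 0 < x -> x `^ (- (2 * w)) = x `^ (- w) * x `^ (- w).
  by move=> x0; rewrite powRN W// invfM -powRN.
 rewrite W// V2//.
 have := V _ q0; have := V _ dR; move: (_ `^ w) (_ `^ (- w)) => a b.
 move: (_ `^ w) (_ `^ (- w)) => a' b' h1 h2.
 transitivity ((mobius d)%:~R * (N %/ n)%:R `^ (- w) * (a * b) * a' * b); first by ring.
 rewrite h1; transitivity ((mobius d)%:~R * (N %/ n)%:R `^ (- w) * a' * (a' * b') * b); last by ring.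
 by rewrite h2; ring.
transitivity (N%:R `^ (- w) * \sum_(e < N.+1 | (e %| N)%N) e%:R `^ (2 * w) *
  \sum_(d <- divisors (N %/ e)) (mobius d)%:~R : R).
 congr (_ * _); rewrite exchange_big /=.
 under eq_bigr do rewrite (exchange_big_dep xpredT) //=.
 rewrite exchange_big /= [RHS]big_mkcond; apply: eq_bigr => e _.
 have pt (d : 'I_N.+1) : \sum_(n < N.+1 | (n %| N)%N && (d * e == n)%N) (mobius d)%:~R * (e%:R `^ (2 * w) : R)
  = if (d * e %| N)%N then (mobius d)%:~R * e%:R `^ (2 * w) else 0.
  case: ifPn => [de|de]; last first.
   rewrite big_pred0// => n; apply/negbTE; apply: contra de.
   by case/andP => nN /eqP ->.
  have lt : (d * e < N.+1)%N by rewrite ltnS dvdn_leq.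
  rewrite (big_pred1 (Ordinal lt)) => [//|n]; rewrite /pred1 /= -val_eqE /= [in RHS]eq_sym.
  by case: eqP => [<-|]; rewrite ?de// andbF.
 under eq_bigr do rewrite pt.
 case: ifPn => eN; last first.
  rewrite big1// => d _; case: ifPn => // de; case/negP: eN.
  by apply: dvdn_trans de; rewrite dvdn_mull.
 have e0 : (0 < e)%N by rewrite (dvdn_gt0 _ eN).
 rewrite DE ?dvdn_div// mulr_sumr [RHS]big_mkcond; apply: eq_bigr => d _.
 by rewrite dvdn_divRL// mulrC.
under eq_bigr => e eN.
 rewrite sum_mobius; last by rewrite divn_gt0 ?(dvdn_gt0 _ eN)// dvdn_leq.
 over.
rewrite (bigD1 ord_max)//= divnn N0 eqxx mulr1 big1 ?addr0 => [|e /andP[eN eM]].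
 rewrite -powRD; first by congr (_ `^ _); ring.
 by rewrite pnatr_eq0 -lt0n N0 implybT.
rewrite -[(_ %/ _)%N == _](eqn_pmul2r (dvdn_gt0 N0 eN)) divnK// mul1n.
rewrite [N == _]eq_sym; move: eM; rewrite -val_eqE /= => /negbTE ->.
by rewrite mulr0.
Qed.
End Cw.

(** * Identification of [zeta] with the constructed function *)

Section Continuation.
Variable R : realType.
Notation cnt := (@counting nat R).
Local Notation C := R[i].

(** Index [n] carries the coefficient of [n.+1], so no zeroth term has to be excluded. *)
Definition Dirf (f : nat -> R) (z : C) := Lap cnt setT f (fun n => - lnS R n) z.

Lemma meas_cnt (f : nat -> R) : measurable_fun (setT : set nat) f.
Proof. by move=> _ Y _; rewrite setTI. Qed.
Lemma Dirf_holo (f : nat -> R) x : (forall n, 0 <= f n) ->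
 itg cnt setT (fun n => f n * expR (x * - lnS R n)) -> holo (hplane x) (Dirf f).
Proof.
move=> f0 ix; apply: (Lap_holo measurableT (meas_cnt f) (meas_cnt _) _ _ ix) => // n _.
by rewrite oppr_le0 lnS_ge0.
Qed.
Lemma hasI_zeta1 s : 1 < s -> hasI cnt setT (fun n => 1 * expR (s * - lnS R n)) (zr s).
Proof. by move=> s1; apply: eq_hasI (hasI_zeta s1) => // n _; rewrite mul1r. Qed.
Lemma zet1_Dir z : 1 < Re z -> zet1 z = (z - 1) * Dirf (fun=> 1) z.
Proof.
move: z; apply: (@identity_real R (hplane 1) (@zet1 R) (fun z => (z - 1) * Dirf (fun=> 1) z) 1 2).
- exact: hplane_open.
- exact: hplane_convex.
- exact: holoS (@holo_zet1 R).
- apply: holoM; first by apply: holoB; [exact: holo_id|exact: holo_cst].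
 move=> z z1; have [y y1 zy] := hplane_mid z1.
 by apply: (@Dirf_holo (fun=> 1) y) => //; exact: (hasI_zeta1 y1).1.
- by rewrite ltr1n.
- by move=> x /andP[].
- move=> x /andP[x1 _]; rewrite zet1_real// /Dirf (Lap_real measurableT (hasI_zeta1 x1)).
 by rewrite rmorphM /= rmorphB rmorph1.
Qed.
Lemma zet_Dir z : 1 < Re z -> zet z = Dirf (fun=> 1) z.
Proof.
move=> z1; rewrite /zet zet1_Dir// mulrC mulKf// subr_eq0; apply: contraTneq z1 => ->.
by rewrite /= ltxx.
Qed.
Lemma Dirf_series (f : nat -> R) z : (itg cnt setT (fun n => f n * expR (Re z * - lnS R n))) ->
 cvs (fun N => \sum_(0 <= n < N) lapF f (fun n => - lnS R n) z n) (Dirf f z).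
Proof.
move=> i1; have [c1 c2] := lap_citg measurableT (meas_cnt f) (meas_cnt _) i1.
apply: cvs_ReIm.
 have := count_series c1; apply: cvg_trans; apply: near_eq_cvg; near=> N.
 by rewrite /series /= (big_morph _ (@ReD R) (erefl : Re 0 = 0)).
have := count_series c2; apply: cvg_trans; apply: near_eq_cvg; near=> N.
by rewrite /series /= (big_morph _ (@ImD R) (erefl : Im 0 = 0)).
Unshelve. all: by end_near. Qed.
Lemma nat_cpowN_lapF n (s : C) : nat_cpowN n.+1 s = lapF (fun=> 1) (fun n => - lnS R n) s n.
Proof.
rewrite /nat_cpowN /lapF /cexp mul1r; ceq; rewrite !mulr0 ?subr0 ?addr0 ?add0r -/(lnS R n) !mulrN mulNr.
 by rewrite cosN.
by rewrite sinN mulrN.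
Qed.
Lemma cvs_cvg (u : nat -> C) (l : C) : cvs u l <-> (u : nat -> R[i]^o) @ \oo --> (l : R[i]^o).
Proof.
split.
 move=> H; apply/cvgrPdist_lt => e /gt0_complexP[r r0 ->].
 have [N HN] := H r r0; exists N => // n /= /HN h.
 by rewrite distrC nm_lt_normr.
move=> /cvgrPdist_lt H e e0.
have e0' : 0 < e%:C :> R[i] by rewrite ltcR.
have [N _ HN] := H _ e0'; exists N => n /HN /=.
by rewrite distrC nm_lt_normr.
Qed.
Lemma zet_continuation : zeta_continuation (@zet R).
Proof.
split.
 move=> s s1; apply/cvs_cvg.
 have := @Dirf_series (fun=> 1) s (hasI_zeta1 s1).1; rewrite zet_Dir//.
 apply: (@cvs_ext _ _ _ _ 0%N) => N _; rewrite /series /=.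
 by apply: eq_bigr => n _; rewrite nat_cpowN_lapF.
move=> s s1.
have [l dl] : cder_at (@zet R) s.
 have s10 : s - 1 != 0 by rewrite subr_eq0; apply/eqP.
 have [l1 d1] := @holo_zet1 R s I.
 have d2 : cderiv (fun z => z - 1) s 1 by have := cderivB (cderiv_id s) (cderiv_cst 1 s); rewrite subr0.
 by eexists; exact: (cderivM d1 (@cderivV _ (fun z => z - 1) s _ s10 d2)).
by have [] := dl.
Qed.
Lemma zeta_is_continuation : zeta_continuation (@zeta R).
Proof. by rewrite /zeta; apply: (@xgetPex _ (fun=> 0) [set f | zeta_continuation f]); exists (@zet R); exact: zet_continuation. Qed.
Lemma derivable_cder (f : C -> C) (z : C) : derivable (f : R[i]^o -> R[i]^o) z 1 -> cder_at f z.
Proof. by move=> H; exists ('D_1 (f : R[i]^o -> R[i]^o) z); exact: DeriveDef. Qed.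
Lemma lin_open (a b c : R) : copen (fun z : C => c < a * Re z + b * Im z).
Proof.
move=> z h; pose k := `|a| + `|b| + 1.
have k0 : 0 < k by rewrite ltr_wpDl// addr_ge0.
exists ((a * Re z + b * Im z - c) / k); first by rewrite divr_gt0// subr_gt0.
move=> y [h1 h2]; set d := _ / k in h1 h2.
have kd : k * d = a * Re z + b * Im z - c by rewrite mulrC divfK// gt_eqF.
have b1 : `|a * (Re y - Re z)| <= `|a| * d by rewrite normrM ler_wpM2l// ltW.
have b2 : `|b * (Im y - Im z)| <= `|b| * d by rewrite normrM ler_wpM2l// ltW.
have d0 : 0 < d by rewrite divr_gt0// subr_gt0.
move: b1 b2; rewrite !ler_norml => /andP[b1 _] /andP[b2 _].
by move: kd; rewrite /k !mulrDl mul1r; lra.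
Qed.
Lemma lin_convex (a b c : R) : cconvex (fun z : C => c < a * Re z + b * Im z).
Proof.
move=> x y t hx hy tt; rewrite !reimE /= !mulr0 ?mul0r ?subr0 ?addr0 ?add0r.
have := convex_bounds hx hy tt; congr (_ < _); ring.
Qed.

(** [zeta] is chosen among all continuations, so uniqueness has to be shown. The punctured plane is
    not convex; the identity theorem is applied on the half-planes Im z > 0, Im z < 0 and Re z < 1,
    each of which avoids 1 and meets a region where equality is already known. *)
Theorem zeta_zet (s : C) : s != 1 -> zeta s = zet s.
Proof.
move=> s1; have [Z1 Z2] := zeta_is_continuation; have [Y1 Y2] := zet_continuation.
have E1 (z : C) : 1 < Re z -> zeta z = zet z.
 move=> z1; apply: (@cvs_unique R (series (fun n => nat_cpowN n.+1 z))); apply/cvs_cvg.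
  exact: Z1.
 exact: Y1.
have ext (a b c : R) (w : C) : c < a * Re w + b * Im w ->
  (forall z, c < a * Re z + b * Im z -> z != 1) ->
  (exists2 r, 0 < r & forall z, nm (z - w) < r -> zeta z = zet z) ->
  forall z, c < a * Re z + b * Im z -> zeta z = zet z.
 move=> Dw D1 [r r0 Hr] z Dz; apply/eqP; rewrite -subr_eq0; apply/eqP.
 apply: (@identity_accum R (fun z : C => c < a * Re z + b * Im z) (fun z => zeta z - zet z) w) => //.
 - exact: lin_open.
 - exact: lin_convex.
 - move=> y Dy; have y1 : y <> 1 by apply/eqP; exact: D1.
  have [l1 d1] := derivable_cder (Z2 y y1); have [l2 d2] := derivable_cder (Y2 y y1).
  by exists (l1 - l2); exact: cderivB.
 - move=> d d0; pose e := Num.min r d / 2.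
  have m0 : 0 < Num.min r d by rewrite lt_min r0.
  have mr : Num.min r d <= r by rewrite ge_min lexx.
  have md : Num.min r d <= d by rewrite ge_min lexx orbT.
  have we : w + e%:C - w = e%:C by ring.
  exists (w + e%:C); split.
  + by rewrite -subr_eq0 we -nm_eq0 nmR normr_eq0 gt_eqF// /e; lra.
  + by rewrite we nmR ger0_norm /e; lra.
  + by rewrite Hr ?subrr// we nmR ger0_norm /e; lra.
have nbr1 (w : C) : 1 < Re w -> exists2 r, 0 < r & forall z, nm (z - w) < r -> zeta z = zet z.
 move=> w1; exists (Re w - 1); first by rewrite subr_gt0.
 by move=> z /nm_in_sq[h _]; apply: E1; move: h; rewrite ltr_distlC => /andP[]; lra.
have E2 (z : C) : 0 < Im z -> zeta z = zet z.
 move=> z0; apply: (ext 0 1 0 (Complex 2 1)) => /=; rewrite ?mul0r ?mul1r ?add0r//.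
  by move=> y; rewrite mul0r mul1r add0r; apply: contraTneq => ->; rewrite /= ltxx.
 by apply: nbr1; rewrite /= ltr1n.
have E3 (z : C) : Im z < 0 -> zeta z = zet z.
 move=> z0; apply: (ext 0 (-1) 0 (Complex 2 (-1))) => /=; rewrite ?mul0r ?mulN1r ?add0r ?opprK ?oppr_gt0//.
  by move=> y; rewrite mul0r mulN1r add0r oppr_gt0; apply: contraTneq => ->; rewrite /= ltxx.
 by apply: nbr1; rewrite /= ltr1n.
have E4 (z : C) : Re z < 1 -> zeta z = zet z.
 move=> z0; apply: (ext (-1) 0 (-1) 'i) => /=; rewrite ?mul0r ?mulN1r ?addr0 ?oppr0 ?ltrN2 ?ltrN10//.
  by move=> y; rewrite mul0r mulN1r addr0 ltrN2; apply: contraTneq => ->; rewrite /= ltxx.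
 exists 1 => // y /nm_in_sq[_ h]; apply: E2; move: h; rewrite /= ltr_distlC => /andP[]; lra.
have [h|h|h] := ltgtP (Im s) 0; [exact: E3|exact: E2|].
have [h1|h1|h1] := ltgtP (Re s) 1; [exact: E4|exact: E1|].
by case/eqP: s1; apply: ceqP.
Qed.

End Continuation.

(** * Zeta to the right of and on the line 1 *)

Section NonVanishing.
Variable R : realType.
Notation cnt := (@counting nat R).
Local Notation C := R[i].

Lemma powR_lnS (n : nat) (a : R) : n.+1%:R `^ a = expR (a * lnS R n).
Proof. by rewrite /powR pnatr_eq0. Qed.
Lemma zr_gt0 (s : R) : 1 < s -> 0 < zr s.
Proof.
move=> s1; have H := hasI_le measurableT (@count_single R 0 (fun n => expR (s * - lnS R n)) (expR_ge0 _)) (hasI_zeta s1).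
apply: lt_le_trans (H _); first exact: expR_gt0.
by move=> n _; case: eqP => // _; exact: expR_ge0.
Qed.
Lemma lnS_mul (m k : nat) : ln ((k.+1 * m.+1)%N%:R : R) = lnS R k + lnS R m.
Proof. by rewrite natrM lnM ?posrE. Qed.
(** The sum over m and its multiples N of c(m) (N / m)^(-w) N^(-s) is evaluated both ways: along the
    multiples it is zeta(s + w) times the series of [c], and along the divisors of N [c_conv] turns
    it into zeta(s - w). *)
Lemma hasI_c (w s : R) : 0 <= w -> 1 + w < s ->
 hasI cnt setT (fun n => c w n.+1 * expR (s * - lnS R n)) (zr (s - w) / zr (s + w)).
Proof.
move=> w0 sw.
have c0 m : 0 <= c w m.+1 by have /andP[] := @c_bounds R w m.+1 w0 isT.
pose f (z : nat * nat) := if (z.1.+1 %| z.2.+1)%N then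
 c w z.1.+1 * (z.2.+1 %/ z.1.+1)%:R `^ (- w) * expR (s * - lnS R z.2) else 0.
have mf : measurable_fun (setT `*` setT) f.
 by apply: (@meas_nat_prod _ nat R setT (fun k N => f (k, N)) measurableT) => n; exact: meas_cnt.
have f0 x y : setT x -> setT y -> 0 <= f (x, y).
 move=> _ _; rewrite /f /=; case: ifP => // _; apply: mulr_ge0; last exact: expR_ge0.
 by apply: mulr_ge0; [exact: c0|exact: powR_ge0].
have HA (m : nat) : setT m -> hasI cnt setT (fun N => f (m, N)) (c w m.+1 * expR (s * - lnS R m) * zr (s + w)).
 move=> _; pose F k := c w m.+1 * k%:R `^ (- w) * expR (s * - ln (k * m.+1)%N%:R).
 have F0 k : 0 <= F k.
  by apply: mulr_ge0; last exact: expR_ge0; apply: mulr_ge0; [exact: c0|exact: powR_ge0].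
 have sw1 : 1 < s + w by lra.
 have HF : hasI cnt setT (fun k => F k.+1) (c w m.+1 * expR (s * - lnS R m) * zr (s + w)).
  apply: eq_hasI (hasI_Z _ measurableT (hasI_zeta sw1)) => // k _.
  rewrite /F lnS_mul powR_lnS -!mulrA -!expRD.
  by move: (lnS R m) (lnS R k) => p q; have -> : s * - p + (s + w) * - q = - w * q + s * - (q + p) by ring.
 apply: eq_hasI (count_multiples (ltn0Sn m) F0 HF) => // N _.
 by rewrite /f /=; case: ifP => // dN; rewrite /F divnK.
have HB (N : nat) : setT N -> hasI cnt setT (fun m => f (m, N)) (expR ((s - w) * - lnS R N)).
 move=> _; have := @count_fin R (fun m => f (m, N)) N.+1 (fun m => f0 m N I I).
 have -> : \sum_(m < N.+1) f (nat_of_ord m, N) = expR ((s - w) * - lnS R N).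
  have -> : expR ((s - w) * - lnS R N) = (N.+1)%:R `^ w * expR (s * - lnS R N).
   by rewrite powR_lnS -expRD; congr expR; ring.
  rewrite -(c_conv w (ltn0Sn N)) mulr_suml.
  have P : perm_eq (divisors N.+1) [seq d <- iota 1 N.+1 | (d %| N.+1)%N].
   apply: uniq_perm; [exact: divisors_uniq|exact/filter_uniq/iota_uniq|].
   move=> d; rewrite mem_filter mem_iota -dvdn_divisors//; case: (boolP (d %| N.+1)%N) => //= dN.
   have d1 : (d <= N.+1)%N := dvdn_leq (ltn0Sn N) dN; have d2 : (0 < d)%N := dvdn_gt0 (ltn0Sn N) dN.
   by rewrite d2 add1n ltnS d1.
  rewrite (perm_big _ P) big_filter (iotaDl 1 0) big_map.
  rewrite -(big_mkord xpredT (fun m => f (m, N))) /index_iota subn0 [RHS]big_mkcond.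
  by apply: eq_bigr => i _; rewrite /f /= add1n; case: ifP.
 apply: eq_hasI => // m _; case: ltnP => // Nm; rewrite /f /=.
 by case: ifP => // /dvdn_leq; rewrite ltnNge => /(_ isT); rewrite ltnS leqNgt Nm.
have sw1 : 1 < s - w by lra.
have H := @tonelli' _ _ nat nat R cnt cnt setT setT f measurableT measurableT mf f0 _ _ _ HA HB (hasI_zeta sw1).
have sw2 : 1 < s + w by lra.
have z0 := zr_gt0 sw2.
rewrite mulrC; apply: eq_hasI (hasI_Z (zr (s + w))^-1 measurableT H) => // n _.
by rewrite mulrC mulfK// gt_eqF.
Qed.
Definition Cdir w (z : C) := Dirf (fun n => c w n.+1) z.

(** Cleared of denominators, because the nonvanishing of [zet1] for Re z > 1 is deduced from it. *)
Lemma Cdir_eq w z : 0 <= w -> 1 + w < Re z ->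
 zet1 (z + w%:C) * (z - w%:C - 1) * Cdir w z = zet1 (z - w%:C) * (z + w%:C - 1).
Proof.
move=> w0; move: z; apply: (@identity_real R (hplane (1 + w)) (fun z => zet1 (z + w%:C) * (z - w%:C - 1) * Cdir w z)
 (fun z => zet1 (z - w%:C) * (z + w%:C - 1)) (1 + w) (2 + w)).
- exact: hplane_open.
- exact: hplane_convex.
- apply: holoM; first apply: holoM.
 + apply: (holo_comp (D' := @whole R) (g := @zet1 R)) => //; last exact: holo_zet1.
  by apply: holoD; [exact: holo_id|exact: holo_cst].
 + by apply: holoB; [apply: holoB; [exact: holo_id|exact: holo_cst]|exact: holo_cst].
 + move=> z z1; have [y y1 zy] := hplane_mid z1.
  apply: (@Dirf_holo R (fun n => c w n.+1) y) => //; first by move=> n; have /andP[] := @c_bounds R w n.+1 w0 isT.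
  exact: (hasI_c w0 y1).1.
- apply: holoM.
  apply: (holo_comp (D' := @whole R) (g := @zet1 R)) => //; last exact: holo_zet1.
  by apply: holoB; [exact: holo_id|exact: holo_cst].
 by apply: holoB; [apply: holoD; [exact: holo_id|exact: holo_cst]|exact: holo_cst].
- by lra.
- by move=> x /andP[].
- move=> x /andP[x1 _]; rewrite /Cdir /Dirf (Lap_real measurableT (hasI_c w0 x1)).
 have x2 : 1 < x + w by lra. have x3 : 1 < x - w by lra.
 rewrite -rmorphD -rmorphB zet1_real// zet1_real//; have := zr_gt0 x2.
 move: (zr (x + w)) (zr (x - w)) => a b a0.
 rewrite -(rmorph1 (real_complex R)) -!rmorphB -!rmorphM /=; congr (_%:C).
 by field; rewrite gt_eqF.
Qed.
Lemma zet1_2 : zet1 2%:C != 0 :> C.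
Proof.
have := (xi_pos_real (ltr0n R 2)).1; apply: contraTneq => E.
by rewrite xi_zet1 /=; [rewrite E !mul0r ltxx|lra].
Qed.
(** A zero at [z] is moved to [z - q]: take w = q / 2 and evaluate [Cdir_eq] at z - w. The zeros
    fill a segment, and the function would vanish identically. *)
Lemma zet1_neq0_gt1 z : 1 < Re z -> zet1 z != 0 :> C.
Proof.
move=> z1; apply/eqP => z0.
have := @zero_propagates R (@whole R) (@zet1 R) z (Re z - 1) (@whole_open R) (@whole_convex R) (@holo_zet1 R) I.
rewrite subr_gt0 => /(_ z1) H.
suff : forall y, whole y -> zet1 y = 0 :> C by move=> /(_ 2%:C I) E; have := zet1_2; rewrite E eqxx.
apply: H => q /andP[q0 qz].
have w0 : 0 <= q / 2 by lra.
have h : 1 + q / 2 < Re (z - (q / 2)%:C) by rewrite !reimE /=; lra.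
have := Cdir_eq w0 h; rewrite subrK z0 !mul0r.
have -> : z - (q / 2)%:C - (q / 2)%:C = z - q%:C.
 by rewrite -addrA -opprD -rmorphD /=; congr (_ - _%:C); field.
move=> /esym/eqP; rewrite mulf_eq0 => /orP[/eqP//|].
rewrite subr_eq0 => /eqP E; move: z1; rewrite E /= ltxx.
by [].
Qed.
Lemma zet_neq0 z : 1 < Re z -> zet z != 0 :> C.
Proof.
move=> z1; rewrite mulf_neq0 ?zet1_neq0_gt1// invr_eq0 subr_eq0.
by apply: contraTneq z1 => ->; rewrite /= ltxx.
Qed.
Lemma Re_mono_lim (f : R -> C) (l : C) (d : R) : 0 < d -> rderiv f 0 l ->
 (forall w, 0 < w < d -> Re (f 0) <= Re (f w)) -> 0 <= Re l.
Proof.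
move=> d0 df H; rewrite leNgt; apply/negP => l0.
have e0 : 0 < - Re l / 2 by lra.
have [d1 d10 H1] := df _ e0.
pose h := Num.min d d1 / 2.
have m0 : 0 < Num.min d d1 by rewrite lt_min d0.
have md : Num.min d d1 <= d by rewrite ge_min lexx.
have md1 : Num.min d d1 <= d1 by rewrite ge_min lexx orbT.
have h0 : 0 < h by rewrite /h; lra.
have hd : 0 < h < d by rewrite h0 /=; rewrite /h; lra.
have := H1 h; rewrite ger0_norm ?(ltW h0)// add0r => /(_ _) H2.
have {}H2 : nm (f h - f 0 - l * h%:C) <= - Re l / 2 * h by apply: H2; rewrite /h; lra.
have := le_trans (le_Re_nm _) H2; rewrite !reimE /= mulr0 subr0 ler_norml => /andP[_ b].
by have := H h hd; nra.
Qed.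

Section line1.
Variable t : R.
Let pt (k : nat) (x : R) : C := Complex x (k%:R * t).
Let dz := cder (@zet R).

Lemma zet_cder z : 1 < Re z -> cderiv (@zet R) z (dz z).
Proof.
move=> z1; apply: cderE; have s1 : z <> 1 by move=> E; move: z1; rewrite E /= ltxx.
by have [_ /(_ z s1) /derivable_cder] := zet_continuation R.
Qed.
Lemma Cdir_zet w z : 0 < w -> 1 + w < Re z -> Cdir w z = zet (z - w%:C) / zet (z + w%:C).
Proof.
move=> w0 zw; have := Cdir_eq (ltW w0) zw; rewrite /zet.
have h1 : 1 < Re (z + w%:C) by rewrite reimE /=; lra.
have h2 : 1 < Re (z - w%:C) by rewrite !reimE /=; lra.
have n1 := zet1_neq0_gt1 h1.
have n2 : z + w%:C - 1 != 0 by rewrite subr_eq0; apply: contraTneq h1 => ->; rewrite /= ltxx.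
have n3 : z - w%:C - 1 != 0 by rewrite subr_eq0; apply: contraTneq h2 => ->; rewrite /= ltxx.
move: (zet1 _) (zet1 _) (Cdir w z) (z + w%:C - 1) (z - w%:C - 1) n1 n2 n3 => a b d p q a0 p0 q0 E.
have -> : d = (b * q)^-1 * (a * p) by rewrite -E mulKf// mulf_neq0.
by field; rewrite a0 p0 q0.
Qed.
(** The inequality 3 + 4 cos x + cos 2x >= 0 against the nonnegative coefficients [c]; the bound 8
    is the term n = 1. *)
Lemma Cdir_341 w x : 0 < w -> 1 + w < x ->
 8 <= 3 * Re (Cdir w (pt 0 x)) + 4 * Re (Cdir w (pt 1 x)) + Re (Cdir w (pt 2 x)).
Proof.
move=> w0 xw; have i1 := (hasI_c (ltW w0) xw).1.
have R1 k : hasI cnt setT (fun n => Re (lapF (fun n => c w n.+1) (fun n => - lnS R n) (pt k x) n)) (Re (Cdir w (pt k x))).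
 by apply: hasI_itg; have [] := lap_citg measurableT (meas_cnt (fun n => c w n.+1)) (meas_cnt _) (i1 : itg cnt setT (fun n => c w n.+1 * expR (Re (pt k x) * - lnS R n))).
have := hasI_D measurableT (hasI_D measurableT (hasI_Z 3 measurableT (R1 0%N)) (hasI_Z 4 measurableT (R1 1%N))) (R1 2%N).
have L n k : Re (lapF (fun n => c w n.+1) (fun n => - lnS R n) (pt k x) n) =
  c w n.+1 * expR (x * - lnS R n) * cos (k%:R * (t * lnS R n)).
 rewrite /lapF /cexp !reimE /= !mulr0 !mul0r !subr0 ?add0r ?addr0 mulrA.
 by congr (_ * _); rewrite -cosN; congr cos; ring.
have c0 n : 0 <= c w n.+1 by have /andP[] := @c_bounds R w n.+1 (ltW w0) isT.
pose F n := c w n.+1 * expR (x * - lnS R n) * (3 + 4 * cos (t * lnS R n) + cos (2 * (t * lnS R n))).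
have F0 n : 0 <= F n.
 rewrite /F mulr_ge0//; first by rewrite mulr_ge0 ?expR_ge0.
 have -> : cos (2 * (t * lnS R n)) = 2 * cos (t * lnS R n) ^+ 2 - 1.
  by rewrite mulr_natl cos_mulr2n mulr_natl.
 have := sqr_ge0 (cos (t * lnS R n) + 1); lra.
move=> H; have {}H := eq_hasI measurableT _ H.
have {}H : hasI cnt setT F (3 * Re (Cdir w (pt 0 x)) + 4 * Re (Cdir w (pt 1 x)) + Re (Cdir w (pt 2 x))).
 by apply: H => n _; rewrite !L /F mul0r cos0 mul1r; ring.
have := hasI_le measurableT (count_single (F0 0%N)) H.
have -> : F 0%N = 8.
 rewrite /F /lnS ln1 !(mulr0, oppr0) expR0 cos0 !mulr1.
 have -> : c w 1 = 1 by rewrite /c powR1 mul1r /divisors /= big_seq1 /mobius /= powR1 mulr1.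
 by ring.
by apply => n _; case: eqP => // _; exact: F0.
Qed.
(** At w = 0 the quotient zeta(s - w) / zeta(s + w) equals 1 and has derivative -2 zeta' / zeta in
    w. By [Cdir_341] the weighted combination is at least its value 8 at w = 0 for small w > 0, so
    its one-sided derivative is nonnegative. *)
Lemma zet_341 x : 1 < x ->
 3 * Re (dz (pt 0 x) / zet (pt 0 x)) + 4 * Re (dz (pt 1 x) / zet (pt 1 x)) + Re (dz (pt 2 x) / zet (pt 2 x)) <= 0.
Proof.
move=> x1.
pose Q k (v : C) := zet (pt k x - v) / zet (pt k x + v).
have p1 k : 1 < Re (pt k x) by [].
have dQ k : cderiv (Q k) 0 (- 2 * (dz (pt k x) / zet (pt k x))).
 have z1 : cderiv (@zet R) (pt k x - 0) (dz (pt k x)) by rewrite subr0; exact: zet_cder.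
 have z2 : cderiv (@zet R) (pt k x + 0) (dz (pt k x)) by rewrite addr0; exact: zet_cder.
 have d1 := cderiv_comp (cderivB (cderiv_cst (pt k x) 0) (cderiv_id 0)) z1.
 have d2 := cderiv_comp (cderivD (cderiv_cst (pt k x) 0) (cderiv_id 0)) z2.
 have n0 : zet (pt k x + 0) != 0 by rewrite addr0; exact: zet_neq0.
 have := cderivM d1 (@cderivV R (fun v => zet (pt k x + v)) 0 _ n0 d2); congr (cderiv _ _ _).
 rewrite subr0 addr0; rewrite addr0 in n0.
 by field.
pose F v := 3%:C * Q 0%N v + 4%:C * Q 1%N v + Q 2%N v.
have dF := cderivD (cderivD (cderivZ 3%:C (dQ 0%N)) (cderivZ 4%:C (dQ 1%N))) (dQ 2%N).
have dF0 : cderiv F (0 + 1 * (0 : R)%:C) (3%:C * (- 2 * (dz (pt 0 x) / zet (pt 0 x))) + 4%:C * (- 2 * (dz (pt 1 x) / zet (pt 1 x))) +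
  - 2 * (dz (pt 2 x) / zet (pt 2 x))) by rewrite mulr0 addr0.
have dr := cderiv_rcomp (@rderiv_affine R 0 1 0) dF0.
have x10 : 0 < x - 1 by rewrite subr_gt0.
have := Re_mono_lim x10 dr; rewrite mulr1 => H.
have {}H : 0 <= Re (3%:C * (- 2 * (dz (pt 0 x) / zet (pt 0 x))) + 4%:C * (- 2 * (dz (pt 1 x) / zet (pt 1 x))) +
  - 2 * (dz (pt 2 x) / zet (pt 2 x))).
 apply: H => w /andP[w0 wx]; rewrite mulr0 addr0 add0r mul1r.
 have Q0 k : Q k 0 = 1 by rewrite /Q subr0 addr0 divff// zet_neq0.
 have wx' : 1 + w < x by lra.
 have Qw k : Q k w%:C = Cdir w (pt k x) by rewrite /Q Cdir_zet.
 have := Cdir_341 w0 wx'; rewrite /F !Q0 !Qw !reimE /= !mul0r !subr0 mulr1; lra.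
move: H; have m2 (y : C) : - 2 * y = (- 2)%:C * y by rewrite rmorphN /= rmorph_nat.
rewrite !m2; move: (dz (pt 0 x) / _) (dz (pt 1 x) / _) (dz (pt 2 x) / _) => p q r.
rewrite !reimE /= !mul0r !subr0; lra.
Qed.
(** Squared moduli, whose logarithms are real and differentiable, with derivative twice the real
    part of zeta' / zeta. *)
Let N k x := nm (zet (pt k x)) ^+ 2.

Lemma N_gt0 k x : 1 < x -> 0 < N k x.
Proof. by move=> x1; rewrite exprn_gt0// nm_gt0; exact: zet_neq0. Qed.
Lemma is_derive_lnN k (x : R) : 1 < x -> is_derive x 1 (fun x => ln (N k x)) (2 * Re (dz (pt k x) / zet (pt k x))).
Proof.
move=> x1; have x1' : 1 < Re (hline (k%:R * t) x) by [].
have dr := cderiv_rcomp (@rderiv_hline R (k%:R * t) x) (zet_cder x1'); rewrite mulr1 in dr.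
have d1 := rderiv_Re dr; have d2 := rderiv_Im dr.
have d3 := is_deriveD (is_deriveM d1 d1) (is_deriveM d2 d2).
have NE : N k = (fun s => Re (zet (hline (k%:R * t) s))) * (fun s => Re (zet (hline (k%:R * t) s))) +
  (fun s => Im (zet (hline (k%:R * t) s))) * (fun s => Im (zet (hline (k%:R * t) s))).
 by apply/funext => y; rewrite /N nm_sqr !expr2.
rewrite -NE in d3.
have := is_derive1_comp (is_derive1_ln (N_gt0 k x1)) d3.
congr (is_derive _ _ _ _).
have n0 := zet_neq0 x1'; have N0 := N_gt0 k x1.
have nE : N k x = Re (zet (hline (k%:R * t) x)) ^+ 2 + Im (zet (hline (k%:R * t) x)) ^+ 2 by rewrite /N nm_sqr.
rewrite -/(hline (k%:R * t) x).
have -> : Re (dz (pt k x) / zet (pt k x)) = (Re (dz (pt k x)) * Re (zet (pt k x)) + Im (dz (pt k x)) * Im (zet (pt k x))) / N k x.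
 have -> : zet (pt k x) = zet (hline (k%:R * t) x) by [].
 move: nE N0 n0; rewrite /N; case: (zet (hline _ x)) => a b /= nE N0 n0.
 case: (dz _) => p q /=; rewrite nE; field.
 by move: N0; rewrite nE => /gt_eqF ->.
rewrite /GRing.scale /=; ring.
Qed.
Let L x := 3 * ln (N 0 x) + 4 * ln (N 1 x) + ln (N 2 x).

Lemma L_mono x : 1 < x <= 2 -> L 2 <= L x.
Proof.
move=> /andP[x1]; rewrite le_eqVlt => /predU1P[->//|x2].
pose dL y := 3 * (2 * Re (dz (pt 0 y) / zet (pt 0 y))) + 4 * (2 * Re (dz (pt 1 y) / zet (pt 1 y))) + 2 * Re (dz (pt 2 y) / zet (pt 2 y)).
have dLy (y : R) : 1 < y -> is_derive y 1 L (dL y).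
 move=> y1; exact: (is_deriveD (is_deriveD (is_deriveZ 3 (is_derive_lnN 0 y1)) (is_deriveZ 4 (is_derive_lnN 1 y1))) (is_derive_lnN 2 y1)).
have cw : {within `[x, 2], continuous L}.
 apply: continuous_in_subspaceT => y; rewrite inE /= in_itv /= => /andP[xy _].
 apply: differentiable_continuous; apply/derivable1_diffP.
 by have [] := dLy y (lt_le_trans x1 xy).
have [y] := @MVT R L dL x 2 x2 (fun y yi => dLy y (lt_trans x1 (andP yi).1)) cw.
rewrite in_itv /= => /andP[xy _] E.
have h := zet_341 (lt_trans x1 xy).
have x20 : 0 <= 2 - x by rewrite subr_ge0 ltW.
by rewrite -subr_le0 E /dL; nra.
Qed.
Lemma zet1_bound1 (z : C) (m : R) : 1 < Re z -> nm z <= m -> nm (zet1 z) <= m + m * (m + 1) * 2.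
Proof.
move=> z1 zm; apply: le_trans (zet1_bound (lt_trans ltr01 z1)) _.
have n0 := nm_ge0 z; have q2 : 2 / Re z <= 2 by rewrite ler_pdivrMr; nra.
have q0 : 0 <= 2 / Re z by rewrite divr_ge0; lra.
move: (2 / _) q0 q2 => q q0 q2; apply: lerD => //; apply: ler_pM => //; first by nra.
by apply: ler_pM => //; lra.
Qed.
Lemma pow_le (p q : R) n : 0 <= p -> p <= q -> p ^+ n <= q ^+ n.
Proof. by move=> p0 pq; rewrite lerXn2r ?nnegrE// (le_trans p0). Qed.
Lemma nm_zet (z : C) : nm (zet z) = nm (zet1 z) / nm (z - 1).
Proof. by rewrite /zet nmM nmV. Qed.
(** As x tends to 1, a zero at 1 + it would give a factor (x - 1)^(-6) from the pole at 1, a factor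
    (x - 1)^8 from the zero, and a bounded factor near 1 + 2it. The product would tend to 0, while
    [L_mono] keeps it at least its value at x = 2. *)
Lemma zet1_line : t != 0 -> zet1 (Complex 1 t) != 0 :> C.
Proof.
move=> t0; apply/eqP => Z.
have tt : 0 < `|t| by rewrite normr_gt0.
have [M [d [d0 M0 HM]]] := cderiv_bound (cderE (@holo_zet1 R (Complex 1 t) I)).
pose B : R := (2 + 2 * `|t|) + (2 + 2 * `|t|) * (2 + 2 * `|t| + 1) * 2.
have B0 : 0 < B by rewrite /B; nra.
(* 14 bounds [zet1] at real points between 1 and 2, [M] is a Lipschitz constant at the supposed
   zero, and [B] bounds [zet1] near 1 + 2it. *)
pose K := (14 ^+ 2) ^+ 3 * ((M + 1) ^+ 2 / `|t| ^+ 2) ^+ 4 * (B / `|t|) ^+ 2.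
have M1 : 0 < M + 1 by apply: ltr_wpDl.
have K0 : 0 < K by rewrite !mulr_gt0 ?exprn_gt0 ?mulr_gt0 ?invr_gt0 ?exprn_gt0.
have UB x : 1 < x < 2 -> x - 1 < d -> expR (L x) <= K * (x - 1) ^+ 2.
 move=> /andP[x1 x2] xd; have x10 : 0 < x - 1 by rewrite subr_gt0.
 have eL : expR (L x) = N 0 x ^+ 3 * N 1 x ^+ 4 * N 2 x.
  by rewrite /L !expRD !expRM_natl !lnK ?posrE ?N_gt0.
 have h0 : N 0 x <= 14 ^+ 2 / (x - 1) ^+ 2.
  have -> : 14 ^+ 2 / (x - 1) ^+ 2 = (14 / (x - 1)) ^+ 2 by rewrite expr_div_n.
  rewrite /N nm_zet; have -> : pt 0 x - 1 = (x - 1)%:C by ceq; rewrite ?mul0r ?oppr0 ?addr0.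
  rewrite nmR (ger0_norm (ltW x10)) lerXn2r ?nnegrE ?divr_ge0 ?(ltW x10)//.
  rewrite ler_pM2r ?invr_gt0//.
  have := @zet1_bound1 (pt 0 x) 2 x1; have -> : 2 + 2 * (2 + 1) * 2 = 14 :> R by ring.
  apply; rewrite (_ : pt 0 x = x%:C); last by apply: ceqP; rewrite /= ?mul0r.
  by rewrite nmR ger0_norm; lra.
 have h1 : N 1 x <= (M + 1) ^+ 2 / `|t| ^+ 2 * (x - 1) ^+ 2.
  have -> : (M + 1) ^+ 2 / `|t| ^+ 2 * (x - 1) ^+ 2 = ((M + 1) * (x - 1) / `|t|) ^+ 2.
   by rewrite !exprMn exprVn; ring.
  apply: pow_le; first exact: nm_ge0.
  rewrite nm_zet; apply: ler_pM; rewrite ?invr_ge0 ?nm_ge0//.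
   have e : Complex 1 t + (x - 1)%:C = pt 1 x by ceq; rewrite ?mul1r ?addr0//; ring.
   have := HM (x - 1)%:C; rewrite nmR (ger0_norm (ltW x10)) => /(_ xd).
   rewrite Z subr0 e => /le_trans; apply; clear Z HM; nra.
  have tn : `|t| <= nm (pt 1 x - 1).
   by apply: le_trans (le_Im_nm _); rewrite !reimE /= mul1r oppr0 addr0.
  by rewrite lef_pV2 ?posrE//; apply: lt_le_trans tn.
 have h2 : N 2 x <= (B / `|t|) ^+ 2.
  apply: pow_le; first exact: nm_ge0.
  rewrite nm_zet; apply: ler_pM; rewrite ?invr_ge0 ?nm_ge0//.
   apply: zet1_bound1 => //; apply: le_trans (nm_le_ReIm _) _; rewrite /= normrM (ger0_norm (ler0n _ 2)).
   by rewrite lerD2r ger0_norm ltW// (lt_trans ltr01).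
  have tn : `|t| <= nm (pt 2 x - 1).
   apply: le_trans (le_Im_nm _); rewrite !reimE /= oppr0 addr0 normrM (ger0_norm (ler0n _ 2)).
   by have := normr_ge0 t; lra.
  by rewrite lef_pV2 ?posrE//; apply: lt_le_trans tn.
 rewrite eL; have n0 k := ltW (N_gt0 k x1).
 apply: (@le_trans _ _ ((14 ^+ 2 / (x - 1) ^+ 2) ^+ 3 * ((M + 1) ^+ 2 / `|t| ^+ 2 * (x - 1) ^+ 2) ^+ 4 * (B / `|t|) ^+ 2)).
  apply: ler_pM => //; first by rewrite mulr_ge0// exprn_ge0.
  by apply: ler_pM; rewrite ?exprn_ge0//; apply: pow_le.
 apply: eq_ler; rewrite /K.
 by field; rewrite !gt_eqF.
pose y := Num.min (Num.min (d / 2) (1 / 2)) (expR (L 2) / K / 2).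
have y0 : 0 < y by rewrite !lt_min !divr_gt0// expR_gt0.
have yd : y <= d / 2 by rewrite !ge_min lexx.
have y1 : y <= 1 / 2 by rewrite !ge_min lexx orbT.
have yK : y <= expR (L 2) / K / 2 by rewrite ge_min lexx orbT.
have := UB (1 + y); have -> : 1 + y - 1 = y by ring.
have h1 : 1 < 1 + y < 2 by lra.
have h2 : y < d by lra.
move=> /(_ h1 h2) U.
have h3 : 1 < 1 + y <= 2 by lra.
have := L_mono h3; rewrite -ler_expR => V.
have e0 := expR_gt0 (L 2).
have : K * y <= expR (L 2) / 2.
 by move: yK; rewrite -(ler_pM2l K0) => /le_trans; apply; apply: eq_ler; field; rewrite gt_eqF.
by nra.
Qed.

End line1.

Theorem zet1_neq0 (z : C) : 1 <= Re z -> zet1 z != 0.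
Proof.
rewrite le_eqVlt => /predU1P[z1|]; last exact: zet1_neq0_gt1.
have -> : z = Complex 1 (Im z) by apply: ceqP.
have [->|t0] := eqVneq (Im z) 0; last exact: zet1_line.
have -> : Complex 1 0 = 1%:C :> C by [].
rewrite zet1_frac /=; last exact: ltr01.
by rewrite rmorph1 subrr mulr0 mul0r subr0 oner_eq0.
Qed.

End NonVanishing.

(** * The Laplace transform of h *)

Section MellinH.
Variable R : realType.
Notation cnt := (@counting nat R).
Notation mu := (@lebesgue_measure R).
Local Notation C := R[i].
Variable w : R.
Hypothesis w01 : 0 < w < 1 / 2.

Let w0 : 0 < w. Proof. by case/andP: w01. Qed.
Let w2 : w < 1 / 2. Proof. by case/andP: w01. Qed.
Lemma cw_ge0 m : 0 <= c w m.+1. Proof. by have /andP[] := @c_bounds R w m.+1 (ltW w0) isT. Qed.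
Lemma cw_le m : c w m.+1 <= expR (w * lnS R m).
Proof. by have /andP[_] := @c_bounds R w m.+1 (ltW w0) isT; rewrite powR_lnS. Qed.
Lemma meas_ite d (T : measurableType d) (D : set T) (p q f : T -> R) : measurable D ->
 measurable_fun D p -> measurable_fun D q -> measurable_fun D f -> measurable_fun D (fun z => if p z <= q z then f z else 0).
Proof.
move=> mD mp mq mf; apply: measurable_fun_if => //; first exact: measurable_fun_ler.
by apply: measurable_funS mf => // z [].
Qed.
(** Covers both incomplete beta functions of [g]: [th = 1 - w] gives the parameter (3 - 2w) / 2 and
    [th = 1 / 2] gives (5 - 2w) / 4. *)
Definition kap (th : R) : R := 1 + (th - w) / 2.
Lemma kap_gt0 th : w < th -> 0 < kap th. Proof. by rewrite /kap; lra. Qed.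

(* [b th n u] is the incomplete beta integral in the summand of index [n.+1] at x = e^u *)
Definition b th n u : R := if lnS R n < u then inc_beta (expR (2 * (lnS R n - u))) (kap th) w else 0.
Definition bf th n u (v : R) : R := if 2 * (lnS R n - u) <= ln v then betak (kap th) w v else 0.

Lemma betakE (p q v : R) : 0 < v < 1 -> betak p q v = v `^ (p - 1) * (1 - v) `^ (q - 1).
Proof.
move=> /andP[v0 v1]; rewrite /betak; have -> : v `^ (p - 1) = v^-1 * expR (p * ln v); last by ring.
by rewrite /powR gt_eqF// mulrBl mul1r expRD expRN lnK ?posrE// mulrC.
Qed.
Lemma betak_ge0 (p q v : R) : 0 < v < 1 -> 0 <= betak p q v.
Proof. by move=> v01; rewrite betakE// mulr_ge0 ?powR_ge0. Qed.
Lemma hasI_inc_beta z p q : 0 < z < 1 -> 0 < p -> 0 < q ->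
 hasI mu `]0, 1[ (fun v => if z <= v then betak p q v else 0) (inc_beta z p q).
Proof.
move=> /andP[z0 z1] p0 q0; have [i1 _] := hasI_beta p0 q0.
have sub : `[z, 1[ `<=` (`]0, 1[%classic : set R).
 by move=> v /=; rewrite !in_itv /= => /andP[h1 h2]; rewrite h2 andbT (lt_le_trans z0).
have i2 : itg mu `[z, 1[ (betak p q) by apply: itgS i1; [exact: mitv|exact: mitv|exact: sub].
have E v : `[z, 1[%classic v -> betak p q v = v `^ (p - 1) * (1 - v) `^ (q - 1).
 by rewrite /= in_itv /= => /andP[h1 h2]; rewrite betakE// h2 andbT (lt_le_trans z0).
have i3 : itg mu `[z, 1[ (fun v => v `^ (p - 1) * (1 - v) `^ (q - 1)) by exact: (@eq_itg _ _ _ mu `[z, 1[ (betak p q) _ (mitv _) E i2).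
have h : hasI mu `[z, 1[ (betak p q) (inc_beta z p q).
 apply: eq_hasI (_ : hasI mu `[z, 1[ (fun v => v `^ (p - 1) * (1 - v) `^ (q - 1)) _); first exact: mitv.
  by move=> v vi; rewrite E.
 by split; [exact: i3|rewrite /inc_beta -Rintegral_itv_bndo_bndc//; exact: i3].
apply: eq_hasI (hasI_sub (mitv _) (mitv _) sub h); first exact: mitv.
move=> v /=; rewrite in_itv /= => /andP[h1 h2].
by rewrite (_ : (v \in _) = (z <= v))// mem_setE in_itv /= h2 andbT.
Qed.
Lemma hasI_b th n u : w < th -> hasI mu `]0, 1[ (bf th n u) (b th n u).
Proof.
move=> thw; rewrite /b; case: ltP => nu.
 have r0 : 0 < expR (2 * (lnS R n - u)) < 1.
  by rewrite expR_gt0 /= expR_lt1; lra.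
 apply: eq_hasI (hasI_inc_beta r0 (kap_gt0 thw) w0); first exact: mitv.
 move=> v /=; rewrite in_itv /= => /andP[v0 v1]; rewrite /bf.
 by rewrite -{1}(@lnK R v) ?posrE// ler_expR.
have h0 : hasI mu `]0, 1[ (fun=> 0) 0.
 have := hasI_Z 0 (mitv _) (hasI_beta (kap_gt0 thw) w0); rewrite mul0r; apply: eq_hasI; first exact: mitv.
 by move=> v _; rewrite mul0r.
apply: eq_hasI h0; first exact: mitv.
move=> v /=; rewrite in_itv /= => /andP[v0 v1]; rewrite /bf ifF//; apply/negbTE; rewrite -ltNge.
have : ln v < 0 by rewrite -ln1 ltr_ln ?posrE.
lra.
Qed.
Lemma bf_ge0 th n u v : `]0, 1[%classic v -> 0 <= bf th n u v.
Proof. by rewrite /= in_itv /= => v01; rewrite /bf; case: ifP => // _; exact: betak_ge0. Qed.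
Lemma b_ge0 th n u : w < th -> 0 <= b th n u.
Proof. by move=> thw; apply: (hasI_ge0 (hasI_b n u thw)) => v; exact: bf_ge0. Qed.
Lemma b_mono th n u u' : w < th -> u <= u' -> b th n u <= b th n u'.
Proof.
move=> thw uu; apply: (@hasI_le _ _ _ mu `]0, 1[ _ _ _ _ (mitv _) (hasI_b n u thw) (hasI_b n u' thw)).
move=> v /[dup] vi /=; rewrite in_itv /= => /andP[v0 v1]; rewrite /bf.
case: ifP => [h|_]; last by case: ifP => // _; apply: betak_ge0; rewrite v0.
by rewrite ifT//; apply: le_trans h; lra.
Qed.
Lemma meas_bf th n : measurable_fun (`]0, 1[%classic `*` `[0, +oo[%classic : set (mR R * mR R))
 (fun z => bf th n z.2 z.1).
Proof.
apply: meas_ite.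
- by apply: measurableX; exact: mitv.
- apply: (@meas_snd _ _ (mR R) (mR R) R `]0, 1[ `[0, +oo[ (fun u => 2 * (lnS R n - u)) (mitv _) (mitv _)).
 by apply: meas_cont => u; apply: cvgM; [exact: cvg_cst|apply: cvgB; [exact: cvg_cst|exact: cvg_id]].
- exact: (@meas_fst _ _ (mR R) (mR R) R `]0, 1[ `[0, +oo[ (@ln R) (mitv _) (mitv _) (@meas_ln01 R)).
- apply: (@meas_fst _ _ (mR R) (mR R) R `]0, 1[ `[0, +oo[ (betak (kap th) w) (mitv _) (mitv _)).
 exact: (meas_fexp (kap th) (@meas_betaf R w) (@meas_ln01 R)).
Qed.
(** After the exchange, the inner integral over u is an exponential tail starting at
    [lnS R n - ln v / 2], whose power of v moves the first beta parameter from [kap th] to 1 + (s -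
    w) / 2. Once the term is weighted by [aw], [th] survives only in the factor 1 / (s - th). *)
Lemma hasI_b_lap th s n : w < th -> th < s ->
 hasI mu `[0, +oo[ (fun u => b th n u * expR (- (s - th) * u))
 (expR (- (s - th) * lnS R n) * (Gr (1 + (s - w) / 2) * Gr w / Gr (1 + (s + w) / 2) / (s - th))).
Proof.
move=> thw ths.
pose q := s - th; have q0 : 0 < q by rewrite /q; lra.
pose f (z : R * R) := bf th n z.2 z.1 * expR (- q * z.2).
have p0 : 0 < 1 + (s - w) / 2 by lra.
have HV := hasI_Z (expR (- q * lnS R n) / q) (mitv _) (hasI_beta p0 w0).
have mf : measurable_fun (`]0, 1[%classic `*` `[0, +oo[%classic : set (mR R * mR R)) f.
 apply: measurable_funM; first exact: meas_bf.
 apply: (@meas_snd _ _ (mR R) (mR R) R `]0, 1[ `[0, +oo[ (fun u => expR (- q * u)) (mitv _) (mitv _)).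
 by apply: meas_cont; exact: cont_expM.
have f0 (x y : R) : `]0, 1[%classic x -> `[0, +oo[%classic y -> 0 <= f (x, y).
 by move=> xi _; apply: mulr_ge0; [exact: bf_ge0|exact: expR_ge0].
have HA (v : R) : `]0, 1[%classic v -> hasI mu `[0, +oo[ (fun u => f (v, u)) (expR (- q * lnS R n) / q * betak (1 + (s - w) / 2) w v).
 rewrite /= in_itv /= => /andP[v0 v1].
 have lv : ln v < 0 by rewrite -ln1 ltr_ln ?posrE.
 pose a := lnS R n - ln v / 2.
 have a0 : 0 <= a by have := lnS_ge0 R n; rewrite /a; lra.
 have sub : `[a, +oo[ `<=` (`[0, +oo[%classic : set R).
  by move=> u /=; rewrite !in_itv /= !andbT; exact: le_trans.
 have := hasI_sub (mitv _) (mitv _) sub (hasI_Z (betak (kap th) w v) (mitv _) (hasI_exp_tail a q0)).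
 have -> : betak (kap th) w v * (expR (- q * a) / q) = expR (- q * lnS R n) / q * betak (1 + (s - w) / 2) w v.
  rewrite /betak; have -> : expR (- q * a) = expR (- q * lnS R n) * expR (q / 2 * ln v) by rewrite -expRD; congr expR; rewrite /a; field.
  have -> : expR ((1 + (s - w) / 2) * ln v) = expR (kap th * ln v) * expR (q / 2 * ln v) by rewrite -expRD; congr expR; rewrite /kap /q; field.
  by move: (expR _) (expR _) (expR _) (_ `^ _) => A B D E; ring.
 apply: eq_hasI; first exact: mitv.
 move=> u /= ui; rewrite /f /bf /= mem_setE in_itv /= andbT.
 have -> : (2 * (lnS R n - u) <= ln v) = (a <= u) by rewrite /a; apply/idP/idP; lra.
 by case: ifP; rewrite ?mul0r.
have HB (u : R) : `[0, +oo[%classic u -> hasI mu `]0, 1[ (fun v => f (v, u)) (b th n u * expR (- q * u)).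
 move=> _; rewrite mulrC; apply: eq_hasI (hasI_Z (expR (- q * u)) (mitv _) (hasI_b n u thw)); first exact: mitv.
 by move=> v _; rewrite /f /= mulrC.
have := @tonelli _ _ (mR R) (mR R) R mu mu `]0, 1[ `[0, +oo[ f (mitv _) (mitv _) mf f0 _ _ _ HA HB HV.
congr (hasI _ _ _ _).
have -> : 1 + (s - w) / 2 + w = 1 + (s + w) / 2 by field.
move: (Gr _) (Gr _) (Gr _) (expR _) => A B D E; rewrite -/q; ring.
Qed.
Definition aw th n : R := c w n.+1 * expR (- th * lnS R n).
Lemma aw_ge0 th n : 0 <= aw th n. Proof. by apply: mulr_ge0; [exact: cw_ge0|exact: expR_ge0]. Qed.
Lemma aw_le th n : aw th n <= expR ((w - th) * lnS R n).
Proof. by rewrite mulrBl expRD -mulNr; apply: ler_wpM2r; [exact: expR_ge0|exact: cw_le]. Qed.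
(** Both sums in h have this shape, for [th = 1 / 2] and [th = 1 - w]. Their terms are nonnegative;
    cancellation occurs only between the two sums. *)
Definition Ah th u : R := \sum_(n < (Num.truncn (expR u)).+1) aw th n * b th n u.

Lemma b_big th n u : expR u <= n%:R -> b th n u = 0.
Proof.
move=> un; rewrite /b ifF//; apply/negbTE; rewrite -leNgt.
rewrite -ler_expR expR_lnS; apply: le_trans un _; by rewrite ler_nat.
Qed.
Lemma Ah_sum th u N : expR u <= N%:R -> Ah th u = \sum_(n < N) aw th n * b th n u.
Proof.
move=> uN; rewrite /Ah -!(big_mkord xpredT (fun n => aw th n * b th n u)).
have /andP[_ h] := truncn_itv (expR_ge0 u).
have key (a d : nat) : expR u <= a%:R -> (a <= d)%N -> \sum_(0 <= i < a) aw th i * b th i u = \sum_(0 <= i < d) aw th i * b th i u.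
 move=> ua ad; rewrite (big_cat_nat (n := a) (p := d))//= [X in _ + X]big1_seq ?addr0// => i /andP[_].
 rewrite mem_index_iota => /andP[ai _]; rewrite b_big ?mulr0//; apply: le_trans ua _; by rewrite ler_nat.
have [/(key _ _ (ltW h)) //|/ltnW /(key _ _ uN) //] := leqP (Num.truncn (expR u)).+1 N.
Qed.
Lemma Ah_ge0 th u : w < th -> 0 <= Ah th u.
Proof. by move=> thw; apply: sumr_ge0 => n _; apply: mulr_ge0; [exact: aw_ge0|exact: b_ge0]. Qed.
Lemma Ah_count th u : w < th -> hasI cnt setT (fun n => aw th n * b th n u) (Ah th u).
Proof.
move=> thw; have f0 n : 0 <= aw th n * b th n u by apply: mulr_ge0; [exact: aw_ge0|exact: b_ge0].
apply: eq_hasI (count_fin (Num.truncn (expR u)).+1 f0) => // n _.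
case: ltnP => // h; rewrite b_big ?mulr0//.
have /andP[_ /ltW h'] := truncn_itv (expR_ge0 u); apply: le_trans h' _; by rewrite ler_nat.
Qed.
Definition betaW s : R := Gr (1 + (s - w) / 2) * Gr w / Gr (1 + (s + w) / 2).

Lemma hasI_Ah th s : w < th -> th < s -> 1 + w < s ->
 hasI mu `[0, +oo[ (fun u => Ah th u * expR (- (s - th) * u)) (zr (s - w) / zr (s + w) * (betaW s / (s - th))).
Proof.
move=> thw ths sw.
pose f (z : nat * R) := aw th z.1 * b th z.1 z.2 * expR (- (s - th) * z.2).
have mf : measurable_fun (setT `*` `[0, +oo[%classic : set (nat * mR R)) f.
 apply: (@meas_nat_prod _ (mR R) R `[0, +oo[ (fun n u => f (n, u)) (mitv _)) => n.
 have [/itg_meas h _] := hasI_Z (aw th n) (mitv _) (hasI_b_lap n thw ths).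
 by apply: eq_measurable_fun h => u _; rewrite /f /= mulrA.
have f0 (x : nat) (y : R) : setT x -> `[0, +oo[%classic y -> 0 <= f (x, y).
 by move=> _ _; apply: mulr_ge0; [apply: mulr_ge0; [exact: aw_ge0|exact: b_ge0]|exact: expR_ge0].
have HA (n : nat) : setT n -> hasI mu `[0, +oo[ (fun u => f (n, u)) (betaW s / (s - th) * (c w n.+1 * expR (s * - lnS R n))).
 move=> _; have := hasI_Z (aw th n) (mitv _) (hasI_b_lap n thw ths).
 have -> : aw th n * (expR (- (s - th) * lnS R n) * (Gr (1 + (s - w) / 2) * Gr w / Gr (1 + (s + w) / 2) / (s - th))) =
  betaW s / (s - th) * (c w n.+1 * expR (s * - lnS R n)).
  rewrite -/(betaW s) /aw; have -> : expR (s * - lnS R n) = expR (- th * lnS R n) * expR (- (s - th) * lnS R n) by rewrite -expRD; congr expR; ring.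
  by move: (betaW s) (c w _) (expR _) (expR _) => A B D E; ring.
 by apply: eq_hasI; [exact: mitv|move=> u _; rewrite /f /= mulrA].
have HB (u : R) : `[0, +oo[%classic u -> hasI cnt setT (fun n => f (n, u)) (Ah th u * expR (- (s - th) * u)).
 move=> _; rewrite mulrC; apply: eq_hasI (hasI_Z (expR (- (s - th) * u)) measurableT (Ah_count u thw)) => // n _.
 by rewrite /f /= mulrC.
have HV := hasI_Z (betaW s / (s - th)) measurableT (hasI_c (ltW w0) sw).
have := @tonelli _ _ nat (mR R) R cnt mu setT `[0, +oo[ f measurableT (mitv _) mf f0 _ _ _ HA HB HV.
by rewrite mulrC.
Qed.
(** Written with 1 - 2w, against the sign in [g], so that the constant is positive. *)
Definition Kw : R := 4 * w / (1 - 2 * w) * (pi `^ w / Gamma w).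
Definition kpw : R := (2 * w + 1) / (4 * w).

Lemma g_term n u : g w (n.+1%:R / expR u) =
 - Kw * (expR ((1 - w) * (u - lnS R n)) * b (1 - w) n u - kpw * (expR (1 / 2 * (u - lnS R n)) * b (1 / 2) n u)).
Proof.
have e : n.+1%:R / expR u = expR (lnS R n - u) by rewrite expRD expRN expR_lnS.
rewrite e /g /b; have -> : (expR (lnS R n - u) < 1) = (lnS R n < u) by rewrite expR_lt1 subr_lt0.
case: ifP => _; last by ring.
have -> : expR (lnS R n - u) ^+ 2 = expR (2 * (lnS R n - u)) by rewrite -expRM_natl.
have -> : (3 - 2 * w) / 2 = kap (1 - w) by rewrite /kap; field.
have -> : (5 - 2 * w) / 4 = kap (1 / 2) by rewrite /kap; field.
have pe y a : expR y `^ a = expR (a * y) by rewrite /powR gt_eqF ?expR_gt0// expRK.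
rewrite !pe.
have -> : (w - 1) * (lnS R n - u) = (1 - w) * (u - lnS R n) by ring.
have -> : - (1 / 2) * (lnS R n - u) = 1 / 2 * (u - lnS R n) by ring.
rewrite -/kpw; have -> : 4 * w / (2 * w - 1) * (pi `^ w / Gamma w) = - Kw; last by [].
rewrite /Kw -mulNr; congr (_ * _); field.
by apply/andP; split; apply/eqP => E; move: w2; lra.
Qed.
(** The factor x^(-1/2) turns the powers of x / n in [g] into n^(-th) times a power of x: the power
    0 for th = 1/2 and 1/2 - w for th = 1 - w. *)
Lemma hE u : h w (expR u) = Kw * (kpw * Ah (1 / 2) u - expR ((1 / 2 - w) * u) * Ah (1 - w) u).
Proof.
pose N := (Num.truncn (expR u)).+1.
have /andP[_ /ltW hN] := truncn_itv (expR_ge0 u); rewrite -/N in hN.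
pose G n := c w n.+1 * g w (n.+1%:R / expR u).
have G0 n : (N <= n)%N -> G n = 0.
 move=> Nn; rewrite /G g_term !b_big ?mulr0 ?subr0 ?mulr0//; apply: le_trans hN _; by rewrite ler_nat.
rewrite /h.
have -> : limn (fun M => \sum_(1 <= n < M) c w n * g w (n%:R / expR u) : R) = \sum_(n < N) G n.
 apply/cvg_lim => //; apply: (@cvg_near_cst _ _ _ _ _ _ _); exists N.+1 => // M /= NM.
 case: M NM => // M; rewrite ltnS => NM.
 rewrite big_add1 /= -(big_mkord xpredT G) (big_cat_nat (n := N) (p := M))//=.
 by rewrite [X in _ + X]big1_seq ?addr0// => i /andP[_]; rewrite mem_index_iota => /andP[Ni _]; exact: G0.
rewrite !(Ah_sum _ hN) !mulr_sumr -sumrB mulr_sumr; apply: eq_bigr => n _.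
have -> : expR u `^ (- (1 / 2)) = expR (- (1 / 2) * u) by rewrite /powR gt_eqF ?expR_gt0// expRK.
rewrite /G g_term /aw.
have -> : expR ((1 - w) * (u - lnS R n)) = expR (1 / 2 * u) * (expR ((1 / 2 - w) * u) * expR (- (1 - w) * lnS R n)) by rewrite -!expRD; congr expR; field.
have -> : expR (1 / 2 * (u - lnS R n)) = expR (1 / 2 * u) * expR (- (1 / 2) * lnS R n) by rewrite -!expRD; congr expR; field.
have E1 : expR (- (1 / 2) * u) * expR (1 / 2 * u) = 1 by rewrite -expRD -mulrDl addNr mul0r expR0.
move: (b (1 - w) n u) (b (1 / 2) n u) (expR (- (1 / 2) * u)) (expR (1 / 2 * u)) (c w n.+1) (expR ((1 / 2 - w) * u)) (expR (- (1 - w) * lnS R n)) (expR (- (1 / 2) * lnS R n)) Kw kpw E1 => B1 B2 p q cc e1 e2 e3 K k E1.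
transitivity (p * q * (K * (k * (cc * e3 * B2) - e1 * (cc * e2 * B1)))); first by ring.
by rewrite E1 mul1r.
Qed.

End MellinH.

(** * Zeros from eventual nonnegativity *)

Section LaplaceH.
Variable R : realType.
Notation mu := (@lebesgue_measure R).
Local Notation C := R[i].
Variable w : R.
Hypotheses (w0 : 0 < w) (w2 : w < 1 / 2).

Let w01 : 0 < w < 1 / 2. Proof. by rewrite w0. Qed.
Local Ltac wlra := have ? := w0; have ? := w2; lra.

Definition hu (u : R) : R := h w (expR u).

(** With s = z + 1/2, the poles at s = 1/2 and s = 1 - w of the two sums, weighted by [kpw], combine
    into the rational factor (z - 1/2 - w) / (z (z - 1/2 + w)). Its numerator and the second factor
    below are (s - w) - 1 and (s + w) - 1, exactly what turns the zeta quotient into a quotient of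
    [xi]. *)
Definition hlap (z : R) : R :=
 pi `^ w * (z - 1 / 2 - w) / (z * (z - 1 / 2 + w)) * (Gr (1 + (z + 1 / 2 - w) / 2) / Gr (1 + (z + 1 / 2 + w) / 2)) *
 (zr (z + 1 / 2 - w) / zr (z + 1 / 2 + w)).

Lemma hasI_hu (z : R) : 1 / 2 + w < z -> hasI mu `[0, +oo[ (fun u => hu u * expR (z * - u)) (hlap z).
Proof.
move=> zw; pose s := z + 1 / 2.
have h1 : w < 1 / 2 by []. have h2 : w < 1 - w by wlra.
have h3 : 1 / 2 < s by rewrite /s; wlra. have h4 : 1 - w < s by rewrite /s; wlra.
have h5 : 1 + w < s by rewrite /s; wlra.
have := hasI_Z (Kw w) (mitv _) (hasI_B (mitv _) (hasI_Z (kpw w) (mitv _) (hasI_Ah w01 h1 h3 h5)) (hasI_Ah w01 h2 h4 h5)).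
have -> : Kw w * (kpw w * (zr (s - w) / zr (s + w) * (betaW w s / (s - 1 / 2))) - zr (s - w) / zr (s + w) * (betaW w s / (s - (1 - w)))) = hlap z.
 have sw : 1 < s + w by wlra.
 have g1 : 0 < 1 + (s + w) / 2 by wlra.
 have := Gr_gt0 g1; have := Gr_gt0 w0; have := zr_gt0 sw.
 rewrite /Kw /kpw /hlap -/s /betaW Gamma_Gr//.
 move: (zr (s - w)) (zr (s + w)) (Gr (1 + (s + w) / 2)) (Gr (1 + (s - w) / 2)) (Gr w) (pi `^ w) => A B D E G P B0 G0 D0.
 rewrite /s; field.
 by rewrite !gt_eqF//; wlra.
apply: eq_hasI; first exact: mitv.
move=> u _; rewrite /hu hE//.
have e1 : expR (- (s - 1 / 2) * u) = expR (z * - u) by congr expR; rewrite /s; ring.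
have e2 : expR (- (s - (1 - w)) * u) = expR ((1 / 2 - w) * u) * expR (z * - u) by rewrite -expRD; congr expR; rewrite /s; field.
by rewrite e1 e2; move: (Ah w _ u) (Ah w _ u) (expR _) (expR _) (Kw w) (kpw w) => A B D E K k; ring.
Qed.
Lemma meas_hu : measurable_fun (ray0 R) hu.
Proof.
have z1 : 1 / 2 + w < 1 by wlra.
have [/itg_meas h _] := hasI_hu z1.
have h' : measurable_fun (ray0 R) (fun u => expR (1 * u)) by apply: meas_cont; exact: cont_expM.
apply: eq_measurable_fun (measurable_funM h h') => u _ /=.
by rewrite -mulrA -expRD !mul1r addNr expR0 mulr1.
Qed.
Lemma hlap_xi (z : R) : 1 / 2 + w < z ->
 z%:C * xi (2^-1%:C + z%:C + w%:C) * (hlap z)%:C = xi (2^-1%:C + z%:C - w%:C).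
Proof.
move=> zw; have z1 : 1 < 2^-1 + z + w by wlra. have z2 : 1 < 2^-1 + z - w by wlra.
rewrite -!rmorphD -rmorphB !xi_real// -!rmorphM; congr (_%:C); rewrite /hlap.
have -> : 1 + (z + 1 / 2 - w) / 2 = (2^-1 + z - w) / 2 + 1 by field.
have -> : 1 + (z + 1 / 2 + w) / 2 = (2^-1 + z + w) / 2 + 1 by field.
have -> : z + 1 / 2 + w = 2^-1 + z + w by field.
have -> : z + 1 / 2 - w = 2^-1 + z - w by field.
have -> : expR (- ((2^-1 + z - w) / 2) * lnpi R) = pi `^ w * expR (- ((2^-1 + z + w) / 2) * lnpi R).
 by rewrite /powR gt_eqF ?pi_gt0// -expRD -/(lnpi R); congr expR; field.
have g0 : 0 < (2^-1 + z + w) / 2 + 1 by wlra.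
have := Gr_gt0 g0; have := zr_gt0 z1.
move: (Gr _) (Gr _) (expR _) (pi `^ w) (zr _) (zr _) => A B D P E F E0 A0.
by field; rewrite !gt_eqF//; wlra.
Qed.
Definition Lh (z : C) := Lap mu `[0, +oo[ hu (fun u => - u) z.

Lemma holo_Lh : holo (hplane (1 / 2 + w)) Lh.
Proof.
move=> z zw; have [y y1 yz] := hplane_mid zw.
have y2 : 1 / 2 + w < Re z + 1 by move: zw; rewrite /hplane; wlra.
eexists; apply: (@lap_deriv _ _ _ mu _ (mitv _) hu (fun u => - u) y (Re z + 1) meas_hu (@meas_opp R _)
 (hasI_hu y1).1 (hasI_hu y2).1).
by apply/andP; split; [exact: yz|lra].
Qed.
Lemma holo_xi_shift (D : C -> Prop) (a : C) : holo D (fun z => xi (2^-1%:C + z + a)).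
Proof.
apply: (holo_comp (D' := @whole R) (f := fun z => 2^-1%:C + z + a)) => //; last exact: holo_xi.
by apply: holoD; [apply: holoD; [exact: holo_cst|exact: holo_id]|exact: holo_cst].
Qed.
Lemma Lh_eq (z : C) : 1 / 2 + w < Re z -> z * xi (2^-1%:C + z + w%:C) * Lh z = xi (2^-1%:C + z - w%:C).
Proof.
move: z; apply: (@identity_real R (hplane (1 / 2 + w)) (fun z => z * xi (2^-1%:C + z + w%:C) * Lh z)
 (fun z => xi (2^-1%:C + z - w%:C)) 1 2).
- exact: hplane_open.
- exact: hplane_convex.
- by apply: holoM; [apply: holoM; [exact: holo_id|exact: holo_xi_shift]|exact: holo_Lh].
- exact: holo_xi_shift.
- by wlra.
- by move=> x /andP[x1 _]; rewrite /hplane /=; wlra.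
- move=> x /andP[x1 _]; have x2 : 1 / 2 + w < x by wlra.
 by rewrite /Lh (Lap_real (mitv _) (hasI_hu x2)); exact: hlap_xi.
Qed.

Section landau_step.
Variable U0 : R.
Hypothesis U00 : 0 <= U0.
Hypothesis hpos : forall u, U0 < u -> 0 <= hu u.

Let D1 : set (mR R) := `]U0, +oo[%classic.
Let D2 : set (mR R) := `[0, U0]%classic.
Let sub1 : D1 `<=` `[0, +oo[%classic.
Proof. by move=> u; rewrite /D1 /= !in_itv /= !andbT => h; rewrite ltW// (le_lt_trans U00). Qed.
Let sub2 : D2 `<=` `[0, +oo[%classic.
Proof. by move=> u; rewrite /D2 /= !in_itv /= andbT => /andP[]. Qed.
Let i1 x : 1 / 2 + w < x -> itg mu D1 (fun u => hu u * expR (x * - u)).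
Proof. by move=> xw; apply: itgS (hasI_hu xw).1; [exact: mitv|exact: mitv|exact: sub1]. Qed.
Let m1 : measurable_fun D1 hu. Proof. by apply: measurable_funS meas_hu; [exact: mitv|exact: sub1]. Qed.
Let m2 : measurable_fun D2 hu. Proof. by apply: measurable_funS meas_hu; [exact: mitv|exact: sub2]. Qed.
Let i2 x : itg mu D2 (fun u => hu u * expR (x * - u)).
Proof.
have x1 : 1 / 2 + w < 1 by wlra.
have j : itg mu D2 (fun u => hu u * expR (1 * - u)) by apply: itgS (hasI_hu x1).1; [exact: mitv|exact: mitv|exact: sub2].
apply: (@itg_le _ _ _ mu D2 _ _ (mitv _) _ (itgZ (expR (`|x - 1| * U0)) (mitv _) (itg_norm j))).
 by apply: meas_fexp; [exact: m2|exact: meas_opp].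
move=> u; rewrite /D2 /= in_itv /= => /andP[u0 u1].
rewrite !normrM mulrCA ler_wpM2l// !(ger0_norm (expR_ge0 _)) -expRD ler_expR.
have : `|x - 1| * u <= `|x - 1| * U0 by rewrite ler_wpM2l.
have := ler_norm (- (x - 1)); rewrite normrN => h; have : - (x - 1) * u <= `|x - 1| * u by rewrite ler_wpM2r.
by rewrite -/(is_true _); move: (`|x - 1|) => q; wlra.
Qed.
Let L1 z := Lap mu D1 hu (fun u => - u) z.
Let L2 z := Lap mu D2 hu (fun u => - u) z.
Let holoL2 : holo (@whole R) L2.
Proof.
move=> z _; eexists; apply: (@lap_deriv _ _ _ mu _ (mitv _) hu (fun u => - u) (Re z - 1) (Re z + 1) m2 (@meas_opp R _) (i2 _) (i2 _)).
by wlra.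
Qed.
Let splitL (x : R) : 1 / 2 + w < x -> L1 x%:C + L2 x%:C = (hlap x)%:C.
Proof.
move=> xw; rewrite /L1 /L2 (Lap_real (mitv _) (hasI_itg (i1 xw))) (Lap_real (mitv _) (hasI_itg (i2 x))) -rmorphD.
congr (_%:C); apply: (@hasI_uniq _ _ _ mu `[0, +oo[ _ _ _ _ (hasI_hu xw)).
have := hasI_D (mitv _) (hasI_sub (mitv _) (mitv _) sub1 (hasI_itg (i1 xw))) (hasI_sub (mitv _) (mitv _) sub2 (hasI_itg (i2 x))).
apply: eq_hasI; first exact: mitv.
move=> u /=; rewrite in_itv /= andbT => u0; rewrite !mem_setE !in_itv /= u0 andbT /=.
by case: ltP => h; rewrite ?addr0 ?add0r.
Qed.
(** The transform [L2] over the bounded interval up to [U0] is entire and goes into the right side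
    [N]; the rest [L1] has a nonnegative density. Landau's theorem makes [L1] holomorphic for Re z >
    0, so a zero of [M] is a zero of [N] and hence of the numerator. *)
Lemma xi_zero_shift (z : C) : 0 < Re z -> xi (2^-1%:C + z + w%:C) = 0 -> xi (2^-1%:C + z - w%:C) = 0.
Proof.
pose M (z : C) := z * xi (2^-1%:C + z + w%:C).
pose N z := xi (2^-1%:C + z - w%:C) - M z * L2 z.
have hM D : holo D M by apply: holoM; [exact: holo_id|exact: holo_xi_shift].
have hN D : holo D N.
 by apply: holoB; [exact: holo_xi_shift|apply: holoM; [exact: hM|apply: holoS holoL2]].
have rel (x : R) : 1 < x -> M x%:C * L1 x%:C = N x%:C.
 move=> x1; have xw : 1 / 2 + w < x by wlra.
 have := hlap_xi xw; rewrite -(splitL xw) -/(M x%:C) /N => <-; ring.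
have a0 (u : mR R) : D1 u -> - u <= 0 :> R.
 by rewrite /D1 /= in_itv /= andbT => h; rewrite oppr_le0 ltW// (le_lt_trans U00).
have f0 (u : mR R) : D1 u -> 0 <= hu u by rewrite /D1 /= in_itv /= andbT; exact: hpos.
have x1 : 1 / 2 + w < 1 by wlra.
have ok := @landau _ _ R mu D1 hu (fun u => - u) (mitv _) m1 (@meas_opp R _) f0 a0 M N 1 (hM _) (hN _) _ ltr01 (i1 x1) rel.
have {}ok : forall x : R, 0 < x -> itg mu D1 (fun u => hu u * expR (x * - u)).
 apply: ok => x x0; apply: mulf_neq0; first by rewrite (inj_eq (@complexI R)) gt_eqF.
 rewrite -!rmorphD; have p0 : 0 < 2^-1 + x + w by wlra.
 by have [h _] := xi_pos_real p0; apply: contraTneq h => ->; rewrite ltxx.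
have hL1 : holo (hplane 0) L1.
 move=> y y0; have [q q0 qy] := hplane_mid y0.
 exact: (@Lap_holo _ _ R mu D1 hu (fun u => - u) (mitv _) m1 (@meas_opp R _) f0 a0 q (ok q q0)).
move=> z0 Z; have := @identity_real R (hplane 0) (fun z => M z * L1 z) N 1 2 (@hplane_open R 0) (@hplane_convex R 0).
move=> /(_ (holoM (hM _) hL1) (hN _)) H.
have {}H : forall z, hplane 0 z -> M z * L1 z = N z.
 apply: H; first by wlra.
  by move=> x /andP[x1' _]; rewrite /hplane /=; wlra.
 by move=> x /andP[x1' _]; exact: rel.
by have := H z z0; rewrite /N /M Z mulr0 !mul0r subr0 => <-.
Qed.
End landau_step.

End LaplaceH.

Section PartOne.
Variable R : realType.
Local Notation C := R[i].

Definition eventually_ge0 (w : R) := exists xw : R, 1 <= xw /\ (forall x : R, xw < x -> 0 <= h w x).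

(** To the right of -2 the factor Gamma(s / 2 + 1) is finite and nonzero, so no trivial zero
    interferes. *)
Lemma zeta_xi (s : C) : s <> 1 -> -2 < Re s -> (zeta s = 0 <-> xi s = 0).
Proof.
move=> /eqP s1 s2; rewrite zeta_zet// /zet xi_zet1//; split.
 move=> /eqP; rewrite mulf_eq0 invr_eq0 subr_eq0 (negbTE s1) orbF => /eqP ->.
 by rewrite !mul0r.
have g0 : 0 < Re (s / 2 + 1) by rewrite reimE Re_half /=; lra.
have e0 := cexp_neq0 (- (s / 2 * (lnpi R)%:C)); move: (cgam_neq0 g0) e0 (zet1 s).
move: (cgam _) (cexp _) => p q p0 q0 y /eqP.
by rewrite mulf_eq0 (negbTE p0) orbF mulf_eq0 (negbTE q0) orbF => /eqP ->; rewrite mul0r.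
Qed.

Theorem criterion_part1 (w0 : R) : 0 <= w0 < 1 / 2 ->
 (forall w, w0 < w < 1 / 2 -> eventually_ge0 w) -> forall s : C, s <> 1 -> 1 / 2 + w0 < Re s -> zeta s <> 0.
Proof.
move=> /andP[w00 w02] H s s1 sw /zeta_xi -/(_ s1) E.
have {}E : xi s = 0 by apply: E; lra.
(* [w] must stay below 1 / 2 and below Re s - 1 / 2, the latter to keep s - 1/2 - w in the
   half-plane Re z > 0. *)
pose m := Num.min (1 / 2) (Re s - 1 / 2).
have m1 : m <= 1 / 2 by rewrite ge_min lexx.
have m2 : m <= Re s - 1 / 2 by rewrite ge_min lexx orbT.
have m0 : w0 < m by rewrite lt_min w02; lra.
have Z : forall z, whole z -> xi z = 0 :> C.
 apply: (@zero_propagates R (@whole R) (@xi R) (s - (2 * w0)%:C) (2 * (m - w0)) (@whole_open R) (@whole_convex R) (@holo_xi R) I).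
  by lra.
 move=> q /andP[q0 qm]; pose w := w0 + q / 2.
 have ww : w0 < w < 1 / 2 by rewrite /w; lra.
 have w0' : 0 < w by rewrite /w; lra.
 have [xw [xw1 hx]] := H w ww.
 have hp u : ln xw < u -> 0 <= hu w u.
  move=> lu; apply: hx; rewrite -(@lnK R xw) ?posrE ?ltr_expR//.
  exact: lt_le_trans xw1.
 have := @xi_zero_shift R w w0' (andP ww).2 (ln xw) (ln_ge0 xw1) hp (s - 2^-1%:C - w%:C).
 have -> : 2^-1%:C + (s - 2^-1%:C - w%:C) + w%:C = s by ring.
 have -> : 2^-1%:C + (s - 2^-1%:C - w%:C) - w%:C = s - (2 * w0)%:C - q%:C.
  have -> : (2 * w0)%:C = w%:C + w%:C - q%:C by rewrite -rmorphD -rmorphB; congr (_%:C); rewrite /w; field.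
  by ring.
 by apply => //; rewrite !reimE /= /w; clear E; lra.
have [h _] := @xi_pos_real R 2 (ltr0n R 2); move: h; rewrite Z//= ltxx.
by [].
Qed.

Theorem criterion_rh : (forall w : R, 0 < w < 1 / 2 -> eventually_ge0 w) -> riemann_hypothesis R.
Proof.
move=> H s /andP[s0 s1] E.
have P := @criterion_part1 0 _ H; have {}P : forall s : C, s <> 1 -> 1 / 2 < Re s -> zeta s <> 0.
 by move=> z z1 zw; apply: P => //; [lra|rewrite addr0].
have sn1 : s <> 1 by move=> e; move: s1; rewrite e /= ltxx.
case: (ltgtP (Re s) (1 / 2)) => // h; last by case: (P s sn1 h).
have sn1' : 1 - s <> 1.
 by move=> e; move: s0; rewrite (_ : s = 1 - (1 - s)); [rewrite e subrr /= ltxx|ring].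
have s2 : -2 < Re s by lra.
have h2 : -2 < Re (1 - s) by rewrite !reimE /=; lra.
case: (P (1 - s) sn1'); first by rewrite !reimE /=; lra.
apply/(zeta_xi sn1' h2); rewrite xi_sym; exact/(zeta_xi sn1 s2).
Qed.

End PartOne.

(** * Consequences of the Riemann hypothesis *)

Section LogZeta.
Variable R : realType.
Notation cnt := (@counting nat R).
Local Notation C := R[i].

(** The factor z - 1 in [zet1] removes the pole, and the division by z + 2 restores the size of
    zeta: [zst] is bounded for Re z >= 3 and bounded away from 0 on Re z = 4, uniformly in the
    height. *)
Definition zst (z : C) : C := zet1 z / (z + 2).

Lemma nm_ge_Re (z : C) (m : R) : m <= Re z -> m <= nm z.
Proof. by move=> h; apply: le_trans (le_Re_nm z); apply: le_trans h (ler_norm _). Qed.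
Lemma add2_neq0 (z : C) : 0 < Re z -> z + 2 != 0.
Proof.
by move=> z0; apply/eqP => /(congr1 (fun z : C => Re z)); rewrite !reimE /= => E; lra.
Qed.
Lemma nm_add2 (z : C) : 0 < Re z -> 2 <= nm (z + 2) /\ nm z <= nm (z + 2).
Proof.
move=> z0; split; first by apply: nm_ge_Re; rewrite reimE /=; lra.
rewrite -(ler_sqr (nm_ge0 _) (nm_ge0 _)) !nm_sqr !reimE /= addr0; nra.
Qed.
Lemma zst_upper (z : C) : 1 / 2 < Re z -> nm (zst z) <= 5 * (nm z + 2).
Proof.
move=> z0; have z00 : 0 < Re z by lra.
have [n2 n1] := nm_add2 z00; have n0 := nm_ge0 z.
rewrite /zst nmM nmV ler_pdivrMr; last by apply: lt_le_trans n2.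
apply: le_trans (zet1_bound z00) _.
have q4 : 2 / Re z <= 4 by rewrite ler_pdivrMr//; lra.
have h : nm z * (nm z + 1) * (2 / Re z) <= nm z * (nm z + 1) * 4.
 by rewrite ler_wpM2l// mulr_ge0// addr_ge0.
by move: h; move: (2 / Re z) (nm (z + 2)) n1 n2 => q m n1 n2 h; nra.
Qed.
Lemma zr4 : zr 4 <= 4 / 3 :> R.
Proof.
rewrite /zr; have -> : 4 - 1 = 3 :> R by ring.
rewrite gerBl mulr_ge0//; apply: Rintegral_ge0 => u _; apply: mulr_ge0; [exact: frac_ge0|exact: expR_ge0].
Qed.
Lemma itg1 (z : C) : 1 < Re z -> itg cnt setT (fun n => 1 * expR (Re z * - lnS R n)).
Proof. by move=> z1; exact: (hasI_zeta1 z1).1. Qed.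
(** The first term minus all others: 1 - (zeta(4) - 1) is at least 2 - 4/3. *)
Lemma zet_lower4 (t : R) : 2 / 3 <= nm (zet (Complex 4 t)).
Proof.
have r4 : 1 < (4 : R) by lra.
apply: nm_ge_Re; rewrite zet_Dir//.
have H : hasI cnt setT (fun n => Re (lapF (fun=> 1) (fun n => - lnS R n) (Complex 4 t) n)) (Re (Dirf (fun=> 1) (Complex 4 t))).
 apply: hasI_itg.
 by have [] := lap_citg measurableT (meas_cnt (fun=> 1)) (meas_cnt _) (itg1 (r4 : 1 < Re (Complex 4 t))).
have H2 := hasI_B measurableT (@count_single R 0 (fun=> 2) (ler0n _ 2)) (hasI_zeta1 r4).
have := hasI_le measurableT H2 H _ => /(_ _) K.
apply: le_trans (K _); first by have := zr4; lra.
move=> n _; rewrite /lapF /cexp !reimE /= !mul1r !mulr0 !mul0r !subr0 ?addr0 ?add0r.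
move: (expR_gt0 (4 * - lnS R n)) (cos_geN1 (t * - lnS R n)).
case: eqP => [->|_].
 by rewrite /lnS ln1 oppr0 !mulr0 expR0 cos0; lra.
by move: (expR _) (cos _) => e cc e0 c1; nra.
Qed.
Lemma zet_upper3 (z : C) : 3 <= Re z -> nm (zet z) <= 2 * (3 / 2).
Proof.
move=> z3; have z1 : 1 < Re z by lra.
have r3 : 1 < (3 : R) by lra.
rewrite zet_Dir//; have := CI_bound measurableT (lap_citg measurableT (meas_cnt (fun=> 1)) (meas_cnt _) (itg1 z1)) (hasI_zeta1 r3) _.
move=> /(_ _) K; apply: le_trans (K _) _.
 move=> n _; rewrite nm_lapF normr1 !mul1r ler_expR; have := lnS_ge0 R n; nra.
rewrite ler_wpM2l// /zr; have -> : 3 - 1 = 2 :> R by ring.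
rewrite gerBl mulr_ge0//; apply: Rintegral_ge0 => u _; apply: mulr_ge0; [exact: frac_ge0|exact: expR_ge0].
Qed.
Lemma zst_zet (z : C) : 1 < Re z -> zst z = zet z * ((z - 1) / (z + 2)).
Proof.
move=> z1; have n1 : z - 1 != 0 by rewrite subr_eq0; apply: contraTneq z1 => ->; rewrite /= ltxx.
by rewrite /zst /zet mulrA mulfVK.
Qed.
Lemma nm_ratio (z : C) : 1 < Re z -> nm ((z - 1) / (z + 2)) <= 1.
Proof.
move=> z1; have z0 : 0 < Re z by lra.
have [n2 _] := nm_add2 z0.
rewrite nmM nmV ler_pdivrMr ?mul1r; last by apply: lt_le_trans n2.
by rewrite -(ler_sqr (nm_ge0 _) (nm_ge0 _)) !nm_sqr !reimE /= oppr0 !addr0; nra.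
Qed.
Lemma zst_lower4 (t : R) : 1 / 3 <= nm (zst (Complex 4 t)).
Proof.
rewrite zst_zet /=; last by lra.
have h := zet_lower4 t; rewrite nmM.
have : 1 / 2 <= nm ((Complex 4 t - 1) / (Complex 4 t + 2)).
 have z0 : 0 < Re (Complex 4 t) by rewrite /=; lra.
 have [n2 _] := nm_add2 z0; have n0 : 0 < nm (Complex 4 t + 2) by apply: lt_le_trans n2.
 rewrite nmM nmV ler_pdivlMr//.
 rewrite -(ler_sqr) ?nnegrE ?mulr_ge0 ?nm_ge0 ?divr_ge0// exprMn !nm_sqr !reimE /= oppr0 !addr0.
 by have := sqr_ge0 t; lra.
by move: (nm _) (nm _) h => p q h1 h2; nra.
Qed.

Hypothesis RH : riemann_hypothesis R.

Lemma zst_neq0 (z : C) : 1 / 2 < Re z -> zst z != 0.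
Proof.
move=> z1; have z0 : 0 < Re z by lra.
apply: mulf_neq0; last by rewrite invr_eq0 add2_neq0.
have [h|h] := leP 1 (Re z); first exact: zet1_neq0.
have zn1 : z != 1 by apply: contraTneq h => ->; rewrite /= ltxx.
apply/eqP => E; have : Re z = 1 / 2.
 by apply: RH; [rewrite z0 h|rewrite zeta_zet// /zet E mul0r].
by clear E; lra.
Qed.
Lemma holo_zst : holo (hplane (1 / 2)) zst.
Proof.
apply: holoM; first by apply: holoS (@holo_zet1 R).
apply: holoV; first by move=> z h; apply: add2_neq0; move: h; rewrite /hplane; lra.
by apply: holoD; [exact: holo_id|exact: holo_cst].
Qed.
Lemma geo_tail_small (q e : R) : 0 < q < 1 -> 0 < e -> exists N : nat, q ^+ N / (1 - q) <= e.
Proof.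
move=> /andP[q0 q1] e0.
have : (fun n => q ^+ n) @ \oo --> (0 : R) by apply: cvg_expr; rewrite ger0_norm ?ltW.
move=> /cvgrPdist_lt /(_ (e * (1 - q))) H.
have e1 : 0 < e * (1 - q) by rewrite mulr_gt0// subr_gt0.
have [N _ HN] := H e1; exists N; have := HN N (leqnn N); rewrite /= sub0r normrN ger0_norm ?exprn_ge0 ?(ltW q0)// => HN'.
by rewrite ler_pdivrMr ?subr_gt0// ltW.
Qed.
(** The first N coefficients use the bound [A], which in the application does not depend on the
    height; only the tail uses the bound [B] from the large circle. As the tail carries a small
    geometric factor, a [B] growing with the height enters with small weight, as in a three circles
    argument. *)
Lemma pser_split (u : nat -> C) a f r (rr rho A B : R) z N : pser u a f r -> nm (z - a) <= rr -> 1 <= rr -> rr < rho -> rho < r ->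
 0 <= A -> 0 <= B ->
 (forall n, (0 < n)%N -> nm (u n) <= A) -> (forall n, (0 < n)%N -> nm (u n) * rho ^+ n <= B) ->
 nm (f z - u 0%N) <= N%:R * (A * rr ^+ N) + B * ((rr / rho) ^+ N / (1 - rr / rho)).
Proof.
move=> P zr' r1 rrho rhor A0 B0 HA HB.
have rho0 : 0 < rho by lra.
set q := rr / rho.
have q0 : 0 < q by rewrite divr_gt0//; lra.
have q1 : q < 1 by rewrite ltr_pdivrMr//; lra.
have rr0 : 0 <= rr by lra.
pose S M := \sum_(0 <= n < M) (if n == 0%N then 0 else nm (u n) * rr ^+ n).
have S1 M : (M <= N)%N -> S M <= M%:R * (A * rr ^+ N).
 elim: M => [|M IH] MN; first by rewrite /S big_geq// mul0r.
 rewrite /S big_nat_recr//= -/(S M) -natr1 mulrDl mul1r; apply: lerD; first by apply: IH; exact: ltnW.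
 case: eqP => [_|/eqP M0]; first by rewrite mulr_ge0// exprn_ge0.
 by apply: ler_pM; rewrite ?exprn_ge0 ?nm_ge0 ?HA ?lt0n// ler_weXn2l// ltnW.
have S2 k : S (N + k)%N <= N%:R * (A * rr ^+ N) + B * ((q ^+ N - q ^+ (N + k)) / (1 - q)).
 elim: k => [|k IH]; first by rewrite addn0 subrr mul0r mulr0 addr0; exact: S1.
 rewrite addnS /S big_nat_recr//= -/(S (N + k)%N).
 have h : (if (N + k == 0)%N then 0 else nm (u (N + k)%N) * rr ^+ (N + k)) <= B * q ^+ (N + k).
  case: eqP => [_|/eqP M0]; first by rewrite mulr_ge0// exprn_ge0// ltW.
  have -> : rr ^+ (N + k) = rho ^+ (N + k) * q ^+ (N + k).
   by rewrite -exprMn; congr (_ ^+ _); rewrite /q mulrC divfK// gt_eqF.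
  by rewrite mulrA ler_wpM2r ?exprn_ge0 ?(ltW q0)// HB// lt0n.
 apply: le_trans (lerD IH h) _; rewrite -addrA lerD2l exprS; apply: eq_ler.
 by field; rewrite subr_eq0 gt_eqF.
have cv : cvs (fun n => psum u (z - a) n - u 0%N) (f z - u 0%N).
 by apply: cvsB; [apply: P; lra|exact: cvs_cst].
apply: (cvs_le (N0 := N.+1) cv) => n Nn.
have -> : psum u (z - a) n - u 0%N = \sum_(0 <= k < n) (if k == 0%N then 0 else u k * (z - a) ^+ k).
 case: n Nn => // n _; rewrite /psum !big_nat_recl//= expr0 mulr1 add0r addrC addKr.
 by [].
apply: le_trans (nm_sum _ _ _) _.
apply: (@le_trans _ _ (S n)).
 apply: ler_sum => k _; case: eqP => _; first by rewrite nm0.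
 by rewrite nmM nmX ler_wpM2l ?nm_ge0// lerXn2r ?nnegrE ?nm_ge0.
rewrite -(subnKC (ltnW Nn)); apply: le_trans (S2 _) _; rewrite lerD2l ler_wpM2l// ler_wpM2r ?invr_ge0 ?subr_ge0 ?(ltW q1)//.
by rewrite gerBl exprn_ge0// ltW.
Qed.

Theorem log_zst_bound (eta e : R) : 0 < eta <= 1 -> 0 < e ->
 exists K : R, forall z : C, 1 / 2 + eta <= Re z -> Re z <= 4 ->
  `|ln (nm (zst z))| <= K + e * ln (2 + `|Im z|).
Proof.
move=> /andP[eta0 eta1] e0.
(* The centre 4 + it has distance 7/2 from the line Re z = 1/2; the three radii leave nested margins
   for the target point, the coefficient bound and the logarithm. *)
pose rr : R := 7 / 2 - eta; pose rho := 7 / 2 - eta / 2; pose r := 7 / 2 - eta / 4.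
have rr1 : 1 <= rr by rewrite /rr; lra.
have rrrho : rr < rho by rewrite /rr /rho; lra.
have rhor : rho < r by rewrite /r /rho; lra.
have rho0 : 0 < rho by lra.
have q01 : 0 < rr / rho < 1 by apply/andP; split; [rewrite divr_gt0//; lra|rewrite ltr_pdivrMr//; lra].
have e4 : 0 < e / 4 by rewrite divr_gt0.
have [N HN] := geo_tail_small q01 e4.
have l30 : 0 <= ln (3 : R) by apply: ln_ge0; lra.
exists (ln 3 + N%:R * (8 * ln 3 * rr ^+ N) + e * (ln 25 + ln 3)) => z z1 z2.
set t := Im z; pose a : C := Complex 4 t.
have hsq : holo_sq zst a (7 / 2).
 move=> y [y1 _]; apply: holo_zst; move: y1; rewrite /hplane /= ltr_distlC /= => /andP[]; lra.
have nz y : in_sq a (7 / 2) y -> zst y != 0.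
 by move=> [y1 _]; apply: zst_neq0; move: y1; rewrite /= ltr_distlC /= => /andP[]; lra.
have rr7 : 0 < r < 7 / 2 by rewrite /r; lra.
have [l hl lE] := log_modulus rr7 hsq nz.
have r0 : 0 < r by rewrite /r; lra.
have [u pu] := taylor r0 hl.
have lnE y : in_sq a r y -> Re (l y) = ln (nm (zst y)) by move=> /lE <-; rewrite expRK.
have ina : in_sq a r a by split; rewrite subrr normr0.
have u0 : u 0%N = l a.
 have h : nm (a - a) < r by rewrite subrr nm0.
 have h2 : cvs (psum u (a - a)) (u 0%N).
  apply: (cvs_ext (s := fun=> u 0%N) (N0 := 1)); last exact: cvs_cst.
  case=> // n _; rewrite /psum big_nat_recl// expr0 mulr1 big1 ?addr0// => i _.
  by rewrite subrr expr0n mulr0.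
 exact: cvs_unique h2 (pu _ h).
have z3 y : 3 <= Re y -> nm (zst y) <= 3.
 move=> y3; have y1 : 1 < Re y by lra.
 rewrite zst_zet// nmM; have := nm_ratio y1; have := zet_upper3 y3.
 have := nm_ge0 (zet y); have := nm_ge0 ((y - 1) / (y + 2)).
 by move: (nm _) (nm _) => p q; nra.
have a1 : `|Re (u 0%N)| <= ln 3.
 rewrite u0 lnE// ler_norml; apply/andP; split.
  have -> : - ln 3 = ln (1 / 3) :> R by rewrite div1r lnV ?posrE.
  rewrite ler_ln ?posrE; [exact: zst_lower4|lra|].
  by apply: lt_le_trans (zst_lower4 t); lra.
 rewrite ler_ln ?posrE//; [by apply: z3; rewrite /=; lra|].
 by apply: lt_le_trans (zst_lower4 t); lra.
clear u0.
have a1' : - ln 3 <= Re (u 0%N) by move: a1; rewrite ler_norml => /andP[].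
have insq y (s : R) : s < r -> nm (y - a) <= s -> in_sq a r y by move=> sr h; apply: nm_in_sq; apply: le_lt_trans sr.
have pos y : in_sq a r y -> 0 < nm (zst y) by move=> h; rewrite nm_gt0; apply: nz; apply: in_sqS h; rewrite /r; lra.
(* On the unit disc about the centre the real part is at least 3 and [zst] is at most 3 at every
   height, so these bounds are uniform. *)
have HA n : (0 < n)%N -> nm (u n) <= 8 * ln 3.
 move=> n0; have r1 : 1 < r by rewrite /r; lra.
 have h1 : 0 < (1 : R) < r by rewrite ltr01.
 have := @borel_caratheodory R l u a r 1 (ln 3) h1 hl pu _ n n0; rewrite expr1n mulr1 => H.
 apply: le_trans (H _) _; last by lra.
 move=> y ya; have yi := insq y 1 r1 ya; rewrite lnE// ler_ln ?posrE//; last exact: pos.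
 apply: z3; have := le_trans (le_Re_nm _) ya; rewrite !reimE /= ler_norml => /andP[]; lra.
(* 25 (2 + |t|) bounds [zst] on the large disc, and Borel-Caratheodory needs only the logarithm of
   this, so [B] grows like log |t|. *)
pose B := 4 * (ln 25 + ln (2 + `|t|) + ln 3).
have t0 : 0 <= `|t| by [].
have l25 : 0 <= ln (25 : R) by apply: ln_ge0; lra.
have l2t : 0 <= ln (2 + `|t|) by apply: ln_ge0; lra.
have B0 : 0 <= B by rewrite /B; lra.
have HB n : (0 < n)%N -> nm (u n) * rho ^+ n <= B.
 move=> n0; have h1 : 0 < rho < r by rewrite rho0.
 have := @borel_caratheodory R l u a r rho (ln 25 + ln (2 + `|t|)) h1 hl pu _ n n0 => H.
 apply: le_trans (H _) _; last by rewrite /B; lra.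
 move=> y ya; have yi := insq y rho rhor ya; rewrite lnE// -lnM ?posrE; [|lra|lra].
 rewrite ler_ln ?posrE; [|exact: pos|by rewrite mulr_gt0//; lra].
 have y1 : 1 / 2 < Re y by case: yi; rewrite /= ltr_distlC /r => /andP[]; lra.
 apply: le_trans (zst_upper y1) _.
 have : nm y <= 8 + `|t|.
  have -> : y = (y - a) + a by rewrite subrK.
  apply: le_trans (nmD _ _) _; have : nm a <= 4 + `|t| by apply: le_trans (nm_le_ReIm _) _; rewrite /= ger0_norm.
  by move: ya; rewrite /rho; move: (nm _) (nm _) => p q; lra.
 by lra.
have zi : nm (z - a) <= rr.
 have -> : z - a = (Re z - 4)%:C by apply: ceqP; rewrite !reimE //= subrr.
 by rewrite nmR ler0_norm /rr; lra.
have rrr : rr < r by lra.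
have := pser_split N pu zi rr1 rrrho rhor (mulr_ge0 _ l30) B0 HA HB => /(_ (ler0n _ 8)) H.
rewrite -lnE; last exact: insq zi.
have h1 : `|Re (l z)| <= `|Re (l z - u 0%N)| + `|Re (u 0%N)|.
 by rewrite reimE ReN; apply: le_trans (ler_normD _ _); rewrite subrK.
apply: le_trans h1 _.
have h2 := le_trans (le_Re_nm _) H.
have h3 : B * ((rr / rho) ^+ N / (1 - rr / rho)) <= B * (e / 4) by rewrite ler_wpM2l.
have h4 : B * (e / 4) = e * (ln 25 + ln 3) + e * ln (2 + `|t|) by rewrite /B; field.
apply: le_trans (lerD h2 a1) _; apply: le_trans (lerD (lerD (lexx _) h3) (lexx _)) _.
by rewrite h4; apply: eq_ler; ring.
Qed.

End LogZeta.

(** * The quotient of Gamma factors *)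

Section BetaDecay.
Variable R : realType.
Notation mu := (@lebesgue_measure R).
Local Notation C := R[i].
Variables (a q : R).
Hypotheses (a0 : 0 < a) (q0 : 0 < q) (q1 : q < 1).

Lemma phib_decr u v : 0 < u -> u <= v -> phib a q v <= phib a q u.
Proof.
move=> u0 uv; rewrite /phib; apply: ler_pM; [exact: expR_ge0|exact: powR_ge0| |].
 by rewrite ler_expR; have := a0; nra.
have v0 : 0 < v by apply: lt_le_trans uv.
have := one_sub_exp_gt0 u0; have := one_sub_exp_gt0 v0 => h1 h2.
rewrite /powR (gt_eqF h1) (gt_eqF h2) ler_expR ler_wnM2l//; first by rewrite subr_le0 ltW.
by rewrite ler_ln ?posrE// lerD2l lerN2 ler_expR lerN2.
Qed.
Definition phi0 (u : R) : R := if 0 < u then phib a q u else 0.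

Lemma hasI_phi0 : hasI mu setT phi0 (Gr a * Gr q / Gr (a + q)).
Proof.
apply: eq_hasI (hasI_sub measurableT (mitv _) (@subsetT _ _) (hasI_phib a0 q0)) => // u _.
by rewrite mem_setE in_itv /= andbT.
Qed.
End BetaDecay.

Section BetaBound.
Variable R : realType.
Notation mu := (@lebesgue_measure R).
Local Notation C := R[i].

Lemma expR1_le4 : expR 1 <= 4 :> R.
Proof.
have h : 2^-1 <= expR (- 2^-1) :> R by apply: le_trans (expR_ge1Dx _); lra.
have e0 := expR_gt0 (2^-1 : R).
have h2 : expR 2^-1 <= 2 :> R by move: h; rewrite expRN lef_pV2 ?posrE.
have -> : expR 1 = expR 2^-1 * expR 2^-1 :> R by rewrite -expRD; congr expR; field.
by nra.
Qed.
(** Young's inequality with exponents 1 / (1 - q) and 1 / q, used as a tangent line bound for a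
    concave power. *)
Lemma young1 (t q : R) : 0 < t -> 0 < q < 1 -> t `^ (1 - q) <= (1 - q) * t + q.
Proof.
move=> t0 /andP[q0 q1]; have p0 : 0 < (1 - q)^-1 by rewrite invr_gt0; lra.
have qi : 0 < q^-1 by rewrite invr_gt0.
have := @conjugate_powR R (t `^ (1 - q)) 1 (1 - q)^-1 q^-1 (powR_ge0 _ _) ler01 p0 qi.
rewrite !invrK mulr1 powR1 mul1r -powRrM mulfV ?powRr1 ?(ltW t0)//; last by rewrite subr_eq0 gt_eqF.
by rewrite subrK => /(_ erefl); rewrite mulrC.
Qed.

(* log-convexity of Gamma between P + q and P + q + 1, from Young's inequality with parameter P + q *)
Lemma Gr_ratio (P q : R) : 1 <= P -> 0 < q < 1 -> Gr P <= Gr (P + q) * (2 * P `^ (- q)).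
Proof.
move=> P1 q01; have /andP[q0 q1] := q01.
have P0 : 0 < P by lra. have Q0 : 0 < P + q by lra.
have H1 : 0 < P + 1 by lra. have H2 : 0 < P + q + 1 by lra.
pose M := P + q; have M0 : 0 < M by [].
have M2 : M <= 2 * P by rewrite /M; lra.
have h : M `^ (1 - q) <= 2 * P `^ (1 - q).
 have h1 : M `^ (1 - q) <= (2 * P) `^ (1 - q).
  by apply: ge0_ler_powR; rewrite ?nnegrE ?subr_ge0 ?mulr_ge0// ltW.
 apply: le_trans h1 _; rewrite powRM ?(ltW P0)// ler_wpM2r ?powR_ge0//.
 by have t2 : 0 < (2 : R) by []; have := young1 t2 q01; lra.
have PE : P `^ (1 - q) = P * P `^ (- q).
 by rewrite powRD; [rewrite powRr1// ltW|rewrite (gt_eqF P0) implybT].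
have := hasI_le measurableT (hasI_Z (M `^ (- (1 - q))) measurableT (hasI_Gr H1))
 (hasI_D measurableT (hasI_Z ((1 - q) / M) measurableT (hasI_Gr H2)) (hasI_Z q measurableT (hasI_Gr Q0))) _.
rewrite !Gr_rec// => H.
have {}H : M `^ (- (1 - q)) * (P * Gr P) <= (1 - q) / M * ((P + q) * Gr (P + q)) + q * Gr (P + q).
 apply: H => u _.
 have e0 := expR_gt0 u; have t0 : 0 < expR u / M by rewrite divr_gt0.
 have := young1 t0 q01.
 have -> : (expR u / M) `^ (1 - q) = expR ((1 - q) * u) * M `^ (- (1 - q)).
  by rewrite /powR !gt_eqF// ln_div ?posrE// expRK -expRD; congr expR; ring.
 have -> : expR ((P + 1) * u) = expR ((P + q) * u) * expR ((1 - q) * u) by rewrite -expRD; congr expR; ring.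
 have -> : expR ((P + q + 1) * u) = expR ((P + q) * u) * expR u by rewrite -expRD; congr expR; ring.
 move=> Y; have G0 : 0 <= Gker u * expR ((P + q) * u) by rewrite mulr_ge0 ?expR_ge0.
 have := ler_wpM2l G0 Y.
 by move: (Gker u) (expR _) (expR _) (expR u) (M `^ _) => g e1 e2 e3 m; lra.
have E : (1 - q) / M * ((P + q) * Gr (P + q)) + q * Gr (P + q) = Gr (P + q).
 by rewrite -/M; move: (Gr M) => G; field; rewrite gt_eqF.
rewrite E in H; have MM : M `^ (- (1 - q)) * M `^ (1 - q) = 1 by rewrite -powRD ?addNr ?powRr0// (gt_eqF M0) implybT.
have m0 : 0 < M `^ (1 - q) by exact: powR_gt0.
have {}H : P * Gr P <= Gr (P + q) * M `^ (1 - q).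
 have := ler_wpM2r (ltW m0) H; rewrite mulrAC MM mul1r; exact.
rewrite -(ler_pM2l P0); apply: le_trans H _; apply: le_trans (ler_wpM2l _ h) _; first by rewrite ltW// Gr_gt0.
by rewrite PE; apply: eq_ler; ring.
Qed.

Section decay.
Variables (a q eta : R).
Hypotheses (a0 : 0 < a) (q0 : 0 < q) (q1 : q < 1) (eta0 : 0 < eta) (eta1 : eta <= 1).
Let psi (u : R) : R := if (0 < u) && (u <= eta) then phib a q u else 0.

Lemma itg_psi : itg mu setT psi.
Proof.
have sub : `]0, eta] `<=` (`]0, +oo[%classic : set R) by move=> u /=; rewrite !in_itv /= andbT => /andP[].
have i1 : itg mu `]0, eta] (phib a q) by apply: itgS (hasI_phib a0 q0).1; [exact: mitv|exact: mitv|exact: sub].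
have [i2 _] := hasI_sub measurableT (mitv _) (@subsetT _ _) (hasI_itg i1).
by apply: (@eq_itg _ _ _ mu setT _ _ measurableT _ i2) => u _; rewrite mem_setE in_itv.
Qed.
Definition Jb := 8 * Gr q * (eta^-1) `^ (- q).

(** For 0 < u <= eta the exponential is at most e times exp(- u / eta), so the integral is at most e
    times a full beta integral with parameter 1 / eta, which [Gr_ratio] estimates. The 8 in [Jb] is
    the bound 4 for e times the 2 of that estimate. *)
Lemma psi_le : \int[mu]_(u in setT) psi u <= Jb.
Proof.
have P0 : 0 < eta^-1 by rewrite invr_gt0.
have := hasI_le measurableT (hasI_itg itg_psi) (hasI_Z (expR 1) measurableT (hasI_phi0 P0 q0)) _ => H.
apply: (@le_trans _ _ (expR 1 * (Gr eta^-1 * Gr q / Gr (eta^-1 + q)))).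
 apply: H => u _; rewrite /psi /phi0; case: ltP => u0 /=; last by rewrite mulr0.
 case: ifP => ue; last by rewrite mulr_ge0 ?expR_ge0 ?phib_ge0.
 rewrite /phib mulrA ler_wpM2r ?powR_ge0// -expRD ler_expR.
 have h1 : eta^-1 * u <= 1 by rewrite mulrC ler_pdivrMr// mul1r.
 have h2 : 0 <= a * u by rewrite mulr_ge0// ltW//; exact: a0.
 by rewrite !mulNr; move: (_^-1 * _) (a * u) h1 h2 => p r; lra.
have P1 : 1 <= eta^-1 by rewrite invf_ge1.
have q01 : 0 < q < 1 by rewrite q0.
have := Gr_ratio P1 q01; have Pq : 0 < eta^-1 + q by have := q0; lra.
have := Gr_gt0 P0; have := Gr_gt0 Pq; have := Gr_gt0 q0.
have e3 : expR 1 <= 4 :> R by exact: expR1_le4.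
move: (expR_gt0 (1 : R)) e3; rewrite /Jb; move: (expR 1) (Gr (eta^-1 + q)) (Gr q) (Gr eta^-1) (_ `^ _) => e A B D p e0 e3 B0 A0 D0 H'.
have h : D * B / A <= 2 * p * B by rewrite ler_pdivrMr//; nra.
have p0 : 0 <= 2 * p * B by rewrite (le_trans _ h)// divr_ge0 ?mulr_ge0 ?ltW.
have E : 8 * B * p = 4 * (2 * p * B) by ring.
have DB : 0 <= D * B / A by rewrite divr_ge0 ?mulr_ge0 ?ltW.
by rewrite E; apply: ler_pM => //; exact: ltW.
Qed.
(** Adding the integral to its translate by the half-period [eta] leaves the difference of two
    translated kernels. For u > 0 this difference has constant sign because [phib] decreases, and
    its integral telescopes to the part over []0, eta]]; the piece just before 0 adds the same
    amount once more. *)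
Lemma osc_bound (k : R -> R) v : (forall u, `|k u| <= 1) -> (forall u, k (u + eta) = - k u) ->
 hasI mu setT (fun u => phi0 a q u * k u) v -> `|v| <= Jb.
Proof.
move=> k1 ks H; have Hs := hasI_shift eta H.
have H2 := hasI_D measurableT H Hs.
have Hp := hasI_itg itg_psi; set J := \int[mu]_(u in setT) psi u in Hp.
have H0 := hasI_phi0 a0 q0.
have HM := hasI_D measurableT (hasI_B measurableT H0 (hasI_shift eta H0)) (hasI_Z 2 measurableT (hasI_shift eta Hp)).
have := RI_abs_le measurableT H2.1 HM _; rewrite H2.2 subrr add0r => B.
have {}B : `|v + v| <= 2 * J.
 apply: B => u _; rewrite ks (mulrN (phi0 a q (u + eta))) -mulrBl normrM.
 apply: le_trans (ler_pM (normr_ge0 _) (normr_ge0 _) (lexx _) (k1 u)) _; rewrite mulr1.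
 rewrite /phi0 /psi; case: ltP => u0.
  have u1 : 0 < u + eta by have := eta0; lra.
  rewrite u1 /= ger0_norm; last by rewrite subr_ge0; apply: phib_decr => //; have := eta0; lra.
  rewrite lerDl mulr_ge0//; case: ifP => // _; exact: phib_ge0.
 case: ltP => u1 /=; last by rewrite subrr normr0 add0r mulr0.
 have -> : u + eta <= eta by lra.
 by rewrite sub0r normrN ger0_norm ?phib_ge0//; lra.
have := psi_le; rewrite -/J; move: B; rewrite -mulr2n normrMn -mulr_natl; lra.
Qed.
End decay.

(** cos and sin change sign under translation by pi / |Im z|; the 16 is 8 for each of the real and
    imaginary parts. *)
Lemma cbeta_bound q (z : C) : 0 < q < 1 -> 0 < Re z -> pi <= `|Im z| -> nm (cbeta q z) <= 16 * Gr q * (`|Im z| / pi) `^ (- q).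
Proof.
move=> /andP[q0 q1] z0 zp; have p0 := pi_gt0 R.
pose eta := pi / `|Im z|; have I0 : 0 < `|Im z| by apply: lt_le_trans zp.
have e0 : 0 < eta by rewrite divr_gt0.
have e1 : eta <= 1 by rewrite ler_pdivrMr// mul1r.
have [c1 c2] := lap_citg (mitv _) (meas_bcore q0) (@meas_opp R _) (hasI_bcore z0 q0).1.
have ext (f k : R -> R) : (forall u, 0 < u -> f u = phib (Re z) q u * k u) -> itg mu `]0, +oo[ f ->
  hasI mu setT (fun u => phi0 (Re z) q u * k u) (\int[mu]_(u in `]0, +oo[) f u).
 move=> fk i; apply: eq_hasI (hasI_sub measurableT (mitv _) (@subsetT _ _) (hasI_itg i)) => // u _.
 by rewrite mem_setE in_itv /= andbT /phi0; case: ltP => u0; rewrite ?mul0r// fk.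
have sgE : exists2 sg : R, Im z * eta = sg * pi & (sg = 1 \/ sg = -1).
 have [h|h] := leP 0 (Im z).
  exists 1; last by left. rewrite /eta ger0_norm// mul1r mulrC divfK// gt_eqF//; move: I0; rewrite ger0_norm//.
 exists (-1); last by right. by rewrite /eta ltr0_norm// invrN mulrN mulrN mulrC mulN1r divfK// lt_eqF.
have [sg sE sg1] := sgE.
have K1 := @osc_bound (Re z) q eta z0 q0 q1 e0 e1 (fun u => cos (Im z * u)) _ _ _ (ext (fun u => Re (lapF (bcore q) (fun u => - u) z u)) _ _ c1).
have K2 := @osc_bound (Re z) q eta z0 q0 q1 e0 e1 (fun u => - sin (Im z * u)) _ _ _ (ext (fun u => Im (lapF (bcore q) (fun u => - u) z u)) _ _ c2).
have {}K1 : `|Re (cbeta q z)| <= Jb q eta.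
 apply: K1.
 - by move=> u; rewrite ler_norml cos_geN1 cos_le1.
 - move=> u; rewrite mulrDr sE; case: sg1 => ->; rewrite ?mul1r ?mulN1r; first exact: cosDpi.
  by rewrite cosB cospi sinpi mulr0 addr0 mulrN1.
 - by move=> u u0; rewrite bcoreE /lapF /cexp !reimE /= !mulr0 !mul0r !subr0 ?addr0 ?add0r -[cos (Im z * u)]cosN -mulrN mulrA.
have {}K2 : `|Im (cbeta q z)| <= Jb q eta.
 apply: K2.
 - by move=> u; rewrite normrN ler_norml sin_geN1 sin_le1.
 - move=> u; rewrite mulrDr sE; case: sg1 => ->; rewrite ?mul1r ?mulN1r; first by rewrite sinDpi.
  by rewrite sinB cospi sinpi mulr0 subr0 mulrN1.
 - by move=> u u0; rewrite bcoreE /lapF /cexp !reimE /= !mulr0 !mul0r ?subr0 ?addr0 ?add0r -sinN -mulrN mulrA.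
apply: le_trans (nm_le_ReIm _) _; apply: le_trans (lerD K1 K2) _.
by rewrite /Jb /eta invf_div; lra.
Qed.

(** Plays the role of Stirling's formula: Gamma(p + dl) is the beta integral at (p + dl, 1 - dl)
    times Gamma(p + 1) / Gamma(1 - dl), and the beta integral decays in the imaginary direction. *)
Theorem cgam_ratio (dl : R) (p : C) : 0 < dl < 1 -> 0 < Re p -> pi <= `|Im p| ->
 nm (cgam (p + dl%:C)) <= 16 * nm p * (`|Im p| / pi) `^ (dl - 1) * nm (cgam p).
Proof.
move=> /andP[d0 d1] p0 pp; have q01 : 0 < 1 - dl < 1 by lra.
have q0 : 0 < 1 - dl by lra.
have p1 : 0 < Re (p + dl%:C) by rewrite reimE /=; lra.
have p2 : pi <= `|Im (p + dl%:C)| by rewrite reimE /= addr0.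
have := cbeta_bound q01 p1 p2; rewrite ImD /= addr0 opprB => B.
have := cbeta_cgam q0 p1.
have -> : p + dl%:C + (1 - dl)%:C = p + 1 by rewrite -addrA -rmorphD [dl + _]addrC subrK.
rewrite cgam_rec// => /(congr1 (@nm R)); rewrite !nmM nmR.
have G0 := Gr_gt0 q0; rewrite ger0_norm ?(ltW G0)// => E.
rewrite -(ler_pM2r G0) E.
apply: le_trans (ler_wpM2r _ B) _; first by rewrite mulr_ge0 ?nm_ge0.
by apply: eq_ler; ring.
Qed.
(** The functional equation reflects the imaginary part in the numerator; conjugation gives the two
    Gamma arguments the same imaginary part again. *)
Lemma nm_cgam_conj (x y : R) : 0 < x -> nm (cgam (Complex x (- y))) = nm (cgam (Complex x y)).
Proof.
move=> x0; have i0 : itg mu setT (fun u => Gker u * expR (x * u)) := itg_Gr x0.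
have m1 : measurable_fun (setT : set (mR R)) id by exact: measurable_id.
have [c1 c2] := @lap_citg _ _ _ mu setT measurableT (@Gker R) id (Complex x y) (@meas_Gker R) m1 i0.
have [c3 c4] := @lap_citg _ _ _ mu setT measurableT (@Gker R) id (Complex x (- y)) (@meas_Gker R) m1 i0.
rewrite !nmE; congr (Num.sqrt (_ + _)).
 rewrite /cgam /Lap /CI /=; congr (_ ^+ 2); apply: eq_Rintegral => u _.
 by rewrite /= !mulr0 !mul0r !subr0 ?addr0 ?add0r mulNr cosN.
have -> : Im (cgam (Complex x (- y))) = - Im (cgam (Complex x y)); last by rewrite sqrrN.
apply: (hasI_uniq (hasI_itg c4)).
have := hasI_Z (-1) measurableT (hasI_itg c2); rewrite mulN1r; apply: eq_hasI => // u _.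
by rewrite mulN1r /= !mulr0 !mul0r ?subr0 ?addr0 ?add0r mulNr sinN mulrN mulrN.
Qed.

End BetaBound.

(** * The transform left of the imaginary axis *)

Section ThetaBounds.
Variable R : realType.
Notation mu := (@lebesgue_measure R).
Local Notation C := R[i].
Hypothesis RH : riemann_hypothesis R.

Lemma zst_bounds (eta e : R) : 0 < eta <= 1 -> 0 < e ->
 exists2 K : R, 0 < K & forall z : C, 1 / 2 + eta <= Re z -> Re z <= 4 ->
  nm (zst z) <= K * (2 + `|Im z|) `^ e /\ (nm (zst z))^-1 <= K * (2 + `|Im z|) `^ e.
Proof.
move=> h1 e0; have [K HK] := log_zst_bound RH h1 e0; exists (expR K); first exact: expR_gt0.
move=> z z1 z2; have := HK z z1 z2; have zh : 1 / 2 < Re z by case/andP: h1 => ? _; lra.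
have n0 : 0 < nm (zst z) by rewrite nm_gt0; exact: zst_neq0.
have p0 : 0 < 2 + `|Im z| by have := normr_ge0 (Im z); lra.
rewrite /powR gt_eqF// -expRD ler_norml => /andP[a b]; split.
 by rewrite -[nm _]lnK ?posrE// ler_expR.
by rewrite -[nm _]lnK ?posrE// -expRN ler_expR lerNl.
Qed.
Lemma zet1_neq0_RH (z : C) : 1 / 2 < Re z -> zet1 z != 0.
Proof. by move=> /(zst_neq0 RH); rewrite /zst mulf_eq0 => /norP[]. Qed.
Lemma half_add1 (z : C) : Re (z / 2 + 1) = Re z / 2 + 1.
Proof. by rewrite reimE Re_half. Qed.
Lemma xi_neq0 (z : C) : 1 / 2 < Re z -> xi z != 0.
Proof.
move=> z1; have z2 : -2 < Re z by lra.
have g0 : 0 < Re (z / 2 + 1) by rewrite half_add1; lra.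
have n1 := zet1_neq0_RH z1; have n2 := cexp_neq0 (- (z / 2 * (lnpi R)%:C)); have n3 := cgam_neq0 g0.
rewrite (xi_zet1 z2); apply: mulf_neq0 => //; exact: mulf_neq0.
Qed.
Lemma ratio_alg (x p e c y g : R) : 0 < e -> 0 < y -> 0 < g -> x * (p * e) * (c * g) / (y * e * g) = x / y * p * c.
Proof. by move=> e0 y0 g0; field; rewrite !gt_eqF. Qed.
Lemma nm_xi (z : C) : -2 < Re z -> nm (xi z) = nm (zet1 z) * expR (- (Re z / 2 * lnpi R)) * nm (cgam (z / 2 + 1)).
Proof.
move=> z2; rewrite (xi_zet1 z2) (nmM (zet1 z * _)) (nmM (zet1 z)) nm_cexp.
by have -> : Re (- (z / 2 * (lnpi R)%:C)) = - (Re z / 2 * lnpi R) by rewrite ReN ReM Re_half /= mulr0 subr0.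
Qed.
Lemma zet1_zst (z : C) : 0 < Re z -> zet1 z = zst z * (z + 2).
Proof. by move=> z0; rewrite /zst divfK// add2_neq0. Qed.
Lemma quarter_pi (q : R) : q / (4 * pi) = q / 2 * 2^-1 / pi.
Proof. by have := pi_gt0 R; move: pi => P P0; field; rewrite gt_eqF. Qed.
Lemma powR_pred (Y a : R) : 0 < Y -> Y `^ a = Y * Y `^ (a - 1).
Proof.
move=> Y0; have -> : Y `^ a = Y `^ (1 + (a - 1)) by rewrite addrC subrK.
by rewrite [LHS]powRD ?(gt_eqF Y0) ?implybT// powRr1// ltW.
Qed.
(** Here [p] is half of an argument of [xi] plus one, whence [Im p = y / 2] and the constants 2 and
    4 pi. *)
Lemma gamma_part (dl y : R) (p : C) : 0 < dl < 1 -> 2 * pi <= `|y| -> Im p = y / 2 -> 0 < Re p -> Re p <= 2 ->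
 nm (cgam (p + dl%:C)) / nm (cgam p) <= 16 * 2 * (4 * pi) `^ (1 - dl) * (1 + `|y|) `^ dl.
Proof.
move=> dl01 yp Ip Rp0 Rp2; have /andP[d0 d1] := dl01; have pp := pi_gt0 R; have p2 := pi_ge2 R.
have Ipp : pi <= `|Im p| by rewrite Ip normrM [`|2^-1|]ger0_norm//; lra.
have gb0 : 0 < nm (cgam p) by rewrite nm_gt0 cgam_neq0.
rewrite ler_pdivrMr//; apply: le_trans (cgam_ratio dl01 Rp0 Ipp) _; rewrite ler_wpM2r ?nm_ge0//; clear gb0.
have np : nm p <= 2 + `|y| / 2.
 apply: le_trans (nm_le_ReIm _) _; rewrite Ip normrM [`|2^-1|]ger0_norm// (ger0_norm (ltW Rp0)); lra.
have yI : `|Im p| = `|y| / 2 by rewrite Ip normrM [`|2^-1|]ger0_norm.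
have n0 := nm_ge0 p.
rewrite yI in Ipp *; move: `|y| (nm p) np n0 yp Ipp => r q np n0 yp Ipp.
pose Y := 1 + r; have Y0 : 0 < Y by rewrite /Y; lra.
have qY : q <= 2 * Y by rewrite /Y; lra.
have b3 : Y / (4 * pi) <= r / 2 / pi.
 rewrite quarter_pi; apply: ler_wpM2r; first by rewrite invr_ge0 ltW.
 by apply: ler_wpM2r => //; rewrite /Y; lra.
have b2 : 0 < Y / (4 * pi) by rewrite divr_gt0 ?mulr_gt0.
have p40 : 0 <= 4 * pi :> R by rewrite mulr_ge0// ltW.
have hp : (r / 2 / pi) `^ (dl - 1) <= (4 * pi) `^ (1 - dl) * Y `^ (dl - 1).
 have -> : (4 * pi) `^ (1 - dl) * Y `^ (dl - 1) = (Y / (4 * pi)) `^ (dl - 1).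
  by rewrite [RHS]powRM ?invr_ge0 ?(ltW Y0)// -(powR_inv1 p40) -powRrM mulN1r opprB mulrC.
 move: (r / 2 / pi) (Y / (4 * pi)) b3 b2 => x z b3 b2.
 have x0 : 0 < x by apply: lt_le_trans b3.
 by rewrite /powR !gt_eqF// ler_expR ler_wnM2l ?subr_le0 ?(ltW d1)// ler_ln ?posrE.
rewrite -/Y (powR_pred dl Y0).
have -> : 16 * 2 * (4 * pi) `^ (1 - dl) * (Y * Y `^ (dl - 1)) = 16 * (2 * Y) * ((4 * pi) `^ (1 - dl) * Y `^ (dl - 1)) by ring.
apply: ler_pM => //; rewrite ?powR_ge0 ?mulr_ge0//.
by apply: ler_wpM2l.
Qed.

Variable w : R.
Hypotheses (w0 : 0 < w) (w2 : w < 1 / 2).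
Local Ltac wlra := have ? := w0; have ? := w2; lra.

(** z times the transform of h; under the Riemann hypothesis it is holomorphic for Re z > - w. *)
Definition Th (z : C) := xi (2^-1%:C + z - w%:C) / xi (2^-1%:C + z + w%:C).

Lemma den_neq0 (z : C) : - w < Re z -> xi (2^-1%:C + z + w%:C) != 0.
Proof. by move=> zw; apply: xi_neq0; rewrite !reimE /=; wlra. Qed.
Lemma holo_Th : holo (hplane (- w)) Th.
Proof.
apply: holoM; first exact: holo_xi_shift.
by apply: holoV; [move=> z; exact: den_neq0|exact: holo_xi_shift].
Qed.
(** The functional equation identifies numerator and denominator at 0, so the transform of h has the
    same pole there as the transform of the constant 1. *)
Lemma Th0 : Th 0 = 1.
Proof.
rewrite /Th addr0; have -> : xi (2^-1%:C - w%:C) = xi (2^-1%:C + w%:C) :> C.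
 by rewrite -xi_sym; congr xi; ceq; [field|ring].
have := @den_neq0 0; rewrite addr0 /= => H; rewrite divff//; apply: H; wlra.
Qed.
(** The continued transform of h - 1: subtracting the transform 1 / z of the constant 1 removes the
    pole at 0, and [slope] supplies the value there. *)
Definition Lt : C -> C := slope Th (cder Th) 0.

Lemma holo_Lt : holo (hplane (- w)) Lt.
Proof.
move=> z zw; have [->|z0] := eqVneq z 0.
 have sub y : in_sq 0 w y -> hplane (- w) y.
  by move=> [+ _]; rewrite /hplane /= subr0 ltr_norml => /andP[].
 have h1 : holo_sq (cder Th) 0 w.
  by move=> y /sub; exact: (holo_cder (@hplane_open R (- w)) holo_Th).
 have h2 y : in_sq 0 w y -> cderiv Th y (cder Th y) by move=> /sub /holo_Th /cderE.
 have h3 : in_sq (0 : C) w 0 by split; rewrite subrr normr0.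
 exact: (slope_holo h1 h2 h3).
have n0 : 0 < nm z by rewrite nm_gt0.
have [l hl] : cder_at (fun y => (Th y - Th 0) * y^-1) z.
 apply: (@holoM R (fun y => hplane (- w) y /\ y != 0) (fun y => Th y - Th 0) (fun y => y^-1)) => //.
 - apply: holoB; last exact: holo_cst.
  by apply: holoS holo_Th => y [].
 - by apply: holoV; [move=> y []|exact: holo_id].
exists l; apply: (@cderiv_near _ (fun y => (Th y - Th 0) * y^-1) _ _ _ _ n0 _ hl) => y yz.
rewrite /Lt /slope; case: eqP => [y0|_]; last by rewrite subr0.
by move: yz; rewrite y0 sub0r nmN ltxx.
Qed.
Lemma Lt_off0 (z : C) : z != 0 -> Lt z = (Th z - 1) / z.
Proof. by move=> /negbTE z0; rewrite /Lt /slope z0 Th0 subr0. Qed.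
Lemma nm_Lt (z : C) : z != 0 -> nm (Lt z) <= (nm (Th z) + 1) / nm z.
Proof.
move=> z0; rewrite Lt_off0// nmM nmV ler_wpM2r ?invr_ge0 ?nm_ge0//.
by apply: le_trans (nmB _ _) _; rewrite nm1.
Qed.
Lemma nm_cbeta_le (z : C) : 1 <= Re z -> nm (cbeta w z) <= 2 * (Gr 1 * Gr w / Gr (1 + w)).
Proof.
move=> z1; have z0 : 0 < Re z by lra.
apply: (CI_bound (mitv _) (lap_citg (mitv _) (meas_bcore w0) (@meas_opp R _) (hasI_bcore z0 w0).1) (hasI_bcore ltr01 w0)).
move=> u /=; rewrite in_itv /= andbT => u0; rewrite nm_lapF ger0_norm ?powR_ge0// ler_wpM2l ?powR_ge0// ler_expR.
by rewrite !mulrN lerN2 ler_wpM2r// ltW.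
Qed.

Section strip.
Variable dl : R.
Hypotheses (d0 : 0 < dl) (d1 : dl < w) (d2 : dl < 1 / 2 - w).
Local Ltac dlra := solve [generalize w0 w2 d0 d1 d2; clear; intros; lra |
 have ? := w0; have ? := w2; have ? := d0; have ? := d1; have ? := d2; lra].

(** A rough polynomial bound, for use where a Gaussian factor dominates it. [zet1] in the numerator
    gives degree 2, its inverse in the denominator degree 1, and the Gamma quotient is a bounded
    beta integral. *)
Lemma Th_strip : exists2 K : R, 0 < K & forall z : C, - dl <= Re z -> Re z <= 2 -> nm (Th z) <= K * (6 + `|Im z|) ^+ 3.
Proof.
have h1 : 0 < w - dl <= 1 by dlra.
have [K K0 HK] := zst_bounds h1 (@ltr01 R).
pose r0 := 1 / 2 - dl - w; have r00 : 0 < r0 by rewrite /r0; dlra.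
have g1 : 0 < 1 + w by wlra.
pose G := 2 * (Gr 1 * Gr w / Gr (1 + w)) / Gr w.
have G0 : 0 < G by rewrite !mulr_gt0 ?invr_gt0 ?Gr_gt0.
pose P := expR (w * lnpi R); have P0 : 0 < P by exact: expR_gt0.
exists ((1 + 2 / r0) * K * P * G); first by do 3?[apply: mulr_gt0 => //]; apply: addr_gt0 => //; exact: divr_gt0.
move=> z z1 z2.
set a := 2^-1%:C + z - w%:C; set b := 2^-1%:C + z + w%:C.
have Ra : Re a = 2^-1 + Re z - w by rewrite !reimE.
have Rb : Re b = 2^-1 + Re z + w by rewrite !reimE.
have Ib : Im b = Im z by rewrite !reimE /= add0r addr0.
have Ia : Im a = Im z by rewrite !reimE /= oppr0 add0r addr0.
have a0 : r0 <= Re a by rewrite Ra /r0; dlra.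
have a00 : 0 < Re a by apply: lt_le_trans a0.
have b0 : 1 / 2 < Re b by rewrite Rb; dlra.
have a2 : -2 < Re a by lra. have b2 : -2 < Re b by lra.
have b00 : 0 < Re b by lra.
set Y := 6 + `|Im z|; have Y0 : 6 <= Y by rewrite /Y lerDl.
have Y00 : 0 < Y by lra.
have na : nm a <= Y - 1.
 apply: le_trans (nm_le_ReIm _) _; rewrite Ia Ra /Y.
 have : `|2^-1 + Re z - w| <= 4 by rewrite ler_norml; dlra.
 by move: `|_ - w| `|Im z| => p q; lra.
have Za : nm (zet1 a) <= (1 + 2 / r0) * Y ^+ 2.
 apply: le_trans (zet1_bound a00) _; have n0 := nm_ge0 a.
 have q0 : 2 / Re a <= 2 / r0 by rewrite ler_wpM2l// lef_pV2 ?posrE.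
 have q1 : 0 < 2 / r0 by rewrite divr_gt0.
 have h : nm a * (nm a + 1) <= Y ^+ 2 by nra.
 have h3 : nm a * (nm a + 1) * (2 / Re a) <= Y ^+ 2 * (2 / r0).
  by apply: ler_pM => //; [rewrite mulr_ge0 ?addr_ge0|rewrite divr_ge0// ltW].
 have h4 : nm a <= Y ^+ 2 by nra.
 by rewrite [leRHS]mulrDl mul1r; apply: lerD => //; rewrite [leRHS]mulrC.
have Zb : (nm (zet1 b))^-1 <= K * Y.
 have b1 : 1 / 2 + (w - dl) <= Re b by rewrite Rb; dlra.
 have b4 : Re b <= 4 by rewrite Rb; dlra.
 have [_] := HK b b1 b4; rewrite powRr1 Ib; last by rewrite addr_ge0.
 have [n2 _] := nm_add2 b00.
 rewrite zet1_zst// (nmM (zst b)) invfM => h.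
 have i1 : (nm (b + 2))^-1 <= 1 by rewrite invf_le1; lra.
 have n0 : 0 <= (nm (zst b))^-1 by rewrite invr_ge0 nm_ge0.
 have h2 : (nm (zst b))^-1 / nm (b + 2) <= (nm (zst b))^-1 by rewrite ler_piMr.
 apply: le_trans h2 _; apply: le_trans h _; rewrite ler_wpM2l ?(ltW K0)// /Y; lra.
have ga : 0 < Re (a / 2 + 1) by rewrite half_add1; lra.
have ga1 : 1 <= Re (a / 2 + 1) by rewrite half_add1; lra.
have gb : 0 < Re (b / 2 + 1) by rewrite half_add1; lra.
have CG := cbeta_cgam w0 ga.
have ab : a / 2 + 1 + w%:C = b / 2 + 1.
 have -> : b = a + (w%:C + w%:C) by rewrite /b /a; ring.
 by field.
rewrite ab in CG.
have Gw := Gr_gt0 w0.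
have CGn : nm (cgam (a / 2 + 1)) = nm (cbeta w (a / 2 + 1)) / Gr w * nm (cgam (b / 2 + 1)).
 have := congr1 (@nm R) CG; rewrite !nmM nmR (ger0_norm (ltW Gw)).
 move: (nm _) (nm _) (nm _) (Gr w) Gw => x y v gw gw0 E.
 by rewrite mulrAC -E mulfK// gt_eqF.
clear CG ab.
have CB : nm (cbeta w (a / 2 + 1)) / Gr w <= G by rewrite /G ler_wpM2r ?invr_ge0 ?(ltW Gw)// nm_cbeta_le.
have gb0 : 0 < nm (cgam (b / 2 + 1)) by rewrite nm_gt0 cgam_neq0.
have E : nm (Th z) = nm (zet1 a) * (nm (zet1 b))^-1 * P * (nm (cbeta w (a / 2 + 1)) / Gr w).
 rewrite /Th -/a -/b (nmM (xi a)) nmV (nm_xi a2) (nm_xi b2) CGn.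
 have -> : expR (- (Re a / 2 * lnpi R)) = P * expR (- (Re b / 2 * lnpi R)).
  by rewrite /P -expRD Ra Rb; congr expR; field.
 have zb : 0 < nm (zet1 b) by rewrite nm_gt0 zet1_neq0_RH.
 exact: ratio_alg (expR_gt0 _) zb gb0.
rewrite E.
have -> : (1 + 2 / r0) * K * P * G * Y ^+ 3 = ((1 + 2 / r0) * Y ^+ 2) * (K * Y) * P * G by ring.
apply: ler_pM => //; rewrite ?mulr_ge0 ?invr_ge0 ?nm_ge0 ?(ltW P0) ?(ltW Gw)//.
apply: ler_wpM2r; first exact: ltW.
by apply: ler_pM; rewrite ?invr_ge0 ?nm_ge0.
Qed.
Lemma Lt_strip : exists2 K : R, 0 < K & forall z : C, - dl <= Re z -> Re z <= 2 -> 1 <= `|Im z| -> nm (Lt z) <= K * (6 + `|Im z|) ^+ 3.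
Proof.
have [K K0 HK] := Th_strip; exists (K + 1); first by rewrite addr_gt0.
move=> z z1 z2 z3; have nz : 1 <= nm z := le_trans z3 (le_Im_nm z).
have z0 : z != 0 by rewrite -nm_gt0; apply: lt_le_trans nz.
apply: le_trans (nm_Lt z0) _; have h := HK z z1 z2.
have i1 : (nm z)^-1 <= 1 by rewrite invf_le1; lra.
have n0 : 0 <= nm (Th z) + 1 by rewrite addr_ge0 ?nm_ge0.
apply: (@le_trans _ _ (nm (Th z) + 1)); first by rewrite ler_piMr.
rewrite mulrDl; apply: lerD => //; rewrite mul1r; apply: exprn_ege1; have := normr_ge0 (Im z); lra.
Qed.
(** On Re z = -dl the argument of the numerator lies left of 1/2; the functional equation moves it
    to 1/2 + w + dl - iy. The numerator and the inverse of the denominator then each contribute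
    |y|^e from zeta, and the Gamma arguments differ by [dl] up to conjugation, which gives
    |y|^dl. *)
Lemma Th_line (e : R) : 0 < e -> exists2 K : R, 0 < K & forall y : R, 2 * pi <= `|y| ->
 nm (Th (Complex (- dl) y)) <= K * (1 + `|y|) `^ (dl + 2 * e).
Proof.
move=> e0.
have h1 : 0 < w - dl <= 1 by dlra.
have [K K0 HK] := zst_bounds h1 e0.
have pp := pi_gt0 R; have p2 := pi_ge2 R.
pose E1 := expR (- (dl * lnpi R)).
have E10 : 0 < E1 by exact: expR_gt0.
exists (2 * (K * 2 `^ e) ^+ 2 * E1 * (16 * 2 * (4 * pi) `^ (1 - dl))).
 by rewrite !mulr_gt0 ?exprn_gt0 ?mulr_gt0 ?powR_gt0 ?mulr_gt0.
move=> y yp.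
pose A := 1 / 2 + w; pose a : C := Complex (A + dl) (- y); pose b : C := Complex (A - dl) y.
have a2 : -2 < Re a by rewrite /= /A; dlra. have b2 : -2 < Re b by rewrite /= /A; dlra.
have a0 : 0 < Re a by rewrite /= /A; dlra. have b0 : 0 < Re b by rewrite /= /A; dlra.
have b12 : 1 / 2 < Re b by rewrite /= /A; dlra.
set Y := 1 + `|y|.
have yY : Y / 2 <= `|y| by rewrite /Y; lra.
have Y1 : 1 <= Y by rewrite /Y lerDl.
have Y0 : 0 < Y by lra.
have Ye : (2 + `|y|) `^ e <= 2 `^ e * Y `^ e.
 rewrite -powRM//; last exact: ltW.
 by apply: ge0_ler_powR; rewrite ?nnegrE ?mulr_ge0 ?addr_ge0 ?(ltW e0) ?(ltW Y0)// /Y; have := normr_ge0 y; lra.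
have Z1 : nm (zst a) <= K * 2 `^ e * Y `^ e.
 have [] := HK a _ _; rewrite ?normrN.
 - by rewrite /= /A; dlra.
 - by rewrite /= /A; dlra.
 - rewrite /= ?normrN => h _; apply: le_trans h _; by rewrite -mulrA ler_wpM2l// ltW.
have Z2 : (nm (zst b))^-1 <= K * 2 `^ e * Y `^ e.
 have [] := HK b _ _.
 - by rewrite /= /A; dlra.
 - by rewrite /= /A; dlra.
 - move=> _ h; apply: le_trans h _; by rewrite -mulrA ler_wpM2l// ltW.
have Z3 : nm (a + 2) / nm (b + 2) <= 2.
 have [n2 _] := nm_add2 b0; rewrite ler_pdivrMr; last by apply: lt_le_trans n2.
 rewrite -ler_sqr ?nnegrE ?mulr_ge0 ?nm_ge0// exprMn !nm_sqr !reimE /= !addr0 sqrrN.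
 have := sqr_ge0 y; have := w0; have := w2; have := d0; have := d1; rewrite /A; nra.
have ZZ : nm (zet1 a) / nm (zet1 b) <= 2 * (K * 2 `^ e * Y `^ e) ^+ 2.
 rewrite !zet1_zst// (nmM (zst a)) (nmM (zst b)) invfM.
 have -> : nm (zst a) * nm (a + 2) * ((nm (zst b))^-1 / nm (b + 2)) = nm (a + 2) / nm (b + 2) * (nm (zst a) * (nm (zst b))^-1) by ring.
 apply: ler_pM => //; rewrite ?mulr_ge0 ?invr_ge0 ?nm_ge0//.
 by rewrite expr2; apply: ler_pM; rewrite ?invr_ge0 ?nm_ge0.
pose p : C := b / 2 + 1.
have Ip : Im p = y / 2 by rewrite /p !reimE /= ?mulr0 ?oppr0 ?mul0r; field.
have Rp : Re p = (A - dl) / 2 + 1 by rewrite /p half_add1.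
have Rp0 : 0 < Re p by rewrite Rp /A; dlra.
have dl01 : 0 < dl < 1 by dlra.
have Ipp : pi <= `|Im p| by rewrite Ip normrM [`|2^-1|]ger0_norm//; lra.
have GA : nm (cgam (a / 2 + 1)) = nm (cgam (p + dl%:C)).
 have -> : a / 2 + 1 = Complex ((A + dl) / 2 + 1) (- (y / 2)).
  by ceq; rewrite ?mulr0 ?oppr0 ?mul0r; field.
 have -> : p + dl%:C = Complex ((A + dl) / 2 + 1) (y / 2).
  by ceq; rewrite ?mulr0 ?oppr0 ?mul0r; field.
 by apply: nm_cgam_conj; rewrite /A; dlra.
have gb0 : 0 < nm (cgam p) by rewrite nm_gt0 cgam_neq0.
have Rp2 : Re p <= 2 by rewrite Rp /A; dlra.
have GR : nm (cgam (a / 2 + 1)) / nm (cgam p) <= 16 * 2 * (4 * pi) `^ (1 - dl) * Y `^ dl.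
 by rewrite GA; exact: gamma_part.
have aE : xi (2^-1%:C + Complex (- dl) y - w%:C) = xi a.
 by rewrite -xi_sym; congr xi; ceq; rewrite /A; [field|ring].
have bE : 2^-1%:C + Complex (- dl) y + w%:C = b by ceq; rewrite /A; [field|ring].
rewrite /Th aE bE (nmM (xi a)) nmV (nm_xi a2) (nm_xi b2).
have -> : expR (- (Re a / 2 * lnpi R)) = E1 * expR (- (Re b / 2 * lnpi R)).
 by rewrite /E1 -expRD /=; congr expR; field.
have zb : 0 < nm (zet1 b) by rewrite nm_gt0 zet1_neq0_RH.
have -> : nm (zet1 a) * (E1 * expR (- (Re b / 2 * lnpi R))) * nm (cgam (a / 2 + 1)) /
  (nm (zet1 b) * expR (- (Re b / 2 * lnpi R)) * nm (cgam (b / 2 + 1))) =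
  nm (zet1 a) / nm (zet1 b) * E1 * (nm (cgam (a / 2 + 1)) / nm (cgam p)).
 have := @ratio_alg (nm (zet1 a)) E1 _ (nm (cgam (a / 2 + 1)) / nm (cgam p)) _ _ (expR_gt0 (- (Re b / 2 * lnpi R))) zb gb0.
 by rewrite divfK// gt_eqF.
have -> : 2 * (K * 2 `^ e) ^+ 2 * E1 * (16 * 2 * (4 * pi) `^ (1 - dl)) * Y `^ (dl + 2 * e) =
 (2 * (K * 2 `^ e * Y `^ e) ^+ 2) * E1 * (16 * 2 * (4 * pi) `^ (1 - dl) * Y `^ dl).
 have -> : Y `^ (dl + 2 * e) = Y `^ dl * (Y `^ e) ^+ 2.
  rewrite powRD ?(gt_eqF Y0) ?implybT//; congr (_ * _).
  by rewrite mulrDl mul1r powRD ?(gt_eqF Y0) ?implybT// expr2.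
 by ring.
apply: ler_pM => //; first exact: mulr_ge0 (divr_ge0 (nm_ge0 _) (nm_ge0 _)) (expR_ge0 _).
 exact: divr_ge0 (nm_ge0 _) (nm_ge0 _).
by apply: ler_wpM2r => //; exact: ltW.
Qed.
(** Division by z lowers the exponent by one for |y| >= 2 pi; the remaining compact range is covered
    by continuity. *)
Lemma Lt_line (e : R) : 0 < e -> dl + 2 * e <= 1 -> exists2 K : R, 0 < K & forall y : R,
 nm (Lt (Complex (- dl) y)) <= K * (1 + `|y|) `^ (dl + 2 * e - 1).
Proof.
move=> e0 ke; have [K K0 HK] := Th_line e0.
have pp := pi_gt0 R; have p2 := pi_ge2 R.
have cc : cctn (fun y => Lt (vline (- dl) y)) (- (2 * pi)) (2 * pi).
 move=> y _; apply: (@ccont_comp _ Lt (vline (- dl)) y _ _ (@rderiv_vline R (- dl) y)).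
 by apply: holo_Lt; rewrite /hplane /=; dlra.
have [|B HB] := compact_bound _ cc; first by lra.
have B0 : 0 <= B.
 have h : - (2 * pi) <= (0 : R) <= 2 * pi by lra.
 exact: le_trans (nm_ge0 _) (HB 0 h).
exists (2 * K + 2 + B * (1 + 2 * pi) `^ (1 - (dl + 2 * e))).
 by rewrite ltr_pwDl// ?mulr_ge0 ?powR_ge0// addr_gt0// mulr_gt0.
move=> y; set Y := 1 + `|y|; have Y1 : 1 <= Y by rewrite /Y lerDl.
have Y0 : 0 < Y by lra.
set k := dl + 2 * e.
have P0 : 0 <= Y `^ (k - 1) by exact: powR_ge0.
have [yp|yp] := leP (2 * pi) `|y|.
 have y0 : 1 <= `|y| by lra.
 have ny : `|y| <= nm (Complex (- dl) y) := le_Im_nm (Complex (- dl) y).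
 have z0 : Complex (- dl) y != 0 by rewrite -nm_gt0; apply: lt_le_trans ny; lra.
 apply: le_trans (nm_Lt z0) _.
 have h : nm (Th (Complex (- dl) y)) + 1 <= (K + 1) * Y `^ k.
  rewrite mulrDl mul1r; apply: lerD; first exact: HK.
  by rewrite -[leLHS](powRr0 Y); apply: ler_powR => //; rewrite /k; have := d0; lra.
 have i : (nm (Complex (- dl) y))^-1 <= 2 * Y^-1.
  have -> : 2 * Y^-1 = (Y / 2)^-1 by rewrite invfM invrK mulrC.
  rewrite lef_pV2 ?posrE ?divr_gt0//; last by apply: lt_le_trans ny; lra.
  by apply: le_trans ny; rewrite /Y; lra.
 have E : Y `^ (k - 1) = Y `^ k * Y^-1.
  by rewrite powRD ?(gt_eqF Y0) ?implybT// powR_inv1// ltW.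
 apply: (@le_trans _ _ ((K + 1) * Y `^ k * (2 * Y^-1))).
  by apply: ler_pM => //; rewrite ?addr_ge0 ?invr_ge0 ?nm_ge0.
 have -> : (K + 1) * Y `^ k * (2 * Y^-1) = (2 * K + 2) * Y `^ (k - 1) by rewrite E; ring.
 by rewrite ler_wpM2r// lerDl mulr_ge0 ?powR_ge0.
have yb : - (2 * pi) <= y <= 2 * pi by move: yp => /ltW; rewrite ler_norml.
apply: le_trans (HB y yb) _.
have h : 1 <= (1 + 2 * pi) `^ (1 - k) * Y `^ (k - 1).
 have -> : Y `^ (k - 1) = (Y `^ (1 - k))^-1 by rewrite -powRN opprB.
 rewrite ler_pdivlMr ?powR_gt0// mul1r; apply: ge0_ler_powR; rewrite ?nnegrE ?subr_ge0 ?(ltW Y0)//; [lra|rewrite /Y; lra].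
have : B <= B * ((1 + 2 * pi) `^ (1 - k) * Y `^ (k - 1)) by rewrite ler_peMr.
move=> /le_trans; apply; rewrite mulrA [leRHS]mulrDl lerDr mulr_ge0//; lra.
Qed.
End strip.

End ThetaBounds.

(** * Gaussian smoothing *)

Section Gaussian.
Variable R : realType.
Notation mu := (@lebesgue_measure R).
Local Notation C := R[i].

Lemma hasI_scale (g : R -> R) (s v : R) : continuous g -> (forall x, 0 <= g x) -> 0 < s ->
 hasI mu setT g v -> hasI mu setT (fun x => g (s * x)) (v / s).
Proof.
move=> cg g0 s0 H.
have cs : continuous (fun x : R => g (s * x)).
 by move=> x; apply: (@continuous_comp _ _ _ (fun x : R => s * x) g); [exact: cont_id_mul|exact: cg].
have dx (x : R) : is_derive x 1 (fun x => s * x) s.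
 by have := is_deriveZ s (is_derive_id x 1); rewrite /GRing.scale /= mulr1.
have E := @subst_integral R setT (fun x => s * x) (fun=> s) g measurableT dx (fun x => cvg_cst _)
 (fun=> s0) (fun=> I) (fun y _ => ex_intro _ (s^-1 * y) (esym (mulVKf (lt0r_neq0 s0) y))) (fun y _ => cg y) (fun y _ => g0 y).
have H2 : hasI mu setT (fun x => g (s * x) * s) v.
 apply: EFin_hasI => //.
 - by apply: meas_cont => x; apply: cvgM; [exact: cs|exact: cvg_cst].
 - by move=> x _; rewrite mulr_ge0// ltW.
 - by rewrite -E; exact: hasI_EFin H.
have := hasI_Z s^-1 measurableT H2; rewrite mulrC; apply: eq_hasI => // x _.
by rewrite mulrC mulfK// gt_eqF.
Qed.
Definition ga (y : R) := expR (- y ^+ 2).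
Lemma ga_ge0 y : 0 <= ga y. Proof. exact: expR_ge0. Qed.
Lemma cont_ga : continuous ga.
Proof.
move=> y; apply: (@continuous_comp _ _ _ (fun y : R => - y ^+ 2) expR); last exact: continuous_expR.
by apply: cvgN; apply: cvgM; exact: cvg_id.
Qed.
Lemma ga_le y : ga y <= expR 1 * expR (- 1 * `|y|).
Proof.
rewrite -expRD ler_expR -(real_normK (num_real y)); move: `|y| => t.
by have := sqr_ge0 (t - 2^-1); lra.
Qed.
(** T >= 5 / tau^2 turns the exponent tau^2 T^2 into at least 5 T, and (6 + T)^3 is at most 6^3
    e^(T/2), whence 216. *)
Lemma ga_cube_le (tau T : R) : 0 < tau -> 1 <= T -> 5 / tau ^+ 2 <= T ->
 ga (tau * T) * (6 + T) ^+ 3 <= 216 * expR (- T / 2).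
Proof.
move=> t0 T1 TT; have T0 : 0 <= T by lra.
have a1 : ga (tau * T) <= expR (- 5 * T).
 rewrite ler_expR exprMn mulNr lerN2 [T ^+ 2]expr2 mulrA ler_wpM2r//.
 by move: TT; rewrite ler_pdivrMr ?exprn_gt0// mulrC.
have a2 : (6 + T) ^+ 3 <= 216 * expR (T / 2).
 have -> : expR (T / 2) = expR (T / 6) ^+ 3 by rewrite -expRM_natl; congr expR; field.
 have -> : 216 = 6 ^+ 3 :> R by ring.
 rewrite -exprMn lerXn2r ?nnegrE ?mulr_ge0 ?expR_ge0//; first by lra.
 by have := expR_ge1Dx (T / 6); lra.
apply: le_trans (ler_pM (ga_ge0 _) _ a1 a2) _; first by rewrite exprn_ge0//; lra.
by rewrite mulrCA ler_wpM2l// -expRD ler_expR; lra.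
Qed.
Lemma le_exp_tail (Q T1 x y : R) : 0 <= Q -> 1 <= T1 ->
 (forall T, T1 <= T -> x <= y + Q * expR (- T / 2)) -> x <= y.
Proof.
move=> Q0 T11 step; apply/ler_addgt0Pr => e e0.
pose T := T1 + 2 * Q / e.
have q0 : 0 <= 2 * Q / e by rewrite divr_ge0 ?mulr_ge0// ltW.
apply: le_trans (step T _) _; first by rewrite lerDl.
rewrite lerD2l; have TT : 0 < 1 + T / 2 by rewrite /T; lra.
have h : expR (- T / 2) <= (1 + T / 2)^-1.
 by rewrite mulNr expRN lef_pV2 ?posrE ?expR_gt0// expR_ge1Dx.
apply: le_trans (ler_wpM2l Q0 h) _; rewrite ler_pdivrMr//.
have -> : e * (1 + T / 2) = e * (1 + T1 / 2) + Q by rewrite /T; field; rewrite gt_eqF.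
by rewrite lerDr mulr_ge0 ?(ltW e0)//; lra.
Qed.
Lemma itg_ga : itg mu setT ga.
Proof.
apply: (@itg_le _ _ _ mu setT _ _ measurableT _ (itgZ (expR 1) measurableT (itg_exp_abs ltr01))).
 by apply: meas_cont; exact: cont_ga.
by move=> y _; rewrite ger0_norm ?ga_ge0// ga_le.
Qed.
Definition c1 : R := \int[mu]_(y in setT) ga y.
Lemma hasI_ga : hasI mu setT ga c1. Proof. exact: hasI_itg itg_ga. Qed.
Lemma c1_gt0 : 0 < c1.
Proof.
have cst1 : hasI mu `[0, 1] (fun=> expR (-1)) (expR (-1)).
 apply: EFin_hasI; [exact: mitv|exact: measurable_cst|by move=> x _; exact: expR_ge0|].
 by rewrite integral_cst//= lebesgue_measure_itv /= lte_fin ltr01 oppr0 adde0 mule1.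
have := hasI_le measurableT (hasI_sub measurableT (mitv _) (@subsetT _ _) cst1) hasI_ga => H.
apply: lt_le_trans (H _); first exact: expR_gt0.
move=> y _; rewrite mem_setE in_itv /=; case: ifP => [/andP[y0 y1]|_]; last exact: ga_ge0.
by rewrite ler_expR lerN2; nra.
Qed.

Section tau.
Variable tau : R.
Hypothesis t0 : 0 < tau.

Lemma hasI_gat : hasI mu setT (fun y => ga (tau * y)) (c1 / tau).
Proof. by apply: hasI_scale; [exact: cont_ga|exact: ga_ge0|exact: t0|exact: hasI_ga]. Qed.
Lemma cont_gat : continuous (fun y : R => ga (tau * y)).
Proof. by move=> y; apply: (@continuous_comp _ _ _ (fun y : R => tau * y) ga); [exact: cont_id_mul|exact: cont_ga]. Qed.
Lemma hasI_gat_exp (x : R) : hasI mu setT (fun y => ga (tau * y) * expR (x * y)) (c1 / tau * expR ((x / (2 * tau)) ^+ 2)).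
Proof.
have tn : tau != 0 by rewrite gt_eqF.
have := hasI_Z (expR ((x / (2 * tau)) ^+ 2)) measurableT (hasI_shift (- (x / (2 * tau ^+ 2))) hasI_gat).
rewrite [_ * (c1 / tau)]mulrC; apply: eq_hasI => // y _.
rewrite /ga -!expRD; have e (v : R) : (x / (2 * tau)) ^+ 2 + - (tau * (v - x / (2 * tau ^+ 2))) ^+ 2 = - (tau * v) ^+ 2 + x * v.
 by field.
by rewrite e.
Qed.
(** Completing the square gives the transform at real arguments; the identity theorem carries it to
    an imaginary argument, whose real part is this integral. *)
Lemma gauss_cos (be : R) : hasI mu setT (fun y => ga (tau * y) * cos (be * y)) (c1 / tau * ga (be / (2 * tau))).
Proof.
have mg : measurable_fun (setT : set (mR R)) (fun y => ga (tau * y)) by apply: meas_cont; exact: cont_gat.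
have mi : measurable_fun (setT : set (mR R)) (id : R -> R) by exact: measurable_id.
pose LG (z : C) := Lap mu setT (fun y => ga (tau * y)) id z.
have tn : tau != 0 by rewrite gt_eqF.
pose k : C := ((2 * tau)^-1 ^+ 2)%:C.
have E : forall z, whole z -> LG z = (c1 / tau)%:C * cexp (z ^+ 2 * k).
 apply: (@identity_real R (@whole R) LG _ 0 1 (@whole_open R) (@whole_convex R)).
 - move=> z _; eexists; apply: (@lap_deriv _ _ _ mu setT measurableT (fun y => ga (tau * y)) id (Re z - 1) (Re z + 1) mg mi (hasI_gat_exp _).1 (hasI_gat_exp _).1).
  by lra.
 - apply: holoM; first exact: holo_cst.
  apply: holo_cexp; apply: holoM; last exact: holo_cst.
  by apply: holoM; exact: holo_id.
 - exact: ltr01.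
 - by [].
 - move=> x _; rewrite /LG (Lap_real measurableT (hasI_gat_exp x)) rmorphM; congr (_ * _).
  have -> : x%:C ^+ 2 * k = ((x / (2 * tau)) ^+ 2)%:C by rewrite /k -rmorphXn -rmorphM /= exprMn.
  by rewrite cexpR.
have [ic _] := @lap_citg _ _ _ mu setT measurableT (fun y => ga (tau * y)) id (Complex 0 be) mg mi (hasI_gat_exp 0).1.
have H := hasI_itg ic.
have v : \int[mu]_(x in setT) Re (lapF (fun y => ga (tau * y)) id (Complex 0 be) x) = c1 / tau * ga (be / (2 * tau)).
 have := congr1 (fun z : C => Re z) (E (Complex 0 be) I); rewrite {1}/LG /Lap /CI => e; rewrite [LHS]e.
 have -> : Complex 0 be ^+ 2 * k = (- (be / (2 * tau)) ^+ 2)%:C.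
  by apply: ceqP; rewrite /k expr2 !reimE /=; field.
 by rewrite cexpR ReM /= mul0r subr0.
rewrite -v; apply: eq_hasI H => // y _.
by rewrite /lapF /cexp !reimE /= !mulr0 !mul0r !subr0 ?addr0 ?add0r expR0 mul1r.
Qed.
(** On every vertical line its modulus is a constant times a Gaussian in the height, and the real
    part integrates over the line to a Gaussian in [U] of width 2 tau, the same for all lines.
    Weighting a transform by it therefore averages the function around [U]. *)
Definition gE (U : R) (z : C) : C := cexp ((tau ^+ 2)%:C * z ^+ 2 + z * U%:C).

Lemma Re_gE (U s y : R) : Re ((tau ^+ 2)%:C * (Complex s y) ^+ 2 + (Complex s y) * U%:C) = tau ^+ 2 * (s ^+ 2 - y ^+ 2) + s * U.
Proof. by rewrite !expr2 !reimE /=; ring. Qed.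
Lemma Im_gE (U s y : R) : Im ((tau ^+ 2)%:C * (Complex s y) ^+ 2 + (Complex s y) * U%:C) = (U + 2 * tau ^+ 2 * s) * y.
Proof. by rewrite !expr2 !reimE /=; ring. Qed.
Lemma Re_gEE (U s y : R) : Re (gE U (Complex s y)) = expR (tau ^+ 2 * (s ^+ 2 - y ^+ 2) + s * U) * cos ((U + 2 * tau ^+ 2 * s) * y).
Proof. by rewrite -Re_gE -Im_gE. Qed.
Lemma nm_gE (U s y : R) : nm (gE U (Complex s y)) = expR (tau ^+ 2 * s ^+ 2 + s * U) * ga (tau * y).
Proof. by rewrite /gE nm_cexp Re_gE /ga -expRD; congr expR; ring. Qed.
Lemma gauss_line (v s : R) : hasI mu setT (fun y => Re (gE v (Complex s y))) (c1 / tau * ga (v / (2 * tau))).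
Proof.
have tn : tau != 0 by rewrite gt_eqF.
have := hasI_Z (expR (tau ^+ 2 * s ^+ 2 + s * v)) measurableT (gauss_cos (v + 2 * tau ^+ 2 * s)).
have -> : expR (tau ^+ 2 * s ^+ 2 + s * v) * (c1 / tau * ga ((v + 2 * tau ^+ 2 * s) / (2 * tau))) = c1 / tau * ga (v / (2 * tau)).
 rewrite mulrCA /ga -expRD; congr (_ * expR _); field.
 by [].
apply: eq_hasI => // y _.
rewrite Re_gEE mulrA /ga -expRD; congr (expR _ * _).
have e (x : R) : tau ^+ 2 * s ^+ 2 + s * v + - (tau * x) ^+ 2 = tau ^+ 2 * (s ^+ 2 - x ^+ 2) + s * v by ring.
exact: e.
Qed.
Lemma gED (U u : R) (z : C) : gE (U - u) z = gE U z * cexp (z * (- u)%:C).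
Proof. by rewrite /gE -cexpD rmorphB rmorphN /=; congr cexp; ring. Qed.
End tau.

(** * Averages of a function from bounds on its continued transform *)

Section smoothing.
Variables (f : R -> R) (Lt : C -> C) (dl k K1 K2 : R).
Hypotheses (mf : measurable_fun (ray0 R) f)
 (if2 : itg mu `[0, +oo[ (fun u => f u * expR (2 * - u)))
 (d0 : 0 < dl) (d1 : dl <= 1) (k0 : 0 < k) (k1 : k <= 1) (K10 : 0 < K1) (K20 : 0 < K2)
 (Lf : forall y, Lap mu `[0, +oo[ f (fun u => - u) (Complex 2 y) = Lt (Complex 2 y))
 (hL : forall z, - dl <= Re z -> cder_at Lt z)
 (Ls : forall z : C, - dl <= Re z -> Re z <= 2 -> 1 <= `|Im z| -> nm (Lt z) <= K1 * (6 + `|Im z|) ^+ 3)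
 (Ll : forall y : R, nm (Lt (Complex (- dl) y)) <= K2 * (1 + `|y|) `^ (k - 1)).

Section fixed.
Variables (tau U : R).
Hypotheses (t0 : 0 < tau) (t1 : tau <= 1) (U0 : 0 <= U).

Local Notation E4 := (expR (4 + 2 * U)).
Local Notation V1 := (K2 * expR (1 - dl * U)).
Local Notation Hb3 T := (E4 * ga (tau * T) * (K1 * (6 + T) ^+ 3)).

Definition Gz (z : C) := gE tau U z * Lt z.

(** On Re z = 2 the transform converges absolutely, so the weighted line integral can be exchanged
    with the integral over u; what remains is the Gaussian average of [f]. *)
Lemma smooth_fubini : exists v,
 hasI mu `[0, +oo[ (fun u => f u * (c1 / tau * ga ((U - u) / (2 * tau)))) v /\
 hasI mu setT (fun y => Re (Gz (Complex 2 y))) v.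
Proof.
pose D1 : set (mR R) := `[0, +oo[%classic.
pose F (p : R * R) := f p.1 * Re (gE tau (U - p.1) (Complex 2 p.2)).
pose q (y : R) := expR (tau ^+ 2 * 2 ^+ 2 + 2 * U) * ga (tau * y).
have iq : itg mu setT q by apply: itgZ => //; exact: (hasI_gat t0).1.
have ip := itg_norm if2.
have mF : measurable_fun (D1 `*` setT : set (mR R * mR R)) F.
 apply: measurable_funM.
  exact: (@meas_fst _ _ (mR R) (mR R) R D1 setT f (mitv _) measurableT mf).
 have e : (fun p : mR R * mR R => Re (gE tau (U - p.1) (Complex 2 p.2))) =
  (fun p => expR (tau ^+ 2 * 2 ^+ 2 + 2 * U) * expR (- 2 * p.1) * ga (tau * p.2) * cos ((U - p.1 + 2 * tau ^+ 2 * 2) * p.2)).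
  apply/funext => p; rewrite Re_gEE /ga -!expRD; congr (expR _ * _).
  have e' (x y : R) : tau ^+ 2 * (2 ^+ 2 - y ^+ 2) + 2 * (U - x) = tau ^+ 2 * 2 ^+ 2 + 2 * U + - 2 * x + - (tau * y) ^+ 2 by ring.
  exact: e'.
 rewrite e.
 have m1 (g : R -> R) : continuous g -> measurable_fun (D1 `*` setT : set (mR R * mR R)) (fun p => g p.1).
  by move=> cg; apply: (@meas_fst _ _ (mR R) (mR R) R D1 setT g (mitv _) measurableT); exact: meas_cont.
 have m2 (g : R -> R) : continuous g -> measurable_fun (D1 `*` setT : set (mR R * mR R)) (fun p => g p.2).
  by move=> cg; apply: (@meas_snd _ _ (mR R) (mR R) R D1 setT g (mitv _) measurableT); exact: meas_cont.
 apply: measurable_funM; first apply: measurable_funM.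
 - by apply: (m1 (fun x => expR (tau ^+ 2 * 2 ^+ 2 + 2 * U) * expR (- 2 * x))) => x; apply: cvgM; [exact: cvg_cst|exact: cont_expM].
 - by apply: (m2 (fun y => ga (tau * y))); exact: cont_gat.
 - apply: (@measurableT_comp _ _ _ _ _ _ (@cos R)).
   by apply: continuous_measurable_fun; exact: continuous_cos.
  apply: measurable_funM; last by apply: (m2 id) => y; exact: cvg_id.
  apply: (m1 (fun x => U - x + 2 * tau ^+ 2 * 2)) => x.
  by apply: cvgD; [apply: cvgB; [exact: cvg_cst|exact: cvg_id]|exact: cvg_cst].
have B0 (x y : R) : D1 x -> setT y -> `|F (x, y)| <= `|f x * expR (2 * - x)| * q y.
 move=> _ _; rewrite /F [`|_ * _|]normrM [`|f x * _|]normrM -[leRHS]mulrA ler_wpM2l//.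
 apply: le_trans (le_Re_nm _) _; rewrite nm_gE /q [leRHS]mulrA ler_wpM2r ?ga_ge0// ger0_norm ?expR_ge0// -expRD ler_expR.
 by rewrite /=; apply: eq_ler; ring.
have HA (x : R) : D1 x -> hasI mu setT (fun y => F (x, y)) (f x * (c1 / tau * ga ((U - x) / (2 * tau)))).
 by move=> _; exact: (hasI_Z (f x) measurableT (gauss_line t0 (U - x) 2)).
have HB (y : R) : setT y -> hasI mu D1 (fun x => F (x, y)) (Re (Gz (Complex 2 y))).
 move=> _; have i2 : itg mu D1 (fun u => f u * expR (Re (Complex 2 y) * - u)) by [].
 have [c c'] := lap_citg (mitv _) mf (@meas_opp R _) i2.
 have Z : citg mu D1 (fun u => gE tau U (Complex 2 y) * lapF f (fun u => - u) (Complex 2 y) u).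
  by apply: citgZ; [exact: mitv|split].
 have -> : Re (Gz (Complex 2 y)) = Re (CI mu D1 (fun u => gE tau U (Complex 2 y) * lapF f (fun u => - u) (Complex 2 y) u)).
  by rewrite CIZ; [rewrite /Gz -Lf|exact: mitv|split].
 apply: eq_hasI (hasI_itg Z.1); first exact: mitv.
 have ReZ (x : R) (z : C) : Re (x%:C * z) = x * Re z by rewrite ReM /= mul0r subr0.
 have key (x : R) : Re (gE tau U (Complex 2 y) * lapF f (fun u => - u) (Complex 2 y) x) = f x * Re (gE tau (U - x) (Complex 2 y)).
  by rewrite gED /lapF mulrCA ReZ.
 by move=> u _; exact: key.
exact: (@fubini_dom _ _ (mR R) (mR R) R mu mu D1 setT F _ _ _ _ (mitv _) measurableT mF ip iq B0 HA HB).
Qed.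
(** Half of the exponential decay is spent on the factor e^(-T/2), the other half on
    integrability. *)
Lemma line_tail (B : R -> R) (M v : R) : 0 <= M -> hasI mu setT B v -> (forall y, `|B y| <= M * expR (- 1 * `|y|)) ->
 exists2 M', 0 <= M' & forall T, 0 <= T -> `|v - ivl B (- T) T| <= M' * expR (- T / 2).
Proof.
move=> M0 HB bB; have h2 : 0 < (2^-1 : R) by lra.
have He := hasI_itg (itg_exp_abs h2); set m := \int[mu]_(x in _) _ in He.
have m0 : 0 <= m by apply: (hasI_ge0 He) => y _; exact: expR_ge0.
exists (M * m); first exact: mulr_ge0.
move=> T T0.
have i1 : itg mu `[- T, T] B by apply: itgS HB.1; [exact: measurableT|exact: mitv|].
have Hs := hasI_sub measurableT (mitv _) (@subsetT _ _) (hasI_itg i1).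
have Hd := hasI_B measurableT HB Hs.
have := RI_abs_le measurableT Hd.1 (hasI_Z (M * expR (- T / 2)) measurableT He) _.
rewrite Hd.2 /ivl => H; rewrite mulrAC; apply: H => y _.
rewrite mem_setE in_itv /=; case: ifP => [_|yT].
 by rewrite subrr normr0 !mulr_ge0 ?expR_ge0.
rewrite subr0; apply: le_trans (bB y) _; rewrite -mulrA ler_wpM2l// -expRD ler_expR.
have : T < `|y| by rewrite ltNge ler_norml yT.
by move: `|_| => t; lra.
Qed.
Lemma ctn_power T : ctn (fun y => (1 + y) `^ (k - 1) * ga (tau * y)) 0 T.
Proof.
move=> y /andP[y0 _]; apply: cvgM; last exact: cont_gat.
have p0 : 0 < 1 + y by lra.
apply: (@continuous_comp _ _ _ (fun y : R => 1 + y) (fun v : R => v `^ (k - 1))); last exact: cont_powR.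
by apply: cvgD; [exact: cvg_cst|exact: cvg_id].
Qed.
(** With m(y) = 1 + tau (1 + y) the quotient (1 + y) / m has logarithmic derivative 1 / ((1 + y) m),
    so its k-th power is a primitive of k (1 + y)^(k - 1) m^(-(k + 1)). The quotient stays below 1 /
    tau, and 8 m^(-2) dominates the Gaussian. *)
Lemma line_power (T : R) : 0 <= T -> ivl (fun y => (1 + y) `^ (k - 1) * ga (tau * y)) 0 T <= 8 / k * tau `^ (- k).
Proof.
move=> T0; have t0' := t0; have t1' := t1; have k0' := k0; have k1' := k1.
pose m y : R := 1 + tau + tau * y.
pose F y : R := 8 / k * expR (k * (ln (1 + y) - ln (m y))).
pose F' y : R := 8 * ((1 + y) `^ (k - 1) * expR (- (k + 1) * ln (m y))).
have m0 y : 0 <= y -> 1 < m y by move=> y0; have : 0 <= tau * y by [rewrite mulr_ge0// ltW]; rewrite /m; lra.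
have cm y : 0 <= y -> {for y, continuous (fun y => ln (m y))}.
 move=> y0; apply: (@continuous_comp _ _ _ m (@ln R)); last by apply: continuous_ln; have := m0 y y0; lra.
 by apply: cvgD; [exact: cvg_cst|exact: cont_id_mul].
have cF' : ctn F' 0 T.
 move=> y /andP[y0 _]; have p0 : 0 < 1 + y by lra.
 apply: cvgM; first exact: cvg_cst.
 apply: cvgM.
  apply: (@continuous_comp _ _ _ (fun y : R => 1 + y) (fun v : R => v `^ (k - 1))); last exact: cont_powR.
  by apply: cvgD; [exact: cvg_cst|exact: cvg_id].
 apply: (@continuous_comp _ _ _ (fun y : R => - (k + 1) * ln (m y)) expR); last exact: continuous_expR.
 by apply: cvgM; [exact: cvg_cst|exact: cm].
have dF (y : R) : 0 <= y <= T -> is_derive y 1 F (F' y).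
 move=> /andP[y0 _]; have p0 : 0 < 1 + y by lra.
 have my := m0 y y0; have my0 : 0 < m y by lra.
 have e1 : is_derive y 1 (fun y => ln (1 + y)) (1 + y)^-1.
  have e : is_derive y 1 (fun y => 1 + y : R) 1.
   by have := is_deriveD (is_derive_cst (1 : R) y (1 : R)) (is_derive_id y (1 : R)); rewrite add0r.
  by have := @is_derive1_comp R (@ln R) (fun y => 1 + y) y _ _ (is_derive1_ln p0) e; rewrite mulr1.
 have e2 : is_derive y 1 (fun y => ln (m y)) ((m y)^-1 * tau).
  have e : is_derive y 1 m tau.
   by have := is_deriveD (is_derive_cst (1 + tau) y (1 : R)) (is_deriveZ tau (is_derive_id y (1 : R))); rewrite add0r /GRing.scale /= mulr1.
  exact: (@is_derive1_comp R (@ln R) m y _ _ (is_derive1_ln my0) e).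
 have e3 := is_deriveZ k (is_deriveB e1 e2).
 have e4 := is_deriveZ (8 / k) (@is_derive1_comp R expR _ y _ _ (is_derive_expR _) e3).
 move: e4; congr (is_derive _ _ _ _).
 rewrite /F' /GRing.scale /= fctE /= /GRing.scale /=.
 have -> : expR (k * (ln (1 + y) - ln (m y))) = (1 + y) * (1 + y) `^ (k - 1) * (m y * expR (- (k + 1) * ln (m y))).
  rewrite /powR gt_eqF//.
  transitivity (expR (ln (1 + y)) * expR ((k - 1) * ln (1 + y)) * (expR (ln (m y)) * expR (- (k + 1) * ln (m y)))).
   by rewrite -!expRD; congr expR; ring.
  by rewrite !lnK ?posrE.
 move: (expR _) (_ `^ _) => q1 q2; rewrite /m; field.
 by rewrite !gt_eqF//; have := my0; rewrite /m.
apply: (@le_trans _ _ (ivl F' 0 T)).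
 apply: ivl_le; [exact: ctn_power|exact: cF'|].
 move=> y /andP[y0 _]; rewrite /F' mulrCA ler_wpM2l ?powR_ge0//.
 have my := m0 y y0; have my0 : 0 < m y by lra.
 have h1 : expR (- 2 * ln (m y)) <= expR (- (k + 1) * ln (m y)).
  by rewrite ler_expR ler_wpM2r ?ln_ge0 ?(ltW my)//; lra.
 apply: (@le_trans _ _ (8 * expR (- 2 * ln (m y)))); last by rewrite ler_wpM2l.
 have -> : expR (- 2 * ln (m y)) = (m y ^+ 2)^-1 by rewrite mulNr expRN expRM_natl lnK ?posrE.
 rewrite ler_pdivlMr ?exprn_gt0// /ga expRN mulrC ler_pdivrMr ?expR_gt0//.
 have x0 : 0 <= tau * y by rewrite mulr_ge0// ltW.
 have := expR_ge1Dx ((tau * y) ^+ 2); rewrite /m; move: (tau * y) x0 => x x0 h.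
 have : (1 + tau + x) ^+ 2 <= (2 + x) ^+ 2 by rewrite lerXn2r ?nnegrE; lra.
 by move=> /le_trans; apply; nra.
rewrite (ivl_FTC T0 cF' dF).
have F0 : 0 <= F 0 by rewrite mulr_ge0 ?expR_ge0// divr_ge0// ltW.
apply: (@le_trans _ _ (F T)); first by rewrite gerBl.
rewrite /F ler_wpM2l//; first by rewrite divr_ge0// ltW.
rewrite /powR gt_eqF// ler_expR mulNr -mulrN ler_wpM2l//; first exact: ltW.
have mT := m0 T T0; have p0 : 0 < 1 + T by lra.
have mT0 : 0 < m T by lra.
have h : ln tau + ln (1 + T) <= ln (m T) by rewrite -lnM ?posrE// ler_ln ?posrE ?mulr_gt0// /m; lra.
by move: h; move: (ln _) (ln _) (ln _) => x y z; lra.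
Qed.
Lemma ivl_opp (g : R -> R) T : 0 <= T -> ctn g (- T) 0 -> ivl g (- T) 0 = ivl (fun y => g (- y)) 0 T.
Proof.
move=> T0 cg; rewrite /ivl /Rintegral -[X in `[_, X]]oppr0 integration_by_substitution_oppr//.
by apply: ctn_within; rewrite oppr0.
Qed.
Lemma ivl_abs_le (g M : R -> R) (x y : R) : ctn g x y -> ctn M x y -> (forall t, x <= t <= y -> `|g t| <= M t) -> `|ivl g x y| <= ivl M x y.
Proof.
move=> cg cM H; rewrite ler_norml; apply/andP; split.
 have cN : ctn (fun t => -1 * M t) x y by move=> t ti; apply: cvgM; [exact: cvg_cst|exact: cM].
 rewrite -mulN1r -ivlZ//; apply: ivl_le => // t ti; have := H t ti; rewrite ler_norml mulN1r => /andP[]//.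
by apply: ivl_le => // t ti; have := H t ti; rewrite ler_norml => /andP[].
Qed.
Lemma holo_Gz z : - dl <= Re z -> cder_at Gz z.
Proof.
move=> z1; apply: (@holoM R (fun y => - dl <= Re y) (gE tau U) Lt) => //.
apply: holo_cexp; apply: holoD.
 by apply: holoM; [exact: holo_cst|apply: holoM; exact: holo_id].
by apply: holoM; [exact: holo_id|exact: holo_cst].
Qed.
Lemma Gz_line y : `|Re (Gz (Complex (- dl) y))| <= V1 * ((1 + `|y|) `^ (k - 1) * ga (tau * y)).
Proof.
apply: le_trans (le_Re_nm _) _; rewrite nmM nm_gE.
have h : expR (tau ^+ 2 * (- dl) ^+ 2 + - dl * U) <= expR (1 - dl * U).
 rewrite ler_expR mulNr lerD2r sqrrN; have := t0; have := t1; have := d0; have := d1 => a b c d.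
 by rewrite -exprMn; apply: exprn_ile1; [rewrite mulr_ge0// ltW|rewrite mulr_ile1// ltW].
have -> : V1 * ((1 + `|y|) `^ (k - 1) * ga (tau * y)) = expR (1 - dl * U) * ga (tau * y) * (K2 * (1 + `|y|) `^ (k - 1)) by ring.
apply: ler_pM; rewrite ?mulr_ge0 ?expR_ge0 ?nm_ge0 ?ga_ge0//.
by rewrite ler_wpM2r// ga_ge0.
Qed.
Lemma Vl_bound T : 0 <= T -> `|ivl (fun y => Re (Gz (vline (- dl) y))) (- T) T| <= 2 * (V1 * (8 / k * tau `^ (- k))).
Proof.
move=> T0.
have cc x y : cctn (fun t => Gz (vline (- dl) t)) x y.
 move=> t _; apply: (@ccont_comp _ Gz (vline (- dl)) t _ _ (@rderiv_vline R (- dl) t)).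
 by apply: holo_Gz; rewrite /= lexx.
have cR x y := cctn_Re (cc x y).
have T1 : - T <= 0 by rewrite oppr_le0.
rewrite (ivl_cat T1 T0 (cR _ _)).
have K0 : 0 <= V1 by rewrite mulr_ge0 ?expR_ge0// ltW.
have key (g : R -> R) : ctn g 0 T -> (forall t, 0 <= t <= T -> `|g t| <= V1 * ((1 + t) `^ (k - 1) * ga (tau * t))) ->
  `|ivl g 0 T| <= V1 * (8 / k * tau `^ (- k)).
 move=> cg bg; have cp := @ctn_power T.
 have cM : ctn (fun t => V1 * ((1 + t) `^ (k - 1) * ga (tau * t))) 0 T.
  by move=> t ti; apply: cvgM; [exact: cvg_cst|exact: cp].
 apply: le_trans (ivl_abs_le cg cM bg) _; rewrite ivlZ// ler_wpM2l//; exact: line_power.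
apply: le_trans (ler_normD _ _) _; rewrite [leRHS]mulr_natl mulr2n; apply: lerD.
 rewrite ivl_opp//; apply: key.
  move=> t ti; apply: (@continuous_comp _ _ _ (fun t : R => - t) (fun y => Re (Gz (vline (- dl) y)))).
   by apply: cvgN; exact: cvg_id.
  by apply: (cR (- t) (- t)); rewrite lexx.
 move=> t /andP[ti _]; apply: le_trans (Gz_line _) _; rewrite normrN (ger0_norm ti).
 by rewrite /ga mulrN sqrrN.
by apply: key => // t /andP[ti _]; apply: le_trans (Gz_line _) _; rewrite (ger0_norm ti).
Qed.
Lemma H_bound (T s : R) : 1 <= T -> (s = T \/ s = - T) ->
 nm (cI (fun x => Gz (hline s x)) (- dl) 2) <= 6 * (Hb3 T).
Proof.
move=> T1 sT; have d0' := d0; have d1' := d1; have t0' := t0; have t1' := t1; have U0' := U0.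
have nT : `|s| = T by case: sT => ->; rewrite ?normrN ger0_norm; lra.
have s2 : s ^+ 2 = T ^+ 2 by case: sT => ->; rewrite ?sqrrN.
set M := _ * _ * (K1 * _).
have cc : cctn (fun x => Gz (hline s x)) (- dl) 2.
 move=> t /andP[ta _]; apply: (@ccont_comp _ Gz (hline s) t _ _ (@rderiv_hline R s t)).
 exact: holo_Gz.
have M0 : 0 <= M by rewrite !mulr_ge0 ?expR_ge0 ?ga_ge0 ?exprn_ge0 ?(ltW K10)//; lra.
have d2 : - dl <= 2 by lra.
apply: le_trans (cI_bound d2 cc (M := M) _) _; last by nra.
move=> t /andP[ta tb]; rewrite nmM nm_gE /M; apply: ler_pM; rewrite ?mulr_ge0 ?expR_ge0 ?nm_ge0 ?ga_ge0//.
 have -> : ga (tau * s) = ga (tau * T) by rewrite /ga !exprMn s2.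
 rewrite ler_wpM2r ?ga_ge0// ler_expR; apply: lerD.
  have t2 : tau ^+ 2 <= 1 by rewrite exprn_ile1// ltW.
  have t20 : 0 <= tau ^+ 2 by exact: sqr_ge0.
  have tt : t ^+ 2 <= 4 by nra.
  by have := sqr_ge0 t; nra.
 by rewrite ler_wpM2r.
by have := @Ls (Complex t s) ta tb; rewrite /= nT; exact.
Qed.
(** Goursat's theorem on the rectangle between Re z = 2 and Re z = -dl, up to height T. The
    horizontal sides and the part of the right line beyond T are exponentially small, so for large T
    only the integral on Re z = -dl remains. *)
Lemma contour_bound v : hasI mu setT (fun y => Re (Gz (Complex 2 y))) v ->
 `|v| <= 2 * (V1 * (8 / k * tau `^ (- k))).
Proof.
move=> Hv; set Bd := leRHS.
have d0' := d0; have d1' := d1; have t0' := t0; have t1' := t1; have U0' := U0.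
set m := \int[mu]_(u in `[0, +oo[) `|f u * expR (2 * - u)|.
have Hm := hasI_itg (itg_norm if2).
have m0 : 0 <= m by apply: (hasI_ge0 Hm) => u _.
have Lb y : nm (Lt (Complex 2 y)) <= 2 * m.
 rewrite -Lf; apply: (CI_bound (mitv _) (lap_citg (mitv _) mf (@meas_opp R _) (if2 : itg mu _ (fun u => f u * expR (Re (Complex 2 y) * - u)))) Hm).
 by move=> u _; rewrite nm_lapF normrM (ger0_norm (expR_ge0 _)).
have tb y : `|Re (Gz (Complex 2 y))| <= E4 * expR ((2 * tau)^-1 ^+ 2) * (2 * m) * expR (- 1 * `|y|).
 apply: le_trans (le_Re_nm _) _; rewrite nmM nm_gE.
 have -> : E4 * expR ((2 * tau)^-1 ^+ 2) * (2 * m) * expR (- 1 * `|y|) =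
  E4 * (expR ((2 * tau)^-1 ^+ 2) * expR (- 1 * `|y|)) * (2 * m) by ring.
 apply: ler_pM; rewrite ?mulr_ge0 ?expR_ge0 ?nm_ge0 ?ga_ge0//.
 apply: ler_pM; rewrite ?expR_ge0 ?ga_ge0//.
  by rewrite ler_expR lerD2r; have : tau ^+ 2 <= 1 by [rewrite exprn_ile1// ltW]; lra.
 rewrite -expRD ler_expR exprMn -(real_normK (num_real y)); move: `|y| => r.
 have := sqr_ge0 (tau * r - (2 * tau)^-1); have tn : tau != 0 by rewrite gt_eqF.
 have -> : (tau * r - (2 * tau)^-1) ^+ 2 = tau ^+ 2 * r ^+ 2 - r + (2 * tau)^-1 ^+ 2 by field.
 by move: (_^-1 ^+ 2) (_ * r ^+ 2) => p q; lra.
have M0 : 0 <= E4 * expR ((2 * tau)^-1 ^+ 2) * (2 * m) by rewrite !mulr_ge0 ?expR_ge0.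
have [M' M'0 HT] := line_tail M0 Hv tb.
pose N := 12 * (E4 * (K1 * 216)).
have N0 : 0 <= N by rewrite !mulr_ge0 ?expR_ge0// ltW.
pose T1 := 1 + 5 / tau ^+ 2.
have t2 : 0 < tau ^+ 2 by rewrite exprn_gt0.
have T11 : 1 <= T1 by rewrite lerDl divr_ge0// ltW.
have T1b : 5 / tau ^+ 2 <= T1 by rewrite lerDr.
have step T : T1 <= T -> `|v| <= Bd + (M' + N) * expR (- T / 2).
 move=> TT; have T1' : 1 <= T by lra. have T0 : 0 <= T by lra.
 have TN : - T <= T by lra. have dd : - dl <= 2 by lra.
 have hr : holo_rect Gz (- dl) 2 (- T) T by move=> z [/andP[z1 _] _]; exact: holo_Gz.
 have G := Goursat dd TN hr.
 have E : ivl (fun y => Re (Gz (vline 2 y))) (- T) T =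
  Im (cI (fun t => Gz (hline T t)) (- dl) 2) - Im (cI (fun t => Gz (hline (- T) t)) (- dl) 2) + ivl (fun y => Re (Gz (vline (- dl) y))) (- T) T.
  have := congr1 (fun z : C => Im z) G; rewrite /rct !reimE /=.
  move: (ivl _ _ _) (ivl _ _ _) (ivl _ _ _) (ivl _ _ _) => a1 a2 a3 a4; lra.
 have b1 := H_bound T1' (or_introl erefl); have b2 := H_bound T1' (or_intror erefl).
 have i1 := le_trans (le_Im_nm _) b1; have i2 := le_trans (le_Im_nm _) b2.
 have i3 := Vl_bound T0; rewrite -/Bd in i3.
 have i4 := HT T T0.
 have hN : 12 * (Hb3 T) <= N * expR (- T / 2).
  have g5 := ga_cube_le t0 T1' (le_trans T1b TT).
  rewrite /N; have -> : 12 * (Hb3 T) = 12 * E4 * K1 * (ga (tau * T) * (6 + T) ^+ 3) by ring.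
  have -> : 12 * (E4 * (K1 * 216)) * expR (- T / 2) = 12 * E4 * K1 * (216 * expR (- T / 2)) by ring.
  by rewrite ler_wpM2l// !mulr_ge0 ?expR_ge0// ltW.
 have vE : v = (v - ivl (fun y => Re (Gz (Complex 2 y))) (- T) T) + ivl (fun y => Re (Gz (Complex 2 y))) (- T) T by rewrite subrK.
 rewrite vE; apply: le_trans (ler_normD _ _) _.
 have j : `|ivl (fun y => Re (Gz (Complex 2 y))) (- T) T| <= 12 * (Hb3 T) + Bd.
  rewrite [ivl _ _ _]E; apply: le_trans (ler_normD _ _) _; apply: lerD => //.
  apply: le_trans (ler_normB _ _) _; apply: le_trans (lerD i1 i2) _.
  by apply: eq_ler; ring.
 apply: le_trans (lerD i4 j) _; apply: le_trans (lerD (lexx _) (lerD hN (lexx _))) _.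
 by apply: eq_ler; ring.
exact: (@le_exp_tail (M' + N) T1 _ _ (addr_ge0 M'0 N0) T11 step).
Qed.

(** The kernel is left unnormalised, with mass 2 tau [c1]; dividing by this mass later turns tau^(1
    - k) into tau^(-k). *)
Theorem smooth_bound : exists2 v, hasI mu `[0, +oo[ (fun u => f u * ga ((U - u) / (2 * tau))) v &
 `|v| <= 16 / k * K2 * expR 1 / c1 * (expR (- dl * U) * tau `^ (1 - k)).
Proof.
have t0' := t0; have [v [Ha Hb]] := smooth_fubini.
have B := contour_bound Hb; have c0 := c1_gt0; have k0' := k0.
exists (tau / c1 * v).
 apply: eq_hasI (hasI_Z (tau / c1) (mitv _) Ha); first exact: mitv.
 move=> u _; move: (f u) (ga _) => p q; field.
 by rewrite !gt_eqF.
rewrite normrM (ger0_norm (divr_ge0 (ltW t0') (ltW c0))).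
have tc : 0 <= tau / c1 by rewrite divr_ge0// ltW.
apply: le_trans (ler_wpM2l tc B) _.
have -> : tau `^ (1 - k) = tau * tau `^ (- k).
 by rewrite powRD; [rewrite powRr1// ltW|rewrite (gt_eqF t0') implybT].
have -> : expR (1 - dl * U) = expR 1 * expR (- dl * U) by rewrite -expRD mulNr.
apply: eq_ler; move: (expR 1) (expR (- dl * U)) (tau `^ (- k)) => e1 e2 p.
by field; rewrite !gt_eqF.
Qed.
End fixed.
End smoothing.
End Gaussian.

(** * Regularity of h *)

Section Regularity.
Variable R : realType.
Notation mu := (@lebesgue_measure R).

Lemma bernoulli_concave (x b : R) : 0 < x -> 0 < b < 1 -> x `^ b <= 1 + b * (x - 1).
Proof.
move=> x0 /andP[b0 b1]; have q : 0 < 1 - b < 1 by lra.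
by have := young1 x0 q; rewrite opprB addrC subrK; lra.
Qed.
Lemma count_window (a d M : nat) : (\sum_(n < M) ((a <= n) && (n < d)) = minn M d - a)%N.
Proof.
elim: M => [|M IH]; first by rewrite big_ord0 min0n.
by rewrite big_ord_recr /= IH; case: (leqP a M); case: (ltnP M d); lia.
Qed.
(** Induction on [N]: the increment of N^(1 - al) is bounded below by concavity of the power. *)
Lemma sum_pow_le (al : R) N : 0 < al < 1 ->
 \sum_(n < N) expR (- al * lnS R n) <= (N%:R) `^ (1 - al) / (1 - al).
Proof.
move=> /andP[a0 a1]; have b0 : 0 < 1 - al by lra.
elim: N => [|N IH]; first by rewrite big_ord0 divr_ge0 ?powR_ge0// ltW.
rewrite big_ord_recr /=; apply: le_trans (lerD IH (lexx _)) _.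
rewrite -powR_lnS ler_pdivlMr// mulrDl divfK ?gt_eqF//.
have [->|N0] := posnP N.
 rewrite powR0 ?gt_eqF// add0r !powR1 mul1r; lra.
have n0 : 0 < N%:R :> R by rewrite ltr0n.
have m0 : 0 < N.+1%:R :> R by rewrite ltr0n.
have b01 : 0 < 1 - al < 1 by lra.
have x0 : 0 < N%:R / N.+1%:R :> R by rewrite divr_gt0.
have := bernoulli_concave x0 b01.
have -> : (N%:R / N.+1%:R) `^ (1 - al) = N%:R `^ (1 - al) / N.+1%:R `^ (1 - al) :> R.
 by rewrite powRM ?invr_ge0 ?(ltW n0) ?(ltW m0)// -powR_inv1 ?(ltW m0)// -powRrM mulN1r powRN.
rewrite ler_pdivrMr ?powR_gt0// => h; rewrite addrC -lerBrDl; apply: le_trans h _.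
have -> : N.+1%:R `^ (- al) = N.+1%:R `^ (1 - al) / N.+1%:R :> R.
 by rewrite powRD ?(gt_eqF m0) ?implybT// powRr1 ?(ltW m0)// mulrC mulKf// gt_eqF.
rewrite -natr1; move: (_ `^ _) => p; apply: eq_ler.
by field; rewrite natr1 gt_eqF.
Qed.

Variable w : R.
Hypotheses (w0 : 0 < w) (w2 : w < 1 / 2).
Let w01 : 0 < w < 1 / 2. Proof. by rewrite w0. Qed.
Lemma Ah_mono th u u' : w < th -> u <= u' -> Ah w th u <= Ah w th u'.
Proof.
move=> thw uu; apply: (hasI_le measurableT (Ah_count w01 u thw) (Ah_count w01 u' thw)) => n _.
by apply: ler_wpM2l; [exact: aw_ge0|exact: b_mono].
Qed.

Section th.
Variable th : R.
Hypotheses (th1 : w < th) (th2 : th < 1 + w).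

(* partial sums of a_n over n.+1 <= e^t *)
Definition Sa t : R := \sum_(n < (Num.truncn (expR t)).+1) (if lnS R n <= t then aw w th n else 0).

Lemma Sa_sum t N : expR t <= N%:R -> Sa t = \sum_(n < N) (if lnS R n <= t then aw w th n else 0).
Proof.
move=> tN; pose F n := if lnS R n <= t then aw w th n else 0.
rewrite /Sa -!(big_mkord xpredT F).
have F0 n : expR t <= n%:R -> F n = 0.
 move=> tn; rewrite /F ifF//; apply/negbTE; rewrite -ltNge -ltr_expR expR_lnS.
 by apply: le_lt_trans tn _; rewrite ltr_nat.
have /andP[_ h] := truncn_itv (expR_ge0 t).
have key (a d : nat) : expR t <= a%:R -> (a <= d)%N -> \sum_(0 <= i < a) F i = \sum_(0 <= i < d) F i.
 move=> ua ad; rewrite (big_cat_nat (n := a) (p := d))//= [X in _ + X]big1_seq ?addr0// => i /andP[_].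
 rewrite mem_index_iota => /andP[ai _]; rewrite F0//; apply: le_trans ua _; by rewrite ler_nat.
have [/(key _ _ (ltW h)) //|/ltnW /(key _ _ tN) //] := leqP (Num.truncn (expR t)).+1 N.
Qed.
(** Interchanges the sum with the beta integral: the term of index n contributes at v exactly when
    [lnS R n <= u + ln v / 2]. Regularity of [Ah] then follows from that of the step function
    [Sa]. *)
Lemma hasI_Ah_Sa u : hasI mu `]0, 1[ (fun v => betak (kap w th) w v * Sa (u + ln v / 2)) (Ah w th u).
Proof.
have /andP[_ /ltW hN] := truncn_itv (expR_ge0 u); set N := (Num.truncn (expR u)).+1 in hN.
rewrite (Ah_sum w th hN).
have key M : hasI mu `]0, 1[ (fun v => \sum_(n < M) aw w th n * bf w th n u v) (\sum_(n < M) aw w th n * b w th n u).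
 elim: M => [|M IH].
  have := hasI_Z 0 (mitv _) (hasI_b w01 0 u th1); rewrite mul0r big_ord0; apply: eq_hasI; first exact: mitv.
  by move=> v _; rewrite mul0r big_ord0.
 rewrite big_ord_recr /=; have := hasI_D (mitv _) IH (hasI_Z (aw w th M) (mitv _) (hasI_b w01 M u th1)).
 by apply: eq_hasI; [exact: mitv|move=> v _; rewrite big_ord_recr].
apply: eq_hasI (key N); first exact: mitv.
move=> v /=; rewrite in_itv /= => /andP[v0 v1].
have lv : ln v < 0 by rewrite -ln1 ltr_ln ?posrE.
have le1 : expR (u + ln v / 2) <= N%:R by apply: le_trans hN; rewrite ler_expR; lra.
rewrite (Sa_sum le1) mulr_sumr; apply: eq_bigr => n _; rewrite /bf.
have -> : (2 * (lnS R n - u) <= ln v) = (lnS R n <= u + ln v / 2) by apply/idP/idP; lra.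
by case: ifP => _; [rewrite mulrC|rewrite !mulr0].
Qed.
(** Each term in the window is at most [expR ((w - th) * t)], and a half-open window of length
    [expR t' - expR t] contains fewer integers than its length plus one. *)
Lemma Sa_incr t t' : t <= t' -> Sa t' - Sa t <= expR ((w - th) * t) * (expR t' - expR t + 1).
Proof.
move=> tt; have /andP[_ /ltW hN] := truncn_itv (expR_ge0 t'); set N := (Num.truncn (expR t')).+1 in hN.
have hN' : expR t <= N%:R by apply: le_trans hN; rewrite ler_expR.
rewrite (Sa_sum hN) (Sa_sum hN') -sumrB.
pose P n := (t < lnS R n) && (lnS R n <= t').
apply: (@le_trans _ _ (\sum_(n < N) (if P n then expR ((w - th) * t) else 0))).
 apply: ler_sum => n _; rewrite /P; case: (leP (lnS R n) t) => h /=.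
  by rewrite (le_trans h tt) subrr.
 case: ifP => h2; rewrite ?subr0//; apply: le_trans (aw_le w01 th n) _.
 by rewrite ler_expR; have := th1; nra.
have key M : \sum_(n < M) (if P n then expR ((w - th) * t) else 0) <= expR ((w - th) * t) * (\sum_(n < M) (P n)%:R).
 rewrite mulr_sumr; apply: ler_sum => n _; case: ifP => _; rewrite ?mulr1 ?mulr0//.
apply: le_trans (key N) _; rewrite ler_wpM2l ?expR_ge0//.
have /andP[a1 a2] := truncn_itv (expR_ge0 t); have /andP[b1 b2] := truncn_itv (expR_ge0 t').
set a := Num.truncn (expR t) in a1 a2; set d := Num.truncn (expR t') in b1 b2.
apply: (@le_trans _ _ (\sum_(n < N) ((a <= n) && (n < d))%N%:R)).
 apply: ler_sum => n _; rewrite ler_nat /P; case: (ltP t (lnS R n)) => //= h1; case: (leP (lnS R n) t') => //= h2.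
 have h1' : expR t < n.+1%:R by rewrite -expR_lnS ltr_expR.
 have h2' : n.+1%:R <= expR t' by rewrite -expR_lnS ler_expR.
 have -> : (a <= n)%N by rewrite -ltnS -(ltr_nat R); apply: le_lt_trans h1'.
 by have -> : (n < d)%N by rewrite -ltnS -(ltr_nat R); apply: le_lt_trans h2' b2.
rewrite -natr_sum count_window; apply: (@le_trans _ _ (d - a)%:R); first by rewrite ler_nat leq_sub2r// geq_minr.
have ad : (a <= d)%N.
 by rewrite -ltnS -(ltr_nat R); apply: le_lt_trans a1 (le_lt_trans _ b2); rewrite ler_expR.
by rewrite natrB//; move: a2; rewrite -natr1; lra.
Qed.
Lemma Sa_le t : Sa t <= expR ((1 + w - th) * t) / (1 + w - th).
Proof.
have th1' := th1; have th2' := th2.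
have /andP[a1 a2] := truncn_itv (expR_ge0 t); set a := Num.truncn (expR t) in a1 a2.
rewrite /Sa -/a big_ord_recr /= ifF ?addr0; last first.
 by apply/negbTE; rewrite -ltNge -ltr_expR expR_lnS.
have al : 0 < th - w < 1 by lra.
apply: (@le_trans _ _ (\sum_(n < a) expR (- (th - w) * lnS R n))).
 apply: ler_sum => n _; case: ifP => _; last exact: expR_ge0.
 by apply: le_trans (aw_le w01 th n) _; rewrite opprB.
apply: le_trans (sum_pow_le a al) _.
have -> : 1 - (th - w) = 1 + w - th by ring.
rewrite ler_wpM2r ?invr_ge0//; first by lra.
have -> : expR ((1 + w - th) * t) = expR t `^ (1 + w - th) by rewrite /powR gt_eqF ?expR_gt0// expRK.
by apply: ge0_ler_powR; rewrite ?nnegrE ?expR_ge0//; lra.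
Qed.
Definition bw : R := Gr 1 * Gr w / Gr (1 + w).
Lemma bw_ge0 : 0 <= bw.
Proof. by rewrite /bw divr_ge0 ?mulr_ge0// ltW// Gr_gt0//; have := w0; lra. Qed.
(** The factor exp((w - th) (ln v) / 2) coming from [Sa_incr] changes the beta parameter [kap w th]
    into 1, so one constant serves for both values of [th]. *)
Lemma Ah_incr u u' : u <= u' -> Ah w th u' - Ah w th u <= bw * (expR ((w - th) * u) * (expR u' - expR u + 1)).
Proof.
move=> uu; have H := hasI_B (mitv _) (hasI_Ah_Sa u') (hasI_Ah_Sa u).
set k := _ * (_ - _ + 1); rewrite mulrC.
apply: (hasI_le (mitv _) H (hasI_Z k (mitv _) (hasI_beta ltr01 w0))).
move=> v /=; rewrite in_itv /= => /andP[v0 v1].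
have lv : ln v < 0 by rewrite -ln1 ltr_ln ?posrE.
rewrite -mulrBr.
have tt : u + ln v / 2 <= u' + ln v / 2 by rewrite lerD2r.
have b0 : 0 <= betak (kap w th) w v by apply: betak_ge0; rewrite v0.
apply: le_trans (ler_wpM2l b0 (Sa_incr tt)) _.
have l20 : ln v / 2 <= 0 by lra.
have e1 : expR (ln v / 2) <= 1 by rewrite -[leRHS]expR0 ler_expR.
have e0 : 0 < expR (ln v / 2) by exact: expR_gt0.
have d0 : 0 <= expR u' - expR u by rewrite subr_ge0 ler_expR.
have h : expR (u' + ln v / 2) - expR (u + ln v / 2) + 1 <= expR u' - expR u + 1.
 by rewrite !expRD -mulrBl lerD2r ler_piMr.
have E : betak (kap w th) w v * expR ((w - th) * (u + ln v / 2)) = betak 1 w v * expR ((w - th) * u).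
 rewrite /betak -!mulrA; congr (_ * (_ * _)); rewrite -!expRD; congr expR; rewrite /kap.
 by move: (ln v) => l; field.
rewrite mulrA E; have b1 : 0 <= betak 1 w v * expR ((w - th) * u) by rewrite mulr_ge0 ?expR_ge0//; apply: betak_ge0; rewrite v0.
apply: le_trans (ler_wpM2l b1 h) _; rewrite /k; apply: eq_ler.
by move: (betak _ _ _) (expR _) (expR _) (expR _) => *; ring.
Qed.
Lemma Ah_le u : 0 <= u -> Ah w th u <= Gr (kap w th) * Gr w / Gr (kap w th + w) / (1 + w - th) * expR ((1 + w - th) * u).
Proof.
move=> u0; have th1' := th1; have th2' := th2.
have k0 : 0 < kap w th := kap_gt0 th1.
have := hasI_le (mitv _) (hasI_Ah_Sa u) (hasI_Z (expR ((1 + w - th) * u) / (1 + w - th)) (mitv _) (hasI_beta k0 w0)) _ => H.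
have -> : Gr (kap w th) * Gr w / Gr (kap w th + w) / (1 + w - th) * expR ((1 + w - th) * u) =
 expR ((1 + w - th) * u) / (1 + w - th) * (Gr (kap w th) * Gr w / Gr (kap w th + w)).
 by move: (Gr _) (Gr _) (Gr _) (expR _) => A B D E; ring.
apply: H => v /=; rewrite in_itv /= => /andP[v0 v1].
have lv : ln v < 0 by rewrite -ln1 ltr_ln ?posrE.
rewrite mulrC; have b0 : 0 <= betak (kap w th) w v by apply: betak_ge0; rewrite v0.
apply: ler_wpM2r => //; apply: le_trans (Sa_le _) _.
rewrite ler_wpM2r ?invr_ge0//; first by lra.
by rewrite ler_expR ler_wpM2l//; lra.
Qed.
End th.

(** Extension by 0 lets Gaussian averages run over the whole line; at a point u < 0 the difference
    from the value at U is paid for by the distance, which exceeds U. *)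
Definition fh (u : R) : R := if 0 <= u then hu w u - 1 else 0.

Lemma expB_le (u t c : R) : 0 <= t -> 0 <= c <= 1 -> expR (c * (u + t)) - expR (c * u) <= expR (c * u) * (t * expR t).
Proof.
move=> t0 /andP[c0 c1]; rewrite mulrDr expRD -{2}[expR (c * u)]mulr1 -mulrBr ler_wpM2l ?expR_ge0//.
have := abs_expRB1_le (c * t); rewrite (ger0_norm (mulr_ge0 c0 t0)) => /(le_trans (ler_norm _)) h.
apply: le_trans h _; have ct : c * t <= t by rewrite ler_piMl.
by apply: ler_pM; rewrite ?mulr_ge0 ?expR_ge0// ler_expR.
Qed.

Local Notation ew x := (expR ((1 / 2 - w) * x)).

(** The increment splits into that of the first sum, that of the second sum, and that of the weight
    e^((1/2 - w) u) times the second sum. Each is of the order e^((w - 1/2) u) (1 + e^u t), up to a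
    factor depending on t. The two sums enter as abstract monotone functions. *)
Lemma combo_incr (K kp bw CB : R) (A B : R -> R) : 0 <= K -> 0 <= kp -> 0 <= bw -> 0 <= CB ->
 {homo A : x y / x <= y} -> {homo B : x y / x <= y} -> (forall u, 0 <= B u) ->
 (forall u u', u <= u' -> A u' - A u <= bw * (expR ((w - 1 / 2) * u) * (expR u' - expR u + 1))) ->
 (forall u u', u <= u' -> B u' - B u <= bw * (expR ((w - (1 - w)) * u) * (expR u' - expR u + 1))) ->
 (forall u, 0 <= u -> B u <= CB * expR ((1 + w - (1 - w)) * u)) ->
 exists2 K' : R, 0 < K' & forall u t, 0 <= u -> 0 <= t ->
 `|K * (kp * A (u + t) - ew (u + t) * B (u + t)) - K * (kp * A u - ew u * B u)|
  <= K' * (expR ((w - 1 / 2) * u) * ((1 + expR u * t) * expR (2 * t))).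
Proof.
move=> K0 kp0 b0 CB0 Am Bm B0 iA0 iB0 BC; have w0' := w0; have w2' := w2.
exists (K * (kp * bw + bw + CB) + 1); first by apply: ltr_wpDl => //; apply: mulr_ge0 => //; rewrite !addr_ge0// mulr_ge0.
move=> u t u0 t0; set E := expR ((w - 1 / 2) * u); set Q := (1 + expR u * t).
have E0 : 0 < E by exact: expR_gt0.
have ut : u <= u + t by rewrite lerDl.
have et1 : 1 <= expR t by rewrite -expR0 ler_expR.
have eu0 := expR_gt0 u.
have e2 : expR (2 * t) = expR t * expR t by rewrite -expRD; congr expR; ring.
have Q1 : 1 <= Q by rewrite lerDl mulr_ge0// ltW.
have du : expR (u + t) - expR u + 1 <= Q * expR t.
 have := @expB_le u t 1 t0; rewrite !mul1r ler01 lexx => /(_ isT) h.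
 by rewrite /Q mulrDl mul1r mulrA in h *; lra.
have iA : `|A (u + t) - A u| <= bw * (E * (Q * expR t)).
 rewrite ger0_norm; last by rewrite subr_ge0; (exact: Am || exact: Bm).
 apply: le_trans (iA0 _ _ ut) _; rewrite ler_wpM2l// ler_wpM2l ?expR_ge0//.
have iB : ew (u + t) * `|B (u + t) - B u| <= bw * (E * (Q * expR (2 * t))).
 rewrite ger0_norm; last by rewrite subr_ge0; (exact: Am || exact: Bm).
 have h1 : ew (u + t) <= ew u * expR t.
  by rewrite -expRD ler_expR mulrDr lerD2l ler_piMl//; lra.
 have i0 : 0 <= B (u + t) - B u by rewrite subr_ge0; (exact: Am || exact: Bm).
 apply: le_trans (ler_pM (expR_ge0 _) i0 h1 (iB0 _ _ ut)) _.
 have -> : E = ew u * expR ((w - (1 - w)) * u) by rewrite -expRD; congr expR; field.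
 rewrite e2.
 have p0 : 0 <= bw * (ew u * expR ((w - (1 - w)) * u)) * expR t by apply: mulr_ge0; last exact: expR_ge0; apply: mulr_ge0 => //; apply: mulr_ge0; exact: expR_ge0.
 have := ler_wpM2l p0 du.
 move: (ew u) (expR ((w - (1 - w)) * u)) (expR t) (expR (u + t)) (expR u) => x1 x2 x3 x4 x5 h.
 have -> : x1 * x3 * (bw * (x2 * (x4 - x5 + 1))) = bw * (x1 * x2) * x3 * (x4 - x5 + 1) by ring.
 by apply: le_trans h _; apply: eq_ler; ring.
have iC : (ew (u + t) - ew u) * B u <= CB * (E * (Q * expR (2 * t))).
 have c01 : 0 <= 1 / 2 - w <= 1 by lra.
 have d0 : 0 <= ew (u + t) - ew u by rewrite subr_ge0 ler_expR ler_wpM2l//; lra.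
 apply: le_trans (ler_pM d0 (B0 u) (expB_le u t0 c01) (BC u u0)) _.
 have -> : ew u * (t * expR t) * (CB * expR ((1 + w - (1 - w)) * u)) = CB * (E * (expR u * t * expR t)).
  have -> : expR ((1 + w - (1 - w)) * u) = E * expR u * expR (- (1 / 2 - w) * u) by rewrite -!expRD; congr expR; field.
  have e1 : ew u * expR (- (1 / 2 - w) * u) = 1 by rewrite -expRD -mulrDl subrr mul0r expR0.
  move: (ew u) (expR (- (1 / 2 - w) * u)) e1 (expR u) (expR t) => x1 x2 e1 x3 x4.
  transitivity (x1 * x2 * (CB * (E * (x3 * t * x4)))); first by ring.
  by rewrite e1 mul1r.
 rewrite ler_wpM2l// ler_wpM2l ?(ltW E0)// e2.
 apply: ler_pM; rewrite ?mulr_ge0 ?expR_ge0//; first by rewrite lerDr.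
 by rewrite ler_peMr ?expR_ge0.
have -> : K * (kp * A (u + t) - ew (u + t) * B (u + t)) -
 K * (kp * A u - ew u * B u) =
 K * (kp * (A (u + t) - A u) - ew (u + t) * (B (u + t) - B u)
  - (ew (u + t) - ew u) * B u).
 by ring.
have d0 : 0 <= (ew (u + t) - ew u) * B u.
 by rewrite mulr_ge0 ?B0// subr_ge0 ler_expR ler_wpM2l//; lra.
have P0 : 0 <= E * (Q * expR (2 * t)) by rewrite !mulr_ge0 ?expR_ge0 ?(ltW E0)//; lra.
have iA' : `|A (u + t) - A u| <= bw * (E * (Q * expR (2 * t))).
 apply: le_trans iA _; rewrite ler_wpM2l// ler_wpM2l ?(ltW E0)// ler_wpM2l//; first by lra.
 by rewrite e2 ler_peMl ?expR_ge0.
rewrite normrM (ger0_norm K0); apply: (@le_trans _ _ (K * (kp * bw + bw + CB) * (E * (Q * expR (2 * t))))); last by apply: ler_wpM2r => //; rewrite lerDl.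
rewrite -[leRHS]mulrA ler_wpM2l// [leRHS]mulrDl [X in _ <= X + _]mulrDl; apply: le_trans (ler_normB _ _) _; apply: lerD; last by rewrite ger0_norm.
apply: le_trans (ler_normB _ _) _; apply: lerD.
 by rewrite normrM (ger0_norm kp0) -mulrA ler_wpM2l.
by rewrite normrM (ger0_norm (expR_ge0 _)).
Qed.
Lemma hu_incr : exists2 K : R, 0 < K & forall u t, 0 <= u -> 0 <= t ->
 `|hu w (u + t) - hu w u| <= K * (expR ((w - 1 / 2) * u) * ((1 + expR u * t) * expR (2 * t))).
Proof.
have w0' := w0; have w2' := w2.
have a1 : w < 1 / 2 by []. have a2 : 1 / 2 < 1 + w by lra.
have b1 : w < 1 - w by lra. have b2 : 1 - w < 1 + w by lra.
pose CB := Gr (kap w (1 - w)) * Gr w / Gr (kap w (1 - w) + w) / (1 + w - (1 - w)).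
have CB0 : 0 <= CB.
 have k0 := kap_gt0 b1; have kw : 0 < kap w (1 - w) + w by lra.
 by rewrite !divr_ge0 ?mulr_ge0 ?(ltW (Gr_gt0 _))//; lra.
have b0 := bw_ge0.
have Kw0 : 0 <= Kw w by rewrite /Kw Gamma_Gr// mulr_ge0 ?divr_ge0 ?mulr_ge0 ?powR_ge0 ?(ltW (Gr_gt0 w0))//; lra.
have kp0 : 0 <= kpw w by rewrite /kpw divr_ge0; lra.
have [K' K'0 H] := combo_incr Kw0 kp0 b0 CB0 (fun u u' => @Ah_mono _ u u' a1) (fun u u' => @Ah_mono _ u u' b1) (fun u => Ah_ge0 w01 u b1) (fun u u' => @Ah_incr _ a1 u u') (fun u u' => @Ah_incr _ b1 u u') (Ah_le b1 b2).
by exists K' => // u t u0 t0; rewrite /hu !hE//; exact: H.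
Qed.
Lemma hu_le : exists2 K : R, 0 < K & forall u, 0 <= u -> `|hu w u| <= K * expR (3 * u).
Proof.
have [K K0 HK] := hu_incr; exists (`|hu w 0| + K); first by rewrite ltr_wpDl.
move=> u u0; move: (hu w) HK => H HK; have := HK 0 u (lexx _) u0; rewrite add0r mulr0 expR0 !mul1r => h.
have -> : H u = (H u - H 0) + H 0 by rewrite subrK.
apply: le_trans (ler_normD _ _) _; rewrite mulrDl addrC; apply: lerD.
 by rewrite ler_peMr// -expR0 ler_expR mulr_ge0.
apply: le_trans h _; rewrite ler_wpM2l ?(ltW K0)//.
have -> : expR (3 * u) = expR u * expR (2 * u) by rewrite -expRD; congr expR; ring.
by rewrite ler_wpM2r ?expR_ge0// expR_ge1Dx.
Qed.
Lemma fh_reg : exists2 K : R, 0 < K & forall U u, 0 <= U ->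
 `|fh u - fh U| <= K * (expR ((w - 1 / 2) * U) * ((1 + expR U * `|u - U|) * expR (4 * `|u - U|))).
Proof.
have w0' := w0; have w2' := w2.
have [K K0 HK] := hu_incr; have [L L0 HL] := hu_le.
rewrite /fh; move: (hu w) HK HL => H HK HL.
exists (K + (L + 1)); first by rewrite addr_gt0// addr_gt0.
move=> U u U0; set t := `|u - U|; have t0 : 0 <= t by exact: normr_ge0.
set E := expR ((w - 1 / 2) * U); have E0 : 0 <= E by exact: expR_ge0.
have eU := expR_ge0 U.
have Q0 : 0 <= 1 + expR U * t by rewrite addr_ge0// mulr_ge0.
have ee (x : R) : x <= 4 * t -> E * ((1 + expR U * t) * expR x) <= E * ((1 + expR U * t) * expR (4 * t)).
 by move=> xt; rewrite ler_wpM2l// ler_wpM2l// ler_expR.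
have P0 : 0 <= E * ((1 + expR U * t) * expR (4 * t)) by rewrite !mulr_ge0 ?expR_ge0.
rewrite U0; case: (leP 0 u) => u0.
 have e1 (x y : R) : x - 1 - (y - 1) = x - y by ring.
 rewrite e1.
 rewrite mulrDl ler_wpDr//; first by rewrite mulr_ge0// addr_ge0// ltW.
 have [uU|uU] := leP U u.
  have tE : t = u - U by rewrite /t ger0_norm// subr_ge0.
  have := HK U t U0 t0; have -> : U + t = u by rewrite tE addrC subrK.
  move=> /le_trans; apply.
  by rewrite ler_wpM2l ?(ltW K0)//; apply: ee; lra.
 have tE : t = U - u by rewrite /t ltr0_norm ?opprB// subr_lt0.
 have := HK u t u0 t0; have -> : u + t = U by rewrite tE addrC subrK.
 rewrite distrC => /le_trans; apply.
 rewrite ler_wpM2l ?(ltW K0)//; apply: le_trans (ee (3 * t) _); last by lra.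
 have h1 : expR ((w - 1 / 2) * u) <= E * expR t.
  have c01 : (1 / 2 - w) * t <= t by rewrite ler_piMl//; lra.
  have e2 : (w - 1 / 2) * u = (w - 1 / 2) * U + (1 / 2 - w) * t by rewrite tE; ring.
  by rewrite /E -expRD ler_expR e2 lerD2l.
 have h2 : 1 + expR u * t <= 1 + expR U * t by rewrite lerD2l ler_wpM2r// ler_expR ltW.
 have -> : E * ((1 + expR U * t) * expR (3 * t)) = E * expR t * ((1 + expR U * t) * expR (2 * t)).
  by have -> : expR (3 * t) = expR t * expR (2 * t) by [rewrite -expRD; congr expR; ring]; ring.
 apply: ler_pM => //; rewrite ?mulr_ge0 ?expR_ge0 ?addr_ge0 ?mulr_ge0 ?expR_ge0//.
 by rewrite ler_wpM2r ?expR_ge0.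
(* For u < 0 the distance t is at least U, and the growth e^(3U) is absorbed by e^(4t), since e^((w
   - 1/2) U) is at least e^(-U). *)
rewrite sub0r normrN.
have tU : U <= t by rewrite /t ltr0_norm ?opprB; lra.
have h1 : `|H U - 1| <= (L + 1) * expR (3 * U).
 apply: le_trans (ler_normB _ _) _; rewrite normr1 mulrDl mul1r; apply: lerD; first exact: HL.
 by rewrite -expR0 ler_expR mulr_ge0.
apply: le_trans h1 _; rewrite [leRHS]mulrDl ler_wpDl//; first by rewrite mulr_ge0// ltW.
rewrite ler_wpM2l//; first by rewrite addr_ge0// ltW.
have h2 : expR (3 * U) <= E * expR (4 * t).
 rewrite /E -expRD ler_expR; have : (w - 1 / 2) * U >= - U by nra.
 by move: ((w - 1 / 2) * U) => x; lra.
apply: le_trans h2 _; rewrite ler_wpM2l// ler_peMl ?expR_ge0// lerDl mulr_ge0//.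
Qed.
End Regularity.

(** * Exponential decay of h - 1 under the Riemann hypothesis *)

Section PartTwo.
Variable R : realType.
Notation mu := (@lebesgue_measure R).
Local Notation C := R[i].

Lemma hasI_exp1 (q : R) : 0 < q -> hasI mu `[0, +oo[ (fun u => 1 * expR (q * - u)) q^-1.
Proof.
move=> q0; apply: eq_hasI (hasI_exp0 q0); first exact: mitv.
by move=> u _; rewrite mul1r mulrN mulNr.
Qed.
Lemma Lap_one (z : C) : 0 < Re z -> Lap mu `[0, +oo[ (fun=> 1) (fun u => - u) z = z^-1.
Proof.
move: z; apply: (@identity_real R (hplane 0) _ (fun z => z^-1) 1 2 (@hplane_open R 0) (@hplane_convex R 0)).
- move=> z z0; have [y y0 yz] := hplane_mid z0.
 apply: (@Lap_holo _ _ R mu `[0, +oo[ (fun=> 1) (fun u => - u) (mitv _) _ (@meas_opp R _) _ _ y) => //.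
 + by move=> u /=; rewrite in_itv /= andbT oppr_le0.
 + exact: (hasI_exp1 y0).1.
- by apply: holoV; [move=> z; apply: contraTneq => ->; rewrite /hplane /= ltxx|exact: holo_id].
- by lra.
- by move=> x /andP[x1 _]; rewrite /hplane /=; lra.
- move=> x /andP[x1 _]; have x0 : 0 < x by lra.
 by rewrite (Lap_real (mitv _) (hasI_exp1 x0)) fmorphV.
Qed.
Lemma c1_kernel (tau U : R) : 0 < tau -> hasI mu setT (fun u => ga ((U - u) / (2 * tau))) (2 * tau * c1 R).
Proof.
move=> t0; have s0 : 0 < (2 * tau)^-1 by rewrite invr_gt0 mulr_gt0.
have := hasI_shift (- U) (hasI_scale (@cont_ga R) (@ga_ge0 R) s0 (hasI_ga R)).
rewrite invrK [c1 R * _]mulrC; apply: eq_hasI => // u _.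
rewrite /ga; congr (expR (- _)); have e (x : R) : ((2 * tau)^-1 * (x - U)) ^+ 2 = ((U - x) / (2 * tau)) ^+ 2 by ring.
exact: e.
Qed.
Definition m1 : R := \int[mu]_(x in setT) expR (- 1 * `|x|).

Lemma m1_kernel (tau U : R) : 0 < tau -> hasI mu setT (fun u => expR (- 1 * `|(2 * tau)^-1 * (u - U)|)) (2 * tau * m1).
Proof.
move=> t0; have s0 : 0 < (2 * tau)^-1 by rewrite invr_gt0 mulr_gt0.
have ce : continuous (fun x : R => expR (- 1 * `|x|)).
 move=> x; apply: (@continuous_comp _ _ _ (fun x : R => - 1 * `|x|) expR); last exact: continuous_expR.
 by apply: cvgM; [exact: cvg_cst|exact: norm_continuous].
have := hasI_shift (- U) (hasI_scale ce (fun x => expR_ge0 _) s0 (hasI_itg (itg_exp_abs (@ltr01 R)))).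
by rewrite invrK -/m1 [m1 * _]mulrC.
Qed.
Lemma ga_majorant (X tau s : R) : 0 <= X -> 0 < tau <= 1 ->
 (1 + X * (2 * tau * `|s|)) * expR (4 * (2 * tau * `|s|)) * ga s <= (1 + 2 * X * tau) * expR 25 * expR (- 1 * `|s|).
Proof.
move=> X0 /andP[t0 t1]; set r := `|s|; have r0 : 0 <= r by exact: normr_ge0.
have h1 : 1 + X * (2 * tau * r) <= (1 + 2 * X * tau) * expR r.
 have := expR_ge1Dx r; have Xt : 0 <= 2 * X * tau by rewrite !mulr_ge0// ltW.
 have -> : X * (2 * tau * r) = 2 * X * tau * r by ring.
 by move: (2 * X * tau) Xt => y y0 h; nra.
have h2 : expR (4 * (2 * tau * r)) <= expR (8 * r).
 rewrite ler_expR; have : tau * r <= r by rewrite ler_piMl.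
 by move: (tau * r) => y h; nra.
(* 9r - r^2 <= 25 - r is the inequality (r - 5)^2 >= 0. *)
have h3 : expR r * expR (8 * r) * ga s <= expR 25 * expR (- 1 * r).
 rewrite /ga -!expRD ler_expR -(real_normK (num_real s)) -/r; have := sqr_ge0 (r - 5); lra.
have g0 := ga_ge0 s; have c0 : 0 <= 1 + 2 * X * tau by rewrite addr_ge0// !mulr_ge0// ltW.
apply: (@le_trans _ _ ((1 + 2 * X * tau) * expR r * expR (8 * r) * ga s)).
 apply: ler_wpM2r => //; apply: ler_pM => //; rewrite ?expR_ge0//.
 by rewrite addr_ge0// mulr_ge0// !mulr_ge0// ltW.
by rewrite -[leRHS]mulrA -(mulrA _ _ (expR (8 * r))) -(mulrA _ _ (ga s)) ler_wpM2l.
Qed.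
(** Isolated as an identity in generic variables: dividing the averaged term and the averaging error
    by the kernel mass gives the two terms of the final bound. *)
Lemma decay_alg (k K2 e1 c ed tk t K3 E X e25 m : R) : 0 < c -> 0 < k ->
 16 / k * K2 * e1 / c * (ed * (t * tk)) + K3 * E * ((1 + 2 * X * t) * e25) * (2 * t * m) =
 (16 / k * K2 * e1 / c / (2 * c) * (ed * tk) + K3 * e25 * m / c * (E * (1 + 2 * X * t))) * (2 * t * c).
Proof. by move=> c0 k0; field; rewrite !gt_eqF. Qed.

Hypothesis RH : riemann_hypothesis R.
Variable w : R.
Hypotheses (w0 : 0 < w) (w2 : w < 1 / 2).

Lemma fhE u : 0 <= u -> fh w u = hu w u - 1. Proof. by rewrite /fh => ->. Qed.
Lemma meas_fh : measurable_fun (ray0 R) (fh w).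
Proof.
have h := measurable_funB (meas_hu w0 w2) (@measurable_cst _ _ (mR R) R `[0, +oo[ 1).
apply: eq_measurable_fun h => u; rewrite inE /= in_itv /= andbT => u0.
by rewrite fhE.
Qed.
Lemma itg_fh : itg mu `[0, +oo[ (fun u => fh w u * expR (2 * - u)).
Proof.
have z2 : 1 / 2 + w < 2 by have := w2; lra.
have := itgB (mitv _) (hasI_hu w0 w2 z2).1 (hasI_exp1 (ltr0n R 2)).1.
apply: eq_itg; first exact: mitv.
by move=> u /=; rewrite in_itv /= andbT => u0; rewrite fhE// mulrBl.
Qed.
Lemma Lap_fh y : Lap mu `[0, +oo[ (fh w) (fun u => - u) (Complex 2 y) = Lt w (Complex 2 y).
Proof.
set z := Complex 2 y; have w0' := w0; have w2' := w2.
have z2 : 1 / 2 + w < Re z by rewrite /=; lra.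
have zr0 : 0 < Re z by rewrite /=; lra.
have z0 : z != 0 by apply: contraTneq zr0 => ->; rewrite /= ltxx.
have c1 := lap_citg (mitv _) (meas_hu w0 w2) (@meas_opp R _) (hasI_hu w0 w2 z2).1.
have m1' : measurable_fun (ray0 R) (fun=> 1 : R) by exact: measurable_cst.
have c2 := lap_citg (mitv _) m1' (@meas_opp R _) (hasI_exp1 zr0).1.
have -> : Lap mu `[0, +oo[ (fh w) (fun u => - u) z = Lh w z - Lap mu `[0, +oo[ (fun=> 1) (fun u => - u) z.
 rewrite /Lh /Lap -(CIB (mitv _) c1 c2).
 apply: eq_CI => u /=; rewrite in_itv /= andbT => u0.
 by rewrite /lapF fhE// rmorphB mulrBl.
have zw : - w < Re z by rewrite /=; lra.
rewrite Lap_one// (Lt_off0 RH w0 w2)//.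
have := Lh_eq w0 w2 z2; rewrite /Th; have := den_neq0 RH w0 w2 zw.
move: (xi _) (xi _) (Lh w z) => a b l a0 <-.
by field; rewrite z0 a0.
Qed.

Theorem fh_decay : exists gam K : R, [/\ 0 < gam, 0 < K & forall U, 0 <= U -> `|fh w U| <= K * expR (- gam * U)].
Proof.
have w0' := w0; have w2' := w2.
(* The midpoint of the admissible interval from 1/2 + w to 1. *)
pose B : R := 3 / 4 + w / 2.
have B1 : 1 / 2 + w < B by rewrite /B; lra. have B2 : B < 1 by rewrite /B; lra.
have B0 : 0 < B by lra.
(* [dl < w] keeps the denominator of [Th] free of zeros, and [dl < 1 / 2 - w] keeps the argument of
   the numerator in the right half-plane, where [zet1] is bounded polynomially. *)
pose dl := Num.min w (1 / 2 - w) / 2.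
have dm0 : 0 < Num.min w (1 / 2 - w) by rewrite lt_min w0 subr_gt0.
have dm1 : Num.min w (1 / 2 - w) <= w by rewrite ge_min lexx.
have dm2 : Num.min w (1 / 2 - w) <= 1 / 2 - w by rewrite ge_min lexx orbT.
have d0 : 0 < dl by rewrite /dl; lra.
have d1 : dl < w by rewrite /dl; lra.
have d2 : dl < 1 / 2 - w by rewrite /dl; lra.
(* Makes k = dl (1 + (1 - B) / 2), close enough to [dl] for B k < dl. *)
pose e := dl * (1 - B) / 4; have e0 : 0 < e by rewrite /e divr_gt0// mulr_gt0//; lra.
pose k := dl + 2 * e.
have ke : k = dl * (1 + (1 - B) / 2) by rewrite /k /e; field.
have k0 : 0 < k by rewrite /k; lra.
have k1 : k <= 1 by rewrite ke; nra.
have kB1 : B * (1 + (1 - B) / 2) < 1 by nra.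
have kB : B * k < dl by rewrite ke mulrCA gtr_pMr.
have d11 : dl <= 1 by lra.
have [K1 K10 HK1] := Lt_strip RH w0 w2 d0 d1 d2.
have [K2 K20 HK2] := Lt_line RH w0 w2 d0 d1 d2 e0 k1.
have [K3 K30 HK3] := fh_reg w0 w2.
have hL z : - dl <= Re z -> cder_at (Lt w) z by move=> h; apply: (holo_Lt RH w0 w2); rewrite /hplane; lra.
have c10 := c1_gt0 R.
have m10 : 0 <= m1 by apply: (hasI_ge0 (hasI_itg (itg_exp_abs (@ltr01 R)))) => x _; exact: expR_ge0.
pose M1 := 16 / k * K2 * expR 1 / c1 R / (2 * c1 R).
have M10 : 0 <= M1 by rewrite !mulr_ge0 ?invr_ge0 ?expR_ge0 ?mulr_ge0 ?(ltW c10) ?(ltW K20) ?(ltW k0).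
pose M2 := K3 * expR 25 * m1 / c1 R.
have M20 : 0 <= M2 by rewrite !mulr_ge0 ?invr_ge0 ?expR_ge0 ?(ltW c10) ?(ltW K30).
(* Three rates: that of the averaged function, that of the constant part of the averaging error, and
   that of its part proportional to e^U tau. *)
pose gam := Num.min (dl - B * k) (Num.min (1 / 2 - w) (B - 1 / 2 - w)).
have g1 : gam <= dl - B * k by rewrite ge_min lexx.
have g2 : gam <= 1 / 2 - w by rewrite !ge_min lexx orbT.
have g3 : gam <= B - 1 / 2 - w by rewrite !ge_min lexx !orbT.
have g0 : 0 < gam by rewrite !lt_min; apply/and3P; split; lra.
exists gam, (M1 + 3 * M2 + 1); split => //.
 by rewrite ltr_wpDl// addr_ge0// mulr_ge0.
move=> U U0; pose tau := expR (- B * U).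
have t0 : 0 < tau by exact: expR_gt0.
have t1 : tau <= 1 by rewrite -expR0 ler_expR mulNr oppr_le0 mulr_ge0// ltW.
have [v Hv Bv] := smooth_bound meas_fh itg_fh d0 d11 k0 k1 K10 K20 Lap_fh hL HK1 HK2 t0 t1 U0.
have Hv' : hasI mu setT (fun u => fh w u * ga ((U - u) / (2 * tau))) v.
 apply: eq_hasI (hasI_sub measurableT (mitv _) (@subsetT _ _) Hv) => // u _.
 by rewrite mem_setE in_itv /= andbT /fh; case: (0 <= _); rewrite ?mul0r.
have Hd := hasI_B measurableT (hasI_Z (fh w U) measurableT (c1_kernel U t0)) Hv'.
set X := expR U; have X0 : 0 <= X by exact: expR_ge0.
set E := expR ((w - 1 / 2) * U); have E0 : 0 <= E by exact: expR_ge0.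
have Hm := hasI_Z (K3 * E * ((1 + 2 * X * tau) * expR 25)) measurableT (m1_kernel U t0).
have D : `|fh w U * (2 * tau * c1 R) - v| <= K3 * E * ((1 + 2 * X * tau) * expR 25) * (2 * tau * m1).
 have := RI_abs_le measurableT Hd.1 Hm _; rewrite Hd.2; apply => u _.
 rewrite -mulrBl normrM (ger0_norm (ga_ge0 _)) distrC.
 have t01 : 0 < tau <= 1 by rewrite t0.
 have key (u' : R) : `|fh w u' - fh w U| * ga ((U - u') / (2 * tau)) <= K3 * E * ((1 + 2 * X * tau) * expR 25) * expR (- 1 * `|(2 * tau)^-1 * (u' - U)|).
  set s := (2 * tau)^-1 * (u' - U).
  have gs : ga ((U - u') / (2 * tau)) = ga s by rewrite /ga /s; congr (expR (- _)); ring.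
  have us : `|u' - U| = 2 * tau * `|s|.
   rewrite /s normrM (ger0_norm (_ : 0 <= (2 * tau)^-1)) ?invr_ge0 ?mulr_ge0 ?(ltW t0)//.
   by rewrite mulrA divff ?mul1r// mulf_neq0// gt_eqF.
  rewrite gs; apply: le_trans (ler_wpM2r (ga_ge0 s) (HK3 U u' U0)) _; rewrite -/E -/X us.
  have := ga_majorant s X0 t01; move=> h.
  have KE : 0 <= K3 * E by rewrite mulr_ge0// ltW.
  by have := ler_wpM2l KE h; rewrite !mulrA.
 exact: key.
have tc : 0 < 2 * tau * c1 R by rewrite !mulr_gt0.
have F : `|fh w U| <= M1 * (expR (- dl * U) * tau `^ (- k)) + M2 * (E * (1 + 2 * X * tau)).
 rewrite -(ler_pM2r tc); have -> : `|fh w U| * (2 * tau * c1 R) = `|fh w U * (2 * tau * c1 R)| by rewrite normrM (ger0_norm (ltW tc)).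
 have -> : fh w U * (2 * tau * c1 R) = v + (fh w U * (2 * tau * c1 R) - v) by rewrite addrC subrK.
 apply: le_trans (ler_normD _ _) _; apply: le_trans (lerD Bv D) _.
 have -> : tau `^ (1 - k) = tau * tau `^ (- k).
  by rewrite powRD; [rewrite powRr1// ltW|rewrite (gt_eqF t0) implybT].
 rewrite /M1 /M2; apply: eq_ler.
 exact: decay_alg.
apply: le_trans F _.
have a1 : expR (- dl * U) * tau `^ (- k) <= expR (- gam * U).
 rewrite /powR gt_eqF// /tau expRK -expRD ler_expR.
 have : gam * U <= (dl - B * k) * U by rewrite ler_wpM2r.
 by move=> h; apply: le_trans (_ : _ <= - ((dl - B * k) * U)) _; [apply: eq_ler; ring|rewrite mulNr lerN2].
have a2 : E <= expR (- gam * U).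
 by rewrite ler_expR mulNr -lerN2 opprK -mulNr opprB ler_wpM2r.
have a3 : E * (X * tau) <= expR (- gam * U).
 rewrite /E /X /tau -!expRD ler_expR.
 have : gam * U <= (B - 1 / 2 - w) * U by rewrite ler_wpM2r.
 by move=> h; apply: le_trans (_ : _ <= - ((B - 1 / 2 - w) * U)) _; [apply: eq_ler; field|rewrite mulNr lerN2].
have ge := expR_ge0 (- gam * U).
have b1 := ler_wpM2l M10 a1.
have b2 : M2 * (E * (1 + 2 * X * tau)) <= 3 * M2 * expR (- gam * U).
 have -> : M2 * (E * (1 + 2 * X * tau)) = M2 * (E + 2 * (E * (X * tau))) by ring.
 have -> : 3 * M2 * expR (- gam * U) = M2 * (3 * expR (- gam * U)) by ring.
 have le3 (x y z : R) : x <= z -> y <= z -> x + 2 * y <= 3 * z by clear; lra.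
 by rewrite ler_wpM2l// le3.
apply: le_trans (lerD b1 b2) _; rewrite !mulrDl mul1r; lra.
Qed.

Theorem criterion_part2 : eventually_ge0 w.
Proof.
have [gam [K [g0 K0 HK]]] := fh_decay.
(* For u beyond K / gam one has e^(gam u) >= 1 + gam u >= K, so h - 1 has modulus at most 1. *)
exists (expR (K / gam)); split.
 by rewrite -[leLHS]expR0 ler_expR divr_ge0// ltW.
move=> x xx; have x0 : 0 < x by apply: lt_trans xx; exact: expR_gt0.
pose U := ln x; have xE : x = expR U by rewrite lnK.
have U1 : K / gam < U by rewrite -ltr_expR -xE.
have U0 : 0 <= U by apply: le_trans (ltW U1); rewrite divr_ge0// ltW.
have h1 : `|fh w U| <= 1.
 apply: le_trans (HK U U0) _; rewrite mulNr expRN ler_pdivrMr ?expR_gt0// mul1r.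
 have := expR_ge1Dx (gam * U); have : K <= gam * U by rewrite mulrC -ler_pdivrMr// ltW.
 lra.
move: h1; rewrite fhE// ler_norml => /andP[hU _].
by rewrite xE -/(hu w U); lra.
Qed.
End PartTwo.

Theorem theorem1 (R : realType) (w0 : R) (hw0 : 0 <= w0 < 1 / 2) :
  ((forall w : R, w0 < w < 1 / 2 ->
      exists xw : R, 1 <= xw /\ (forall x : R, xw < x -> 0 <= h w x)) ->
   forall s : R[i], s <> 1 -> 1 / 2 + w0 < complex.Re s -> zeta s <> 0)
  /\
  (riemann_hypothesis R ->
   forall w : R, 0 < w < 1 / 2 ->
     exists xw : R, 1 <= xw /\ (forall x : R, xw < x -> 0 <= h w x))
  /\
  (riemann_hypothesis R <->
   forall w : R, 0 < w < 1 / 2 ->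
     exists xw : R, 1 <= xw /\ (forall x : R, xw < x -> 0 <= h w x)).
Proof.
have P2 : riemann_hypothesis R -> forall w : R, 0 < w < 1 / 2 -> eventually_ge0 w.
 by move=> RH w /andP[w0' w2']; exact: criterion_part2.
split; first exact: criterion_part1.
by split; [exact: P2|split; [exact: P2|exact: criterion_rh]].
Qed.
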